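(* Assume in addition that $X$ is of type B or C, i.e. either ($\sigma=0$, $\nu(\mathbb{R})=\infty$ and $\int_{|x|\le1}|x|\nu(dx)<\infty$) or ($\sigma>0$ or $\int_{|x|\le1}|x|\nu(dx)=\infty$). Then for every $(t,x)\in[0,T)\times[0,\infty)$, $$P(t,x)=P_e(t,x)+\mathbb E\Big(\int_0^{T-t}k(t+s,S^x_s)e^{-rs}\,ds\Big),$$ where $$k(t,x)=\Big[rK-\delta x-\int_{\{y>0\}}\big(P(t,xe^y)-(K-xe^y)\big)\nu(dy)\Big]\mathbf 1_{\{x<b(t)\}}.$$
   Context: Let $X$ be a real Lévy process with characteristic triplet $(\sigma^2,\gamma,\nu)$, i.e. $\mathbb E e^{izX_t}=\exp\big(t(-\tfrac{\sigma^2}{2}z^2+i\gamma z+\int(e^{izx}-1-izx\mathbf 1_{|x|\le1})\nu(dx))\big)$, and let $(\mathcal F_t)$ be the usual augmentation of its natural filtration. Fix $T>0$, $K>0$, $r>0$, $\delta\ge0$. Assume the martingale conditions $\int_{|x|\ge1}e^x\nu(dx)<\infty$ and $\frac{\sigma^2}{2}+\gamma+\int(e^x-1-x\mathbf 1_{|x|\le1})\nu(dx)=0$, and the non-degeneracy condition: $\sigma\neq0$, or $\nu((-\infty,0))>0$, or $\int_{(0,\infty)}(x\wedge1)\nu(dx)=\infty$. For $x\ge0$ let $S^x_t=xe^{(r-\delta)t+X_t}$. The American put price is $P(t,x)=\sup_{\tau\in\mathcal T_{0,T-t}}\mathbb E[e^{-r\tau}(K-S^x_\tau)_+]$ for $t\in[0,T]$,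 $x\ge0$, where $\mathcal T_{0,s}$ is the set of stopping times with values in $[0,s]$; the European put price is $P_e(t,x)=\mathbb E[e^{-r(T-t)}(K-S^x_{T-t})_+]$. The critical price is $b(t)=\inf\{x\ge0: P(t,x)>(K-x)_+\}$ for $t\in[0,T)$. *)

(* Defs.v *)
From mathcomp Require Import all_boot all_order all_algebra.
From mathcomp Require Import all_classical all_reals all_analysis.
Import Order.TTheory GRing.Theory Num.Theory Num.Def numFieldNormedType.Exports.

Set Implicit Arguments.
Unset Strict Implicit.
Unset Printing Implicit Defensive.

Local Open Scope classical_set_scope.
Local Open Scope ring_scope.

Section levy_american_put.
Context {R : realType} {d : measure_display} {Omega : measurableType d}.

Definition levy_measure (nu : {measure set R -> \bar R}) : Prop :=
  nu [set 0] = 0%E /\ (\int[nu]_x (minr 1 (x ^+ 2))%:E < +oo)%E.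

(* psi(z) = -sigma2/2 z^2 + i gamma z + int (e^{izx} - 1 - izx 1_{|x|<=1}) nu(dx),
   split into real and imaginary parts *)
Definition levy_exp_re (sigma2 : R) (nu : {measure set R -> \bar R}) (z : R) : R :=
  - (sigma2 / 2) * z ^+ 2 + Rintegral nu setT (fun x => cos (z * x) - 1).

Definition levy_exp_im (gamma : R) (nu : {measure set R -> \bar R}) (z : R) : R :=
  gamma * z + Rintegral nu setT
    (fun x => sin (z * x) - z * x * \1_[set y : R | `|y| <= 1] x).

Variable Pr : probability Omega R.

Definition indep_rvs (n : nat) (Y : 'I_n -> Omega -> R) : Prop :=
  forall B : 'I_n -> set R, (forall i, measurable (B i)) ->
    Pr (\bigcap_(i in [set: 'I_n]) (Y i @^-1` B i)) =
    (\prod_(i < n) Pr (Y i @^-1` B i))%E.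

(* X is a Levy process with characteristic triplet (sigma2, gamma, nu),
   i.e. E e^{izX_t} = exp(t psi(z)) (written with real and imaginary parts) *)
Definition is_levy_process (X : R -> Omega -> R) (sigma2 gamma : R)
    (nu : {measure set R -> \bar R}) : Prop :=
  [/\ (forall t, 0 <= t -> measurable_fun setT (X t)),
      (exists N, [/\ measurable N, Pr N = 0%E &
        forall w, ~ N w -> X 0 w = 0 /\
          (forall t, 0 <= t ->
             ((fun s => X s w) @ t^'+ --> X t w) /\
             (0 < t -> cvg ((fun s => X s w) @ t^'-)))]),
      (forall ts : nat -> R, 0 <= ts 0%N -> (forall i, ts i <= ts i.+1) ->
        forall n, indep_rvs (fun i : 'I_n => fun w => X (ts i.+1) w - X (ts i) w)),
      (forall s h B, 0 <= s -> 0 <= h -> measurable B ->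
        Pr ((fun w => X (s + h) w - X s w) @^-1` B) = Pr (X h @^-1` B)) &
      (forall t z, 0 <= t ->
        ('E_Pr[fun w => cos (z * X t w)])%E =
          (expR (t * levy_exp_re sigma2 nu z) * cos (t * levy_exp_im gamma nu z))%:E /\
        ('E_Pr[fun w => sin (z * X t w)])%E =
          (expR (t * levy_exp_re sigma2 nu z) * sin (t * levy_exp_im gamma nu z))%:E)].

Variable X : R -> Omega -> R.

Definition natural_gen (s : R) : set (set Omega) :=
  [set A | exists u B, [/\ 0 <= u <= s, measurable B & A = X u @^-1` B]].

Definition null_sets : set (set Omega) :=
  [set A | exists N, [/\ measurable N, Pr N = 0%E & A `<=` N]].

Definition aug_filtration (t : R) : set (set Omega) :=
  [set A | forall s, t < s -> <<s natural_gen s `|` null_sets >> A].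

Definition stopping_times_le (u : R) : set (Omega -> R) :=
  [set tau | (forall w, 0 <= tau w <= u) /\
     (forall t, 0 <= t -> aug_filtration t [set w | tau w <= t])].

Variables (r delta K T : R).

Definition stock (x s : R) (w : Omega) : R := x * expR ((r - delta) * s + X s w).

Definition amer_put (t x : R) : R :=
  fine (ereal_sup [set (\int[Pr]_w
          (expR (- (r * tau w)) * maxr (K - stock x (tau w) w) 0)%:E)%E
        | tau in stopping_times_le (T - t)]).

Definition euro_put (t x : R) : R :=
  fine (\int[Pr]_w (expR (- (r * (T - t))) * maxr (K - stock x (T - t) w) 0)%:E)%E.

Definition crit_price (t : R) : R :=
  inf [set x | 0 <= x /\ maxr (K - x) 0 < amer_put t x].

Definition kfun (nu : {measure set R -> \bar R}) (t x : R) : R :=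
  (r * K - delta * x
   - Rintegral nu `]0%R, +oo[ (fun y => amer_put t (x * expR y) - (K - x * expR y)))
  * \1_[set x' | x' < crit_price t] x.

End levy_american_put.

(* Main.v *)
(** Let [berm h m] be the price of the put that can be exercised at the dates
    [0, h, ..., m * h] only, and [Qh h] the discounted transition operator of the stock.
    One step of the dynamic programming equation reads
    [berm h m.+1 = Qh h (berm h m) + h * gain h m] with [0 <= gain h m <= r * K]; telescoping
    it along the stock writes the Bermudan price as the European price plus the expectation
    of a Riemann sum of gains.  As [h] tends to 0 the gain converges to the function [k] of
    the theorem off the critical price: above it exercising is not optimal and the gain
    vanishes eventually, below it the limit is computed from [E[f(X_h)] / h --> \int f dnu],
    valid for [f] vanishing near 0, and from the martingale property of [expR (X t)].
    In types B and C the law of [X s] has no atom for [s > 0], so almost every path is at the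
    critical price for a null set of times only, and dominated convergence applies.  The
    Bermudan prices converge to the American one because stopping times can be discretised
    from above.

    The small-time limits come from the characteristic function alone: convolution with a
    Cauchy kernel, whose Fourier transform is [expR (- `|u|)], turns a test function into a
    mixture of cosines and sines. *)

From HB Require Import structures.
Require Import Defs.
From mathcomp Require Import all_boot all_order all_algebra.
From mathcomp Require Import all_classical all_reals all_analysis.
From mathcomp Require Import measurable_realfun ring lra.
Import Order.TTheory GRing.Theory Num.Theory Num.Def numFieldNormedType.Exports.

Set Implicit Arguments.
Unset Strict Implicit.
Unset Printing Implicit Defensive.

Local Open Scope classical_set_scope.
Local Open Scope ring_scope.

(** The obstacle throughout is that the one-dimensional laws of [X] are known only through their
    characteristic functions, whereas the put involves exponential moments. That [expR (X t)] has
    mean 1 must be proved: a truncated supermartingale gives a mean at most 1, and a one-step lower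
    bound [1 - e * h], compounded by Bernoulli's inequality, gives equality.

    Regularity of prices is reduced to two facts, values in [[0, K]] and Lipschitz constant 1. They
    hold for all Bermudan prices uniformly in the step, survive the limit, and allow evaluation at
    moving points.

    The non-degeneracy condition makes the price at the strike positive, so the set whose infimum is
    the critical price contains [K]. The critical price is monotone in time, hence measurable;
    combined with the absence of atoms, Fubini's theorem then discards the times spent on the
    boundary.

    The starting point 0 is handled apart, the stock being frozen there. The formula at 0 asks for a
    positive critical price, which is itself deduced from the formula at positive starting
    points. *)

Notation "mu .-Rint f" := (mu.-integrable [set: _] (fun x => (f x)%:E))
  (at level 2, format "mu .-Rint  f", f at level 1).

(** * Integrable real functions *)

Section integration.
Context {d} {T : measurableType d} {R : realType}.
Implicit Types mu : {measure set T -> \bar R}.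

Lemma Rint_measurable mu (f : T -> R) : mu.-Rint f -> measurable_fun setT f.
Proof. by move=> /measurable_int/measurable_EFinP. Qed.

Lemma le_Rint mu (f g : T -> R) : measurable_fun setT f -> mu.-Rint g ->
  (forall x, `|f x| <= g x) -> mu.-Rint f.
Proof.
move=> mf ig fg; apply: (le_integrable _ _ _ ig) => //.
  exact/measurable_EFinP.
by move=> x _ /=; rewrite lee_fin (le_trans (fg x))// ler_norm.
Qed.

Lemma Rdominated mu (f_ : nat -> T -> R) (f g : T -> R) :
  (forall n, measurable_fun setT (f_ n)) ->
  (forall x, f_ n x @[n --> \oo] --> f x) ->
  mu.-Rint g -> (forall n x, `|f_ n x| <= g x) ->
  mu.-Rint f /\
  (\int[mu]_x f_ n x @[n --> \oo] --> \int[mu]_x f x).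
Proof.
move=> mf cf ig fg.
have mlim : measurable_fun setT f.
  by apply: (measurable_fun_cvg mf) => x _; exact: cf.
have fleg x : `|f x| <= g x.
  apply: (ler_cvg_to (cvg_norm (cf x)) (cvg_cst (g x))).
  by apply: nearW => n; exact: fg.
have iflim : mu.-Rint f by exact: le_Rint ig fleg.
split=> //.
have [|||||_ _] := @dominated_convergence _ _ _ mu setT measurableT
  (fun n x => (f_ n x)%:E) (fun x => (f x)%:E) (fun x => (g x)%:E).
- by move=> n; exact/measurable_EFinP.
- exact/measurable_EFinP.
- by apply: aeW => x _; apply: cvg_EFin; [exact: nearW|exact: cf].
- exact: ig.
- by apply: aeW => x n _; rewrite lee_fin.
by move=> H; apply: fine_cvg; rewrite fineK//; exact: integrable_fin_num.
Qed.

(** Integrability of the limit is part of the conclusion: moments and masses are obtained below from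
    uniform bounds on truncated integrands. *)
Lemma Rfatou mu (f_ : nat -> T -> R) (f : T -> R) (C : R) :
  (forall n x, 0 <= f_ n x) -> (forall n, mu.-Rint (f_ n)) ->
  (forall x, f_ n x @[n --> \oo] --> f x) ->
  (forall n, \int[mu]_x f_ n x <= C) ->
  mu.-Rint f /\ \int[mu]_x f x <= C.
Proof.
move=> f0 fi fc fC.
have f0' x : 0 <= f x.
  apply: (ler_cvg_to (cvg_cst 0) (fc x)); exact: nearW.
have mf n : measurable_fun setT (f_ n) by exact: Rint_measurable (fi n).
have mfl : measurable_fun setT f by apply: (measurable_fun_cvg mf) => x _; exact: fc.
have H : (\int[mu]_x (f x)%:E <= C%:E)%E.
  have := @fatou _ _ _ mu setT measurableT (fun n x => (f_ n x)%:E)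
    (fun n => (measurable_EFinP _ _).2 (mf n)) (fun n x _ => f0 n x).
  under eq_integral => x _.
    have /cvg_limn_einf_sup[-> _] : (f_ n x)%:E @[n --> \oo] --> (f x)%:E.
      by apply: cvg_EFin; [exact: nearW|exact: fc].
    over.
  move=> /le_trans; apply.
  rewrite limn_einf_lim; apply: lime_le; first exact: is_cvg_einfs.
  apply: nearW => n; apply: (@le_trans _ _ (\int[mu]_x (f_ n x)%:E)%E).
    by apply: ereal_inf_lbound; exists n => /=.
  have -> : (\int[mu]_x (f_ n x)%:E = (\int[mu]_x f_ n x)%R%:E)%E.
    by rewrite fineK//; exact: integrable_fin_num (fi n).
  by rewrite lee_fin.
have fi' : mu.-Rint f.
  apply/integrableP; split; first exact/measurable_EFinP.
  under eq_integral do rewrite /= ger0_norm//.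
  by rewrite (le_lt_trans H)// ltry.
split=> //; rewrite -lee_fin fineK//; exact: integrable_fin_num.
Qed.

Lemma Rint_bounded (mu : {finite_measure set T -> \bar R}) (f : T -> R) M :
  measurable_fun setT f -> (forall x, `|f x| <= M) -> mu.-Rint f.
Proof.
move=> mf fM; apply: measurable_bounded_integrable => //.
  exact: fin_num_fun_lty.
exists M; split => [|N MN x _]; first exact: num_real.
by rewrite /= (le_trans (fM x))// ltW.
Qed.

Lemma Rintegral_prob_cst (P : probability T R) (c : R) : \int[P]_x c = c.
Proof. by rewrite /Rintegral integral_cst//= (@probability_setT _ _ _ P) mule1. Qed.

Lemma RintD mu (f g : T -> R) : mu.-Rint f -> mu.-Rint g ->
  mu.-Rint (fun x => f x + g x).
Proof. by move=> hf hg; have := integrableD measurableT hf hg. Qed.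

Lemma RintB mu (f g : T -> R) : mu.-Rint f -> mu.-Rint g ->
  mu.-Rint (fun x => f x - g x).
Proof. by move=> hf hg; have := integrableB measurableT hf hg. Qed.

Lemma RintZ mu (k : R) (f : T -> R) : mu.-Rint f -> mu.-Rint (fun x => k * f x).
Proof. by move=> hf; have := integrableZl measurableT k hf. Qed.

End integration.

Section fubini.
Context {d1 d2} {T1 : measurableType d1} {T2 : measurableType d2} {R : realType}.

(** By Tonelli, a product bound with integrable factors gives integrability on the product space, so
    the two iterated integrals agree. *)
Lemma RFubini1 (m1 : {sigma_finite_measure set T1 -> \bar R})
  (m2 : {sigma_finite_measure set T2 -> \bar R}) (f : T1 -> T2 -> R) (g1 : T1 -> R) (g2 : T2 -> R) :
  measurable_fun setT (fun z : T1 * T2 => f z.1 z.2) ->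
  (forall x, 0 <= g1 x) -> (forall x, 0 <= g2 x) ->
  m1.-Rint g1 -> m2.-Rint g2 ->
  (forall x y, `|f x y| <= g1 x * g2 y) ->
  m1.-Rint (fun x => \int[m2]_y f x y) /\
  \int[m1]_x \int[m2]_y f x y = \int[m2]_y \int[m1]_x f x y.
Proof.
move=> mf g10 g20 ig1 ig2 fg.
pose F (z : T1 * T2) := (f z.1 z.2)%:E.
have mF : measurable_fun setT F by exact/measurable_EFinP.
have iF : (m1 \x m2)%E.-integrable setT F.
  apply/(integrable12ltyP _ _ mF).
  have [/integrableP[_ +] /integrableP[_ +]] := (ig1, ig2).
  under eq_integral do rewrite gee0_abs ?lee_fin//.
  under [X in _ -> (X < _)%E -> _]eq_integral do rewrite gee0_abs ?lee_fin//.
  move=> l1 l2.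
  apply: (@le_lt_trans _ _ (\int[m1]_x ((g1 x)%:E * \int[m2]_y (g2 y)%:E))%E).
    apply: ge0_le_integral => //.
    - by move=> x _; exact: integral_ge0.
    - apply: (measurable_fun_fubini_tonelli_F (fun z => `|F z|%E)) => //.
      exact: measurableT_comp.
    - apply: emeasurable_funM => //; exact: measurable_int ig1.
    - move=> x _; rewrite -ge0_integralZl//.
      + apply: ge0_le_integral => //.
        * apply: measurableT_comp => //; apply/measurable_EFinP.
          exact: (measurableT_comp mf (pair1_measurable x)).
        * apply: emeasurable_funM => //; exact: measurable_int ig2.
        * by move=> y _ /=; rewrite lee_fin.
      + exact: measurable_int ig2.
      + by move=> y _; rewrite lee_fin.
      + by rewrite lee_fin.
  rewrite ge0_integralZr//; last 3 first.
    - exact: measurable_int ig1.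
    - by move=> x _; rewrite lee_fin.
    - by apply: integral_ge0 => y _; rewrite lee_fin.
  apply: lte_mul_pinfty => //.
  - by apply: integral_ge0 => x _; rewrite lee_fin.
  - by rewrite ge0_fin_numE//; apply: integral_ge0 => x _; rewrite lee_fin.
have fx x : m2.-Rint (f x).
  apply: (@le_Rint _ _ _ _ _ (fun y => g1 x * g2 y)) => //.
    exact: (measurableT_comp mf (pair1_measurable x)).
  exact: RintZ.
have fy y : m1.-Rint (fun x => f x y).
  apply: (@le_Rint _ _ _ _ _ (fun x => g2 y * g1 x)) => //.
    exact: (measurableT_comp mf (pair2_measurable y)).
    exact: RintZ.
  by move=> x; rewrite mulrC.
have E1 x : (\int[m2]_y f x y)%:E = (\int[m2]_y (f x y)%:E)%E.
  by rewrite fineK//; exact: integrable_fin_num.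
have E2 y : (\int[m1]_x f x y)%:E = (\int[m1]_x (f x y)%:E)%E.
  by rewrite fineK//; exact: integrable_fin_num.
split.
- apply: eq_integrable (integrable_fubini_F iF) => // x _; exact/esym/E1.
- congr fine; under eq_integral do rewrite E1.
  by under [in RHS]eq_integral do rewrite E2; exact: (Fubini iF).
Qed.

End fubini.

Section parametric.
Context {d1 d2} {T1 : measurableType d1} {T2 : measurableType d2} {R : realType}.

(** Tonelli handles the positive and negative parts separately, so measurability also covers points
    where the inner integral takes a default value. *)
Lemma measurable_Rintegral (m2 : {sigma_finite_measure set T2 -> \bar R})
    (f : T1 -> T2 -> R) :
  measurable_fun setT (fun z : T1 * T2 => f z.1 z.2) ->
  measurable_fun setT (fun x => \int[m2]_y f x y).
Proof.
move=> mf; pose F (z : T1 * T2) := (f z.1 z.2)%:E.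
have mF : measurable_fun setT F by exact/measurable_EFinP.
apply: (measurableT_comp (f := fine)); first exact: fine_measurable.
have -> : (fun x => \int[m2]_y (f x y)%:E)%E =
    (fun x => \int[m2]_y F^\+ (x, y) - \int[m2]_y F^\- (x, y))%E.
  apply/funext => x; rewrite integralE.
  by congr (_ - _)%E; apply: eq_integral => y _; rewrite ?funeposE ?funenegE.
apply: emeasurable_funB.
- apply: (measurable_fun_fubini_tonelli_F (fun z => F^\+ z)%E) => //; exact: measurable_funepos.
- apply: (measurable_fun_fubini_tonelli_F (fun z => F^\- z)%E) => //; exact: measurable_funeneg.
Qed.

End parametric.

Section fubini2.
Context {d1 d2} {T1 : measurableType d1} {T2 : measurableType d2} {R : realType}.
Variables (m1 : {sigma_finite_measure set T1 -> \bar R})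
  (m2 : {sigma_finite_measure set T2 -> \bar R}).

Lemma RFubini (f : T1 -> T2 -> R) (g1 : T1 -> R) (g2 : T2 -> R) :
  measurable_fun setT (fun z : T1 * T2 => f z.1 z.2) ->
  (forall x, 0 <= g1 x) -> (forall x, 0 <= g2 x) ->
  m1.-Rint g1 -> m2.-Rint g2 ->
  (forall x y, `|f x y| <= g1 x * g2 y) ->
  [/\ m1.-Rint (fun x => \int[m2]_y f x y),
      m2.-Rint (fun y => \int[m1]_x f x y) &
      \int[m1]_x \int[m2]_y f x y = \int[m2]_y \int[m1]_x f x y].
Proof.
move=> mf g10 g20 ig1 ig2 fg.
have [H1 H2] := RFubini1 mf g10 g20 ig1 ig2 fg.
have mf' : measurable_fun setT (fun z : T2 * T1 => f z.2 z.1).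
  exact: (measurableT_comp mf (@measurable_swap _ _ _ _)).
have fg' y x : `|f x y| <= g2 y * g1 x by rewrite mulrC.
by have [H3 _] := RFubini1 mf' g20 g10 ig2 ig1 fg'.
Qed.

End fubini2.

(** * The exponential density and its cosine transform *)

Section exponential_law.
Context {R : realType}.
Local Notation leb := (@lebesgue_measure R).
Local Notation p := (@exponential_pdf R 1).

Lemma expdens_ge0 u : 0 <= p u.
Proof. exact: exponential_pdf_ge0. Qed.

Lemma expdens_meas : measurable_fun setT p.
Proof. exact: measurable_exponential_pdf. Qed.

Lemma expdens_Rint : leb.-Rint p.
Proof. exact: integrable_exponential_pdf. Qed.

Lemma expdens1 : \int[leb]_u p u = 1.
Proof. by rewrite /Rintegral integral_exponential_pdf. Qed.

Lemma expdens_Rint_bounded (g : R -> R) (M : R) : measurable_fun setT g ->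
  (forall u, `|g u| <= M) -> leb.-Rint (fun u => p u * g u).
Proof.
move=> mg gM; refine (@le_Rint _ _ _ leb _ (fun u => M * p u) _ _ _).
- by apply: measurable_funM => //; exact: expdens_meas.
- exact: RintZ expdens_Rint.
- move=> u; rewrite normrM (ger0_norm (expdens_ge0 u)) mulrC.
  by apply: ler_wpM2r => //; exact: expdens_ge0.
Qed.

(** The condition [G' = G - g] says that [- (expR (- u) * G u)] is a primitive of
    [expR (- u) * g u]; boundedness of [G] kills the term at infinity. *)
Lemma expdens_FTC (g G : R -> R) (M : R) : continuous g ->
  (forall u : R, is_derive u 1 G (G u - g u)) ->
  (forall u, 0 <= g u) -> (forall u, `|G u| <= M) ->
  \int[leb]_u (p u * g u) = G 0.
Proof.
move=> cg dG g0 GM.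
have dF (u : R) : is_derive u 1 (fun u => - (expR (- u) * G u)) (expR (- u) * g u).
  have H := dG u.
  apply: is_derive_eq; rewrite -?mulr_regl /=; rewrite /GRing.scale /=; ring.
have cF (u : R) : {for u, continuous (fun u => - (expR (- u) * G u))}.
  apply: differentiable_continuous; apply/derivable1_diffP.
  by have [] := dF u.
have := @ge0_continuous_FTC2y R (fun u => expR (- u) * g u)
  (fun u => - (expR (- u) * G u)) 0 0.
rewrite oppr0 expR0 mul1r => H.
have h1 (x : R) : 0 <= x -> 0 <= expR (- x) * g x.
  by move=> _; rewrite mulr_ge0// expR_ge0.
have h2 : {within `[0, +oo[, continuous fun u : R => expR (- u) * g u}.
  apply: continuous_subspaceT => x; apply: cvgM; last exact: cg.
  by apply: continuous_comp; [exact: opp_continuous|exact: continuous_expR].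
have h3 : - (expR (- x) * G x) @[x --> +oo] --> (0 : R).
  rewrite -oppr0; apply: cvgN.
  apply/cvgrPdist_le => e e0.
  have [M0|M0] := ltP 0 M; last first.
    have G00 u : G u = 0 by apply/normr0_eq0/le_anti; rewrite normr_ge0 (le_trans (GM u)).
    by near=> u; rewrite G00 mulr0 subrr normr0 ltW.
  near=> u; rewrite sub0r normrN normrM ger0_norm ?expR_ge0//.
  rewrite (@le_trans _ _ (expR (- u) * M))// ?ler_wpM2l ?expR_ge0//.
  rewrite -ler_pdivlMr// -[leRHS]lnK; last by rewrite posrE divr_gt0.
  by rewrite ler_expR lerNl; near: u; apply: nbhs_pinfty_ge; rewrite num_real.
have h4 (x : R) : 0 < x -> derivable (fun u : R => - (expR (- u) * G u)) x 1.
  by move=> _; have [] := dF x.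
have h5 : - (expR (- x) * G x) @[x --> 0^'+] --> - G 0.
  have := cF 0; rewrite /prop_for /continuous_at oppr0 expR0 mul1r => h.
  by apply: cvg_at_right_filter; exact: h.
have h6 : {in `]0, +oo[, (fun u : R => - (expR (- u) * G u))^`()%classic =1
    (fun u : R => expR (- u) * g u)}.
  by move=> x _; rewrite derive1E; have [] := dF x.
have {}H := H h1 h2 h3 h4 h5 h6.
rewrite /Rintegral (_ : (\int[leb]_x (p x * g x)%:E)%E = (0%:E - (- G 0)%:E)%E).
  by rewrite /= sub0r opprK.
rewrite -H [RHS]integral_mkcond; apply: eq_integral => x _ /=.
rewrite patchE /exponential_pdf patchE; case: ifPn => // _.
  by rewrite mul1r mulN1r.
by rewrite mul0r.
Unshelve. all: end_near. Qed.

Lemma expdens_cos y : \int[leb]_u (p u * cos (u * y)) = (1 + y ^+ 2)^-1.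
Proof.
have y1 : 1 + y ^+ 2 != 0 by rewrite gt_eqF// ltr_pwDl// sqr_ge0.
have cc : continuous (fun u : R => cos (u * y)).
  by move=> u; apply: continuous_comp; [exact: cvgMl|exact: continuous_cos].
have mc : measurable_fun setT (fun u : R => cos (u * y)).
  exact: continuous_measurable_fun.
have cM u : `|cos (u * y)| <= 1 by rewrite ler_norml cos_geN1 cos_le1.
(* [1 + cos] replaces [cos] to have a nonnegative integrand, as the improper fundamental theorem
   asks. [G] solves [G' = G - (1 + cos (u * y))], and the constant 1 cancels against the mass of the
   density. *)
pose G u : R := 1 + (cos (u * y) - y * sin (u * y)) / (1 + y ^+ 2).
have h1 : continuous (fun u : R => 1 + cos (u * y)).
  by move=> u; apply: cvgD; [exact: cvg_cst|exact: cc].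
have h2 (u : R) : is_derive u 1 G (G u - (1 + cos (u * y))).
  rewrite /G; apply: is_derive_eq; rewrite /GRing.scale /=; field; exact: y1.
have h3 u : 0 <= 1 + cos (u * y).
  by rewrite -lerBlDl sub0r; have := cM u; rewrite ler_norml => /andP[].
have h4 u : `|G u| <= 1 + (1 + `|y|) / (1 + y ^+ 2).
  apply: (le_trans (ler_normD _ _)); rewrite normr1 lerD2l.
  rewrite normrM normfV (@ger0_norm _ (1 + _)); last by rewrite addr_ge0// sqr_ge0.
  rewrite ler_wpM2r// ?invr_ge0 ?addr_ge0 ?sqr_ge0//.
  apply: (le_trans (ler_normB _ _)); apply: lerD => //.
  by rewrite normrM ler_piMr// ler_norml sin_geN1 sin_le1.
have := expdens_FTC h1 h2 h3 h4.
under eq_Rintegral do rewrite mulrDr mulr1.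
rewrite RintegralD//; [|exact: expdens_Rint|exact: (expdens_Rint_bounded mc cM)].
by rewrite expdens1 /G => /addrI ->; rewrite mul0r cos0 sin0 mulr0 subr0 div1r.
Qed.

Lemma expdens_sin y : \int[leb]_u (p u * sin (u * y)) = y / (1 + y ^+ 2).
Proof.
have y1 : 1 + y ^+ 2 != 0 by rewrite gt_eqF// ltr_pwDl// sqr_ge0.
have cc : continuous (fun u : R => sin (u * y)).
  by move=> u; apply: continuous_comp; [exact: cvgMl|exact: continuous_sin].
have mc : measurable_fun setT (fun u : R => sin (u * y)).
  exact: continuous_measurable_fun.
have cM u : `|sin (u * y)| <= 1 by rewrite ler_norml sin_geN1 sin_le1.
pose G u : R := 1 + (sin (u * y) + y * cos (u * y)) / (1 + y ^+ 2).
have h1 : continuous (fun u : R => 1 + sin (u * y)).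
  by move=> u; apply: cvgD; [exact: cvg_cst|exact: cc].
have h2 (u : R) : is_derive u 1 G (G u - (1 + sin (u * y))).
  rewrite /G; apply: is_derive_eq; rewrite /GRing.scale /=; field; exact: y1.
have h3 u : 0 <= 1 + sin (u * y).
  by rewrite -lerBlDl sub0r; have := cM u; rewrite ler_norml => /andP[].
have h4 u : `|G u| <= 1 + (1 + `|y|) / (1 + y ^+ 2).
  apply: (le_trans (ler_normD _ _)); rewrite normr1 lerD2l.
  rewrite normrM normfV (@ger0_norm _ (1 + _)); last by rewrite addr_ge0// sqr_ge0.
  rewrite ler_wpM2r// ?invr_ge0 ?addr_ge0 ?sqr_ge0//.
  apply: (le_trans (ler_normD _ _)); apply: lerD => //.
  by rewrite normrM ler_piMr// ler_norml cos_geN1 cos_le1.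
have := expdens_FTC h1 h2 h3 h4.
under eq_Rintegral do rewrite mulrDr mulr1.
rewrite RintegralD//; [|exact: expdens_Rint|exact: (expdens_Rint_bounded mc cM)].
by rewrite expdens1 /G => /addrI ->; rewrite mul0r cos0 sin0 mulr1 add0r.
Qed.

End exponential_law.

(** * Taylor remainders of the sine, cosine and exponential *)

Section taylor_bounds.
Context {R : realType}.
Implicit Types (a x y : R).

Lemma MVT_le (f df : R -> R) (x y M : R) :
  (forall z : R, is_derive z 1 f (df z)) ->
  (forall z, `|z - x| <= `|y - x| -> `|df z| <= M) ->
  `|f y - f x| <= M * `|y - x|.
Proof.
move=> Df DM.
have cf : continuous f.
  by move=> z; apply/differentiable_continuous/derivable1_diffP; have [] := Df z.
wlog xy : x y DM / x <= y => [hw|].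
  have [xy|/ltW yx] := leP x y; first exact: hw.
  have H z : `|z - y| <= `|x - y| -> `|df z| <= M -> `|df z| <= M by [].
  rewrite distrC (distrC y x).
  have [z zxy ->] := @MVT_segment _ _ _ _ _ yx (fun z _ => Df z) (continuous_subspaceT cf).
  rewrite normrM ler_wpM2r//; apply: DM.
  move: zxy; rewrite in_itv/= => /andP[yz zx].
  by rewrite distrC ger0_norm ?subr_ge0// distrC ger0_norm ?subr_ge0// lerB.
have [z zxy ->] := @MVT_segment _ _ _ _ _ xy (fun z _ => Df z) (continuous_subspaceT cf).
rewrite normrM ler_wpM2r//; apply: DM.
move: zxy; rewrite in_itv/= => /andP[yz zx].
by rewrite ger0_norm ?subr_ge0// ger0_norm ?subr_ge0// lerB.
Qed.

(** Each use integrates a power bound once without dividing by the exponent, which is why the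
    remainders below carry no factorials. *)
Lemma MVT_le_pow (f df : R -> R) (a C : R) n : f 0 = 0 ->
  (forall z : R, is_derive z 1 f (df z)) ->
  (forall z, `|z| <= a -> `|df z| <= C * `|z| ^+ n) ->
  forall x, `|x| <= a -> `|f x| <= C * `|x| ^+ n.+1.
Proof.
move=> f0 Df DC x xa.
have := @MVT_le f df 0 x (C * `|x| ^+ n) Df.
rewrite f0 !subr0 exprSr mulrA; apply => z; rewrite subr0 => zx.
have C0 : 0 <= C * `|x| ^+ n by rewrite (le_trans _ (DC _ xa)).
apply: (le_trans (DC _ (le_trans zx xa))).
case: n DC C0 => [|n] DC C0; first by rewrite !expr0.
have [C0'|C0'] := leP 0 C; first by rewrite ler_wpM2l// lerXn2r ?nnegrE.
have [/eqP|x0] := eqVneq x 0.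
  move=> /eqP x0; move: zx; rewrite x0 normr0 normr_le0 => /eqP->.
  by rewrite normr0.
by move: C0; rewrite pmulr_lge0 ?exprn_gt0 ?normr_gt0// leNgt C0'.
Qed.

Lemma sin_le x : `|sin x| <= `|x|.
Proof.
have h z : `|z| <= `|x| -> `|cos z| <= 1 * `|z| ^+ 0 by rewrite mulr1 cos_max.
have := @MVT_le_pow sin cos `|x| 1 0 (@sin0 R) (fun z => is_derive_sin z) h x.
by rewrite expr1 mul1r; apply.
Qed.

Lemma cos1_le x : `|1 - cos x| <= x ^+ 2.
Proof.
have D (z : R) : is_derive z 1 (fun z => 1 - cos z) (sin z).
  by apply: is_derive_eq; rewrite /GRing.scale /=; ring.
have h z : `|z| <= `|x| -> `|sin z| <= 1 * `|z| ^+ 1.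
  by rewrite expr1 mul1r sin_le.
have h0 : 1 - cos 0 = 0 :> R by rewrite cos0 subrr.
have := @MVT_le_pow _ _ `|x| 1 1 h0 D h x.
by rewrite mul1r real_normK ?num_real//; apply.
Qed.

Lemma sinB_le x : `|sin x - x| <= `|x| ^+ 3.
Proof.
have D (z : R) : is_derive z 1 (fun z => sin z - z) (cos z - 1).
  by apply: is_derive_eq; rewrite /GRing.scale /=; ring.
have h z : `|z| <= `|x| -> `|cos z - 1| <= 1 * `|z| ^+ 2.
  by rewrite real_normK ?num_real// mul1r distrC cos1_le.
have h0 : sin 0 - 0 = 0 :> R by rewrite sin0 subrr.
have := @MVT_le_pow _ _ `|x| 1 2 h0 D h x.
by rewrite mul1r; apply.
Qed.

Lemma cos2_le x : `|1 - cos x - x ^+ 2 / 2| <= `|x| ^+ 4.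
Proof.
have D (z : R) : is_derive z 1 (fun z => 1 - cos z - z ^+ 2 / 2) (sin z - z).
  by apply: is_derive_eq; rewrite /GRing.scale /=; field.
have h z : `|z| <= `|x| -> `|sin z - z| <= 1 * `|z| ^+ 3.
  by rewrite mul1r sinB_le.
have h0 : 1 - cos 0 - 0 ^+ 2 / 2 = 0 :> R.
  by rewrite cos0 expr0n/= mul0r !subrr.
have := @MVT_le_pow _ _ `|x| 1 3 h0 D h x.
by rewrite mul1r; apply.
Qed.

Lemma expR1_le x : `|x| <= 1 -> `|expR x - 1| <= expR 1 * `|x|.
Proof.
have D (z : R) : is_derive z 1 (fun z => expR z - 1) (expR z).
  by apply: is_derive_eq; rewrite /GRing.scale /=; ring.
have h0 : expR 0 - 1 = 0 :> R by rewrite expR0 subrr.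
apply: (@MVT_le_pow _ _ 1 (expR 1) 0 h0 D) => z z1; rewrite expr0 mulr1 ger0_norm ?expR_ge0// ler_expR.
by rewrite (le_trans _ z1)// ler_norm.
Qed.

Lemma expR2_le x : `|x| <= 1 -> `|expR x - 1 - x| <= expR 1 * `|x| ^+ 2.
Proof.
have D (z : R) : is_derive z 1 (fun z => expR z - 1 - z) (expR z - 1).
  by apply: is_derive_eq; rewrite /GRing.scale /=; ring.
have h0 : expR 0 - 1 - 0 = 0 :> R by rewrite expR0 !subrr.
apply: (@MVT_le_pow _ _ 1 (expR 1) 1 h0 D) => z z1; rewrite expr1; exact: expR1_le.
Qed.

Lemma expR3_le x : `|x| <= 1 ->
  `|expR x - 1 - x - x ^+ 2 / 2| <= expR 1 * `|x| ^+ 3.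
Proof.
have D (z : R) : is_derive z 1 (fun z => expR z - 1 - z - z ^+ 2 / 2) (expR z - 1 - z).
  by apply: is_derive_eq; rewrite /GRing.scale /=; field.
have h0 : expR 0 - 1 - 0 - 0 ^+ 2 / 2 = 0 :> R.
  by rewrite expR0 expr0n/= mul0r !subrr.
apply: (@MVT_le_pow _ _ 1 (expR 1) 2 h0 D) => z z1; exact: expR2_le.
Qed.

End taylor_bounds.

(** * Second moment of the exponential law *)

Section moments.
Context {R : realType}.
Local Notation leb := (@lebesgue_measure R).
Local Notation p := (@exponential_pdf R 1).

(** Second difference quotient at 0 of the cosine transform of the density: its integral is explicit
    by [expdens_cos], and it tends to half the integrand of the second moment. *)
Let f (n : nat) (u : R) := p u * (n.+1%:R ^+ 2 * (1 - cos (u * n.+1%:R^-1))).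

Let mf n : measurable_fun setT (f n).
Proof.
apply: measurable_funM; first exact: expdens_meas.
apply: measurable_funM => //; apply: measurable_funB => //.
apply: continuous_measurable_fun => u.
by apply: continuous_comp; [exact: cvgMl|exact: continuous_cos].
Qed.

Let fcvg u : f n u @[n --> \oo] --> p u * (u ^+ 2 / 2).
Proof.
apply: cvgMr; apply/cvgrPdist_le => e e0; near=> n.
have n0 : (n.+1%:R : R) != 0 by [].
rewrite (_ : _ - _ = - (n.+1%:R ^+ 2 *
  (1 - cos (u / n.+1%:R) - (u / n.+1%:R) ^+ 2 / 2))); last by field.
rewrite normrN normrM ger0_norm ?sqr_ge0//.
apply: (@le_trans _ _ (n.+1%:R ^+ 2 * `|u / n.+1%:R| ^+ 4)).
  by rewrite ler_wpM2l ?sqr_ge0//; exact: cos2_le.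
rewrite normrM normfV (ger0_norm (ler0n _ _)).
rewrite (_ : _ * _ = `|u| ^+ 4 / n.+1%:R ^+ 2); last by field.
rewrite ler_pdivrMr ?exprn_gt0//.
apply: (@le_trans _ _ (e * n.+1%:R)); last first.
  by rewrite ler_pM2l// expr2 ler_peMl// ler1n.
rewrite mulrC -ler_pdivrMr//; near: n.
by apply: filterS (nbhs_infty_ger (`|u| ^+ 4 / e)) => k /le_trans; apply; rewrite ler_nat.
Unshelve. all: end_near. Qed.

Let f0 n u : 0 <= f n u.
Proof.
rewrite mulr_ge0 ?expdens_ge0// mulr_ge0 ?sqr_ge0// subr_ge0; exact: cos_le1.
Qed.

Let fint n : leb.-Rint (f n) /\ \int[leb]_u f n u = n.+1%:R ^+ 2 / (1 + n.+1%:R ^+ 2).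
Proof.
have n0 : (n.+1%:R : R) != 0 by [].
have E u : f n u = n.+1%:R ^+ 2 * (p u - p u * cos (u / n.+1%:R)) by rewrite /f; ring.
have i1 : leb.-Rint (fun u => p u * cos (u / n.+1%:R)).
  apply: (@expdens_Rint_bounded _ _ 1); last by move=> u; exact: cos_max.
  apply: continuous_measurable_fun => u.
  by apply: continuous_comp; [exact: cvgMl|exact: continuous_cos].
have i2 : leb.-Rint (fun u => p u - p u * cos (u / n.+1%:R)).
  by apply: RintB i1; exact: expdens_Rint.
have fE : f n = fun u => n.+1%:R ^+ 2 * (p u - p u * cos (u / n.+1%:R)) by apply/funext.
rewrite fE; split; first exact: RintZ.
rewrite RintegralZl// RintegralB//; last exact: expdens_Rint.
rewrite expdens1 expdens_cos; move: (n.+1%:R : R) n0 => a a0; field.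
by rewrite a0 /= andbT gt_eqF// ltr_pwDl// sqr_ge0.
Qed.

Let half_moment : leb.-Rint (fun u => p u * (u ^+ 2 / 2)).
Proof.
have [] // := @Rfatou _ _ _ leb f (fun u => p u * (u ^+ 2 / 2)) 1 f0 (fun n => (fint n).1) fcvg.
move=> n; rewrite (fint n).2 ler_pdivrMr; last by rewrite ltr_pwDr// sqr_ge0.
by rewrite mul1r lerDr.
Qed.

Lemma expdens_Rint_sqr : leb.-Rint (fun u => p u * u ^+ 2).
Proof.
have := RintZ 2 half_moment.
by under eq_fun do rewrite mulrCA [2 * _]mulrC divfK//.
Qed.

(** Fatou has made [p u * u ^+ 2] integrable, and this function dominates all the quotients [f n];
    the value 2 is the limit of twice their integrals. *)
Lemma expdens_sqr : \int[leb]_u (p u * u ^+ 2) = 2.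
Proof.
have fle : (forall n u, `|f n u| <= p u * u ^+ 2).
  move=> n u; rewrite ger0_norm// ler_wpM2l ?expdens_ge0//.
  have n0 : (n.+1%:R : R) != 0 by [].
  rewrite -[leRHS](_ : n.+1%:R ^+ 2 * (u / n.+1%:R) ^+ 2 = _); last by field.
  by rewrite ler_wpM2l ?sqr_ge0// (le_trans _ (cos1_le _))// ler_norm.
have [_] := @Rdominated _ _ _ leb f (fun u => p u * (u ^+ 2 / 2))
   (fun u => p u * u ^+ 2) mf fcvg expdens_Rint_sqr fle.
under eq_cvg do rewrite (fint _).2.
under eq_Rintegral do rewrite mulrA mulrC.
rewrite RintegralZl//; last exact: expdens_Rint_sqr.
move=> h.
have h1 : (n.+1%:R ^+ 2 / (1 + n.+1%:R ^+ 2) : R) @[n --> \oo] --> (1 : R).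
  apply/cvgrPdist_le => e e0; near=> n.
  have n1 : (1 + n.+1%:R ^+ 2 : R) != 0 by rewrite gt_eqF// ltr_pwDr// sqr_ge0.
  rewrite (_ : _ - _ = (1 + n.+1%:R ^+ 2)^-1); last by field.
  rewrite ger0_norm ?invr_ge0 ?addr_ge0 ?sqr_ge0//.
  have n2 : 0 < 1 + n.+1%:R ^+ 2 :> R by rewrite ltr_pwDr// sqr_ge0.
  rewrite -[leRHS]invrK lef_pV2 ?posrE ?invr_gt0//.
  apply: (@le_trans _ _ n.+1%:R).
    near: n; apply: filterS (nbhs_infty_ger (e^-1)) => k /le_trans; apply.
    by rewrite ler_nat.
  by rewrite (@le_trans _ _ (n.+1%:R ^+ 2))// ?lerDr// expr2 ler_peMl// ler1n.
have hh := cvg_unique (@Rhausdorff R) h h1.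
have E (a : R) : a = 2 * (2^-1 * a) by field.
by rewrite [LHS]E hh mulr1.
Unshelve. all: end_near. Qed.

Lemma expdens_Rint_poly : leb.-Rint (fun u => p u * (1 + u ^+ 2)).
Proof.
have := RintD expdens_Rint expdens_Rint_sqr.
by under eq_fun do rewrite -[X in X + _]mulr1 -mulrDr.
Qed.

Lemma expdens_Rint_dom (g : R -> R) (C : R) : measurable_fun setT g ->
  (forall u, `|g u| <= C * (1 + u ^+ 2)) -> leb.-Rint (fun u => p u * g u).
Proof.
move=> mg gC; refine (@le_Rint _ _ _ leb _ (fun u => C * (p u * (1 + u ^+ 2))) _ _ _).
- by apply: measurable_funM => //; exact: expdens_meas.
- exact/RintZ/expdens_Rint_poly.
- move=> u; rewrite normrM (ger0_norm (expdens_ge0 u)) mulrCA.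
  by rewrite ler_wpM2l// expdens_ge0.
Qed.

Lemma expdens_Rint_id : leb.-Rint (fun u => p u * u).
Proof.
apply: (@expdens_Rint_dom _ 1) => // u; rewrite mul1r -(real_normK (num_real u)).
have := sqr_ge0 (`|u| - 1); have := normr_ge0 u; nra.
Qed.

End moments.

Section expdens_fubini.
Context {R : realType} {d} {T : measurableType d}.
Variable m : {sigma_finite_measure set T -> \bar R}.
Local Notation leb := (@lebesgue_measure R).
Local Notation p := (@exponential_pdf R 1).

(** Quadratic growth in [u] is that of a Levy exponent and is absorbed by the second moment of the
    exponential law. *)
Lemma expdens_Fubini (k : R -> T -> R) (g : T -> R) :
  measurable_fun setT (fun z : R * T => k z.1 z.2) ->
  (forall t, 0 <= g t) -> m.-Rint g ->
  (forall u t, `|k u t| <= (1 + u ^+ 2) * g t) ->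
  [/\ leb.-Rint (fun u => p u * \int[m]_t k u t),
      m.-Rint (fun t => \int[leb]_u (p u * k u t)) &
      \int[m]_t \int[leb]_u (p u * k u t) = \int[leb]_u (p u * \int[m]_t k u t)].
Proof.
move=> mk g0 ig kg.
have pu0 (u : R) : 0 <= p u * (1 + u ^+ 2).
  by rewrite mulr_ge0 ?expdens_ge0// addr_ge0// sqr_ge0.
have mpk : measurable_fun setT (fun z : R * T => p z.1 * k z.1 z.2).
  by apply: measurable_funM => //; exact: (measurableT_comp expdens_meas).
have H u t : `|p u * k u t| <= p u * (1 + u ^+ 2) * g t.
  rewrite normrM (ger0_norm (expdens_ge0 _)) -mulrA.
  by rewrite ler_wpM2l// expdens_ge0.
have [h1 h2 h3] := @RFubini _ _ _ _ _ leb m (fun u t => p u * k u t) _ g mpk pu0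
  g0 expdens_Rint_poly ig H.
have E u : \int[m]_t (p u * k u t) = p u * \int[m]_t k u t.
  rewrite RintegralZl//; apply: (@le_Rint _ _ _ m _ (fun t => (1 + u ^+ 2) * g t)) => //.
    exact: (measurableT_comp mk (pair1_measurable u)).
  exact: RintZ.
under [in X in leb.-Rint X]eq_fun do rewrite -E.
split=> //; rewrite -h3; apply: eq_Rintegral => u _; exact: E.
Qed.

End expdens_fubini.

(** * Cauchy kernels and convergence of positive functionals *)

Section cauchy_kernel.
Context {R : realType}.
Local Notation leb := (@lebesgue_measure R).

(** Compactness of a segment exceeding the support by 1 gives the modulus there; as [eta < 1], a
    point outside it is only compared with points where [g] vanishes too. *)
Lemma compact_support_unif_cont (g : R -> R) (A : R) : continuous g ->
  (forall y, A < `|y| -> g y = 0) ->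
  forall e : R, 0 < e -> exists2 eta, 0 < eta &
    forall x y, `|x - y| < eta -> `|g x - g y| <= e.
Proof.
move=> cg gA e e0.
have H0 := (@compact_near_coveringP _ _).1 (@segment_compact R (- (`|A| + 1)) (`|A| + 1)) R
  (0^'+) (fun eta x => forall y, `|x - y| < eta -> `|g x - g y| <= e) _.
have hH : (forall x : R, `[- (`|A| + 1), `|A| + 1]%classic x ->
  \forall x' \near x & i \near 0^'+, forall y : R, `|x' - y| < i -> `|g x' - g y| <= e).
  move=> x _.
  have e2 : 0 < e / 2 by rewrite divr_gt0.
  have /cvgrPdist_le/(_ _ e2)/nbhs_ballP[r /= r0 hr] := cg x.
  exists (ball x (r / 2), [set i | i < r / 2]).
    split => /=; first by apply: nbhsx_ballx; rewrite divr_gt0.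
    by apply: nbhs_right_lt; rewrite divr_gt0.
  move=> [x' i] /= [xx' ir] y x'y.
  have h1 : `|g x - g x'| <= e / 2.
    by apply: hr; rewrite /ball/=; apply: lt_le_trans xx' _; rewrite ler_pdivrMr// ler_pMr// ler1n.
  have h2 : `|g x - g y| <= e / 2.
    apply: hr; rewrite /ball/= -[x](subrK x') -addrA (le_lt_trans (ler_normD _ _))//.
    by rewrite [ltRHS]splitr ltrD// (lt_trans x'y).
  rewrite -[g x'](subrK (g x)) -addrA (le_trans (ler_normD _ _))//.
  by rewrite [leRHS]splitr lerD// distrC.
have H := H0 _ hH.
have {H} [eta [eta0 eta1 heta]] : exists eta, [/\ 0 < eta, eta < 1 &
    `[- (`|A| + 1), `|A| + 1] `<=` (fun x => forall y : R, `|x - y| < eta -> `|g x - g y| <= e)].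
  near (0:R)^'+ => eta; exists eta; split.
  - by near: eta; exact: nbhs_right_gt.
  - by near: eta; exact: nbhs_right_lt.
  - by near: eta; exact: H.
exists eta => // x y xy.
have [xA|] := leP `|x| (`|A| + 1).
  by apply: heta => //=; rewrite in_itv/= -ler_norml.
move=> Ax.
have AA := ler_norm A.
have Ax' : A < `|x| by apply: le_lt_trans Ax; lra.
rewrite gA// gA; first by rewrite subrr normr0 ltW.
have : `|x| <= `|x - y| + `|y| by rewrite -{1}[x](subrK y) ler_normD.
by move=> h; apply: le_lt_trans (_ : `|x| - 1 < _); lra.
Unshelve. all: end_near. Qed.

(** Density of the Cauchy law of scale [1 / s], an approximate identity as [s] tends to infinity. *)
Definition cauchy_kernel (s z : R) : R := s / pi / (1 + (s * z) ^+ 2).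

Lemma cauchy_kernel_ge0 s z : 0 <= s -> 0 <= cauchy_kernel s z.
Proof.
move=> s0; rewrite /cauchy_kernel divr_ge0// ?divr_ge0 ?pi_ge0//.
by rewrite addr_ge0// sqr_ge0.
Qed.

Lemma continuous_cauchy_kernel s y : continuous (fun a => cauchy_kernel s (y - a)).
Proof.
move=> a; apply: cvgMr; apply: cvgV.
  by rewrite gt_eqF// ltr_pwDl// sqr_ge0.
apply: cvgD; first exact: cvg_cst.
apply: (@continuous_comp _ _ _ (fun a => s * (y - a)) (fun x => x ^+ 2)); last exact: exprn_continuous.
by apply: cvgMr; apply: cvgB; [exact: cvg_cst|exact: cvg_id].
Qed.

Lemma integral_cauchy_kernel s y B : 0 < B ->
  \int[leb]_(a in `[- B, B]) cauchy_kernel s (y - a) =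
  (atan (s * (B - y)) + atan (s * (B + y))) / pi.
Proof.
move=> B0.
pose F a := atan (s * (a - y)) / pi.
have dF (a : R) : is_derive a 1 F (cauchy_kernel s (y - a)).
  rewrite /F /cauchy_kernel; apply: is_derive_eq.
  rewrite /GRing.scale /= (_ : (s * (y - a)) ^+ 2 = (s * (a - y)) ^+ 2); last by ring.
  ring.
have cF : continuous F.
  by move=> z; apply/differentiable_continuous/derivable1_diffP; have [] := dF z.
rewrite /Rintegral (@continuous_FTC2 _ _ F).
- rewrite /= /F [s * (- B - y)](_ : _ = - (s * (B + y))); last by ring.
  by rewrite atanN; ring.
- lra.
- exact/continuous_subspaceT/continuous_cauchy_kernel.
- split; [by move=> x _; have [] := dF x| |].
  + by apply: cvg_at_right_filter; exact: cF.
  + by apply: cvg_at_left_filter; exact: cF.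
- by move=> x _; rewrite derive1E; have [] := dF x.
Qed.

(** The window exceeds the support by 1 on each side, so for [y] in the support both ends are at
    distance at least 1 and the missing mass of the kernel is controlled by [atan s], uniformly in
    [y]. For other [y] the missing mass is multiplied by [g y = 0]. *)
Lemma cauchy_approx (g : R -> R) (A : R) : 0 < A -> continuous g ->
  (forall y, A < `|y| -> g y = 0) ->
  forall e : R, 0 < e -> \forall s \near +oo, 0 < s /\
   forall y, `|\int[leb]_(a in `[- (A + 1), A + 1]) (g a * cauchy_kernel s (y - a)) - g y| <= e.
Proof.
move=> A0 cg gA e e0.
have B0 : 0 < A + 1 by lra.
have [eta eta0 heta] := compact_support_unif_cont cg gA (divr_gt0 e0 (ltr0n _ 3)).
have [M [M0 gM]] : exists M, 0 < M /\ forall y, `|g y| <= M.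
  have := compact_bounded (continuous_compact (continuous_subspaceT cg) (@segment_compact R (- A) A)).
  move=> /ex_strict_bound_gt0[M M0 hM]; exists M; split => // y.
  have [yA|/gA->] := leP `|y| A; last by rewrite normr0 ltW.
  apply/ltW/hM; exists y => //=; by rewrite in_itv/= -ler_norml.
have p0 : (0 : R) < pi := pi_gt0 R.
have patan : \forall s \near (+oo : set_system R), pi / 2 - atan s <= e / (6 * M).
  have h : 0 < e / (6 * M) by rewrite divr_gt0// mulr_gt0.
  have /cvgrPdist_le/(_ _ h) := @cvgy_atan R.
  by apply: filterS => s; rewrite ler_norml => /andP[].
near=> s.
have s0 : 0 < s by near: s; apply: nbhs_pinfty_gt; rewrite num_real.
split => // y.
pose D := `[- (A + 1), A + 1]%classic : set R.
have mD : measurable D by exact: measurable_itv.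
have ci (f : R -> R) : continuous f -> leb.-integrable D (EFin \o f).
  move=> cf; apply: continuous_compact_integrable; first exact: segment_compact.
  exact: continuous_subspaceT.
have cK := @continuous_cauchy_kernel s y.
pose I := \int[leb]_(a in D) cauchy_kernel s (y - a).
have IE : I = (atan (s * (A + 1 - y)) + atan (s * (A + 1 + y))) / pi.
  exact: integral_cauchy_kernel.
have I1 : I <= 1.
  rewrite IE ler_pdivrMr// mul1r.
  by have := atan_ltpi2 (s * (A + 1 - y)); have := atan_ltpi2 (s * (A + 1 + y)); lra.
(* In the first term either [g a] is close to [g y] or the kernel is small; the second term is the
   kernel mass missing from the window. *)
have -> : \int[leb]_(a in D) (g a * cauchy_kernel s (y - a)) - g y =
   \int[leb]_(a in D) ((g a - g y) * cauchy_kernel s (y - a)) + g y * (I - 1).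
  under [X in _ = X + _]eq_Rintegral do rewrite mulrBl.
  rewrite RintegralB//; last 2 first.
    by apply: ci => a; apply: cvgM; [exact: cg|exact: cK].
    by apply: ci => a; apply: cvgMr; exact: cK.
  rewrite RintegralZl//; last exact: ci.
  by rewrite -/I; ring.
have Ky a : eta <= `|a - y| -> cauchy_kernel s (y - a) <= (s * pi * eta ^+ 2)^-1.
  move=> ha; rewrite /cauchy_kernel.
  have h : s * pi * eta ^+ 2 != 0 by rewrite gt_eqF// !mulr_gt0// exprn_gt0.
  have [s0' p0' eta0'] : [/\ s != 0, (pi : R) != 0 & eta != 0] by rewrite !gt_eqF.
  have hs : 0 < (s * eta) ^+ 2 by rewrite exprn_gt0// mulr_gt0.
  rewrite [leRHS](_ : _ = s / pi / (s * eta) ^+ 2); last by move: (pi : R) p0' => q q0; field; rewrite eta0' s0' q0.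
  apply: ler_wpM2l; first by rewrite divr_ge0// ltW.
  rewrite lef_pV2 ?posrE//; last by rewrite ltr_pwDl// sqr_ge0.
  apply: (@le_trans _ _ ((s * (y - a)) ^+ 2)); last by rewrite lerDr.
  rewrite !exprMn ler_pM2l ?exprn_gt0//.
  rewrite -(real_normK (num_real (y - a))) lerXn2r ?nnegrE ?normr_ge0 ?(ltW eta0)//.
  by rewrite distrC.
have cgy : continuous (fun a => (g a - g y) * cauchy_kernel s (y - a)).
  by move=> a; apply: cvgM; [apply: cvgB; [exact: cg|exact: cvg_cst]|exact: cK].
have c2 : continuous (fun a => e / 3 * cauchy_kernel s (y - a) + 2 * M * (s * pi * eta ^+ 2)^-1).
  by move=> a; apply: cvgD; [apply: cvgMr; exact: cK|exact: cvg_cst].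
have first_term : `|\int[leb]_(a in D) ((g a - g y) * cauchy_kernel s (y - a))| <= e / 3 + e / 3.
  have h := @le_normr_Rintegral _ _ _ leb D _ (measurable_itv _) (ci _ cgy).
  apply: (le_trans h).
  apply: (@le_trans _ _ (\int[leb]_(a in D) (e / 3 * cauchy_kernel s (y - a) + 2 * M * (s * pi * eta ^+ 2)^-1))).
    apply: le_Rintegral => //; [|exact: ci|].
      apply: (ci (fun a => `|(g a - g y) * cauchy_kernel s (y - a)|)) => a.
      exact: cvg_norm (cgy a).
    move=> a _; rewrite normrM (ger0_norm (cauchy_kernel_ge0 _ (ltW s0))).
    have K0 := cauchy_kernel_ge0 (y - a) (ltW s0).
    have q0 : 0 <= (s * pi * eta ^+ 2)^-1.
      by rewrite invr_ge0 mulr_ge0 ?sqr_ge0// mulr_ge0// ltW.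
    have [ay|ay] := ltP `|a - y| eta.
      rewrite -[leLHS]addr0 lerD//; first by rewrite ler_wpM2r// heta.
      by rewrite mulr_ge0// mulr_ge0// ltW.
    rewrite -[leLHS]add0r lerD//; first by rewrite mulr_ge0// divr_ge0// ltW.
    apply: ler_pM => //; last exact: Ky.
    by rewrite (le_trans (ler_normB _ _))// mulr_natl mulr2n lerD.
  rewrite RintegralD//; last 2 first.
    by apply: ci => a; apply: cvgMr; exact: cK.
    by apply: (ci (fun=> _)) => a; exact: cvg_cst.
  rewrite RintegralZl//; last exact: ci.
  apply: lerD; first by rewrite -/I ler_piMr// divr_ge0// ltW.
  have lD : leb D = ((A + 1) - - (A + 1))%:E.
    have := @lebesgue_measure_itv R `[- (A + 1), A + 1]; rewrite /= lte_fin ifT//; lra.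
  rewrite Rintegral_cst// [X in _ * X <= _](_ : _ = A + 1 - - (A + 1)); last exact: (congr1 fine lD).
  rewrite opprK [leLHS](_ : _ = (4 * M * (A + 1) / (pi * eta ^+ 2)) / s); last first.
    have [s0' p0' eta0'] : [/\ s != 0, (pi : R) != 0 & eta != 0] by rewrite !gt_eqF.
    by move: (pi : R) p0' => q q0; field; rewrite eta0' s0' q0.
  rewrite ler_pdivrMr// -ler_pdivrMl; last by rewrite divr_gt0.
  by near: s; apply: nbhs_pinfty_ge; rewrite num_real.
have second_term : `|g y * (I - 1)| <= e / 3.
  have [yA|/gA->] := leP `|y| A; last by rewrite mul0r normr0 divr_ge0// ltW.
  have I0 : 0 <= 1 - I by rewrite subr_ge0.
  rewrite normrM distrC (ger0_norm I0).
  move: yA; rewrite ler_norml => /andP[y1 y2].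
  have h1 : atan s <= atan (s * (A + 1 - y)) by apply: le_atan; rewrite ler_peMr ?(ltW s0)//; lra.
  have h2 : atan s <= atan (s * (A + 1 + y)) by apply: le_atan; rewrite ler_peMr ?(ltW s0)//; lra.
  have h3 : pi / 2 - atan s <= e / (6 * M) by near: s; exact: patan.
  have pi2 : (2 : R) <= pi by exact: pi_ge2.
  have h4 : (1 - I) * pi <= e / (3 * M).
    rewrite IE mulrBl divfK ?gt_eqF// mul1r.
    rewrite (_ : e / (3 * M) = e / (6 * M) + e / (6 * M)); first lra.
    by field; rewrite gt_eqF.
  apply: (@le_trans _ _ (M * ((1 - I) * pi))).
    by apply: ler_pM => //; nra.
  rewrite (_ : e / 3 = M * (e / (3 * M))); last by field; rewrite gt_eqF.
  by rewrite ler_pM2l.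
apply: le_trans (ler_normD _ _) _; lra.
Unshelve. all: end_near. Qed.

End cauchy_kernel.

(** * Weak convergence from convergence on cosines and sines *)

Section weak_convergence.
Context {R : realType}.
Local Notation leb := (@lebesgue_measure R).
Local Notation p := (@exponential_pdf R 1).
Implicit Types f g : R -> R.

Lemma meas_cos : measurable_fun setT (@cos R).
Proof. exact: continuous_measurable_fun (@continuous_cos R). Qed.

Lemma meas_sin : measurable_fun setT (@sin R).
Proof. exact: continuous_measurable_fun (@continuous_sin R). Qed.

Lemma meas_exp : measurable_fun setT (@expR R).
Proof. exact: continuous_measurable_fun (@continuous_expR R). Qed.

Definition bm f := measurable_fun setT f /\ exists M : R, forall x, `|f x| <= M.

(** What the convergence argument uses of integration against a finite measure. Phrased for
    functionals, it treats an atom at 0 plus a density with respect to [nu] on the same footing as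
    the law of a random variable. The last field exchanges the functional with an exponential
    mixture over frequencies. *)
Record posfun (J : (R -> R) -> R) : Prop := {
  pfD : forall f g, bm f -> bm g -> J (fun x => f x + g x) = J f + J g ;
  pfZ : forall (k : R) f, bm f -> J (fun x => k * f x) = k * J f ;
  pf_ge0 : forall f, bm f -> (forall x, 0 <= f x) -> 0 <= J f ;
  pf_dct : forall (f_ : nat -> R -> R) f (M : R),
     (forall n, measurable_fun setT (f_ n)) -> (forall n x, `|f_ n x| <= M) ->
     (forall x, f_ n x @[n --> \oo] --> f x) -> J (f_ n) @[n --> \oo] --> J f ;
  pf_fubini : forall (k : R -> R -> R) (M : R),
     measurable_fun setT (fun z : R * R => k z.1 z.2) ->
     (forall u y, `|k u y| <= M) ->
     leb.-Rint (fun u => p u * J (k u)) /\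
     J (fun y => \int[leb]_u (p u * k u y)) = \int[leb]_u (p u * J (k u)) }.

Lemma bm_cst (k : R) : bm (fun=> k).
Proof. by split; [exact: measurable_cst|exists `|k|]. Qed.

Lemma bmD f g : bm f -> bm g -> bm (fun x => f x + g x).
Proof.
move=> [mf [M fM]] [mg [N gN]]; split; first exact: measurable_funD.
by exists (M + N) => x; rewrite (le_trans (ler_normD _ _))// lerD.
Qed.

Lemma bmM f g : bm f -> bm g -> bm (fun x => f x * g x).
Proof.
move=> [mf [M fM]] [mg [N gN]]; split; first exact: measurable_funM.
by exists (M * N) => x; rewrite normrM ler_pM.
Qed.

Lemma bm_cos (v : R) : bm (fun x => cos (v * x)).
Proof.
split; last by exists 1 => x; exact: cos_max.
apply: continuous_measurable_fun => x.
by apply: continuous_comp; [exact: cvgMr|exact: continuous_cos].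
Qed.

Lemma bm_sin (v : R) : bm (fun x => sin (v * x)).
Proof.
split; last by exists 1 => x; exact: sin_max.
apply: continuous_measurable_fun => x.
by apply: continuous_comp; [exact: cvgMr|exact: continuous_sin].
Qed.

Lemma bmB f g : bm f -> bm g -> bm (fun x => f x - g x).
Proof.
move=> hf hg; have := bmD hf (bmM (bm_cst (-1)) hg).
by under eq_fun do rewrite mulN1r.
Qed.

Section one.
Variables (J : (R -> R) -> R) (pJ : posfun J).

Lemma pfB f g : bm f -> bm g -> J (fun x => f x - g x) = J f - J g.
Proof.
move=> hf hg; have := pfD pJ hf (bmM (bm_cst (-1)) hg).
rewrite pfZ// mulN1r => <-; congr J; apply/funext => x; by rewrite mulN1r.
Qed.

Lemma pf_le f g : bm f -> bm g -> (forall x, f x <= g x) -> J f <= J g.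
Proof.
move=> hf hg fg; rewrite -subr_ge0 -pfB//; apply: pf_ge0 => //; first exact: bmB.
by move=> x; rewrite subr_ge0.
Qed.

Lemma pf_cst (k : R) : J (fun=> k) = k * J (fun=> 1).
Proof.
rewrite -pfZ//; last exact: bm_cst.
by under [in RHS]eq_fun do rewrite mulr1.
Qed.

Lemma pf_norm f (M : R) : bm f -> (forall x, `|f x| <= M) -> `|J f| <= M * J (fun=> 1).
Proof.
move=> hf fM; have H x : - M <= f x <= M by rewrite -ler_norml.
rewrite ler_norml -mulNr -!pf_cst !pf_le//; try exact: bm_cst.
- by move=> x; have /andP[] := H x.
- by move=> x; have /andP[] := H x.
Qed.

End one.

(** For [u >= 0] one has [expR u * p u = 1], so this is [s / pi] times a Fourier integral of [g];
    for [u < 0] it is 0. Keeping both factors lets measurability follow from [expdens_Fubini]. *)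
Definition smooth_weight (s : R) (q : R -> R) (g : R -> R) (u : R) : R :=
  expR u * (s / pi * (p u * \int[leb]_a (g a * q (u * s * a)))).

(* The Poisson kernel turns the convolution into a mixture of harmonics, on
   which positive functionals commuting with integrals are determined by their
   values on cosines and sines. *)
Lemma cauchy_conv_fourier (g : R -> R) (A s : R) : 0 < A -> 0 < s -> continuous g ->
  (forall y, A < `|y| -> g y = 0) ->
  let k u y := smooth_weight s cos g u * cos (u * s * y) +
               smooth_weight s sin g u * sin (u * s * y) in
  [/\ measurable_fun setT (fun z : R * R => k z.1 z.2),
     measurable_fun setT (smooth_weight s cos g),
     measurable_fun setT (smooth_weight s sin g),
     exists M : R, forall u, `|smooth_weight s cos g u| <= M /\ `|smooth_weight s sin g u| <= M &
     forall y, \int[leb]_(a in `[- (A + 1), A + 1]) (g a * cauchy_kernel s (y - a)) =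
       \int[leb]_u (p u * k u y)].
Proof.
move=> A0 s0 cg gA k.
have p0 : (0 : R) < pi := pi_gt0 R.
pose B := `[- (A + 1), A + 1]%classic : set R.
have ig : leb.-Rint g.
  have : leb.-integrable B (EFin \o g).
    by apply: continuous_compact_integrable; [exact: segment_compact|exact: continuous_subspaceT].
  move/(integrable_mkcond _ _).1 => /(_ (measurable_itv _)).
  apply: eq_integrable => // a _ /=; rewrite patchE; case: ifPn => // aB.
  rewrite gA//; rewrite ltNge; apply: contra aB => aA.
  rewrite inE /B /= in_itv /= -ler_norml; lra.
have ig' : leb.-Rint (fun a => `|g a|) by exact: integrable_norm ig.
have mg : measurable_fun setT g by exact: continuous_measurable_fun.
have mcosz : measurable_fun setT (fun z : R * R => cos (z.1 * s * z.2)).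
  apply: (measurableT_comp meas_cos).
  by apply: measurable_funM => //; apply: measurable_funM.
have msinz : measurable_fun setT (fun z : R * R => sin (z.1 * s * z.2)).
  apply: (measurableT_comp meas_sin).
  by apply: measurable_funM => //; apply: measurable_funM.
have poly1 (u : R) : 1 <= 1 + u ^+ 2 by rewrite lerDl sqr_ge0.
have Q (q : R -> R) : measurable_fun setT (fun z : R * R => q (z.1 * s * z.2)) ->
    (forall x, `|q x| <= 1) ->
    [/\ measurable_fun setT (smooth_weight s q g),
       (forall u, p u * smooth_weight s q g u = s / pi * (p u * \int[leb]_a (g a * q (u * s * a)))) &
       forall u, `|smooth_weight s q g u| <= s / pi * \int[leb]_a `|g a|].
  move=> mq q1.
  have mgq : measurable_fun setT (fun z : R * R => g z.2 * q (z.1 * s * z.2)).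
    by apply: measurable_funM => //; exact: (measurableT_comp mg).
  have H u a : `|g a * q (u * s * a)| <= (1 + u ^+ 2) * `|g a|.
    rewrite normrM mulrC ler_pM//; exact: le_trans (q1 _) (poly1 u).
  have [h1 _ _] := @expdens_Fubini R _ _ leb (fun u a => g a * q (u * s * a)) (fun a => `|g a|) mgq
    (fun a => normr_ge0 _) ig' H.
  have eE (u : R) : u < 0 \/ (0 <= u /\ expR u * p u = 1).
    have [u0|u0] := ltP u 0; [by left|right; split => //].
    by rewrite exponential_pdfE// mul1r mulN1r expRN divff// gt_eqF// expR_gt0.
  have igq u : leb.-Rint (fun a => g a * q (u * s * a)).
    apply: (@le_Rint _ _ _ leb _ (fun a => `|g a|)) ig' _ => //.
      exact: (measurableT_comp mgq (pair1_measurable u)).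
    by move=> a; rewrite normrM ler_piMr.
  split.
  - apply: measurable_funM; first exact: meas_exp.
    by apply: measurable_funM => //; exact: Rint_measurable h1.
  - move=> u; rewrite /smooth_weight; have [u0|[_ E]] := eE u.
      by rewrite lt0_exponential_pdf// !(mul0r, mulr0).
    by rewrite !mulrA (mulrC (p u)) E mul1r.
  - move=> u; rewrite /smooth_weight; have [u0|[_ E]] := eE u.
      rewrite lt0_exponential_pdf// !(mul0r, mulr0) normr0 mulr_ge0//.
        by rewrite divr_ge0// ltW.
      by apply: Rintegral_ge0 => a _.
    rewrite mulrCA [expR u * _]mulrA E mul1r normrM ger0_norm ?divr_ge0 ?(ltW p0) ?(ltW s0)//.
    rewrite ler_pM2l ?divr_gt0//.
    apply: le_trans (@le_normr_Rintegral _ _ _ leb setT _ measurableT (igq u)) _.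
    apply: le_Rintegral => //; first exact: integrable_norm (igq u).
    by move=> a _; rewrite normrM ler_piMr.
have [mc Ec Bc] := Q cos mcosz (fun x => cos_max x).
have [ms Es Bs] := Q sin msinz (fun x => sin_max x).
have mk : measurable_fun setT (fun z : R * R => k z.1 z.2).
  apply: measurable_funD; apply: measurable_funM => //.
  - exact: (measurableT_comp mc).
  - exact: (measurableT_comp ms).
split => //.
  by exists (s / pi * \int[leb]_a `|g a|) => u; split.
move=> y.
rewrite Rintegral_mkcond.
(* The Cauchy kernel is the cosine transform of the exponential density; off the window both
   integrands vanish with [g]. *)
have -> : \int[leb]_a ((fun a => g a * cauchy_kernel s (y - a)) \_ B) a =
    \int[leb]_a \int[leb]_u (p u * (s / pi * (g a * cos (u * s * (y - a))))).
  apply: eq_Rintegral => a _; rewrite patchE.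
  have -> : \int[leb]_u (p u * (s / pi * (g a * cos (u * s * (y - a))))) =
      g a * cauchy_kernel s (y - a).
    rewrite /cauchy_kernel -expdens_cos mulrA -RintegralZl//.
      by apply: eq_Rintegral => u _; rewrite [u * s * _]mulrAC [u * _ * _](_ : _ = u * (s * (y - a))); ring.
    apply: (@expdens_Rint_bounded _ _ 1) => [|u]; last exact: cos_max.
    apply: continuous_measurable_fun => u.
    by apply: continuous_comp; [exact: cvgMl|exact: continuous_cos].
  case: ifPn => // aB; rewrite gA ?mul0r//.
  rewrite ltNge; apply: contra aB => aA.
  rewrite inE /B /= in_itv /= -ler_norml; lra.
have mz : measurable_fun setT (fun z : R * R => s / pi * (g z.2 * cos (z.1 * s * (y - z.2)))).
  apply: measurable_funM => //; apply: measurable_funM; first exact: (measurableT_comp mg).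
  apply: (measurableT_comp meas_cos).
  by apply: measurable_funM => //; [apply: measurable_funM|apply: measurable_funB].
have dz u a : `|s / pi * (g a * cos (u * s * (y - a)))| <= (1 + u ^+ 2) * (s / pi * `|g a|).
  rewrite normrM ger0_norm ?divr_ge0 ?(ltW p0) ?(ltW s0)// mulrCA ler_pM2l ?divr_gt0//.
  by rewrite normrM mulrC ler_pM// (le_trans (cos_max _)).
have [_ _ ->] := @expdens_Fubini R _ _ leb (fun u a => s / pi * (g a * cos (u * s * (y - a))))
  (fun a => s / pi * `|g a|) mz (fun a => mulr_ge0 (divr_ge0 (ltW s0) (ltW p0)) (normr_ge0 _))
  (RintZ _ ig') dz.
apply: eq_Rintegral => u _; rewrite /k mulrDr [p u * (_ * cos _)]mulrA [p u * (_ * sin _)]mulrA Ec Es.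
have iq (q : R -> R) : continuous q -> (forall x, `|q x| <= 1) ->
    leb.-Rint (fun a => g a * q (u * s * a)).
  move=> cq q1; apply: (@le_Rint _ _ _ leb _ (fun a => `|g a|)) ig' _ => //.
    apply: measurable_funM => //; apply: continuous_measurable_fun => a.
    by apply: (@continuous_comp _ _ _ (fun a => u * s * a) q); [exact: cvgMr|exact: cq].
  by move=> a; rewrite normrM ler_piMr.
have ic := iq cos (@continuous_cos R) (@cos_max R).
have is' := iq sin (@continuous_sin R) (@sin_max R).
rewrite RintegralZl//; last first.
  under eq_fun do rewrite mulrBr cosB mulrDr !(mulrCA (g _)).
  apply: RintD; exact: RintZ.
(* The addition formula separates [y] from [a], which leaves the two Fourier integrals of [g] as
   weights. *)
have -> : \int[leb]_a (g a * cos (u * s * (y - a))) =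
    cos (u * s * y) * \int[leb]_a (g a * cos (u * s * a)) +
    sin (u * s * y) * \int[leb]_a (g a * sin (u * s * a)).
  rewrite -!RintegralZl// -RintegralD//; [|exact: RintZ|exact: RintZ].
  by apply: eq_Rintegral => a _; rewrite mulrBr cosB; ring.
set I1 := \int[leb]_a _; set I2 := \int[leb]_a _.
by move: (s / pi) (p u) I1 I2 => c1 c2 c3 c4; ring.
Qed.

Section cvg.
Variables (Jn : nat -> (R -> R) -> R) (J : (R -> R) -> R).
Hypotheses (pJn : forall n, posfun (Jn n)) (pJ : posfun J).
Hypothesis Jcos : forall v, Jn n (fun y => cos (v * y)) @[n --> \oo] --> J (fun y => cos (v * y)).
Hypothesis Jsin : forall v, Jn n (fun y => sin (v * y)) @[n --> \oo] --> J (fun y => sin (v * y)).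

Let J1 : Jn n (fun=> 1) @[n --> \oo] --> J (fun=> 1).
Proof.
have E : (fun y : R => cos (0 * y)) = (fun=> 1).
  by apply/funext => y; rewrite mul0r cos0.
by have := Jcos (v := 0); rewrite E.
Qed.

(** Frequency 0 is among the hypotheses and [cos 0 = 1], so the total masses converge. *)
Lemma pf_mass_bounded : exists2 C : R, 0 < C & forall n, Jn n (fun=> 1) <= C.
Proof.
have [C [_ hC]] : bounded_fun (fun n => Jn n (fun=> 1)).
  by apply: cvg_seq_bounded; apply/cvg_ex; eexists; exact: J1.
exists (`|C| + 1); first by rewrite ltr_wpDl.
move=> n; apply: le_trans (ler_norm _) _; apply: (hC (`|C| + 1)) => //.
by rewrite (le_lt_trans (ler_norm _))// ltrDl.
Qed.

(** [g] is within [e / (3 * C)] of its Cauchy smoothing [h], a common error for functionals of mass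
    at most [C]. On [h] each functional is an exponential average over [u] of its values on the
    harmonics of frequency [u * s], and dominated convergence in [u] concludes. *)
Lemma weak_cvg_compact (g : R -> R) (A : R) : 0 < A -> continuous g ->
  (forall y, A < `|y| -> g y = 0) -> Jn n g @[n --> \oo] --> J g.
Proof.
move=> A0 cg gA.
have [C C0 hC] := pf_mass_bounded.
have J1C : J (fun=> 1) <= C by apply: (ler_cvg_to J1 (cvg_cst C)); exact: nearW.
apply/cvgrPdist_le => e e0.
have e3 : 0 < e / (3 * C) by rewrite divr_gt0// mulr_gt0.
near (+oo : set_system R) => s.
have [s0 hs] : 0 < s /\ forall y, `|\int[leb]_(a in `[- (A + 1), A + 1]) (g a * cauchy_kernel s (y - a)) - g y| <= e / (3 * C).
  by near: s; exact: (cauchy_approx A0 cg gA e3).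
have := cauchy_conv_fourier A0 s0 cg gA.
set k := fun u y => _ => -[mk mwc mws [M wM] kE].
have bk u : bm (k u).
  apply: bmD; (apply: bmM; first exact: bm_cst).
    exact: bm_cos.
  exact: bm_sin.
have kM u y : `|k u y| <= M + M.
  have [h1 h2] := wM u; rewrite (le_trans (ler_normD _ _))// lerD//.
    by rewrite normrM (le_trans _ h1)// ler_piMr// cos_max.
  by rewrite normrM (le_trans _ h2)// ler_piMr// sin_max.
pose h y := \int[leb]_u (p u * k u y).
have hgs y : `|h y - g y| <= e / (3 * C) by rewrite /h -kE.
have pk1 y : leb.-Rint (fun u => p u * k u y).
  apply: (@expdens_Rint_bounded _ _ (M + M)) => //.
  exact: (measurableT_comp mk (pair2_measurable y)).
have bh : bm h.
  split.
    apply: (@measurable_Rintegral _ _ _ _ _ leb (fun y u => p u * k u y)).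
    apply: measurable_funM; first exact: (measurableT_comp expdens_meas).
    exact: (measurableT_comp mk (@measurable_swap _ _ _ _)).
  exists (M + M) => y.
  apply: (le_trans (@le_normr_Rintegral _ _ _ leb setT _ measurableT (pk1 y))).
  have := @le_Rintegral _ _ _ leb setT (fun u => `|p u * k u y|) (fun u => (M + M) * p u) measurableT
    (integrable_norm (pk1 y)) (RintZ _ expdens_Rint).
  rewrite RintegralZl//; last exact: expdens_Rint.
  rewrite expdens1 mulr1; apply => u _.
  rewrite normrM (ger0_norm (expdens_ge0 u)) mulrC.
  by rewrite ler_wpM2r ?expdens_ge0.
have bg : bm g.
  split; first exact: continuous_measurable_fun.
  have [_ [N hN]] := bh; exists (N + e / (3 * C)) => y.
  rewrite -[g y](subrK (h y)) addrC (le_trans (ler_normD _ _))// lerD// distrC.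
  exact: hgs.
have close (K : (R -> R) -> R) : posfun K -> K (fun=> 1) <= C -> `|K h - K g| <= e / 3.
  move=> pK K1; rewrite -pfB//.
  rewrite (le_trans (pf_norm pK (bmB bh bg) hgs))//.
  rewrite (_ : e / 3 = e / (3 * C) * C); last by field; rewrite gt_eqF.
  by rewrite ler_pM2l.
have Jh : Jn n h @[n --> \oo] --> J h.
  have [_ ->] := pf_fubini pJ mk kM.
  under eq_cvg do rewrite (pf_fubini (pJn _) mk kM).2.
  have h1 n : measurable_fun setT (fun u => p u * Jn n (k u)).
    exact: Rint_measurable (pf_fubini (pJn n) mk kM).1.
  have h2 u : p u * Jn n (k u) @[n --> \oo] --> p u * J (k u).
    apply: cvgMr; rewrite /k.
    rewrite pfD//; try (by apply: bmM; [exact: bm_cst|exact: bm_cos]);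
      try (by apply: bmM; [exact: bm_cst|exact: bm_sin]).
    rewrite !pfZ//; try exact: bm_cos; try exact: bm_sin.
    under eq_cvg => n.
      rewrite (pfD (pJn n))//; try (by apply: bmM; [exact: bm_cst|exact: bm_cos]);
        try (by apply: bmM; [exact: bm_cst|exact: bm_sin]).
      rewrite !(pfZ (pJn n))//; try exact: bm_cos; try exact: bm_sin.
      over.
    by apply: cvgD; apply: cvgMr; [exact: Jcos|exact: Jsin].
  have h3 n u : `|p u * Jn n (k u)| <= (M + M) * C * p u.
    rewrite normrM (ger0_norm (expdens_ge0 u)) mulrC ler_wpM2r ?expdens_ge0//.
    rewrite (le_trans (pf_norm (pJn n) (bk u) (kM u)))// ler_wpM2l//.
    by rewrite (le_trans _ (kM 0 0)).
  by have [] := @Rdominated _ _ _ leb _ _ (fun u => (M + M) * C * p u) h1 h2 (RintZ _ expdens_Rint) h3.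
have e30 : 0 < e / 3 by rewrite divr_gt0.
near=> n.
have c1 := close _ pJ J1C.
have c2 := close _ (pJn n) (hC n).
have c3 : `|J h - Jn n h| <= e / 3.
  by near: n; move/cvgrPdist_le : Jh; exact.
rewrite (_ : J g - Jn n g = - (J h - J g) + (J h - Jn n h) + (Jn n h - Jn n g)); last by ring.
apply: (le_trans (ler_normD _ _)); rewrite (splitr e).
have := ler_normD (- (J h - J g)) (J h - Jn n h); rewrite normrN.
lra.
Unshelve. all: end_near. Qed.

Definition cutoff (A y : R) : R := maxr 0 (minr 1 (A + 1 - `|y|)).

Lemma cutoff_cont A : continuous (cutoff A).
Proof.
move=> y; apply: (@continuous_max _ _ (fun=> 0) (fun y => minr 1 (A + 1 - `|y|)) y); first exact: cvg_cst.
apply: (@continuous_min _ _ (fun=> 1) (fun y => A + 1 - `|y|) y); first exact: cvg_cst.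
by apply: cvgB; [exact: cvg_cst|exact: norm_continuous].
Qed.

Lemma cutoff_ge0 A y : 0 <= cutoff A y.
Proof. by rewrite /cutoff le_max lexx. Qed.

Lemma cutoff_le1 A y : cutoff A y <= 1.
Proof. by rewrite /cutoff ge_max ler01/= ge_min lexx. Qed.

Lemma cutoff1 A y : `|y| <= A -> cutoff A y = 1.
Proof.
move=> yA; rewrite /cutoff min_l; last by lra.
by rewrite max_r.
Qed.

Lemma cutoff0 A y : A + 1 < `|y| -> cutoff A y = 0.
Proof.
by move=> yA; rewrite /cutoff max_l// ge_min; apply/orP; right; lra.
Qed.

Lemma bm_continuous_bounded (g : R -> R) (M : R) : continuous g ->
  (forall x, `|g x| <= M) -> bm g.
Proof. by move=> cg gM; split; [exact: continuous_measurable_fun|exists M]. Qed.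

Lemma bm_cutoff A : bm (cutoff A).
Proof.
apply: (@bm_continuous_bounded _ 1); first exact: cutoff_cont.
by move=> x; rewrite ger0_norm ?cutoff_ge0// cutoff_le1.
Qed.

Lemma cutoff_cvg y : cutoff n%:R y @[n --> \oo] --> (1 : R).
Proof.
apply: cvg_near_cst; near=> n; apply/cutoff1.
by near: n; exact: nbhs_infty_ger.
Unshelve. all: end_near. Qed.

(** No mass escapes to infinity: the mass outside a large window is the total mass minus that of a
    compactly supported plateau, and both converge. Tightness is thus inherited from the limit
    functional. *)
Theorem weak_cvg (g : R -> R) (M : R) : continuous g -> (forall x, `|g x| <= M) ->
  Jn n g @[n --> \oo] --> J g.
Proof.
move=> cg gM.
have bg := bm_continuous_bounded cg gM.
have M0 : 0 <= M by exact: le_trans (gM 0).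
apply/cvgrPdist_le => e e0.
have e4 : 0 < e / (4 * (M + 1)) by rewrite divr_gt0// mulr_gt0// ltr_wpDl.
pose c (A : nat) := cutoff A%:R.
have [A A0 hA] : exists2 A : nat, (0 < A)%N & J (fun y => 1 - c A y) <= e / (4 * (M + 1)).
  have H : J (fun y => 1 - c n y) @[n --> \oo] --> J (fun=> 0).
    apply: (pf_dct pJ (M := 1)) => [n|n x|x].
    - by apply: measurable_funB => //; case: (bm_cutoff n%:R).
    - by rewrite ger0_norm ?subr_ge0 ?cutoff_le1// gerBl cutoff_ge0.
    - by rewrite -(subrr 1); apply: cvgB; [exact: cvg_cst|exact: cutoff_cvg].
  rewrite pf_cst// mul0r in H.
  have [N _ hN] := (cvgrPdist_le _ _).1 H _ e4.
  exists N.+1 => //; have := hN N.+1 (leqnSn _).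
  by rewrite sub0r normrN; apply: le_trans; exact: ler_norm.
have b1 : bm (fun y => 1 - c A y) by apply: bmB; [exact: bm_cst|exact: bm_cutoff].
have Jc : Jn n (fun y => 1 - c A y) @[n --> \oo] --> J (fun y => 1 - c A y).
  have E K : posfun K -> K (fun y => 1 - c A y) = K (fun=> 1) - K (c A).
    by move=> pK; apply: pfB => //; [exact: bm_cst|exact: bm_cutoff].
  under eq_cvg do rewrite (E _ (pJn _)).
  rewrite (E _ pJ).
  apply: cvgB => //; apply: (@weak_cvg_compact _ (A%:R + 1)); [by rewrite ltr_wpDl|exact: cutoff_cont|].
  by move=> y; exact: cutoff0.
have Jg : Jn n (fun y => g y * c A y) @[n --> \oo] --> J (fun y => g y * c A y).
  apply: (@weak_cvg_compact _ (A%:R + 1)); first by rewrite ltr_wpDl.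
  - by move=> y; apply: cvgM; [exact: cg|exact: cutoff_cont].
  - by move=> y ?; rewrite /c cutoff0// mulr0.
have close (K : (R -> R) -> R) : posfun K ->
    `|K g - K (fun y => g y * c A y)| <= M * K (fun y => 1 - c A y).
  move=> pK; have bgc : bm (fun y => g y * c A y) by apply: bmM => //; exact: bm_cutoff.
  rewrite -pfB// -pfZ//.
  have bM : bm (fun x => M * (1 - c A x)) by apply: bmM => //; exact: bm_cst.
  have bmn : bm (fun x => (- M) * (1 - c A x)) by apply: bmM => //; exact: bm_cst.
  have ineq x : `|g x - g x * c A x| <= M * (1 - c A x).
    rewrite -[X in X - _]mulr1 -mulrBr normrM (@ger0_norm _ (1 - _)) ?subr_ge0 ?cutoff_le1//.
    by rewrite ler_wpM2r// subr_ge0 cutoff_le1.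
  have ineq2 x : - M * (1 - c A x) <= g x - g x * c A x <= M * (1 - c A x).
    by rewrite mulNr -ler_norml.
  rewrite ler_norml -mulN1r -pfZ//; apply/andP; split.
    apply: pf_le => //; [by apply: bmM => //; exact: bm_cst|exact: bmB|].
    by move=> x; rewrite mulrA mulN1r; have /andP[] := ineq2 x.
  by apply: pf_le => //; [exact: bmB|move=> x; have /andP[] := ineq2 x].
have c1 := close _ pJ.
near=> n.
have c2 := close _ (pJn n).
have c3 : `|J (fun y => g y * c A y) - Jn n (fun y => g y * c A y)| <= e / 4.
  by near: n; move/cvgrPdist_le : Jg; apply; rewrite divr_gt0.
have c4 : `|J (fun y => 1 - c A y) - Jn n (fun y => 1 - c A y)| <= e / (4 * (M + 1)).
  by near: n; move/cvgrPdist_le : Jc; exact.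
have c5 : Jn n (fun y => 1 - c A y) <= 2 * (e / (4 * (M + 1))).
  by move: c4; rewrite ler_norml => /andP[]; lra.
have c6 : M * (e / (4 * (M + 1))) <= e / 4.
  rewrite (_ : e / 4 = (M + 1) * (e / (4 * (M + 1)))); last by field; rewrite gt_eqF// ltr_wpDl.
  by rewrite ler_pM2r// lerDl.
have c7 : M * J (fun y => 1 - c A y) <= M * (e / (4 * (M + 1))) by rewrite ler_wpM2l.
have c8 : M * Jn n (fun y => 1 - c A y) <= M * (2 * (e / (4 * (M + 1)))) by rewrite ler_wpM2l.
rewrite (_ : J g - Jn n g = (J g - J (fun y => g y * c A y)) +
  (J (fun y => g y * c A y) - Jn n (fun y => g y * c A y)) - (Jn n g - Jn n (fun y => g y * c A y))); last by ring.
apply: (le_trans (ler_normB _ _)).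
have := ler_normD (J g - J (fun y => g y * c A y)) (J (fun y => g y * c A y) - Jn n (fun y => g y * c A y)).
lra.
Unshelve. all: end_near. Qed.

End cvg.

End weak_convergence.

(** * The functionals in use and the weight [wc] *)

Section posfun_instances.
Context {R : realType}.
Local Notation leb := (@lebesgue_measure R).
Local Notation p := (@exponential_pdf R 1).

(** Used both for the law of [X] at a small time, with a weight on [Omega], and for [nu], with [Y]
    the identity. *)
Lemma posfun_integral {d} {T : measurableType d}
    (m : {sigma_finite_measure set T -> \bar R}) (Y W : T -> R) :
  measurable_fun setT Y -> (forall t, 0 <= W t) -> m.-Rint W ->
  posfun (fun g => \int[m]_t (W t * g (Y t))).
Proof.
move=> mY W0 iW.
have mW := Rint_measurable iW.
have ib (f : R -> R) : bm f -> m.-Rint (fun t => W t * f (Y t)).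
  move=> [mf [M fM]]; apply: (@le_Rint _ _ _ m _ (fun t => M * W t)) => //.
  - by apply: measurable_funM => //; exact: (measurableT_comp mf).
  - exact: RintZ.
  - by move=> t; rewrite normrM (ger0_norm (W0 t)) mulrC ler_wpM2r.
split.
- move=> f g bf bg; under eq_Rintegral do rewrite mulrDr.
  by rewrite RintegralD//; exact: ib.
- move=> k f bf; under eq_Rintegral do rewrite mulrCA.
  by rewrite RintegralZl//; exact: ib.
- by move=> f bf f0; apply: Rintegral_ge0 => t _; rewrite mulr_ge0.
- move=> f_ f M mf fM ff.
  have mf' n : measurable_fun setT (fun t => W t * f_ n (Y t)).
    by apply: measurable_funM => //; exact: (measurableT_comp (mf n)).
  have cf' t : W t * f_ n (Y t) @[n --> \oo] --> W t * f (Y t) by apply: cvgMr; exact: ff.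
  have df n t : `|W t * f_ n (Y t)| <= M * W t.
    by rewrite normrM (ger0_norm (W0 t)) mulrC ler_wpM2r.
  by have [] := @Rdominated _ _ _ m _ _ (fun t => M * W t) mf' cf' (RintZ _ iW) df.
- move=> k M mk kM.
  have M0 : 0 <= M by exact: le_trans (kM 0 0).
  have mk' : measurable_fun setT (fun z : R * T => W z.2 * k z.1 (Y z.2)).
    apply: measurable_funM; first exact: (measurableT_comp mW).
    have mp : measurable_fun setT (fun z : R * T => (z.1, Y z.2)).
      by apply: measurable_fun_pair => //; exact: (measurableT_comp mY).
    exact: (measurableT_comp mk mp).
  have dk u t : `|W t * k u (Y t)| <= (1 + u ^+ 2) * (M * W t).
    rewrite normrM (ger0_norm (W0 t)) mulrC.
    apply: (@le_trans _ _ (M * W t)); first by rewrite ler_wpM2r.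
    by rewrite ler_peMl ?mulr_ge0// lerDl sqr_ge0.
  have [h1 _ h3] := @expdens_Fubini _ _ _ m (fun u t => W t * k u (Y t)) (fun t => M * W t) mk'
    (fun t => mulr_ge0 M0 (W0 t)) (RintZ _ iW) dk.
  split => //; rewrite -h3; apply: eq_Rintegral => t _.
  rewrite -RintegralZl//.
    by apply: eq_Rintegral => u _; rewrite mulrCA.
  apply: (@expdens_Rint_bounded _ _ M) => //.
  exact: (measurableT_comp mk (pair2_measurable (Y t))).
Qed.

Lemma posfun_dirac (c : R) : 0 <= c -> posfun (fun g : R -> R => c * g 0).
Proof.
move=> c0; split.
- by move=> f g _ _; rewrite mulrDr.
- by move=> k f _; rewrite mulrCA.
- by move=> f _ f0; rewrite mulr_ge0.
- by move=> f_ f M _ _ ff; apply: cvgMr; exact: ff.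
- move=> k M mk kM.
  have i0 : leb.-Rint (fun u => p u * k u 0).
    apply: (@expdens_Rint_bounded _ _ M) => //.
    exact: (measurableT_comp mk (pair2_measurable (0 : R))).
  split.
    by under eq_fun do rewrite mulrCA; exact: RintZ.
  by rewrite -RintegralZl//; apply: eq_Rintegral => u _; rewrite mulrCA.
Qed.

Lemma posfun_add (J1 J2 : (R -> R) -> R) : posfun J1 -> posfun J2 ->
  posfun (fun g => J1 g + J2 g).
Proof.
move=> p1 p2; split.
- by move=> f g bf bg; rewrite (pfD p1)// (pfD p2)//; ring.
- by move=> k f bf; rewrite (pfZ p1)// (pfZ p2)//; ring.
- by move=> f bf f0; rewrite addr_ge0// ?(pf_ge0 p1)// (pf_ge0 p2).
- by move=> f_ f M h1 h2 h3; apply: cvgD; [exact: (pf_dct p1 h1 h2 h3)|exact: (pf_dct p2 h1 h2 h3)].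
- move=> k M h1 h2.
  have [i1 e1] := pf_fubini p1 h1 h2; have [i2 e2] := pf_fubini p2 h1 h2.
  split; first by under eq_fun do rewrite mulrDr; exact: RintD.
  by rewrite e1 e2 -RintegralD//; apply: eq_Rintegral => u _; rewrite mulrDr.
Qed.

Let fid (n : nat) (u : R) := p u * (n.+1%:R * sin (u / n.+1%:R)).

(** Same method as for the second moment, with the difference quotient at 0 of the sine transform;
    the dominating function [p u * (1 + u ^+ 2)] is already available. *)
Lemma expdens_id : \int[leb]_u (p u * u) = 1.
Proof.
have mf n : measurable_fun setT (fid n).
  apply: measurable_funM; first exact: expdens_meas.
  apply: measurable_funM => //; apply: (measurableT_comp meas_sin).
  exact: measurable_funM.
have df n u : `|fid n u| <= p u * (1 + u ^+ 2).
  rewrite /fid normrM (ger0_norm (expdens_ge0 u)) ler_wpM2l ?expdens_ge0//.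
  rewrite normrM ger0_norm//.
  apply: (@le_trans _ _ (n.+1%:R * `|u / n.+1%:R|)); first by rewrite ler_wpM2l// sin_le.
  rewrite normrM normfV (ger0_norm (ler0n _ _)) mulrCA divff// mulr1.
  rewrite -(real_normK (num_real u)); have := sqr_ge0 (`|u| - 1); have := normr_ge0 u; nra.
have cf u : fid n u @[n --> \oo] --> p u * u.
  apply: cvgMr; apply/cvgrPdist_le => e e0; near=> n.
  rewrite (_ : _ - _ = - (n.+1%:R * (sin (u / n.+1%:R) - u / n.+1%:R))); last first.
    by rewrite mulrBr mulrCA divff// mulr1; ring.
  rewrite normrN normrM ger0_norm//.
  apply: (@le_trans _ _ (n.+1%:R * `|u / n.+1%:R| ^+ 3)); first by rewrite ler_wpM2l// sinB_le.
  rewrite normrM normfV (ger0_norm (ler0n _ _)).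
  have n0 : (n.+1%:R : R) != 0 by [].
  rewrite (_ : _ * _ = `|u| ^+ 3 / n.+1%:R ^+ 2); last first.
    by move: (n.+1%:R : R) n0 => a a0; field.
  rewrite ler_pdivrMr ?exprn_gt0//.
  apply: (@le_trans _ _ (e * n.+1%:R)); last first.
    by rewrite ler_pM2l// expr2 ler_peMl// ler1n.
  rewrite mulrC -ler_pdivrMr//; near: n.
  by apply: filterS (nbhs_infty_ger (`|u| ^+ 3 / e)) => k /le_trans; apply; rewrite ler_nat.
have [_] := @Rdominated _ _ _ leb fid _ _ mf cf expdens_Rint_poly df.
have fE n : \int[leb]_u fid n u = n.+1%:R ^+ 2 / (1 + n.+1%:R ^+ 2).
  rewrite /fid; under eq_Rintegral do rewrite mulrCA.
  rewrite RintegralZl//; last first.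
    apply: (@expdens_Rint_bounded _ _ 1); last by move=> u; exact: sin_max.
    by apply: (measurableT_comp meas_sin); exact: measurable_funM.
  rewrite expdens_sin; have n0 : (n.+1%:R : R) != 0 by [].
  move: (n.+1%:R : R) n0 => a a0; field.
  by rewrite a0 /= ?andbT gt_eqF// ltr_pwDl// sqr_ge0.
under eq_cvg do rewrite fE.
move=> h.
have h1 : (n.+1%:R ^+ 2 / (1 + n.+1%:R ^+ 2) : R) @[n --> \oo] --> (1 : R).
  apply/cvgrPdist_le => e e0; near=> n.
  have n1 : (1 + n.+1%:R ^+ 2 : R) != 0 by rewrite gt_eqF// ltr_pwDr// sqr_ge0.
  rewrite (_ : _ - _ = (1 + n.+1%:R ^+ 2)^-1); last by field.
  rewrite ger0_norm ?invr_ge0 ?addr_ge0 ?sqr_ge0//.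
  have n2 : 0 < 1 + n.+1%:R ^+ 2 :> R by rewrite ltr_pwDr// sqr_ge0.
  rewrite -[leRHS]invrK lef_pV2 ?posrE ?invr_gt0//.
  apply: (@le_trans _ _ n.+1%:R).
    near: n; apply: filterS (nbhs_infty_ger (e^-1)) => k /le_trans; apply.
    by rewrite ler_nat.
  by rewrite (@le_trans _ _ (n.+1%:R ^+ 2))// ?lerDr// expr2 ler_peMl// ler1n.
have hh := cvg_unique (@Rhausdorff R) h h1; exact: hh.
Unshelve. all: end_near. Qed.

(** Comparable to [minr 1 (y ^+ 2)], but chosen for [wc_cos]: it is the exponential average of
    [1 - cos (u * y)], so weighted integrals become averages of second differences of the
    characteristic function. *)
Definition wc (y : R) : R := y ^+ 2 / (1 + y ^+ 2).

Lemma wc_den (y : R) : 0 < 1 + y ^+ 2.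
Proof. by rewrite ltr_pwDl// sqr_ge0. Qed.

Lemma wc_ge0 y : 0 <= wc y.
Proof. by rewrite divr_ge0 ?sqr_ge0// ltW// wc_den. Qed.

Lemma wc_le1 y : wc y <= 1.
Proof. by rewrite ler_pdivrMr ?wc_den// mul1r lerDr. Qed.

Lemma continuous_inv1sqr : continuous (fun y : R => (1 + y ^+ 2)^-1).
Proof.
move=> y; apply: cvgV; first by rewrite gt_eqF// wc_den.
by apply: cvgD; [exact: cvg_cst|exact: exprn_continuous].
Qed.

Lemma wc_cont : continuous wc.
Proof.
by move=> y; apply: cvgM; [exact: exprn_continuous|exact: continuous_inv1sqr].
Qed.

Lemma wc_meas : measurable_fun setT wc.
Proof. exact: continuous_measurable_fun wc_cont. Qed.

Lemma wc_cos y : wc y = \int[leb]_u (p u * (1 - cos (u * y))).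
Proof.
under eq_Rintegral do rewrite mulrBr mulr1.
rewrite RintegralB//; [|exact: expdens_Rint|].
  by rewrite expdens1 expdens_cos /wc; have := wc_den y => h; field; rewrite gt_eqF.
apply: (@expdens_Rint_bounded _ _ 1); last by move=> u; exact: cos_max.
by apply: (measurableT_comp meas_cos); exact: measurable_funM.
Qed.

(** The variables are separated into a quadratic factor in the frequency and an integrable weight in
    the jump, the shape required by [expdens_Fubini]. *)
Lemma cos1_le_wc (u y : R) : `|1 - cos (u * y)| <= (1 + u ^+ 2) * (2 * wc y).
Proof.
have h1 := cos1_le (u * y).
have h2 : `|1 - cos (u * y)| <= 2.
  by rewrite (le_trans (ler_normB _ _))// normr1 -[leRHS]/(1 + 1) lerD2l cos_max.
rewrite /wc mulrA mulrA ler_pdivlMr ?wc_den//.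
rewrite mulrDr mulr1; rewrite exprMn in h1.
have : `|1 - cos (u * y)| * y ^+ 2 <= 2 * y ^+ 2 by rewrite ler_wpM2r// sqr_ge0.
have := mulr_ge0 (sqr_ge0 u) (sqr_ge0 y); nra.
Qed.

Lemma indic_unit (y : R) : (\1_[set z : R | `|z| <= 1] y : R) = if `|y| <= 1 then 1 else 0.
Proof.
rewrite indicE; case: ifPn => h; first by rewrite mem_set.
by rewrite memNset//=; exact/negP.
Qed.

Lemma sin_le_wc (u y : R) :
  `|sin (u * y) - u * y * \1_[set z : R | `|z| <= 1] y| <= (1 + u ^+ 2) * (4 * wc y).
Proof.
rewrite indic_unit /wc mulrA mulrA ler_pdivlMr ?wc_den//.
have := sqr_ge0 u; have := sqr_ge0 y; have := mulr_ge0 (sqr_ge0 u) (sqr_ge0 y).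
rewrite -exprMn.
case: ifPn => [y1|]; last rewrite -ltNge => y1; move=> uy y0 u0.
  rewrite mulr1.
  have yy : y ^+ 2 <= 1 by rewrite -(real_normK (num_real y)) exprn_ile1.
  (* The cubic remainder serves when [|u * y| <= 1]; otherwise both terms are at most [|u * y|],
     which is below its square. *)
  have h : `|sin (u * y) - u * y| <= 2 * (u * y) ^+ 2.
    have [uy1|uy1] := leP `|u * y| 1.
      apply: le_trans (sinB_le _) _; rewrite -(real_normK (num_real (u * y))).
      rewrite exprSr; have := sqr_ge0 `|u * y|; nra.
    have := ler_normB (sin (u * y)) (u * y); have := sin_le (u * y).
    rewrite -(real_normK (num_real (u * y))); nra.
  rewrite exprMn in h uy; nra.
rewrite mulr0 subr0.
have yy : 1 <= y ^+ 2 by rewrite -(real_normK (num_real y)) exprn_ege1// ltW.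
have := sin_max (u * y); rewrite exprMn in uy *; nra.
Qed.

(** For [q] a cosine or a sine, [q] times [1 - cos] is a second difference in the frequency, so the
    right-hand side involves nothing but the characteristic function. *)
Lemma wc_fubini {d} {T : measurableType d}
    (m : {sigma_finite_measure set T -> \bar R}) (Y : T -> R) (q : R -> R) :
  measurable_fun setT Y -> m.-Rint (fun t => wc (Y t)) -> bm q ->
  \int[m]_t (wc (Y t) * q (Y t)) =
  \int[leb]_u (p u * \int[m]_t (q (Y t) * (1 - cos (u * Y t)))).
Proof.
move=> mY iw [mq [M qM]].
have M0 : 0 <= M by exact: le_trans (qM 0).
have mk : measurable_fun setT (fun z : R * T => q (Y z.2) * (1 - cos (z.1 * Y z.2))).
  have mY2 : measurable_fun setT (fun z : R * T => Y z.2) by exact: (measurableT_comp mY).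
  apply: measurable_funM; first exact: (measurableT_comp mq).
  apply: measurable_funB => //; apply: (measurableT_comp meas_cos).
  exact: measurable_funM.
have g0 t : 0 <= M * (2 * wc (Y t)) by rewrite mulr_ge0// mulr_ge0// wc_ge0.
have dk u t : `|q (Y t) * (1 - cos (u * Y t))| <= (1 + u ^+ 2) * (M * (2 * wc (Y t))).
  by rewrite normrM mulrCA ler_pM// cos1_le_wc.
have [_ _ <-] := @expdens_Fubini _ _ _ m _ _ mk g0 (RintZ M (RintZ 2 iw)) dk.
apply: eq_Rintegral => t _; rewrite wc_cos mulrC -RintegralZl//.
  by apply: eq_Rintegral => u _; rewrite mulrCA.
apply: (@expdens_Rint_bounded _ _ 2).
  apply: measurable_funB => //; apply: (measurableT_comp meas_cos).
  exact: measurable_funM.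
by move=> u; rewrite (le_trans (ler_normB _ _))// normr1 -[leRHS]/(1 + 1) lerD2l cos_max.
Qed.

End posfun_instances.

(** * First-order expansions in time, and sigma-finiteness of a Levy measure *)

Section small_time_calculus.
Context {R : realType}.
Implicit Types a b : R.

Lemma le_1Dsqr a : a <= 1 + a ^+ 2.
Proof. by have := sqr_ge0 (a - 1); have := sqr_ge0 a; nra. Qed.

Lemma norm_half_le a : `|a / 2| <= `|a|.
Proof.
rewrite normrM (@ger0_norm _ 2^-1) ?invr_ge0// ler_piMr// invf_le1//.
by rewrite ler1n.
Qed.

(** With [a] and [b] proportional to the time step, this bounds the difference quotients in time
    uniformly in the step and provides their domination. *)
Lemma exp_cos_le a b : a <= 0 -> `|expR a * cos b - 1| <= `|a| + `|b|.
Proof.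
move=> a0.
have e1 : expR a <= 1 by rewrite expR_le1.
have -> : expR a * cos b - 1 = (expR a - 1) + expR a * (cos b - 1) by ring.
apply: (le_trans (ler_normD _ _)); apply: lerD.
  by rewrite ler0_norm ?subr_le0// ler0_norm//; have := expR_ge1Dx a; lra.
rewrite normrM ger0_norm ?expR_ge0// (@le_trans _ _ `|cos b - 1|)// ?ler_piMl//.
have := @MVT_le R cos (fun z => - sin z) 0 b 1 (fun z => is_derive_cos z).
by rewrite cos0 subr0 mul1r; apply => z _; rewrite normrN sin_max.
Qed.

Lemma exp_sin_le a b : a <= 0 -> `|expR a * sin b| <= `|b|.
Proof.
move=> a0; rewrite normrM ger0_norm ?expR_ge0//.
by rewrite (le_trans _ (sin_le b))// ler_piMl// expR_le1.
Qed.

Lemma cvg_div_small (hn f : nat -> R) (c C : R) : (forall n, 0 < hn n) ->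
  hn n @[n --> \oo] --> 0 ->
  (\forall n \near \oo, `|f n - hn n * c| <= C * hn n ^+ 2) ->
  f n / hn n @[n --> \oo] --> c.
Proof.
move=> h0 hc H; apply/cvgrPdist_le => e e0.
have C0 : 0 < `|C| + 1 by rewrite ltr_wpDl.
have e1 : 0 < e / (`|C| + 1) by rewrite divr_gt0.
near=> n.
have hn' : hn n <= e / (`|C| + 1).
  by near: n; move/cvgrPdist_le : hc => /(_ _ e1); apply: filterS => n; rewrite sub0r normrN; apply: le_trans; exact: ler_norm.
have hnn0 := h0 n.
rewrite distrC (_ : _ - _ = (f n - hn n * c) / hn n); last by field; rewrite gt_eqF.
rewrite normrM normfV (gtr0_norm hnn0) ler_pdivrMr//.
apply: (@le_trans _ _ (C * hn n ^+ 2)); first by near: n.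
apply: (@le_trans _ _ ((`|C| + 1) * hn n ^+ 2)).
  by rewrite ler_wpM2r ?sqr_ge0// (le_trans (ler_norm _))// lerDl.
by rewrite expr2 mulrA ler_pM2r// mulrC -ler_pdivlMr.
Unshelve. all: end_near. Qed.

Lemma exp_cos_cvg (hn : nat -> R) a b : a <= 0 -> (forall n, 0 < hn n) ->
  hn n @[n --> \oo] --> 0 ->
  (expR (hn n * a) * cos (hn n * b) - 1) / hn n @[n --> \oo] --> a.
Proof.
move=> a0 h0 hc; apply: (@cvg_div_small _ _ _ (expR 1 * a ^+ 2 + b ^+ 2)) => //.
have a1 : 0 < (`|a| + 1)^-1 by rewrite invr_gt0 ltr_wpDl.
near=> n.
have hn' : hn n <= (`|a| + 1)^-1.
  by near: n; move/cvgrPdist_le : hc => /(_ _ a1); apply: filterS => n; rewrite sub0r normrN; apply: le_trans; exact: ler_norm.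
have hnn0 := h0 n.
have ha : `|hn n * a| <= 1.
  rewrite normrM gtr0_norm//; apply: (@le_trans _ _ ((`|a| + 1)^-1 * `|a|)).
    by rewrite ler_wpM2r.
  by rewrite mulrC ler_pdivrMr ?ltr_wpDl// mul1r lerDl.
have e1 : expR (hn n * a) <= 1 by rewrite expR_le1 pmulr_rle0.
have -> : expR (hn n * a) * cos (hn n * b) - 1 - hn n * a =
   (expR (hn n * a) - 1 - hn n * a) - expR (hn n * a) * (1 - cos (hn n * b)) by ring.
apply: (le_trans (ler_normB _ _)); rewrite mulrDl; apply: lerD.
  apply: (le_trans (expR2_le ha)); rewrite -mulrA ler_pM2l ?expR_gt0//.
  by rewrite real_normK ?num_real// exprMn mulrC.
rewrite normrM ger0_norm ?expR_ge0//.
apply: (@le_trans _ _ `|1 - cos (hn n * b)|); first by rewrite ler_piMl.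
by rewrite (le_trans (cos1_le _))// exprMn mulrC.
Unshelve. all: end_near. Qed.

Lemma exp_sin_cvg (hn : nat -> R) a b : a <= 0 -> (forall n, 0 < hn n) ->
  hn n @[n --> \oo] --> 0 ->
  (expR (hn n * a) * sin (hn n * b)) / hn n @[n --> \oo] --> b.
Proof.
move=> a0 h0 hc; apply: (@cvg_div_small _ _ _ (`|a| * `|b| + `|b| ^+ 3)) => //.
near=> n.
have hn' : hn n <= 1.
  by near: n; move/cvgrPdist_le : hc => /(_ _ ltr01); apply: filterS => n; rewrite sub0r normrN; apply: le_trans; exact: ler_norm.
have hnn0 := h0 n.
have ha : hn n * a <= 0 by rewrite pmulr_rle0.
have e1 : `|expR (hn n * a) - 1| <= hn n * `|a|.
  rewrite ler0_norm ?subr_le0 ?expR_le1// (ler0_norm a0).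
  by have := expR_ge1Dx (hn n * a); nra.
have -> : expR (hn n * a) * sin (hn n * b) - hn n * b =
   (expR (hn n * a) - 1) * sin (hn n * b) + (sin (hn n * b) - hn n * b) by ring.
apply: (le_trans (ler_normD _ _)); rewrite [leRHS]mulrDl; apply: lerD.
  rewrite normrM (_ : `|a| * `|b| * hn n ^+ 2 = (hn n * `|a|) * (hn n * `|b|)); last by ring.
  apply: ler_pM => //; rewrite (le_trans (sin_le _))// normrM gtr0_norm//.
apply: (le_trans (sinB_le _)); rewrite normrM gtr0_norm// exprMn mulrC.
by rewrite ler_wpM2l ?exprn_ge0// exprSr ler_piMr// sqr_ge0.
Unshelve. all: end_near. Qed.

(** The origin is null, and each set [n.+1%:R^-1 <= |x|] has finite mass by Markov's inequality,
    since [minr 1 (x ^+ 2)] is there at least the square of the radius. Every use of Fubini's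
    theorem for [nu] rests on this. *)
Lemma levy_measure_sigma_finite (nu : {measure set R -> \bar R}) :
  levy_measure nu -> sigma_finite setT nu.
Proof.
move=> [nu0 nui].
exists (fun n => [set 0] `|` [set x | n.+1%:R^-1 <= `|x|]).
  apply/seteqP; split => x // _.
  have [->|x0] := eqVneq x 0; first by exists 0%N => //; left.
  near \oo => n; exists n => //; right => /=.
  rewrite -[leRHS]invrK lef_pV2 ?posrE ?invr_gt0 ?normr_gt0//.
  near: n; apply: filterS (nbhs_infty_ger (`|x|^-1)) => k /le_trans; apply.
  by rewrite ler_nat.
move=> n; set A := [set x : R | _].
have mA : measurable A.
  rewrite /A -[X in measurable X]setTI.
  have mn : measurable_fun setT (fun x : R => `|x|) by exact: measurableT_comp.
  rewrite (_ : [set x : R | _] = (fun x : R => `|x|) @^-1` `[n.+1%:R^-1, +oo[); first exact: mn.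
  by apply/seteqP; split => x /=; rewrite in_itv/= andbT.
have m0 : measurable ([set 0] : set R) by exact: measurable_set1.
split; first exact: measurableU.
apply: (@le_lt_trans _ _ (nu [set 0%R] + nu A)%E); first exact: measureU2.
rewrite nu0 add0e.
have mi : measurable_fun setT (fun x : R => (\1_A x : R)%:E).
  by apply: measurableT_comp => //; exact: measurable_indic.
pose c : R := n.+1%:R^-1 ^+ 2.
have c0 : 0 < c by rewrite exprn_gt0 ?invr_gt0.
have mm : measurable_fun setT (fun x : R => minr 1 (x ^+ 2)).
  by apply: measurable_minr => //; exact: measurable_funX.
have h : (c%:E * nu A <= \int[nu]_x (minr 1 (x ^+ 2))%:E)%E.
  rewrite -[X in (_ * nu X)%E]setIT -integral_indic// -ge0_integralZl ?lee_fin ?(ltW c0)//.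
  apply: ge0_le_integral => //.
  - by move=> x _; rewrite -EFinM lee_fin mulr_ge0// ltW.
  - by apply: emeasurable_funM => //; exact: mi.
  - exact/measurable_EFinP.
  - move=> x _; rewrite -EFinM lee_fin indicE; case: (boolP (x \in A)) => [|_]; last first.
      by rewrite mulr0 le_min ler01 sqr_ge0.
    rewrite inE /A /= mulr1 => Ax; rewrite le_min.
    rewrite /c exprn_ile1 ?invf_le1 ?ler1n//=.
    by rewrite -(real_normK (num_real x)) lerXn2r ?nnegrE.
have := le_lt_trans h nui.
case: (nu A) (measure_ge0 nu A) => [r _ _| _|//]; first by rewrite ltry.
by rewrite gt0_muley ?lte_fin.
Unshelve. all: end_near. Qed.

End small_time_calculus.

(** * Small-time behaviour of a Levy process *)

Section levy_exponent.
Context {R : realType}.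
Local Notation leb := (@lebesgue_measure R).
Local Notation p := (@exponential_pdf R 1).
Variables (sigma2 gamma : R) (nu : {sigma_finite_measure set R -> \bar R}).
Hypotheses (s20 : 0 <= sigma2) (hnu : levy_measure nu).
Local Notation re := (levy_exp_re sigma2 nu).
Local Notation im := (levy_exp_im gamma nu).
Local Notation one := [set y : R | `|y| <= 1].

Lemma levy_wc_Rint : nu.-Rint wc.
Proof.
have mm : measurable_fun setT (fun x : R => minr 1 (x ^+ 2)).
  by apply: measurable_minr => //; exact: measurable_funX.
have im : nu.-Rint (fun x => minr 1 (x ^+ 2)).
  apply/integrableP; split; first exact/measurable_EFinP.
  under eq_integral => x _.
    rewrite /= ger0_norm; last by rewrite le_min ler01 sqr_ge0.
    over.
  exact: hnu.2.
apply: le_Rint im _; first exact: wc_meas.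
move=> x; rewrite ger0_norm ?wc_ge0// le_min wc_le1/=.
by rewrite ler_pdivrMr ?wc_den// ler_peMr ?sqr_ge0// lerDl sqr_ge0.
Qed.

Lemma wc_int_ge0 : 0 <= \int[nu]_y wc y.
Proof. by apply: Rintegral_ge0 => y _; exact: wc_ge0. Qed.

Lemma meas_one_indic : measurable_fun setT (\1_one : R -> R).
Proof.
apply: measurable_indic; rewrite -[X in measurable X]setTI.
have mn : measurable_fun setT (fun x : R => `|x|) by exact: measurableT_comp.
rewrite (_ : one = (fun x : R => `|x|) @^-1` `]-oo, 1]); first exact: mn.
by apply/seteqP; split => x /=; rewrite in_itv/=.
Qed.

Lemma levy_cos_Rint z : nu.-Rint (fun x => cos (z * x) - 1).
Proof.
apply: (@le_Rint _ _ _ nu _ (fun x => (1 + z ^+ 2) * (2 * wc x))).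
- by apply: measurable_funB => //; case: (bm_cos z).
- exact/RintZ/RintZ/levy_wc_Rint.
- by move=> x; rewrite distrC cos1_le_wc.
Qed.

Lemma levy_sin_Rint z : nu.-Rint (fun x => sin (z * x) - z * x * \1_one x).
Proof.
apply: (@le_Rint _ _ _ nu _ (fun x => (1 + z ^+ 2) * (4 * wc x))).
- apply: measurable_funB; first by case: (bm_sin z).
  by apply: measurable_funM => //; exact: meas_one_indic.
- exact/RintZ/RintZ/levy_wc_Rint.
- by move=> x; rewrite sin_le_wc.
Qed.

Lemma levy_exp_re_le0 z : re z <= 0.
Proof.
rewrite /levy_exp_re; have h : \int[nu]_x (cos (z * x) - 1) <= 0.
  rewrite -oppr_ge0 -[X in 0 <= X]mulN1r -RintegralZl//; last exact: levy_cos_Rint.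
  apply: Rintegral_ge0 => x _; rewrite mulN1r oppr_ge0 subr_le0; exact: cos_le1.
by rewrite -[leRHS]addr0 lerD// mulr_le0_ge0 ?sqr_ge0// oppr_le0 divr_ge0.
Qed.

(** This growth is exactly what the exponential law integrates, so averages of the exponent over
    frequencies converge. *)
Lemma levy_exp_bound : exists2 C : R, 0 < C &
  forall z, `|re z| <= C * (1 + z ^+ 2) /\ `|im z| <= C * (1 + z ^+ 2).
Proof.
have W0 := wc_int_ge0.
have aux1 (a b s g W q : R) : 0 <= s -> 0 <= g -> 0 <= W -> 0 <= q ->
    a <= s * (1 + q) -> b <= (1 + q) * (2 * W) -> a + b <= (1 + s + g + 4 * W) * (1 + q).
  move=> s0 g0 W0' q0 h1 h2; have k1 := mulr_ge0 g0 q0; have k2 := mulr_ge0 W0' q0.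
  by lra.
have aux2 (a b s g W q : R) : 0 <= s -> 0 <= g -> 0 <= W -> 0 <= q ->
    a <= g * (1 + q) -> b <= (1 + q) * (4 * W) -> a + b <= (1 + s + g + 4 * W) * (1 + q).
  move=> s0 g0 W0' q0 h1 h2; have k1 := mulr_ge0 s0 q0.
  by lra.
have aux3 (s q : R) : 0 <= s -> 0 <= q -> s / 2 * q <= s * (1 + q).
  by move=> s0 q0; have := mulr_ge0 s0 q0; lra.
exists (1 + sigma2 + `|gamma| + 4 * \int[nu]_y wc y).
  by rewrite -!addrA ltr_pwDl// !addr_ge0// mulr_ge0.
move=> z; have z0 := sqr_ge0 z; split.
  rewrite /levy_exp_re; apply: (le_trans (ler_normD _ _)).
  apply: aux1 => //.
    by rewrite normrM normrN (ger0_norm z0) ger0_norm ?divr_ge0// aux3.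
  apply: (le_trans (le_normr_Rintegral measurableT (levy_cos_Rint z))).
  rewrite -!RintegralZl//; try exact: levy_wc_Rint; last exact/RintZ/levy_wc_Rint.
  apply: le_Rintegral => //; first exact: integrable_norm (levy_cos_Rint z).
    exact/RintZ/RintZ/levy_wc_Rint.
  by move=> x _; rewrite distrC cos1_le_wc.
rewrite /levy_exp_im; apply: (le_trans (ler_normD _ _)).
apply: aux2 => //.
  rewrite normrM ler_wpM2l// -(real_normK (num_real z)).
  exact: le_1Dsqr.
apply: (le_trans (le_normr_Rintegral measurableT (levy_sin_Rint z))).
rewrite -!RintegralZl//; try exact: levy_wc_Rint; last exact/RintZ/levy_wc_Rint.
apply: le_Rintegral => //; first exact: integrable_norm (levy_sin_Rint z).
  exact/RintZ/RintZ/levy_wc_Rint.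
by move=> x _; rewrite sin_le_wc.
Qed.

Lemma levy_exp_meas : measurable_fun setT re /\ measurable_fun setT im.
Proof.
split.
  apply: measurable_funD.
    by apply: measurable_funM => //; exact: measurable_funX.
  refine (@measurable_Rintegral _ _ _ _ _ nu (fun z x : R => cos (z * x) - 1) _).
  apply: measurable_funB => //; apply: (measurableT_comp meas_cos).
  exact: measurable_funM.
apply: measurable_funD; first exact: measurable_funM.
refine (@measurable_Rintegral _ _ _ _ _ nu (fun z x : R => sin (z * x) - z * x * \1_one x) _).
have mz : measurable_fun setT (fun z : R * R => z.1 * z.2) by exact: measurable_funM.
apply: measurable_funB; first exact: (measurableT_comp meas_sin).
by apply: measurable_funM => //; exact: (measurableT_comp meas_one_indic).
Qed.

(** The second difference in frequency removes the constant of [cos - 1], turns the Gaussian term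
    into [sigma2 / 2 * u ^+ 2], and factors [1 - cos (u * y)] out of the jump part. *)
Lemma levy_re_diff u v : re v - re (v + u) / 2 - re (v - u) / 2 =
  sigma2 / 2 * u ^+ 2 + \int[nu]_y (cos (v * y) * (1 - cos (u * y))).
Proof.
rewrite /levy_exp_re.
have -> : \int[nu]_y (cos (v * y) * (1 - cos (u * y))) =
    \int[nu]_y (cos (v * y) - 1) - 2^-1 * \int[nu]_y (cos ((v + u) * y) - 1)
     - 2^-1 * \int[nu]_y (cos ((v - u) * y) - 1).
  have i0 := levy_cos_Rint v.
  have i1 := RintZ 2^-1 (levy_cos_Rint (v + u)).
  have i2 := RintZ 2^-1 (levy_cos_Rint (v - u)).
  rewrite -(RintegralZl _ measurableT (levy_cos_Rint (v + u))) -(RintegralZl _ measurableT (levy_cos_Rint (v - u))).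
  rewrite -(RintegralB measurableT i0 i1) -(RintegralB measurableT (RintB i0 i1) i2).
  by apply: eq_Rintegral => y _; rewrite mulrDl mulrBl cosD cosB; field.
by field.
Qed.

(** Drift and truncation are linear in the frequency and drop out of a second difference; they are
    recovered by [levy_im_average]. *)
Lemma levy_im_diff u v : im v - im (v + u) / 2 - im (v - u) / 2 =
  \int[nu]_y (sin (v * y) * (1 - cos (u * y))).
Proof.
rewrite /levy_exp_im.
have -> : \int[nu]_y (sin (v * y) * (1 - cos (u * y))) =
    \int[nu]_y (sin (v * y) - v * y * \1_one y)
     - 2^-1 * \int[nu]_y (sin ((v + u) * y) - (v + u) * y * \1_one y)
     - 2^-1 * \int[nu]_y (sin ((v - u) * y) - (v - u) * y * \1_one y).
  have i0 := levy_sin_Rint v.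
  have i1 := RintZ 2^-1 (levy_sin_Rint (v + u)).
  have i2 := RintZ 2^-1 (levy_sin_Rint (v - u)).
  rewrite -(RintegralZl _ measurableT (levy_sin_Rint (v + u))) -(RintegralZl _ measurableT (levy_sin_Rint (v - u))).
  rewrite -(RintegralB measurableT i0 i1) -(RintegralB measurableT (RintB i0 i1) i2).
  by apply: eq_Rintegral => y _; rewrite [(v + u) * y]mulrDl [(v - u) * y]mulrBl sinD sinB; field.
by field.
Qed.

(** The discontinuous truncation is out of reach of weak convergence. Averaging over the exponential
    law exchanges it for the continuous function [y / (1 + y ^+ 2)] and corrects the drift
    accordingly. *)
Lemma levy_im_average : \int[leb]_u (p u * im u) =
  gamma + \int[nu]_y (y / (1 + y ^+ 2) - y * \1_one y).
Proof.
have mk : measurable_fun setT (fun z : R * R => sin (z.1 * z.2) - z.1 * z.2 * \1_one z.2).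
  have mz : measurable_fun setT (fun z : R * R => z.1 * z.2) by exact: measurable_funM.
  apply: measurable_funB; first exact: (measurableT_comp meas_sin).
  by apply: measurable_funM => //; exact: (measurableT_comp meas_one_indic).
have g0 (y : R) : 0 <= 4 * wc y by rewrite mulr_ge0// wc_ge0.
have [h1 _ h3] := @expdens_Fubini _ _ _ nu
  (fun z x : R => sin (z * x) - z * x * \1_one x) (fun y : R => 4 * wc y) mk g0
  (RintZ 4 levy_wc_Rint) (fun u y => sin_le_wc u y).
rewrite /levy_exp_im; under eq_Rintegral do rewrite mulrDr mulrCA.
rewrite RintegralD//; last exact/RintZ/expdens_Rint_id.
rewrite RintegralZl//; last exact: expdens_Rint_id.
rewrite expdens_id mulr1 -h3; congr (_ + _); apply: eq_Rintegral => y _.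
have i1 : leb.-Rint (fun u => p u * sin (u * y)).
  apply: (@expdens_Rint_bounded _ _ 1); last by move=> u; exact: sin_max.
  by apply: (measurableT_comp meas_sin); exact: measurable_funM.
have i2 := RintZ (y * \1_one y) (@expdens_Rint_id R).
have i3 := RintegralB measurableT i1 i2.
rewrite RintegralZl// in i3; last exact: expdens_Rint_id.
rewrite expdens_sin expdens_id mulr1 in i3; rewrite -i3.
apply: eq_Rintegral => u _.
by move: (p u) (\1_one y : R) => a b; ring.
Qed.

End levy_exponent.

Section small_time.
Context {R : realType} {d : measure_display} {Omega : measurableType d}.
Variables (Pr : probability Omega R) (X : R -> Omega -> R).
Variables (sigma2 gamma : R) (nu : {sigma_finite_measure set R -> \bar R}).
Hypotheses (s20 : 0 <= sigma2) (hnu : levy_measure nu)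
  (hX : is_levy_process Pr X sigma2 gamma nu).
Local Notation re := (levy_exp_re sigma2 nu).
Local Notation im := (levy_exp_im gamma nu).
Local Notation leb := (@lebesgue_measure R).
Local Notation p := (@exponential_pdf R 1).

Lemma levy_meas t : 0 <= t -> measurable_fun setT (X t).
Proof. by have [+ _ _ _ _] := hX; apply. Qed.

Lemma Rint_levy t (f : R -> R) : 0 <= t -> bm f -> Pr.-Rint (fun w => f (X t w)).
Proof.
move=> t0 [mf [M fM]]; apply: (@Rint_bounded _ _ _ Pr _ M) => //.
exact: (measurableT_comp mf (levy_meas t0)).
Qed.

Lemma levy_charf t z : 0 <= t ->
  \int[Pr]_w cos (z * X t w) = expR (t * re z) * cos (t * im z) /\
  \int[Pr]_w sin (z * X t w) = expR (t * re z) * sin (t * im z).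
Proof.
move=> t0; have [_ _ _ _ /(_ t z t0)[]] := hX.
by rewrite unlock /Rintegral => -> ->.
Qed.

Variable hn : nat -> R.
Hypotheses (hn0 : forall n, 0 < hn n) (hnc : hn n @[n --> \oo] --> 0).

(* The weight [wc y = y^2 / (1 + y^2)] makes the measures [P(X_h in dy) / h] converge weakly
   including at 0, where the Gaussian part contributes the atom [sigma2]. *)
Definition wmean (n : nat) (g : R -> R) : R :=
  \int[Pr]_w (wc (X (hn n) w) / hn n * g (X (hn n) w)).
Definition wmean_lim (g : R -> R) : R := sigma2 * g 0 + \int[nu]_y (wc y * g y).

Lemma bm_wc : bm (@wc R).
Proof.
by split; [exact: wc_meas|exists 1 => x; rewrite ger0_norm ?wc_ge0 ?wc_le1].
Qed.

Lemma posfun_wmean n : posfun (wmean n).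
Proof.
apply: (@posfun_integral _ _ _ Pr (X (hn n)) (fun w => wc (X (hn n) w) / hn n)).
- exact: levy_meas (ltW (hn0 n)).
- by move=> w; rewrite divr_ge0 ?wc_ge0// ltW.
- under eq_fun do rewrite mulrC; apply: RintZ.
  apply: Rint_levy; [exact: ltW|exact: bm_wc].
Qed.

Lemma posfun_wmean_lim : posfun wmean_lim.
Proof.
apply: posfun_add; first exact: posfun_dirac.
apply: (@posfun_integral _ _ _ nu id wc) => //; first exact: wc_ge0.
exact: levy_wc_Rint.
Qed.

(** Common part of the cosine and sine cases. [En n] is a difference quotient in time of the
    characteristic function and [psi] its limit, the real or imaginary part of the exponent; the
    conclusion is dominated convergence over the frequency [u]. *)
Lemma wmean_cvg_core (tr : R -> R) (En : nat -> R -> R) (psi : R -> R) (v : R) :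
  bm (fun y => tr (v * y)) ->
  (forall n u, \int[Pr]_w (tr (v * X (hn n) w) * (1 - cos (u * X (hn n) w))) / hn n =
     En n v - En n (v + u) / 2 - En n (v - u) / 2) ->
  (forall z, En n z @[n --> \oo] --> psi z) ->
  (forall n, measurable_fun setT (En n)) ->
  (exists C : R, forall n z, `|En n z| <= C * (1 + z ^+ 2)) ->
  (forall u, psi v - psi (v + u) / 2 - psi (v - u) / 2 =
     sigma2 * tr 0 / 2 * u ^+ 2 + \int[nu]_y (tr (v * y) * (1 - cos (u * y)))) ->
  wmean n (fun y => tr (v * y)) @[n --> \oo] --> wmean_lim (fun y => tr (v * y)).
Proof.
move=> btr EnE Enc mEn [C EnC] psiE.
have C0 : 0 <= C.
  have := le_trans (normr_ge0 _) (EnC 0%N 0); rewrite expr0n/= addr0 mulr1; exact.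
pose G n u := p u * (En n v - En n (v + u) / 2 - En n (v - u) / 2).
have JE n : wmean n (fun y => tr (v * y)) = \int[leb]_u G n u.
  rewrite /wmean; under eq_Rintegral do rewrite mulrAC mulrC.
  have h0 := ltW (hn0 n).
  have iw := Rint_levy h0 bm_wc.
  rewrite RintegralZl//; last first.
    have := Rint_levy h0 (bmM bm_wc btr); exact.
  rewrite (wc_fubini (levy_meas h0) iw btr) /G -RintegralZl//.
    by apply: eq_Rintegral => u _; rewrite -EnE mulrCA [_^-1 * _]mulrC.
  have [mtr [M trM]] := btr.
  apply: (@expdens_Rint_bounded _ _ (M * 2)).
    refine (@measurable_Rintegral _ _ _ _ _ Pr (fun (u : R) w => tr (v * X (hn n) w) * (1 - cos (u * X (hn n) w))) _).
    have mX2 : measurable_fun setT (fun z : R * Omega => X (hn n) z.2).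
      exact: (measurableT_comp (levy_meas h0)).
    apply: measurable_funM; first exact: (measurableT_comp mtr mX2).
    apply: measurable_funB => //; apply: (measurableT_comp meas_cos).
    exact: measurable_funM.
  move=> u.
  have bq : bm (fun y => tr (v * y) * (1 - cos (u * y))).
    by apply: bmM => //; apply: bmB; [exact: bm_cst|exact: bm_cos].
  have iq := Rint_levy h0 bq.
  apply: (le_trans (le_normr_Rintegral measurableT iq)).
  apply: (@le_trans _ _ (\int[Pr]_w (M * 2))).
    apply: le_Rintegral => //; first exact: integrable_norm iq.
      by apply: (@Rint_bounded _ _ _ Pr _ `|M * 2|).
    move=> w _; rewrite normrM ler_pM// (le_trans (ler_normB _ _))// normr1 -[leRHS]/(1 + 1).
    by rewrite lerD2l cos_max.
  by rewrite Rintegral_prob_cst.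
pose G0 u := p u * (psi v - psi (v + u) / 2 - psi (v - u) / 2).
have mG n : measurable_fun setT (G n).
  apply: measurable_funM; first exact: expdens_meas.
  apply: measurable_funB.
    apply: measurable_funB => //; apply: measurable_funM => //.
    by apply: (measurableT_comp (mEn n)); exact: measurable_funD.
  apply: measurable_funM => //.
  by apply: (measurableT_comp (mEn n)); exact: measurable_funB.
have cG u : G n u @[n --> \oo] --> G0 u.
  by apply: cvgMr; apply: cvgB; [apply: cvgB; [exact: Enc|]|]; apply: cvgMl; exact: Enc.
have dG n u : `|G n u| <= (3 * C * (1 + v ^+ 2) * 2) * (p u * (1 + u ^+ 2)).
  rewrite normrM (ger0_norm (expdens_ge0 u)) mulrCA ler_wpM2l ?expdens_ge0//.
  have h1 := EnC n v; have h2 := EnC n (v + u); have h3 := EnC n (v - u).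
  have q1 : `|En n v - En n (v + u) / 2 - En n (v - u) / 2| <= `|En n v| + `|En n (v + u)| + `|En n (v - u)|.
    apply: (le_trans (ler_normB _ _)); apply: lerD.
      apply: (le_trans (ler_normB _ _)); apply: lerD => //.
      exact: norm_half_le.
    exact: norm_half_le.
  apply: (le_trans q1).
  have k1 : 1 + v ^+ 2 <= (1 + v ^+ 2) * 2 * (1 + u ^+ 2).
    by have := sqr_ge0 u; have := sqr_ge0 v; nra.
  have k2 : 1 + (v + u) ^+ 2 <= (1 + v ^+ 2) * 2 * (1 + u ^+ 2).
    by have := sqr_ge0 (u - v); have := mulr_ge0 (sqr_ge0 u) (sqr_ge0 v); nra.
  have k3 : 1 + (v - u) ^+ 2 <= (1 + v ^+ 2) * 2 * (1 + u ^+ 2).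
    by have := sqr_ge0 (u + v); have := mulr_ge0 (sqr_ge0 u) (sqr_ge0 v); nra.
  have l1 := ler_wpM2l C0 k1; have l2 := ler_wpM2l C0 k2; have l3 := ler_wpM2l C0 k3.
  lra.
have [_] := @Rdominated _ _ _ leb G G0 _ mG cG (RintZ _ expdens_Rint_poly) dG.
(* The exponential law has second moment 2, which turns [sigma2 / 2 * u ^+ 2] into the atom [sigma2]
   at 0. *)
have -> : \int[leb]_u G0 u = wmean_lim (fun y => tr (v * y)).
  rewrite /G0; under eq_Rintegral do rewrite psiE mulrDr mulrCA.
  have [h1 _ _] : [/\ leb.-Rint (fun u => p u * \int[nu]_y (tr (v * y) * (1 - cos (u * y)))), True & True].
    have [mtr [M trM]] := btr.
    have mk : measurable_fun setT (fun z : R * R => tr (v * z.2) * (1 - cos (z.1 * z.2))).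
      apply: measurable_funM; first exact: (measurableT_comp mtr).
      apply: measurable_funB => //; apply: (measurableT_comp meas_cos).
      exact: measurable_funM.
    have M0 : 0 <= M by exact: le_trans (trM 0).
    have g0 (t : R) : 0 <= M * (2 * wc t) by rewrite mulr_ge0// mulr_ge0// wc_ge0.
    have dk (u t : R) : `|tr (v * t) * (1 - cos (u * t))| <= (1 + u ^+ 2) * (M * (2 * wc t)).
      by rewrite normrM mulrCA ler_pM// cos1_le_wc.
    have [h1 _ _] := @expdens_Fubini _ _ _ nu _ _ mk g0 (RintZ M (RintZ 2 (levy_wc_Rint hnu))) dk.
    by split.
  rewrite RintegralD//; last exact/RintZ/expdens_Rint_sqr.
  rewrite RintegralZl//; last exact: expdens_Rint_sqr.
  rewrite expdens_sqr divfK// /wmean_lim mulr0; congr (_ + _).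
  have mid : measurable_fun [set: R] (id : R -> R) by exact: measurable_id.
  by rewrite (@wc_fubini _ _ _ nu id (fun y => tr (v * y)) mid (levy_wc_Rint hnu) btr).
by under [X in X -> _]eq_cvg do rewrite -JE.
Qed.

Lemma wmean_cos v : wmean n (fun y => cos (v * y)) @[n --> \oo] --> wmean_lim (fun y => cos (v * y)).
Proof.
have [mre mim] := levy_exp_meas sigma2 gamma nu.
apply: (@wmean_cvg_core cos (fun n z => (expR (hn n * re z) * cos (hn n * im z) - 1) / hn n) re v).
- exact: bm_cos.
- move=> n u; have h0 := ltW (hn0 n).
  have i z := Rint_levy h0 (bm_cos z).
  have -> : \int[Pr]_w (cos (v * X (hn n) w) * (1 - cos (u * X (hn n) w))) =
     \int[Pr]_w cos (v * X (hn n) w) - 2^-1 * \int[Pr]_w cos ((v + u) * X (hn n) w)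
       - 2^-1 * \int[Pr]_w cos ((v - u) * X (hn n) w).
    rewrite -(RintegralZl _ measurableT (i (v + u))) -(RintegralZl _ measurableT (i (v - u))).
    rewrite -(RintegralB measurableT (i v) (RintZ _ (i (v + u)))).
    rewrite -(RintegralB measurableT (RintB (i v) (RintZ _ (i (v + u)))) (RintZ _ (i (v - u)))).
    by apply: eq_Rintegral => w _; rewrite mulrDl mulrBl cosD cosB; field.
  rewrite !(levy_charf _ h0).1; have hn' := hn0 n.
  by move: (hn n) hn' => a a0; field; rewrite gt_eqF.
- by move=> z; apply: exp_cos_cvg => //; exact: levy_exp_re_le0.
- move=> n; apply: measurable_funM => //; apply: measurable_funB => //.
  apply: measurable_funM.
    by apply: (measurableT_comp meas_exp); exact: measurable_funM.
  by apply: (measurableT_comp meas_cos); exact: measurable_funM.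
- have [C C0 hC] := levy_exp_bound gamma s20 hnu; exists (C + C) => n z.
  have hn' := hn0 n; rewrite normrM normfV (gtr0_norm hn') ler_pdivrMr//.
  have [h1 h2] := hC z.
  have h3 : hn n * re z <= 0 by rewrite pmulr_rle0// levy_exp_re_le0.
  apply: (le_trans (exp_cos_le _ h3)).
  rewrite !normrM (gtr0_norm hn') -mulrDr mulrC ler_pM2r// mulrDl.
  exact: lerD.
- by move=> u; rewrite levy_re_diff// cos0 mulr1.
Qed.

Lemma sine_bound_cvg : [/\
  (forall z, (expR (hn n * re z) * sin (hn n * im z)) / hn n @[n --> \oo] --> im z),
  (forall n, measurable_fun setT (fun z => (expR (hn n * re z) * sin (hn n * im z)) / hn n)) &
  (exists C : R, forall n z, `|(expR (hn n * re z) * sin (hn n * im z)) / hn n| <= C * (1 + z ^+ 2))].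
Proof.
have [mre mim] := levy_exp_meas sigma2 gamma nu.
split.
- by move=> z; apply: exp_sin_cvg => //; exact: levy_exp_re_le0.
- move=> n; apply: measurable_funM => //; apply: measurable_funM.
    by apply: (measurableT_comp meas_exp); exact: measurable_funM.
  by apply: (measurableT_comp meas_sin); exact: measurable_funM.
- have [C C0 hC] := levy_exp_bound gamma s20 hnu; exists C => n z.
  have hn' := hn0 n; rewrite normrM normfV (gtr0_norm hn') ler_pdivrMr//.
  have [h1 h2] := hC z.
  have h3 : hn n * re z <= 0 by rewrite pmulr_rle0// levy_exp_re_le0.
  apply: (le_trans (exp_sin_le _ h3)).
  by rewrite normrM (gtr0_norm hn') mulrC ler_pM2r.
Qed.

Lemma wmean_sin v : wmean n (fun y => sin (v * y)) @[n --> \oo] --> wmean_lim (fun y => sin (v * y)).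
Proof.
have [c m b] := sine_bound_cvg.
apply: (@wmean_cvg_core sin (fun n z => (expR (hn n * re z) * sin (hn n * im z)) / hn n) im v) => //.
- exact: bm_sin.
- move=> n u; have h0 := ltW (hn0 n).
  have i z := Rint_levy h0 (bm_sin z).
  have -> : \int[Pr]_w (sin (v * X (hn n) w) * (1 - cos (u * X (hn n) w))) =
     \int[Pr]_w sin (v * X (hn n) w) - 2^-1 * \int[Pr]_w sin ((v + u) * X (hn n) w)
       - 2^-1 * \int[Pr]_w sin ((v - u) * X (hn n) w).
    rewrite -(RintegralZl _ measurableT (i (v + u))) -(RintegralZl _ measurableT (i (v - u))).
    rewrite -(RintegralB measurableT (i v) (RintZ _ (i (v + u)))).
    rewrite -(RintegralB measurableT (RintB (i v) (RintZ _ (i (v + u)))) (RintZ _ (i (v - u)))).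
    by apply: eq_Rintegral => w _; rewrite mulrDl mulrBl sinD sinB; field.
  rewrite !(levy_charf _ h0).2; have hn' := hn0 n.
  by move: (hn n) hn' => a a0; field; rewrite gt_eqF.
- by move=> u; rewrite levy_im_diff// sin0 mulr0 !mul0r add0r.
Qed.

Lemma wmean_cvg (g : R -> R) (M : R) : continuous g -> (forall x, `|g x| <= M) ->
  wmean n g @[n --> \oo] --> wmean_lim g.
Proof. exact: (weak_cvg posfun_wmean posfun_wmean_lim wmean_cos wmean_sin). Qed.

(** Being of first order at 0, [y / (1 + y ^+ 2)] is not [wc] times a bounded function. It is
    reached instead as the exponential average of [sin (u * y)]. *)
Lemma drift_cvg :
  \int[Pr]_w (X (hn n) w / (1 + X (hn n) w ^+ 2)) / hn n @[n --> \oo] -->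
  gamma + \int[nu]_y (y / (1 + y ^+ 2) - y * \1_[set z : R | `|z| <= 1] y).
Proof.
have [cS mS [C bS]] := sine_bound_cvg.
rewrite -levy_im_average//.
pose G n u := p u * ((expR (hn n * re u) * sin (hn n * im u)) / hn n).
have E n : \int[Pr]_w (X (hn n) w / (1 + X (hn n) w ^+ 2)) / hn n = \int[leb]_u G n u.
  have h0 := ltW (hn0 n); have mX := levy_meas h0.
  under eq_Rintegral do rewrite -expdens_sin.
  have mk : measurable_fun setT (fun z : R * Omega => sin (z.1 * X (hn n) z.2)).
    apply: (measurableT_comp meas_sin); apply: measurable_funM => //.
    exact: (measurableT_comp mX).
  have i1 : Pr.-Rint (fun=> 1) by apply: (@Rint_bounded _ _ _ Pr _ 1) => // w; rewrite normr1.
  have dk (u : R) (w : Omega) : `|sin (u * X (hn n) w)| <= (1 + u ^+ 2) * 1.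
    by rewrite mulr1 (le_trans (sin_max _))// lerDl sqr_ge0.
  have [h1 _ ->] := @expdens_Fubini _ _ _ Pr (fun u w => sin (u * X (hn n) w)) (fun=> 1) mk
    (fun=> ler01) i1 dk.
  rewrite mulrC -RintegralZl//; apply: eq_Rintegral => u _.
  by rewrite (levy_charf _ h0).2 mulrCA [_^-1 * _]mulrC.
under eq_cvg do rewrite E.
have mG n : measurable_fun setT (G n) by apply: measurable_funM; [exact: expdens_meas|exact: mS].
have cG u : G n u @[n --> \oo] --> p u * im u by apply: cvgMr; exact: cS.
have dG n u : `|G n u| <= C * (p u * (1 + u ^+ 2)).
  by rewrite normrM (ger0_norm (expdens_ge0 u)) mulrCA ler_wpM2l ?expdens_ge0.
by have [] := @Rdominated _ _ _ leb G _ _ mG cG (RintZ _ expdens_Rint_poly) dG.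
Qed.

End small_time.

(** * The Markov property *)

Section independence.
Context {d} {T : measurableType d} {R : realType}.

(** Two finite measures, sending [A] to the mass of its intersection with [B] and to [P A * P B],
    agree on a generating family closed under intersection. *)
Lemma indep_sigma_algebra (P : probability T R) (G : set (set T)) (B : set T) :
  G `<=` measurable -> setI_closed G -> G setT -> measurable B ->
  (forall A, G A -> P (A `&` B) = (P A * P B)%E) ->
  forall A, <<s G >> A -> P (A `&` B) = (P A * P B)%E.
Proof.
move=> mG IG GT mB GB A sA.
have r0 : 0 <= fine (P B) by rewrite fine_ge0.
pose m1 : {measure set T -> \bar R} := mrestr P mB.
pose m2 : {measure set T -> \bar R} := mscale (NngNum r0) P.
have PB : P B = (fine (P B))%:E by rewrite fineK// fin_num_measure.
have m2E C : m2 C = (P C * P B)%E by rewrite muleC PB.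
rewrite -m2E; change (m1 A = m2 A).
apply: (g_sigma_algebra_measure_unique G mG (fun=> setT)) => //.
- by apply/seteqP; split => // x _; exists 0%N.
- by move=> C GC; rewrite m2E; exact: GB.
- move=> k; rewrite /m1 /= /mrestr setTI.
  by rewrite (le_lt_trans (probability_le1 P mB))// ltry.
Qed.

(** The factorisation identifies the joint law of [U] and [Z] with a product measure, where [Y] is a
    copy of [Z] on a possibly different space; Tonelli separates the integrals. *)
Lemma indep_product {d1 d2 d3} {T1 : measurableType d1} {T2 : measurableType d2}
    {T' : measurableType d3} (P : probability T R) (P' : probability T' R)
    (U : T -> T1) (Z : T -> T2) (Y : T' -> T2) (f : T1 * T2 -> \bar R) :
  measurable_fun setT U -> measurable_fun setT Z -> measurable_fun setT Y ->
  (forall C B, measurable C -> measurable B ->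
     P (U @^-1` C `&` Z @^-1` B) = (P (U @^-1` C) * P' (Y @^-1` B))%E) ->
  measurable_fun setT f -> (forall z, 0 <= f z)%E ->
  (\int[P]_w f (U w, Z w) = \int[P]_w \int[P']_w' f (U w, Y w'))%E.
Proof.
move=> mU mZ mY ind mf f0.
pose U' : {mfun T >-> T1} := HB.pack U (isMeasurableFun.Build _ _ _ _ U mU).
pose Y' : {mfun T' >-> T2} := HB.pack Y (isMeasurableFun.Build _ _ _ _ Y mY).
have mUZ : measurable_fun setT (fun w => (U w, Z w)) by exact: measurable_fun_pair.
pose UZ : {mfun T >-> (T1 * T2)%type} := HB.pack (fun w => (U w, Z w))
  (isMeasurableFun.Build _ _ _ _ _ mUZ).
pose m1 := distribution P U'.
pose m2 := distribution P' Y'.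
pose m := distribution P UZ.
have -> : (\int[P]_w f (U w, Z w) = \int[m]_z f z)%E.
  by rewrite /m ge0_integral_distribution.
have -> : (\int[m]_z f z = \int[(m1 \x m2)%E]_z f z)%E.
  apply: eq_measure_integral => S mS _; apply/esym.
  apply: (@product_measure_unique _ _ _ _ _ m1 m2 m) => //.
rewrite fubini_tonelli1// /m1.
rewrite ge0_integral_distribution.
- apply: eq_integral => w _ /=; rewrite /fubini_F /m2.
  rewrite ge0_integral_distribution//.
  exact: (measurableT_comp mf (pair1_measurable _)).
- exact: measurable_fun_fubini_tonelli_F.
- by move=> y; apply: integral_ge0 => z _.
Qed.

End independence.

Section levy_markov.
Context {R : realType} {d : measure_display} {Omega : measurableType d}.
Variables (Pr : probability Omega R) (X : R -> Omega -> R).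
Variables (sigma2 gamma : R) (nu : {measure set R -> \bar R}).
Hypotheses (cPr : measure_is_complete Pr) (hX : is_levy_process Pr X sigma2 gamma nu).

(** The completed filtration before the right limit taken in [aug_filtration]; independence of
    increments is directly available for it. *)
Definition history (s : R) : set (set Omega) := <<s natural_gen X s `|` null_sets Pr >>.

Let mX t : 0 <= t -> measurable_fun setT (X t).
Proof. by have [+ _ _ _ _] := hX; apply. Qed.

Lemma null_sets_measurable : null_sets Pr `<=` measurable.
Proof. by move=> A [N [mN N0 AN]]; apply: cPr; exists N; split. Qed.

Lemma null_sets_0 A : null_sets Pr A -> Pr A = 0%E.
Proof.
move=> nA; have [N [mN N0 AN]] := nA.
by apply: (subset_measure0 _ mN AN N0); exact: null_sets_measurable.
Qed.

Lemma history_measurable s : history s `<=` measurable.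
Proof.
apply: smallest_sub; first exact: sigma_algebra_measurable.
move=> A [[u [B [/andP[u0 _] mB ->]]]|]; last exact: null_sets_measurable.
by rewrite -[X in measurable X]setTI; exact: mX.
Qed.

Lemma levy_start : null_sets Pr [set w | X 0 w != 0].
Proof.
have [_ [N [mN N0 hN]] _ _ _] := hX; exists N; split => // w /=.
by apply: contraNP => /hN[-> _].
Qed.

Lemma history_le s t : s <= t -> history s `<=` history t.
Proof.
move=> st; apply: sub_sigma_algebra2 => A [|nA]; last by right.
move=> [u [B [/andP[u0 us] mB ->]]]; left; exists u, B; split => //.
by rewrite u0 (le_trans us).
Qed.

Lemma history_gen s u B : 0 <= u <= s -> measurable B -> history s (X u @^-1` B).
Proof. by move=> us mB; apply: sub_sigma_algebra; left; exists u, B. Qed.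

(** The observation times sorted, preceded by 0 and followed by [s]. Past the end of the list the
    default of [nth] supplies [s + h], so a single infinite monotone sequence fits the hypothesis on
    increments. *)
Let times (l : seq R) (s h : R) (i : nat) : R :=
  nth (s + h) (0 :: rcons (sort <=%R l) s) i.

Let times_mono l s h : 0 <= h -> 0 <= s -> (forall u, u \in l -> 0 <= u <= s) ->
  0 <= times l s h 0 /\ forall i, times l s h i <= times l s h i.+1.
Proof.
move=> h0 s0 ls; split=> // i; rewrite /times.
set L := 0 :: rcons _ _.
have sL : sorted <=%R L.
  rewrite /L /= rcons_path; apply/andP; split.
    rewrite path_sortedE; last exact: le_trans.
    rewrite sort_le_sorted andbT; apply/allP => u; rewrite mem_sort => /ls/andP[]//.
  case: (lastP (sort <=%R l)) (mem_sort <=%R l) => [//|q x] qx.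
  by rewrite last_rcons; have := qx x; rewrite mem_rcons inE eqxx => /esym/ls/andP[].
have [iL|iL] := ltnP i.+1 (size L).
  by apply: (sorted_leq_nth le_trans le_refl _ sL) => //; rewrite inE// (ltn_trans _ iL).
rewrite [X in _ <= X]nth_default//.
have : all (fun u => u <= s + h) (rcons L (s + h)).
  rewrite all_rcons lexx /= all_rcons lerDl h0 /= addr_ge0//=.
  apply/allP => u; rewrite mem_sort => /ls/andP[_ us].
  by rewrite (le_trans us)// lerDl.
rewrite all_rcons => /andP[_ /allP aL].
have [iL'|iL'] := ltnP i (size L); last by rewrite nth_default.
by apply: aL; exact: mem_nth.
Qed.

Lemma indep_finite_times (l : seq R) s h B : 0 <= s -> 0 <= h ->
  (forall u, u \in l -> 0 <= u <= s) -> measurable B ->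
  forall A, <<s [set A | exists u B, [/\ u \in l, measurable B & A = X u @^-1` B]]
        `|` null_sets Pr >> A ->
  Pr (A `&` (fun w => X (s + h) w - X s w) @^-1` B) =
  (Pr A * Pr ((fun w => X (s + h) w - X s w)%R @^-1` B))%E.
Proof.
move=> s0 h0 ls mB.
have [t00 tm] := times_mono h0 s0 ls.
set t := times l s h in t00 tm.
have [k kE] : exists k, k = (size l).+1 by eexists.
have tk : t k = s.
  by rewrite kE /t /times /= nth_rcons size_sort ltnn eqxx.
have tk1 : t k.+1 = s + h.
  by rewrite kE /t /times /= nth_default// size_rcons size_sort.
have t0 i : 0 <= t i by elim: i => // i /le_trans; apply.
pose Y (i : nat) w := X (t i.+1) w - X (t i) w.
have mY i : measurable_fun setT (Y i) by apply: measurable_funB; exact: mX.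
have [_ _ ind _ _] := hX.
pose rect (D : 'I_k -> set R) := \bigcap_(i in [set: 'I_k]) (Y i @^-1` D i).
(* Rectangles of increments together with null sets: closed under intersection, independent of the
   last increment, and generating, since each [X u] is a sum of increments off the null set where
   [X 0] is not 0. *)
pose G : set (set Omega) := [set A | (exists2 D, (forall i, measurable (D i)) & A = rect D)
   \/ null_sets Pr A].
set Zp := (fun w => X (s + h) w - X s w) @^-1` B.
have mZ : measurable Zp.
  rewrite -[X in measurable X]setTI; apply: measurable_funB => //; apply: mX => //.
  exact: addr_ge0.
have mrect D : (forall i, measurable (D i)) -> measurable (rect D).
  move=> mD; apply: fin_bigcap_measurable => [|i _]; first exact: finite_finset.
  by rewrite -[X in measurable X]setTI; exact: mY.
have GmeasG : G `<=` measurable.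
  by move=> A [[D mD ->]|]; [exact: mrect|exact: null_sets_measurable].
have IG : setI_closed G.
  move=> A1 A2 [[D1 m1 ->]|[N [mN N0 AN]]]; last first.
    by move=> _; right; exists N; split => // w [/AN].
  move=> [[D2 m2 ->]|[N [mN N0 AN]]]; last by right; exists N; split => // w [_ /AN].
  left; exists (fun i => D1 i `&` D2 i); first by move=> i; exact: measurableI.
  by rewrite /rect -bigcapI; apply: eq_bigcapr => i _; rewrite preimage_setI.
have GT : G setT.
  left; exists (fun=> setT) => //; rewrite /rect; apply/seteqP; split => // w _ i _ //.
have GB A : G A -> Pr (A `&` Zp) = (Pr A * Pr Zp)%E.
  move=> [[D mD ->]|nA]; last first.
    rewrite (null_sets_0 nA) mul0e; apply: null_sets_0.
    by have [N [mN N0 AN]] := nA; exists N; split => // w [/AN].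
  (* [B] goes into the last slot, so that independence of [k.+1] increments can be compared with
     that of the first [k]. *)
  pose D' (i : 'I_k.+1) : set R := if unlift ord_max i is Some j then D j else B.
  have mD' i : measurable (D' i) by rewrite /D'; case: unlift.
  have E1 := ind t t00 tm k D mD.
  have := ind t t00 tm k.+1 D' mD'.
  rewrite /indep_rvs big_ord_recr /=.
  have -> : D' ord_max = B by rewrite /D' unlift_none.
  have -> : (fun w => X (t k.+1) w - X (t k) w) @^-1` B = Zp by rewrite tk tk1.
  have -> : (\prod_(i < k) Pr ((fun w => X (t (widen_ord (leqnSn k) i).+1) w -
       X (t (widen_ord (leqnSn k) i)) w)%R @^-1` D' (widen_ord (leqnSn k) i)) = Pr (rect D))%E.
    rewrite /rect E1; apply: eq_bigr => i _; rewrite /D'.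
    have -> : widen_ord (leqnSn k) i = lift ord_max i.
      by apply: val_inj; rewrite /= /bump leqNgt ltn_ord.
    by rewrite liftK /= /bump leqNgt ltn_ord.
  move=> <-; congr (Pr _); apply/seteqP; split => w.
    move=> [wD wZ] i _ /=; rewrite /D'; case: unliftP => [j ->|->] /=; last by rewrite tk tk1.
    by have := wD j I; rewrite /= /Y /bump leqNgt ltn_ord.
  move=> hw; split.
    move=> i _ /=; have := hw (lift ord_max i) I.
    by rewrite /D' liftK /= /Y /bump leqNgt ltn_ord.
  by have := hw ord_max I; rewrite /D' unlift_none /= tk tk1.
suff sG : <<s [set A | exists u B, [/\ u \in l, measurable B & A = X u @^-1` B]]
        `|` null_sets Pr >> `<=` <<s G >>.
  by move=> A /sG; exact: indep_sigma_algebra.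
apply: smallest_sub; first exact: smallest_sigma_algebra.
have Gnull A : null_sets Pr A -> <<s G >> A by move=> nA; apply: sub_sigma_algebra; right.
move=> A [[u [C [ul mC ->]]]|]; last exact: Gnull.
pose GT' := g_sigma_algebraType G.
have sY i : (i < k)%N -> measurable_fun [set: GT'] (Y i : GT' -> R).
  move=> ik _ D mD; rewrite setTI; apply: sub_sigma_algebra; left.
  exists (fun j : 'I_k => if j == i :> nat then D else setT).
    by move=> j; case: ifP.
  apply/seteqP; split => w.
    by move=> wD j _ /=; case: ifPn => // /eqP ->.
  by move=> /(_ (Ordinal ik) I); rewrite /= eqxx.
have [j jk tj] : exists2 j, (j <= k)%N & t j = u.
  have us : u \in sort <=%R l by rewrite mem_sort.
  exists (index u (sort <=%R l)).+1.
    by rewrite kE ltnS (leq_trans (index_size _ _))// size_sort.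
  by rewrite /t /times /= nth_rcons index_mem us nth_index.
have sS : forall j, (j <= k)%N -> measurable_fun [set: GT'] ((fun w => \sum_(i < j) Y i w) : GT' -> R).
  clear j jk tj; elim=> [_|j IH jk].
    by under eq_fun do rewrite big_ord0; exact: measurable_cst.
  under eq_fun do rewrite big_ord_recr /=.
  by apply: measurable_funD; [apply: IH; exact: ltnW|exact: sY].
have telesc w : \sum_(i < j) Y i w = X u w - X 0 w.
  rewrite -tj; elim: j {jk tj} => [|j IH]; first by rewrite big_ord0 subrr.
  by rewrite big_ord_recr /= IH /Y; ring.
pose N0 := [set w | X 0 w != 0].
have -> : X u @^-1` C = (((fun w => \sum_(i < j) Y i w) @^-1` C) `&` ~` N0) `|` (X u @^-1` C `&` N0).
  apply/seteqP; split => w /=.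
    move=> wC; have [e|e] := eqVneq (X 0 w) 0; last by right.
    by left; split; [rewrite telesc e subr0|rewrite /N0 /= e eqxx].
  move=> [[h1 h2]|[]//]; have X0 : X 0 w = 0 by apply: contrapT => X0; apply: h2; exact/eqP.
  by move: h1; rewrite telesc X0 subr0.
have mm : measurable ((fun w => \sum_(i < j) Y i w) @^-1` C : set GT').
  by rewrite -[X in measurable X]setTI; exact: sS.
have mN : measurable (N0 : set GT') by apply: Gnull; exact: levy_start.
have mN' : measurable (X u @^-1` C `&` N0 : set GT').
  apply: Gnull; have [N [mN1 N10 N1s]] := levy_start.
  by exists N; split => // w [_ /N1s].
exact: (measurableU _ _ (measurableI _ _ mm (measurableC mN)) mN').
Qed.

(** Events seen at finitely many times generate the history and are closed under intersection, by
    concatenation of the lists of times. *)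
Lemma indep_increment s h A B : 0 <= s -> 0 <= h -> history s A -> measurable B ->
  Pr (A `&` (fun w => X (s + h) w - X s w) @^-1` B) = (Pr A * Pr (X h @^-1` B))%E.
Proof.
move=> s0 h0 sA mB.
have [_ _ _ stat _] := hX.
rewrite -(stat s h B)//.
pose fin (l : seq R) : set (set Omega) := <<s [set A | exists u B, [/\ u \in l, measurable B & A = X u @^-1` B]]
        `|` null_sets Pr >>.
pose G : set (set Omega) := [set A | exists2 l : seq R, (forall u, u \in l -> 0 <= u <= s) & fin l A].
have finmono l1 l2 : {subset l1 <= l2} -> fin l1 `<=` fin l2.
  move=> l12; apply: sub_sigma_algebra2 => C [|nC]; last by right.
  by move=> [u [D [ul mD ->]]]; left; exists u, D; split => //; exact: l12.
have finm l : (forall u, u \in l -> 0 <= u <= s) -> fin l `<=` measurable.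
  move=> ls; apply: smallest_sub; first exact: sigma_algebra_measurable.
  move=> C [[u [D [ul mD ->]]]|]; last exact: null_sets_measurable.
  by rewrite -[X in measurable X]setTI; apply: mX => //; have /andP[] := ls u ul.
apply: (@indep_sigma_algebra _ _ _ Pr G).
- by move=> C [l ls /finm]; apply.
- move=> C1 C2 [l1 ls1 h1] [l2 ls2 h2]; exists (l1 ++ l2).
    by move=> u; rewrite mem_cat => /orP[/ls1|/ls2].
  have g1 : fin (l1 ++ l2) C1 by apply: finmono h1 => u ul; rewrite mem_cat ul.
  have g2 : fin (l1 ++ l2) C2 by apply: finmono h2 => u ul; rewrite mem_cat ul orbT.
  have := @measurableI _ (g_sigma_algebraType ([set A | exists u B, [/\ u \in l1 ++ l2, measurable B & A = X u @^-1` B]]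
        `|` null_sets Pr)) C1 C2 g1 g2.
  exact.
- exists [::] => //; exact: (@measurableT _ (g_sigma_algebraType _)).
- rewrite -[X in measurable X]setTI; apply: measurable_funB => //; apply: mX => //.
  exact: addr_ge0.
- by move=> C [l ls hC]; exact: (indep_finite_times s0 h0 ls mB hC).
- move: sA; apply: sub_sigma_algebra2 => C [[u [D [us mD ->]]]|nC].
    exists [:: u]; first by move=> v; rewrite inE => /eqP ->.
    by apply: sub_sigma_algebra; left; exists u, D; split => //; rewrite inE.
  by exists [::] => //; apply: sub_sigma_algebra; right.
Qed.

(** The pair formed by the indicator of [A] and [X s] is measurable for the history, hence
    independent of the next increment; the indicator carries the restriction to [A]. *)
Lemma levy_markov s h A (f : R * R -> \bar R) : 0 <= s -> 0 <= h -> history s A ->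
  measurable_fun setT f -> (forall z, 0 <= f z)%E ->
  (\int[Pr]_(w in A) f (X s w, (X (s + h) w - X s w)%R) =
   \int[Pr]_(w in A) \int[Pr]_w' f (X s w, X h w'))%E.
Proof.
move=> s0 h0 sA mf f0.
have mA := history_measurable sA.
pose U (w : Omega) : R * R := (\1_A w, X s w).
pose g (z : (R * R) * R) : \bar R := ((z.1.1)%:E * f (z.1.2, z.2))%E.
(* The absolute value makes the integrand nonnegative everywhere, as Tonelli asks, and changes
   nothing on indicators. *)
pose g' (z : (R * R) * R) : \bar R := ((`|z.1.1|)%:E * f (z.1.2, z.2))%E.
have mU : measurable_fun setT U.
  by apply: measurable_fun_pair; [exact: measurable_indic|exact: mX].
have mZ : measurable_fun setT (fun w => X (s + h) w - X s w).
  by apply: measurable_funB; apply: mX => //; exact: addr_ge0.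
have mg' : measurable_fun setT g'.
  apply: emeasurable_funM.
    apply/measurable_EFinP; apply: measurableT_comp => //.
    exact: (measurableT_comp (@measurable_fst _ _ _ _) (@measurable_fst _ _ _ _)).
  apply: (measurableT_comp mf); apply: measurable_fun_pair => //.
  exact: (measurableT_comp (@measurable_snd _ _ _ _) (@measurable_fst _ _ _ _)).
have ind (C : set (R * R)) (B : set R) : measurable C -> measurable B ->
   Pr (U @^-1` C `&` (fun w => X (s + h) w - X s w) @^-1` B) = (Pr (U @^-1` C) * Pr (X h @^-1` B))%E.
  move=> mC mB; apply: indep_increment => //.
  pose HT := g_sigma_algebraType (natural_gen X s `|` null_sets Pr).
  have mU' : measurable_fun [set: HT] (U : HT -> R * R).
    apply: measurable_fun_pair.
      by apply: measurable_indic; exact: sA.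
    move=> _ D mD; rewrite setTI; apply: history_gen => //.
    by rewrite s0 lexx.
  by have := mU' measurableT C mC; rewrite setTI.
have := @indep_product _ _ _ _ _ _ _ _ _ Pr Pr U _ (X h) g' mU mZ (mX h0) ind mg'.
have ind1 w : `|\1_A w : R| = \1_A w by rewrite ger0_norm.
rewrite /g' /U /= => H.
rewrite integral_mkcond [RHS]integral_mkcond.
have E1 : (\int[Pr]_w ((fun w => f (X s w, (X (s + h) w - X s w)%R)) \_ A) w =
   \int[Pr]_w ((`|\1_A w|)%:E * f (X s w, (X (s + h) w - X s w)%R)))%E.
  apply: eq_integral => w _; rewrite patchE ind1 indicE; case: ifPn => _.
    by rewrite mul1e.
  by rewrite mul0e.
rewrite E1 H; last by move=> z; rewrite mule_ge0.
apply: eq_integral => w _; rewrite patchE ind1 indicE; case: ifPn => _.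
  by apply: eq_integral => w' _; rewrite mul1e.
by rewrite integral0_eq// => w' _; rewrite mul0e.
Qed.

End levy_markov.

(** * The exponential martingale *)

Section levy_exponential.
Context {R : realType} {d : measure_display} {Omega : measurableType d}.
Variables (Pr : probability Omega R) (X : R -> Omega -> R).
Variables (sigma2 gamma : R) (nu : {sigma_finite_measure set R -> \bar R}).
Hypotheses (s20 : 0 <= sigma2) (hnu : levy_measure nu)
  (cPr : measure_is_complete Pr)
  (hX : is_levy_process Pr X sigma2 gamma nu).
Hypothesis hexp : (\int[nu]_(y in [set y : R | (1 <= `|y|)%R]) (expR y)%:E < +oo)%E.
Hypothesis hmart : ((sigma2 / 2 + gamma)%:E
     + \int[nu]_y (expR y - 1 - y * \1_[set z : R | (`|z| <= 1)%R] y)%R%:E = 0)%E.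
Local Notation one := [set y : R | `|y| <= 1].
Local Notation big := [set y : R | 1 <= `|y|].

Let meas_norm : measurable_fun setT (fun x : R => `|x|).
Proof. exact: measurableT_comp. Qed.

Let meas_big : measurable big.
Proof.
rewrite -[X in measurable X]setTI.
rewrite (_ : big = (fun x : R => `|x|) @^-1` `[1, +oo[); first exact: meas_norm.
by apply/seteqP; split => x /=; rewrite in_itv/= andbT.
Qed.

Lemma exp_big_Rint : nu.-Rint (fun y => expR y * \1_big y).
Proof.
have mb : measurable_fun setT (fun y : R => expR y * \1_big y).
  by apply: measurable_funM; [exact: meas_exp|exact: measurable_indic].
apply/integrableP; split; first exact/measurable_EFinP.
apply: le_lt_trans hexp; rewrite [X in (_ <= X)%E]integral_mkcond.
apply: ge0_le_integral => //.
- by apply/measurable_EFinP; exact: measurableT_comp.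
- apply/(measurable_restrictT _ meas_big)/measurable_EFinP.
  exact: (measurable_funS measurableT (@subsetT _ _) meas_exp).
- move=> y _; rewrite patchE indicE; case: (y \in _).
    by rewrite mulr1 lee_fin ger0_norm// expR_ge0.
  by rewrite mulr0 abse0.
Qed.

Lemma indic_big (y : R) : (\1_big y : R) = if 1 <= `|y| then 1 else 0.
Proof.
rewrite indicE; case: ifPn => h; first by rewrite mem_set.
by rewrite memNset//=; exact/negP.
Qed.

Lemma wc_ge_half (y : R) : 1 <= `|y| -> 1 <= 2 * wc y.
Proof.
move=> y1; rewrite /wc mulrA ler_pdivlMr ?wc_den// mul1r.
have : 1 <= y ^+ 2 by rewrite -(real_normK (num_real y)) exprn_ege1.
lra.
Qed.

Lemma sqr_le_wc (y : R) : `|y| <= 1 -> y ^+ 2 <= 2 * wc y.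
Proof.
move=> y1; rewrite /wc mulrA ler_pdivlMr ?wc_den//.
have : y ^+ 2 <= 1 by rewrite -(real_normK (num_real y)) exprn_ile1.
by have := sqr_ge0 y; nra.
Qed.

Lemma mart_Rint : nu.-Rint (fun y => expR y - 1 - y * \1_one y).
Proof.
apply: (@le_Rint _ _ _ nu _ (fun y => (2 * expR 1 + 2) * wc y + expR y * \1_big y)).
- apply: measurable_funB; first by apply: measurable_funB => //; exact: meas_exp.
  by apply: measurable_funM => //; exact: meas_one_indic.
- by apply: RintD; [apply: RintZ; exact: levy_wc_Rint|exact: exp_big_Rint].
- move=> y; rewrite indic_unit indic_big.
  have w0 := wc_ge0 y; have e0 := expR_ge0 y; have e1 := expR_ge0 (1 : R).
  have we := mulr_ge0 e1 w0.
  case: ifPn => [y1|]; last rewrite -ltNge => y1.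
    rewrite mulr1; apply: (le_trans (expR2_le y1)).
    rewrite real_normK ?num_real//.
    have := ler_wpM2l e1 (sqr_le_wc y1).
    have : 0 <= expR y * (if 1 <= `|y| then 1 else 0) by case: ifP => _; rewrite ?mulr1 ?mulr0.
    move: (expR y * _) => q; lra.
  rewrite mulr0 subr0 (ltW y1) mulr1; have := wc_ge_half (ltW y1).
  have := ler_normB (expR y) 1; rewrite normr1 (ger0_norm e0).
  lra.
Qed.

Lemma mart_eq : sigma2 / 2 + gamma + \int[nu]_y (expR y - 1 - y * \1_one y) = 0.
Proof.
have := hmart; rewrite -[X in (_ + X)%E]fineK; last exact: integrable_fin_num mart_Rint.
by rewrite -EFinD => -[].
Qed.

Lemma cutoff_big A y : 1 <= A -> (0 : R) <= 1 - cutoff A y <= \1_big y.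
Proof.
move=> A1; rewrite subr_ge0 cutoff_le1/= indic_big; case: ifPn => [_|].
  by rewrite gerBl cutoff_ge0.
by rewrite -ltNge => y1; rewrite cutoff1 ?subrr// (le_trans (ltW y1)).
Qed.

Definition exp_tail A : R := \int[nu]_y (expR y * (1 - cutoff A y)).

Lemma exp_tail_Rint A : 1 <= A -> nu.-Rint (fun y => expR y * (1 - cutoff A y)).
Proof.
move=> A1; apply: le_Rint exp_big_Rint _.
  apply: measurable_funM; first exact: meas_exp.
  by apply: measurable_funB => //; case: (bm_cutoff A).
move=> y; have /andP[h1 h2] := cutoff_big y A1.
by rewrite normrM !ger0_norm ?expR_ge0// ler_wpM2l ?expR_ge0.
Qed.

Lemma exp_tail_ge0 A : 0 <= exp_tail A.
Proof.
by apply: Rintegral_ge0 => y _; rewrite mulr_ge0 ?expR_ge0// subr_ge0 cutoff_le1.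
Qed.

Lemma cutoff_tail_Rint A : 1 <= A -> nu.-Rint (fun y => 1 - cutoff A y).
Proof.
move=> A1; apply: (@le_Rint _ _ _ nu _ (fun y => 2 * wc y)).
- by apply: measurable_funB => //; case: (bm_cutoff A).
- by apply: RintZ; exact: levy_wc_Rint.
- move=> y; have /andP[h1 h2] := cutoff_big y A1; rewrite ger0_norm//.
  apply: (le_trans h2); rewrite indic_big; case: ifP => [/wc_ge_half//|_].
  by rewrite mulr_ge0// wc_ge0.
Qed.

Let ltr1n n : 1 <= n.+1%:R :> R.
Proof. by rewrite ler1n. Qed.

Let cutoff_cvgS (y : R) : 1 - cutoff n.+1%:R y @[n --> \oo] --> (0 : R).
Proof.
rewrite -(subrr 1); apply: cvgB; first exact: cvg_cst.
by have := cutoff_cvg y; rewrite -cvg_shiftS.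
Qed.

Lemma exp_tail_cvg : exp_tail n.+1%:R @[n --> \oo] --> (0 : R).
Proof.
have m n : measurable_fun setT (fun y : R => expR y * (1 - cutoff n.+1%:R y)).
  exact: Rint_measurable (exp_tail_Rint (ltr1n n)).
have c (y : R) : expR y * (1 - cutoff n.+1%:R y) @[n --> \oo] --> (0 : R).
  by rewrite -(mulr0 (expR y)); apply: cvgMr; exact: cutoff_cvgS.
have dd n (y : R) : `|expR y * (1 - cutoff n.+1%:R y)| <= expR y * \1_big y.
  have /andP[h1 h2] := cutoff_big y (ltr1n n).
  by rewrite normrM !ger0_norm ?expR_ge0// ler_wpM2l ?expR_ge0.
have [_] := @Rdominated _ _ _ nu _ (fun=> 0) _ m c exp_big_Rint dd.
by rewrite (_ : \int[nu]_x 0 = 0)// /Rintegral integral0.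
Qed.

Lemma cutoff_tail_cvg : \int[nu]_y (1 - cutoff n.+1%:R y) @[n --> \oo] --> (0 : R).
Proof.
have m n : measurable_fun setT (fun y : R => 1 - cutoff n.+1%:R y).
  exact: Rint_measurable (cutoff_tail_Rint (ltr1n n)).
have dd n (y : R) : `|1 - cutoff n.+1%:R y| <= 2 * wc y.
  have /andP[h1 h2] := cutoff_big y (ltr1n n); rewrite ger0_norm//.
  apply: (le_trans h2); rewrite indic_big; case: ifP => [/wc_ge_half//|_].
  by rewrite mulr_ge0// wc_ge0.
have [_] := @Rdominated _ _ _ nu _ (fun=> 0) _ m cutoff_cvgS (RintZ 2 (levy_wc_Rint hnu)) dd.
by rewrite (_ : \int[nu]_x 0 = 0)// /Rintegral integral0.
Qed.

Section hseq.
Variable hn : nat -> R.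
Hypotheses (hn0 : forall n, 0 < hn n) (hnc : hn n @[n --> \oo] --> 0).

(** Vanishing near 0 makes [f / wc] continuous and bounded, and its value 0 at 0 discards the
    Gaussian atom. *)
Lemma small_time_cvg (f : R -> R) (c M : R) : 0 < c -> continuous f ->
  (forall y, `|f y| <= M) -> (forall y, `|y| <= c -> f y = 0) ->
  nu.-Rint f /\
  (\int[Pr]_w f (X (hn n) w) / hn n @[n --> \oo] --> \int[nu]_y f y).
Proof.
move=> c0 cf fM f0.
pose g y := f y / wc y.
have wc0 (y : R) : y != 0 -> wc y != 0.
  by move=> y0; rewrite /wc mulf_neq0 ?sqrf_eq0// invr_eq0 gt_eqF// wc_den.
have gE y : wc y * g y = f y.
  rewrite /g; have [->|/wc0 y0] := eqVneq y 0; last by rewrite mulrC divfK.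
  by rewrite f0 ?normr0 ?(ltW c0)// mul0r mulr0.
have wcc (y : R) : c < `|y| -> wc c <= wc y.
  move=> cy; rewrite /wc ler_pdivrMr ?wc_den// mulrAC ler_pdivlMr ?wc_den//.
  have : c ^+ 2 <= y ^+ 2.
    by rewrite -(real_normK (num_real y)) lerXn2r ?nnegrE ?(ltW c0)// ltW.
  lra.
have wcp : 0 < wc c by rewrite /wc divr_gt0 ?wc_den// exprn_gt0.
have gM y : `|g y| <= M / wc c.
  have M0 : 0 <= M by exact: le_trans (fM y).
  have [yc|yc] := leP `|y| c.
    by rewrite /g f0// mul0r normr0 divr_ge0// ltW.
  rewrite /g normrM normfV (ger0_norm (wc_ge0 y)).
  apply: ler_pM => //; first by rewrite invr_ge0 wc_ge0.
  rewrite lef_pV2 ?posrE//; first exact: wcc.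
  exact: lt_le_trans (wcc _ yc).
have cg : continuous g.
  move=> y; have [->|y0] := eqVneq y 0; last first.
    by apply: cvgM; [exact: cf|apply: cvgV; [exact: wc0|exact: wc_cont]].
  have g00 : g 0 = 0 by rewrite /g f0 ?normr0 ?(ltW c0)// mul0r.
  rewrite /continuous_at g00; apply: cvg_near_cst.
  exists c => //= z; rewrite /ball_ /= sub0r normrN => zc.
  by rewrite /g f0 ?mul0r// ltW.
have := wmean_cvg s20 hnu hX hn0 hnc cg gM.
have -> : wmean_lim sigma2 nu g = \int[nu]_y f y.
  rewrite /wmean_lim {1}/g f0 ?normr0 ?(ltW c0)// mul0r mulr0 add0r.
  by apply: eq_Rintegral => y _; exact: gE.
have E n : wmean Pr X hn n g = \int[Pr]_w f (X (hn n) w) / hn n.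
  have bf : bm f by exact: bm_continuous_bounded fM.
  rewrite /wmean mulrC -RintegralZl//; last exact: (Rint_levy hX (ltW (hn0 n)) bf).
  by apply: eq_Rintegral => w _; rewrite mulrAC gE mulrC.
under eq_cvg do rewrite E.
split=> //.
apply: (@le_Rint _ _ _ nu _ (fun y => M / wc c * wc y)).
- exact: continuous_measurable_fun.
- by apply: RintZ; exact: levy_wc_Rint.
- by move=> y; rewrite -gE mulrC normrM (ger0_norm (wc_ge0 y)) ler_wpM2r// wc_ge0.
Qed.

Let c0 (y : R) := y / (1 + y ^+ 2).

Let c0_cont : continuous c0.
Proof. by move=> y; apply: cvgM; [exact: cvg_id|exact: continuous_inv1sqr]. Qed.

Let c0_le1 y : `|c0 y| <= 1.
Proof.
rewrite /c0 normrM normfV (gtr0_norm (wc_den y)) ler_pdivrMr ?wc_den// mul1r.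
by rewrite -(real_normK (num_real y)) le_1Dsqr.
Qed.

(** Quotient by [wc] of the truncated exponential compensated by 1 and [c0]. Its limit [2^-1] at 0
    is the source of [sigma2 / 2] in the martingale condition. *)
Let gA A (y : R) := if y == 0 then 2^-1 else (expR y * cutoff A y - 1 - c0 y) / wc y.

Let gA_eq A y : 1 <= A -> wc y * gA A y = expR y * cutoff A y - 1 - c0 y.
Proof.
move=> A1; rewrite /gA; case: eqP => [->|/eqP y0].
  rewrite cutoff1 ?normr0 ?(le_trans ler01)//.
  by rewrite /wc /c0 expR0 expr0n /= !mul0r mul1r subrr subr0.
by rewrite mulrC divfK// /wc mulf_neq0 ?sqrf_eq0// invr_eq0 gt_eqF// wc_den.
Qed.

Let gA_near0 A y : 1 <= A -> `|y| <= 1 -> `|gA A y - 2^-1| <= 2 * expR 1 * `|y|.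
Proof.
move=> A1 y1; rewrite /gA; case: eqP => [->|/eqP y0].
  by rewrite subrr !normr0 mulr0.
rewrite cutoff1 ?(le_trans y1)// mulr1 /c0 /wc.
have d0 := wc_den y.
have -> : (expR y - 1 - y / (1 + y ^+ 2)) / (y ^+ 2 / (1 + y ^+ 2)) - 2^-1 =
   (expR y - 1 - y - y ^+ 2 / 2) / y ^+ 2 + (expR y - 1).
  by move: (expR y) => e; field; rewrite y0 gt_eqF.
apply: (le_trans (ler_normD _ _)).
rewrite (_ : 2 * _ * _ = expR 1 * `|y| + expR 1 * `|y|); last by ring.
apply: lerD; last exact: expR1_le.
rewrite normrM normfV (ger0_norm (sqr_ge0 y)) ler_pdivrMr; last by rewrite exprn_even_gt0.
have -> : expR 1 * `|y| * y ^+ 2 = expR 1 * `|y| ^+ 3.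
  by rewrite -mulrA; congr (_ * _); rewrite [RHS](exprS _ 2) real_normK// num_real.
exact: expR3_le.
Qed.

Let gA_cont A : 1 <= A -> continuous (gA A).
Proof.
move=> A1 y; have [->|y0] := eqVneq y 0.
  have gA0 : gA A 0 = 2^-1 by rewrite /gA eqxx.
  rewrite /continuous_at gA0; apply/cvgrPdist_le => e e0.
  have e1 : 0 < e / (2 * expR 1) by rewrite divr_gt0// mulr_gt0// expR_gt0.
  near=> z; rewrite distrC.
  have z1 : `|z| <= 1 by near: z; exists 1 => //= ?; rewrite /ball_ /= sub0r normrN => /ltW.
  have z2 : `|z| <= e / (2 * expR 1).
    by near: z; exists (e / (2 * expR 1)) => //= ?; rewrite /ball_ /= sub0r normrN => /ltW.
  apply: (le_trans (gA_near0 A1 z1)).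
  rewrite mulrC -ler_pdivlMr; first exact: z2.
  by rewrite mulr_gt0// expR_gt0.
have E : \forall z \near y, (expR z * cutoff A z - 1 - c0 z) / wc z = gA A z.
  have yp : 0 < `|y| by rewrite normr_gt0.
  exists `|y| => //= z; rewrite /ball_ /= => yz; rewrite /gA ifF//.
  by apply/eqP => z0; move: yz; rewrite z0 subr0 ltxx.
rewrite /continuous_at; have -> : gA A y = (expR y * cutoff A y - 1 - c0 y) / wc y by rewrite /gA (negPf y0).
apply: cvg_trans (_ : (fun z => (expR z * cutoff A z - 1 - c0 z) / wc z) @ y --> _).
  exact: near_eq_cvg.
apply: cvgM.
  apply: cvgB; last exact: c0_cont.
  by apply: cvgB; [apply: cvgM; [exact: continuous_expR|exact: cutoff_cont]|exact: cvg_cst].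
apply: cvgV; last exact: wc_cont.
by rewrite /wc mulf_neq0 ?sqrf_eq0// invr_eq0 gt_eqF// wc_den.
Unshelve. all: end_near. Qed.

Let exp_cut_le (A y : R) : `|expR y * cutoff A y| <= expR (A + 1).
Proof.
rewrite ger0_norm; last by rewrite mulr_ge0 ?expR_ge0 ?cutoff_ge0.
have [yA|yA] := leP `|y| (A + 1); last by rewrite cutoff0// mulr0 expR_ge0.
apply: (@le_trans _ _ (expR y)).
  by rewrite ler_piMr ?expR_ge0 ?cutoff_le1.
by rewrite ler_expR (le_trans (ler_norm y)).
Qed.

Let gA_bound A : 1 <= A -> exists M : R, forall y, `|gA A y| <= M.
Proof.
move=> A1; exists (2^-1 + 2 * expR 1 + 2 * (expR (A + 1) + 1 + 1)) => y.
have e1 := expR_ge0 (1 : R); have e2 := expR_ge0 (A + 1).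
have [y1|y1] := leP `|y| 1.
  have := gA_near0 A1 y1; have := ler_normD (gA A y - 2^-1) 2^-1.
  rewrite subrK (ger0_norm (_ : 0 <= 2^-1 :> R)) ?invr_ge0//.
  have := ler_wpM2l e1 y1; lra.
have w1 := wc_ge_half (ltW y1).
have wp : 0 < wc y by lra.
rewrite /gA; case: eqP => [y0|_].
  by move: y1; rewrite y0 normr0 ltNge ler01.
rewrite normrM normfV (gtr0_norm wp) ler_pdivrMr//.
have h1 : `|expR y * cutoff A y - 1 - c0 y| <= expR (A + 1) + 1 + 1.
  apply: (le_trans (ler_normB _ _)); apply: lerD => //.
  by apply: (le_trans (ler_normB _ _)); rewrite normr1 lerD2r.
apply: (le_trans h1).
have q0 : 0 <= 2^-1 + 2 * expR 1 :> R by rewrite addr_ge0// mulr_ge0.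
have := mulr_ge0 q0 (ltW wp).
have : 0 <= expR (A + 1) + 1 + 1 by lra.
move: (expR (A + 1) + 1 + 1) (2^-1 + 2 * expR 1) => q1 q2 h2 h3; nra.
Qed.

(** Sum of the drift limit and of the weak limit tested on [gA A]; the martingale condition cancels
    everything but the part of the exponential removed by the cutoff. *)
Lemma exp_cut_cvg A : 1 <= A ->
  \int[Pr]_w (expR (X (hn n) w) * cutoff A (X (hn n) w) - 1) / hn n
     @[n --> \oo] --> - exp_tail A.
Proof.
move=> A1; have [M gM] := gA_bound A1.
have H1 := drift_cvg s20 hnu hX hn0 hnc.
have H2 := wmean_cvg s20 hnu hX hn0 hnc (gA_cont A1) gM.
have bc : bm c0 by exact: bm_continuous_bounded c0_cont c0_le1.
have bg : bm (gA A) by exact: bm_continuous_bounded (gA_cont A1) gM.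
have E n : \int[Pr]_w (expR (X (hn n) w) * cutoff A (X (hn n) w) - 1) / hn n =
   \int[Pr]_w (c0 (X (hn n) w)) / hn n + wmean Pr X hn n (gA A).
  have h0 := ltW (hn0 n).
  have -> : wmean Pr X hn n (gA A) = \int[Pr]_w (wc (X (hn n) w) * gA A (X (hn n) w)) / hn n.
    rewrite /wmean [RHS]mulrC -RintegralZl//.
      by apply: eq_Rintegral => w _; rewrite mulrAC mulrC.
    exact: (Rint_levy hX h0 (bmM (@bm_wc R) bg)).
  rewrite -mulrDl -RintegralD//; [|exact: (Rint_levy hX h0 bc)|exact: (Rint_levy hX h0 (bmM (@bm_wc R) bg))].
  by congr (_ / _); apply: eq_Rintegral => w _; rewrite gA_eq//; ring.
under eq_cvg do rewrite E.
have -> : - exp_tail A = (gamma + \int[nu]_y (y / (1 + y ^+ 2) - y * \1_one y)) + wmean_lim sigma2 nu (gA A).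
  have i1 : nu.-Rint (fun y => wc y * gA A y).
    apply: (@le_Rint _ _ _ nu _ (fun y => M * wc y)).
    - by apply: measurable_funM; [exact: wc_meas|case: bg].
    - by apply: RintZ; exact: levy_wc_Rint.
    - by move=> y; rewrite normrM (ger0_norm (wc_ge0 y)) mulrC ler_wpM2r// wc_ge0.
  have i2 : nu.-Rint (fun y => c0 y - y * \1_one y).
    have iA := RintB mart_Rint (exp_tail_Rint A1).
    have := RintB iA i1; apply: eq_integrable => // y _.
    by rewrite gA_eq//; congr (_%:E); ring.
  have H : \int[nu]_y (wc y * gA A y) + \int[nu]_y (c0 y - y * \1_one y) =
     \int[nu]_y (expR y - 1 - y * \1_one y) - exp_tail A.
    rewrite -RintegralD// /exp_tail -RintegralB//; [|exact: mart_Rint|exact: exp_tail_Rint].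
    by apply: eq_Rintegral => y _; rewrite gA_eq//; ring.
  rewrite /wmean_lim (_ : gA A 0 = 2^-1); last by rewrite /gA eqxx.
  have := mart_eq; move: H; rewrite /c0.
  move: (\int[nu]_y (wc y * _)) (\int[nu]_y (_ / _ - _)) (\int[nu]_y (expR _ - _ - _)) (exp_tail A) => a b c e.
  lra.
by apply: cvgD.
Qed.

End hseq.

End levy_exponential.

Section exponential_martingale.
Context {R : realType} {d : measure_display} {Omega : measurableType d}.
Variables (Pr : probability Omega R) (X : R -> Omega -> R).
Variables (sigma2 gamma : R) (nu : {sigma_finite_measure set R -> \bar R}).
Hypotheses (s20 : 0 <= sigma2) (hnu : levy_measure nu)
  (cPr : measure_is_complete Pr)
  (hX : is_levy_process Pr X sigma2 gamma nu).
Hypothesis hexp : (\int[nu]_(y in [set y : R | (1 <= `|y|)%R]) (expR y)%:E < +oo)%E.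
Hypothesis hmart : ((sigma2 / 2 + gamma)%:E
     + \int[nu]_y (expR y - 1 - y * \1_[set z : R | (`|z| <= 1)%R] y)%R%:E = 0)%E.

Lemma history_setT s : history Pr X s setT.
Proof. exact: (@measurableT _ (g_sigma_algebraType (natural_gen X s `|` null_sets Pr))). Qed.

Lemma levy_markov_bounded s h A (f : R * R -> R) (M : R) :
  0 <= s -> 0 <= h -> history Pr X s A ->
  measurable_fun setT f -> (forall z, 0 <= f z <= M) ->
  \int[Pr]_w (\1_A w * f (X s w, X (s + h) w - X s w)) =
  \int[Pr]_w (\1_A w * \int[Pr]_w' f (X s w, X h w')).
Proof.
move=> s0 h0 sA mf fM.
have mf' : measurable_fun setT (fun z => (f z)%:E) by exact/measurable_EFinP.
have f0 z : (0 <= (f z)%:E)%E by rewrite lee_fin; have /andP[] := fM z.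
have := @levy_markov _ _ _ _ _ _ _ _ cPr hX s h A _ s0 h0 sA mf' f0.
rewrite integral_mkcond [in X in _ = X -> _]integral_mkcond => H.
rewrite /Rintegral.
transitivity (fine (\int[Pr]_w ((fun w => (f (X s w, X (s + h) w - X s w))%:E) \_ A) w)).
  congr fine; apply: eq_integral => w _; rewrite patchE indicE; case: (w \in A).
    by rewrite mul1r.
  by rewrite mul0r.
rewrite H; congr fine; apply: eq_integral => w _; rewrite patchE indicE; case: (w \in A); last by rewrite mul0r.
rewrite mul1r fineK//.
apply: (@integrable_fin_num _ _ _ Pr setT) => //.
apply: (@Rint_bounded _ _ _ Pr _ M).
  apply: (measurableT_comp mf); apply: measurable_fun_pair => //.
  exact: levy_meas hX _ h0.
by move=> w'; have /andP[h1 h2] := fM (X s w, X h w'); rewrite ger0_norm.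
Qed.

Section hseq.
Variable hn : nat -> R.
Hypotheses (hn0 : forall n, 0 < hn n) (hnc : hn n @[n --> \oo] --> 0).

(** Inside radius [A] the cutoff is 1 and the bound [x * expR y] applies; outside, [cutoff (A - 1)]
    vanishes and the last term alone is 1. *)
Let minr1_step (A x y : R) : 1 <= A -> 0 <= x <= 1 ->
  minr (x * expR y) 1 <= x + x * (expR y * cutoff A y - 1) + (1 - cutoff (A - 1) y).
Proof.
move=> A1 /andP[x0 x1].
have e0 := expR_ge0 y.
have [yA|yA] := leP `|y| A.
  rewrite cutoff1// ge_min; apply/orP; left.
  by have := cutoff_le1 (A - 1) y; lra.
rewrite (@cutoff0 _ (A - 1)) ?subrK// ge_min; apply/orP; right.
have : 0 <= x * (expR y * cutoff A y) by rewrite !mulr_ge0// cutoff_ge0.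
lra.
Qed.

Let bm_expcut (A : R) : bm (fun y => expR y * cutoff A y).
Proof.
apply: (@bm_continuous_bounded _ _ (expR (A + 1))).
  by move=> y; apply: cvgM; [exact: continuous_expR|exact: cutoff_cont].
move=> y; rewrite ger0_norm; last by rewrite mulr_ge0 ?expR_ge0 ?cutoff_ge0.
have [yA|yA] := leP `|y| (A + 1); last by rewrite cutoff0// mulr0 expR_ge0.
apply: (@le_trans _ _ (expR y)).
  by rewrite ler_piMr ?expR_ge0 ?cutoff_le1.
by rewrite ler_expR (le_trans (ler_norm y)).
Qed.

Lemma bm_minr1 (x : R) : 0 <= x -> bm (fun y => minr (x * expR y) 1).
Proof.
move=> x0; apply: (@bm_continuous_bounded _ _ 1).
  move=> y; apply: (@continuous_min _ _ (fun y => x * expR y) (fun=> 1) y); last exact: cvg_cst.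
  by apply: cvgM; [exact: cvg_cst|exact: continuous_expR].
move=> y; rewrite ger0_norm ?ge_min ?lexx ?orbT//.
by rewrite le_min ler01 mulr_ge0// expR_ge0.
Qed.

(** The error is [e] per unit of time, uniformly in [x]; this uniformity permits iteration from
    random starting points. *)
Lemma minr1_small_time (e : R) : 0 < e -> \forall n \near \oo, forall x, 0 <= x ->
  \int[Pr]_w minr (x * expR (X (hn n) w)) 1 <= minr x 1 + e * hn n.
Proof.
move=> e0.
have e4 : 0 < e / 4 by rewrite divr_gt0.
have [N _ hN] := (cvgrPdist_le _ _).1 (cutoff_tail_cvg hnu) _ e4.
have tN : \int[nu]_y (1 - cutoff N.+1%:R y) <= e / 4.
  by have := hN N (leqnn N); rewrite sub0r normrN; apply: le_trans; exact: ler_norm.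
pose A : R := N.+2%:R.
have A1 : 1 <= A by rewrite ler1n.
have AN : A - 1 = N.+1%:R by rewrite /A -(natr1 N.+1) addrK.
have H1 := exp_cut_cvg s20 hnu hX hexp hmart hn0 hnc A1.
have c1 : continuous (fun y : R => 1 - cutoff N.+1%:R y).
  by move=> y; apply: cvgB; [exact: cvg_cst|exact: cutoff_cont].
have b1 (y : R) : `|1 - cutoff N.+1%:R y| <= 1.
  by rewrite ger0_norm ?subr_ge0 ?cutoff_le1// gerBl cutoff_ge0.
have z1 (y : R) : `|y| <= 1 -> 1 - cutoff N.+1%:R y = 0.
  by move=> y1; rewrite cutoff1 ?subrr// (le_trans y1)// ler1n.
have [_ H2] := small_time_cvg s20 hnu hX hn0 hnc ltr01 c1 b1 z1.
have tA0 := exp_tail_ge0 nu A.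
near=> n.
have h1 : \int[Pr]_w (expR (X (hn n) w) * cutoff A (X (hn n) w) - 1) / hn n <= e / 4.
  have : `|- exp_tail nu A - \int[Pr]_w (expR (X (hn n) w) * cutoff A (X (hn n) w) - 1) / hn n| <= e / 4.
    by near: n; exact: (cvgrPdist_le _ _).1 H1 _ e4.
  by rewrite ler_norml => /andP[]; move: (_ / hn n) (exp_tail _ _) tA0 => a b; lra.
have h2 : \int[Pr]_w (1 - cutoff N.+1%:R (X (hn n) w)) / hn n <= e / 4 + e / 4.
  have : `|\int[nu]_y (1 - cutoff N.+1%:R y) - \int[Pr]_w (1 - cutoff N.+1%:R (X (hn n) w)) / hn n| <= e / 4.
    by near: n; exact: (cvgrPdist_le _ _).1 H2 _ e4.
  by rewrite ler_norml => /andP[]; move: (_ / hn n) (\int[nu]_y _) tN => a b; lra.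
move=> x x0; have hp := hn0 n; have h0 := ltW hp.
have [x1|x1] := leP x 1; last first.
  apply: (@le_trans _ _ 1); last by rewrite lerDl mulr_ge0// ltW.
  rewrite -[leRHS](Rintegral_prob_cst Pr); apply: le_Rintegral => //.
  - exact: (Rint_levy hX h0 (bm_minr1 x0)).
  - exact: Rint_bounded.
  - by move=> w _; rewrite ge_min lexx orbT.
have I1 : Pr.-Rint (fun w => expR (X (hn n) w) * cutoff A (X (hn n) w) - 1).
  exact: (Rint_levy hX h0 (bmB (bm_expcut A) (bm_cst 1))).
have I2 : Pr.-Rint (fun w => 1 - cutoff N.+1%:R (X (hn n) w)).
  exact: (Rint_levy hX h0 (bmB (bm_cst 1) (bm_cutoff _))).
have I3 : Pr.-Rint (fun w => x * (expR (X (hn n) w) * cutoff A (X (hn n) w) - 1)) by exact: RintZ.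
have I4 : Pr.-Rint (fun=> x) by exact: Rint_bounded.
apply: (@le_trans _ _ (\int[Pr]_w (x + x * (expR (X (hn n) w) * cutoff A (X (hn n) w) - 1) + (1 - cutoff N.+1%:R (X (hn n) w))))).
  apply: le_Rintegral => //.
  - exact: (Rint_levy hX h0 (bm_minr1 x0)).
  - by apply: RintD => //; exact: RintD.
  - by move=> w _; rewrite -AN minr1_step// x0.
rewrite RintegralD//; last by apply: RintD.
rewrite RintegralD// Rintegral_prob_cst RintegralZl//.
move: h1 h2; rewrite !ler_pdivrMr//.
move: (\int[Pr]_w (_ - 1)) (\int[Pr]_w (1 - _)) => a b h1 h2.
have : x * a <= e / 4 * hn n.
  have p0 : 0 <= e / 4 * hn n by rewrite mulr_ge0// ltW.
  by have [a0|a0] := leP a 0; nra.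
have : 0 <= e * hn n by rewrite mulr_ge0// ltW.
lra.
Unshelve. all: end_near. Qed.

(** Truncation costs [exp_tail] per unit of time in the limit; the radius is fixed to make that tail
    small, and only afterwards does the step shrink. *)
Lemma exp_small_time_lower (e : R) : 0 < e -> \forall n \near \oo,
  exists2 A, 0 <= A & 1 - e * hn n <= \int[Pr]_w (expR (X (hn n) w) * cutoff A (X (hn n) w)).
Proof.
move=> e0.
have e4 : 0 < e / 4 by rewrite divr_gt0.
have [N _ hN] := (cvgrPdist_le _ _).1 (exp_tail_cvg hexp) _ e4.
have tN : exp_tail nu N.+1%:R <= e / 4.
  by have := hN N (leqnn N); rewrite sub0r normrN; apply: le_trans; exact: ler_norm.
have A1 : 1 <= N.+1%:R :> R by rewrite ler1n.
have H1 := exp_cut_cvg s20 hnu hX hexp hmart hn0 hnc A1.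
near=> n; exists N.+1%:R => //; have hp := hn0 n.
have : `|- exp_tail nu N.+1%:R - \int[Pr]_w (expR (X (hn n) w) * cutoff N.+1%:R (X (hn n) w) - 1) / hn n| <= e / 4.
  by near: n; exact: (cvgrPdist_le _ _).1 H1 _ e4.
rewrite RintegralB//; last 2 first.
- exact: (Rint_levy hX (ltW hp) (bm_expcut _)).
- exact: Rint_bounded.
rewrite Rintegral_prob_cst ler_norml => /andP[_].
move: (\int[Pr]_w _) (exp_tail _ _) tN => a b tN h1.
have : - (e / 2) <= (a - 1) / hn n by lra.
by rewrite ler_pdivlMr//; nra.
Unshelve. all: end_near. Qed.

End hseq.

Lemma levy_start0 (f : R -> R) : measurable_fun setT f -> \int[Pr]_w f (X 0 w) = f 0.
Proof.
move=> mf; rewrite -[RHS](Rintegral_prob_cst Pr) /Rintegral; congr fine.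
apply: ae_eq_integral => //.
- by apply/measurable_EFinP; apply: (measurableT_comp mf); exact: levy_meas hX _ (lexx _).
- have [N [mN N0 hN]] := levy_start hX; exists N; split => // w /=.
  move=> H; apply: hN => /=; apply: contra_notN H => /eqP -> //.
Qed.

Lemma levy_avg_meas (h : R) (f : R * R -> R) : 0 <= h -> measurable_fun setT f ->
  measurable_fun setT (fun z => \int[Pr]_w f (z, X h w)).
Proof.
move=> h0 mf; apply: (@measurable_Rintegral _ _ _ _ _ Pr (fun z w => f (z, X h w))).
apply: (measurableT_comp mf); apply: measurable_fun_pair => //.
by apply: (measurableT_comp (levy_meas hX h0)); exact: measurable_snd.
Qed.

(* [minr (x * e^y) 1] is bounded, so the small-time limits apply to it; iterating [n] steps of
   length [t / n] gives a truncated supermartingale, and [x -> 0] removes the truncation. *)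
Lemma minr1_supermartingale (t x : R) : 0 <= t -> 0 <= x ->
  \int[Pr]_w minr (x * expR (X t w)) 1 <= minr x 1.
Proof.
rewrite le_eqVlt => /orP[/eqP<- x0|t0 x0].
  by rewrite (levy_start0 (f := fun y => minr (x * expR y) 1)) ?expR0 ?mulr1//; case: (bm_minr1 x0).
pose hn n := t / n.+1%:R.
have hn0 n : 0 < hn n by rewrite divr_gt0.
have hnc : hn n @[n --> \oo] --> 0.
  by rewrite -(mulr0 t); apply: cvgMr; exact: cvg_harmonic.
apply/ler_addgt0Pr => e e0.
have et : 0 < e / t by rewrite divr_gt0.
have [n _ /(_ n (leqnn n)) H] := minr1_small_time hn0 hnc et.
have iter j : forall y, 0 <= y -> \int[Pr]_w minr (y * expR (X (hn n *+ j) w)) 1 <= minr y 1 + (e / t * hn n) *+ j.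
  elim: j => [|j IH] y y0.
    by rewrite mulr0n (levy_start0 (f := fun z => minr (y * expR z) 1)) ?expR0 ?mulr1 ?mulr0n ?addr0//; case: (bm_minr1 y0).
  have hj : 0 <= hn n *+ j by rewrite mulrn_wge0// ltW.
  have hp := ltW (hn0 n).
  pose f (z : R * R) := minr (y * expR z.1 * expR z.2) 1.
  have mf : measurable_fun setT f.
    apply: measurable_minr => //; apply: measurable_funM; first apply: measurable_funM => //.
      by apply: (measurableT_comp (f := expR)); [exact: meas_exp|exact: measurable_fst].
    by apply: (measurableT_comp (f := expR)); [exact: meas_exp|exact: measurable_snd].
  have f1 z : 0 <= f z <= 1.
    by rewrite /f le_min ler01 ge_min lexx orbT !mulr_ge0 ?expR_ge0.
  have := levy_markov_bounded hj hp (@history_setT (hn n *+ j)) mf f1.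
  have -> : \int[Pr]_w (\1_setT w * f (X (hn n *+ j) w, X (hn n *+ j + hn n) w - X (hn n *+ j) w)) =
     \int[Pr]_w minr (y * expR (X (hn n *+ j.+1) w)) 1.
    apply: eq_Rintegral => w _; rewrite indicT mul1r /f /= -mulrA -expRD addrC subrK.
    by rewrite mulrSr.
  move=> ->.
  apply: (@le_trans _ _ (\int[Pr]_w (minr (y * expR (X (hn n *+ j) w)) 1 + e / t * hn n))).
    apply: le_Rintegral => //.
    - apply: (@Rint_bounded _ _ _ Pr _ 1).
        apply: measurable_funM => //.
        exact: (measurableT_comp (levy_avg_meas hp mf) (levy_meas hX hj)).
      move=> w; rewrite indicT mul1r; rewrite ger0_norm; last first.
        by apply: Rintegral_ge0 => w' _; have /andP[] := f1 (X (hn n *+ j) w, X (hn n) w').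
      rewrite -[leRHS](Rintegral_prob_cst Pr); apply: le_Rintegral => //; last 2 first.
      + exact: Rint_bounded.
      + by move=> w' _; have /andP[] := f1 (X (hn n *+ j) w, X (hn n) w').
      apply: (@Rint_bounded _ _ _ Pr _ 1).
        apply: (measurableT_comp mf); apply: measurable_fun_pair => //.
        exact: levy_meas hX _ hp.
      by move=> w'; have /andP[h1 h2] := f1 (X (hn n *+ j) w, X (hn n) w'); rewrite ger0_norm.
    - apply: RintD; [exact: (Rint_levy hX hj (bm_minr1 y0))|exact: Rint_bounded].
    - by move=> w _; rewrite indicT mul1r /f/= H// mulr_ge0// expR_ge0.
  rewrite RintegralD//; [|exact: (Rint_levy hX hj (bm_minr1 y0))|exact: Rint_bounded].
  by rewrite Rintegral_prob_cst mulrSr addrA lerD2r IH.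
have := iter n.+1 x x0.
have -> : hn n *+ n.+1 = t by rewrite -mulr_natr divfK.
rewrite -mulrnAr (_ : hn n *+ n.+1 = t); last by rewrite -mulr_natr divfK.
by rewrite divfK// gt_eqF.
Qed.

(** For fixed [z], [n.+1%:R * minr (n.+1%:R^-1 * z) 1] is eventually [z], while the supermartingale
    inequality bounds each of the expectations by 1; Fatou concludes. *)
Lemma exp_levy_le t : 0 <= t ->
  Pr.-Rint (fun w => expR (X t w)) /\ \int[Pr]_w expR (X t w) <= 1.
Proof.
move=> t0.
pose f n w : R := n.+1%:R * minr (n.+1%:R^-1 * expR (X t w)) 1.
have n0 n : 0 <= n.+1%:R^-1 :> R by rewrite invr_ge0.
have ib n : Pr.-Rint (fun w => minr (n.+1%:R^-1 * expR (X t w)) 1).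
  exact: (Rint_levy hX t0 (bm_minr1 (n0 n))).
apply: (@Rfatou _ _ _ Pr f).
- by move=> n w; rewrite /f mulr_ge0// le_min ler01 mulr_ge0// expR_ge0.
- by move=> n; exact: RintZ.
- move=> w; apply: cvg_near_cst; near=> n; rewrite /f min_l ?mulVKf//.
  rewrite mulrC ler_pdivrMr// mul1r.
  have : expR (X t w) <= n%:R by near: n; exact: nbhs_infty_ger.
  by move/le_trans; apply; rewrite ler_nat.
- move=> n; rewrite /f RintegralZl//; last exact: ib.
  have := minr1_supermartingale t0 (n0 n).
  rewrite min_l; last by rewrite invf_le1 ?ler1n.
  by move=> /(ler_wpM2l (ler0n _ n.+1)); rewrite divff.
Unshelve. all: end_near. Qed.

Lemma exp_levy_mul s h : 0 <= s -> 0 <= h ->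
  \int[Pr]_w expR (X (s + h) w) = \int[Pr]_w expR (X s w) * \int[Pr]_w expR (X h w).
Proof.
move=> s0 h0.
pose f (z : R * R) : \bar R := (expR z.1 * expR z.2)%:E.
have mf : measurable_fun setT f.
  apply/measurable_EFinP; apply: measurable_funM.
    by apply: (measurableT_comp (f := expR)); [exact: meas_exp|exact: measurable_fst].
  by apply: (measurableT_comp (f := expR)); [exact: meas_exp|exact: measurable_snd].
have f0 z : (0 <= f z)%E by rewrite lee_fin mulr_ge0// expR_ge0.
have := levy_markov cPr hX s0 h0 (@history_setT s) mf f0.
have [[I1 _] [I2 _]] := (exp_levy_le s0, exp_levy_le h0).
have -> : (\int[Pr]_(w in setT) f (X s w, (X (s + h) w - X s w)%R) = \int[Pr]_w (expR (X (s + h) w))%:E)%E.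
  by apply: eq_integral => w _; rewrite /f /= -expRD addrC subrK.
rewrite /Rintegral => ->.
rewrite -[RHS]/(fine _ * Rintegral Pr setT (fun w => expR (X h w))).
rewrite -[RHS]RintegralZr// /Rintegral; congr fine; apply: eq_integral => w _.
rewrite /f /= EFinM fineK; last exact: integrable_fin_num I2.
by under eq_integral do rewrite EFinM; rewrite integralZl.
Qed.

(** For the lower bound, [t] is cut into [n.+1] steps, on each of which the mean is at least
    [1 - e / t * hn n]; by multiplicativity the product is at least [1 - e]. *)
Lemma exp_levy t : 0 <= t -> \int[Pr]_w expR (X t w) = 1.
Proof.
rewrite le_eqVlt => /orP[/eqP<-|t0]; first by rewrite (levy_start0 (@meas_exp R)) expR0.
apply/eqP; rewrite eq_le (exp_levy_le (ltW t0)).2/=.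
pose hn n := t / n.+1%:R.
have hn0 n : 0 < hn n by rewrite divr_gt0.
have hnc : hn n @[n --> \oo] --> 0.
  by rewrite -(mulr0 t); apply: cvgMr; exact: cvg_harmonic.
apply/ler_addgt0Pl => e e0.
have et : 0 < e / t by rewrite divr_gt0.
have : \forall n \near \oo, (exists2 A, 0 <= A & 1 - e / t * hn n <= \int[Pr]_w (expR (X (hn n) w) * cutoff A (X (hn n) w))) /\ e / t * hn n <= 1.
  apply: filterI; first exact: exp_small_time_lower.
  have : e / t * hn n @[n --> \oo] --> 0 by rewrite -(mulr0 (e / t)); apply: cvgMr.
  by move=> /cvgrPdist_le/(_ _ ltr01); apply: filterS => n; rewrite sub0r normrN; apply: le_trans; exact: ler_norm.
case=> n _ /(_ n (leqnn n))[[A A0 H] H1].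
have [I1 _] := exp_levy_le (ltW (hn0 n)).
have {}H : 1 - e / t * hn n <= \int[Pr]_w expR (X (hn n) w).
  apply: (le_trans H); apply: le_Rintegral => //.
    apply: le_Rint I1 _; last first.
      by move=> w; rewrite ger0_norm ?mulr_ge0 ?expR_ge0 ?cutoff_ge0// ler_piMr ?expR_ge0 ?cutoff_le1.
    apply: (measurableT_comp (f := fun y => expR y * cutoff A y)); last exact: levy_meas hX _ (ltW (hn0 n)).
    by apply: measurable_funM; [exact: meas_exp|case: (bm_cutoff A)].
  by move=> w _; rewrite ler_piMr ?expR_ge0 ?cutoff_le1.
have P j : \int[Pr]_w expR (X (hn n *+ j) w) = (\int[Pr]_w expR (X (hn n) w)) ^+ j.
  elim: j => [|j IH]; first by rewrite mulr0n (levy_start0 (@meas_exp R)) expR0 expr0.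
  by rewrite mulrSr exp_levy_mul ?mulrn_wge0 ?ltW// IH -exprSr.
have := P n.+1; rewrite (_ : hn n *+ n.+1 = t); last by rewrite -mulr_natr divfK.
move=> ->.
(* Bernoulli's inequality. It uses that the loss per step is at most 1, hence the second condition
   in the choice of [n]. *)
have B j : 1 - (e / t * hn n) *+ j <= (1 - e / t * hn n) ^+ j.
  elim: j => [|j IH]; first by rewrite mulr0n subr0 expr0.
  rewrite exprSr mulrSr.
  have p0 : 0 <= e / t * hn n by rewrite mulr_ge0// ltW.
  have q0 : 0 <= (e / t * hn n) *+ j by rewrite mulrn_wge0.
  move: ((e / t * hn n) *+ j) ((1 - e / t * hn n) ^+ j) (e / t * hn n) IH p0 q0 H1 => a b c; nra.
have := B n.+1; rewrite -mulrnAr (_ : hn n *+ n.+1 = t); last by rewrite -mulr_natr divfK.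
rewrite divfK ?gt_eqF// => B1.
rewrite -lerBlDl; apply: (le_trans B1); rewrite lerXn2r ?nnegrE// ?subr_ge0//.
by apply: Rintegral_ge0 => w _; exact: expR_ge0.
Qed.

End exponential_martingale.

Lemma Rint_sum {d} {T : measurableType d} {R : realType} (mu : {measure set T -> \bar R})
    {I : Type} (s : seq I) (f : I -> T -> R) : (forall i, mu.-Rint (f i)) ->
  mu.-Rint (fun x => \sum_(i <- s) f i x) /\
  \int[mu]_x (\sum_(i <- s) f i x) = \sum_(i <- s) \int[mu]_x f i x.
Proof.
move=> fi; elim: s => [|i s [IH1 IH2]].
  under eq_fun do rewrite big_nil; rewrite big_nil; split.
    exact: integrable0.
  by under eq_Rintegral do rewrite big_nil; rewrite /Rintegral integral0.
split.
  under eq_fun do rewrite big_cons; exact: RintD.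
under eq_Rintegral do rewrite big_cons.
by rewrite big_cons -IH2 -RintegralD//; exact: fi.
Qed.

(** * Absence of atoms *)

Section fejer.
Context {R : realType}.
Local Notation leb := (@lebesgue_measure R).
Local Notation p := (@exponential_pdf R 1).

Lemma norm_sin_mul (j : nat) (x : R) : `|sin (j%:R * x)| <= j%:R * `|sin x|.
Proof.
elim: j => [|j IH]; first by rewrite !mul0r sin0 normr0.
rewrite -natr1 !mulrDl !mul1r sinD; apply: (le_trans (ler_normD _ _)).
rewrite !normrM; apply: lerD.
  apply: le_trans IH; rewrite ler_piMr// ler_norml cos_geN1 cos_le1//.
by rewrite ler_piMl// ler_norml cos_geN1 cos_le1.
Qed.

Lemma one_sub_cos (x : R) : 1 - cos x = 2 * sin (x / 2) ^+ 2.
Proof.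
have -> : x = x / 2 + x / 2 by field.
rewrite cosD (_ : (x / 2 + x / 2) / 2 = x / 2); last by field.
have := cos2Dsin2 (x / 2).
move: (cos _) (sin _) => a b; rewrite -!expr2; lra.
Qed.

Lemma one_sub_cosB (k i j : nat) (x : R) : (i <= k)%N -> (j <= k)%N ->
  1 - cos ((i%:R - j%:R) * x) <= 4 * k%:R ^+ 2 * (1 - cos x).
Proof.
move=> ik jk; rewrite !one_sub_cos.
have -> : (i%:R - j%:R) * x / 2 = i%:R * (x / 2) - j%:R * (x / 2) by ring.
set y := x / 2.
have h : `|sin (i%:R * y - j%:R * y)| <= 2 * k%:R * `|sin y|.
  rewrite sinB; apply: (le_trans (ler_normB _ _)); rewrite !normrM.
  have c1 (z : R) : `|cos z| <= 1 by rewrite ler_norml cos_geN1 cos_le1.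
  have s1 (m : nat) : (m <= k)%N -> `|sin (m%:R * y)| <= k%:R * `|sin y|.
    by move=> mk; apply: (le_trans (norm_sin_mul _ _)); rewrite ler_wpM2r// ler_nat.
  rewrite (_ : 2 * k%:R * _ = k%:R * `|sin y| + k%:R * `|sin y|); last by ring.
  apply: lerD.
    by apply: le_trans (s1 i ik); rewrite ler_piMr.
  by apply: le_trans (s1 j jk); rewrite ler_piMl.
have := lerXn2r 2 (_ : `|sin (i%:R * y - j%:R * y)| \in Num.nneg) (_ : 2 * k%:R * `|sin y| \in Num.nneg) h.
rewrite !nnegrE => /(_ (normr_ge0 _)); rewrite !mulr_ge0// => /(_ isT).
rewrite real_normK ?num_real// !exprMn real_normK ?num_real//.
move: (sin _ ^+ 2) (sin y ^+ 2) (k%:R ^+ 2) => a b c; lra.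
Qed.

(** Squared modulus of the mean of [k] successive harmonics, that is, the Fejer kernel scaled to be
    1 at 0. The double sum lets integrals act term by term. *)
Definition fejer (k : nat) (x : R) : R :=
  (\sum_(i <- iota 0 k) \sum_(j <- iota 0 k) cos ((i%:R - j%:R) * x)) / k%:R ^+ 2.

Lemma fejer_ge0 k x : 0 <= fejer k x.
Proof.
rewrite /fejer divr_ge0 ?sqr_ge0//.
have -> : \sum_(i <- iota 0 k) \sum_(j <- iota 0 k) cos ((i%:R - j%:R) * x) =
  (\sum_(i <- iota 0 k) cos (i%:R * x)) ^+ 2 + (\sum_(i <- iota 0 k) sin (i%:R * x)) ^+ 2.
  rewrite !expr2 !big_distrlr/= -big_split/=; apply: eq_bigr => i _.
  by rewrite -big_split/=; apply: eq_bigr => j _; rewrite mulrBl cosB.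
by rewrite addr_ge0// sqr_ge0.
Qed.

Let sum_cst k (c : R) : \sum_(i <- iota 0 k) c = c * k%:R.
Proof. by rewrite big_const_seq count_predT size_iota iter_addr_0 mulr_natr. Qed.

Lemma fejer_ge k x : (0 < k)%N -> 1 - 4 * k%:R ^+ 2 * (1 - cos x) <= fejer k x.
Proof.
move=> k0; have kp : 0 < k%:R ^+ 2 :> R by rewrite exprn_gt0// ltr0n.
rewrite /fejer ler_pdivlMr//.
apply: (@le_trans _ _ (\sum_(i <- iota 0 k) \sum_(j <- iota 0 k) (1 - 4 * k%:R ^+ 2 * (1 - cos x)))).
  by under eq_bigr do rewrite sum_cst; rewrite sum_cst -[leRHS]mulrA -expr2.
rewrite big_seq [leRHS]big_seq; apply: ler_sum => i; rewrite mem_iota add0n => /= ik.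
rewrite big_seq [leRHS]big_seq; apply: ler_sum => j; rewrite mem_iota add0n => /= jk.
have := @one_sub_cosB k i j x (ltnW ik) (ltnW jk).
move: (cos (_ * x)) (_ * (1 - cos x)) => a b; lra.
Qed.

(** If [1 - cos x] is at most [1 / (8 k^2)], the Fejer kernel is at least [1 / 2] by [fejer_ge];
    otherwise [M * (1 - cos x)] exceeds [k] and the exponential is below [1 / k]. *)
Lemma exp_fejer k M (x : R) : (0 < k)%N -> 8 * k%:R ^+ 3 <= M ->
  expR (- (M * (1 - cos x))) <= 2 * fejer k x + k%:R^-1.
Proof.
move=> k0 kM; have kp : 0 < k%:R :> R by rewrite ltr0n.
have kv : 0 <= k%:R^-1 :> R by rewrite invr_ge0 ltW.
have F0 := fejer_ge0 k x; have F1 := fejer_ge x k0.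
have c1 : 0 <= 1 - cos x by rewrite subr_ge0 cos_le1.
have M0 : 0 <= M by apply: le_trans kM; rewrite mulr_ge0// exprn_ge0// ltW.
have [h|h] := leP (8 * k%:R ^+ 2 * (1 - cos x)) 1.
  have : expR (- (M * (1 - cos x))) <= 1.
    by rewrite -expR0 ler_expR oppr_le0 mulr_ge0.
  move: (fejer k x) F0 F1 (k%:R^-1) kv (expR _) => a F0 F1 b kv e; lra.
apply: (@le_trans _ _ k%:R^-1); last by rewrite lerDr mulr_ge0.
rewrite expRN lef_pV2 ?posrE ?expR_gt0//.
apply: (@le_trans _ _ (1 + M * (1 - cos x))); last exact: expR_ge1Dx.
apply: (@le_trans _ _ (M * (1 - cos x))); last by rewrite lerDr.
apply: (@le_trans _ _ (8 * k%:R ^+ 3 * (1 - cos x))); last by rewrite ler_wpM2r.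
rewrite exprS (_ : 8 * _ * _ = k%:R * (8 * k%:R ^+ 2 * (1 - cos x))); last by ring.
by rewrite ler_pMr// ltW.
Qed.

Lemma bm_sum {I : Type} (s : seq I) (f : I -> R -> R) : (forall i, bm (f i)) ->
  bm (fun x => \sum_(i <- s) f i x).
Proof.
move=> bf; elim: s => [|i s IH].
  by under eq_fun do rewrite big_nil; exact: bm_cst.
by under eq_fun do rewrite big_cons; exact: bmD.
Qed.

Lemma bm_fejer k : bm (fejer k).
Proof.
apply: bmM; last exact: bm_cst.
by apply: bm_sum => i; apply: bm_sum => j; exact: bm_cos.
Qed.

(** The [k] diagonal terms out of [k^2] contribute [1 / k]; all others have frequency at least
    [|c|], where the cosine transform is at most [(1 + c ^+ 2)^-1]. *)
Lemma expdens_fejer k c : (0 < k)%N ->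
  \int[leb]_u (p u * fejer k (u * c)) <= k%:R^-1 + (1 + c ^+ 2)^-1.
Proof.
move=> k0; have kp : 0 < k%:R :> R by rewrite ltr0n.
pose f (ij : nat * nat) u := p u * cos (u * ((ij.1%:R - ij.2%:R) * c)).
have fi ij : leb.-Rint (f ij).
  apply: (@expdens_Rint_bounded _ _ 1).
    by apply: (measurableT_comp (f := cos)); [exact: meas_cos|exact: mulrr_measurable].
  by move=> u; rewrite ler_norml cos_geN1 cos_le1.
pose s := [seq (i, j) | i <- iota 0 k, j <- iota 0 k].
have [_ Hs] := Rint_sum s fi.
have -> : \int[leb]_u (p u * fejer k (u * c)) = (\int[leb]_u (\sum_(ij <- s) f ij u)) / k%:R ^+ 2.
  rewrite mulrC -RintegralZl//; last by have [] := Rint_sum s fi.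
  apply: eq_Rintegral => u _; rewrite big_allpairs /fejer mulrA mulrC.
  congr (_ * _); rewrite mulr_sumr; apply: eq_bigr => i _.
  by rewrite mulr_sumr; apply: eq_bigr => j _; rewrite /f /= mulrCA.
rewrite Hs big_allpairs ler_pdivrMr ?exprn_gt0//.
apply: (@le_trans _ _ (\sum_(i <- iota 0 k) \sum_(j <- iota 0 k) ((i == j)%:R + (1 + c ^+ 2)^-1))).
  apply: ler_sum => i _; apply: ler_sum => j _; rewrite expdens_cos/=.
  have c0 : 0 < 1 + c ^+ 2 by rewrite ltr_pwDl// sqr_ge0.
  case: eqP => [->|/eqP ij].
    by rewrite subrr mul0r expr0n addr0 invr1 lerDl invr_ge0 ltW.
  rewrite add0r lef_pV2 ?posrE// ?ltr_pwDl ?sqr_ge0// lerD2l exprMn ler_peMl ?sqr_ge0//.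
  rewrite -(real_normK (num_real _)) exprn_ege1//.
  have [h|h|h] := ltngtP i j; last by rewrite h eqxx in ij.
    by rewrite distrC -natrB ?(ltnW h)// normr_nat ler1n subn_gt0.
  by rewrite -natrB ?(ltnW h)// normr_nat ler1n subn_gt0.
under eq_bigr do rewrite big_split/= sum_cst.
rewrite big_split/= sum_cst.
have -> : \sum_(i <- iota 0 k) \sum_(j <- iota 0 k) (i == j)%:R = k%:R :> R.
  rewrite -[RHS]mul1r -sum_cst; rewrite !big_seq; apply: eq_bigr => i ik.
  rewrite (bigD1_seq i) ?iota_uniq//= eqxx big1 ?addr0// => j; by rewrite eq_sym => /negPf ->.
rewrite mulrDl expr2 mulrA mulVf ?gt_eqF// mul1r mulrA.
by [].
Qed.

End fejer.

Section no_atoms.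
Context {R : realType} {d : measure_display} {Omega : measurableType d}.
Variables (Pr : probability Omega R) (X : R -> Omega -> R).
Variables (sigma2 gamma : R) (nu : {sigma_finite_measure set R -> \bar R}).
Hypotheses (s20 : 0 <= sigma2) (hnu : levy_measure nu)
  (hX : is_levy_process Pr X sigma2 gamma nu).
Local Notation leb := (@lebesgue_measure R).
Local Notation p := (@exponential_pdf R 1).
Local Notation re := (levy_exp_re sigma2 nu).

Lemma levy_exp_re_scale_meas N : measurable_fun setT (fun u : R => re (u * N)).
Proof.
apply: (measurableT_comp (f := re)); last exact: mulrr_measurable.
by have [] := @levy_exp_meas R sigma2 gamma nu.
Qed.

(** The indicator of the atom lies below [(1 + (N * (X s - a)) ^+ 2)^-1], an exponential average of
    cosines, and their expectations are bounded by the modulus of the characteristic function. *)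
Lemma levy_atom_le s (a N : R) : 0 <= s ->
  fine (Pr (X s @^-1` [set a])) <= \int[leb]_u (p u * expR (s * re (u * N))).
Proof.
move=> s0; have mX := levy_meas hX s0.
have mA : measurable (X s @^-1` [set a]) by rewrite -[X in measurable X]setTI; exact: mX.
have mk : measurable_fun setT (fun z : R * Omega => cos (z.1 * (N * (X s z.2 - a)))).
  apply: (measurableT_comp (f := cos)); first exact: meas_cos.
  apply: measurable_funM; first exact: measurable_fst.
  apply: measurable_funM => //; apply: measurable_funB => //.
  by apply: (measurableT_comp mX); exact: measurable_snd.
have g0 (w : Omega) : 0 <= 1 :> R by [].
have ig : Pr.-Rint (fun=> 1 : R) by exact: Rint_bounded.
have kg (u : R) (w : Omega) : `|cos (u * (N * (X s w - a)))| <= (1 + u ^+ 2) * 1.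
  rewrite mulr1; apply: (@le_trans _ _ 1); last by rewrite lerDl sqr_ge0.
  by rewrite ler_norml cos_geN1 cos_le1.
have [h1 h2 h3] := @expdens_Fubini _ _ _ Pr _ _ mk g0 ig kg.
apply: (@le_trans _ _ (\int[Pr]_w \int[leb]_u (p u * cos (u * (N * (X s w - a)))))).
  have -> : fine (Pr (X s @^-1` [set a])) = \int[Pr]_w (\1_(X s @^-1` [set a]) w).
    by rewrite /Rintegral integral_indic// setIT.
  apply: le_Rintegral => //.
    apply: (@Rint_bounded _ _ _ Pr _ 1) => //.
    by move=> w; rewrite indicE; case: (_ \in _); rewrite ?normr1 ?normr0.
  move=> w _; rewrite expdens_cos indicE; case: (boolP (w \in _)) => /= [|_]; last first.
    by rewrite invr_ge0 addr_ge0// sqr_ge0.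
  by rewrite inE/= => ->; rewrite subrr mulr0 expr0n addr0 invr1.
rewrite h3; apply: le_Rintegral => //.
  apply: (@expdens_Rint_bounded _ _ 1).
    apply: (measurableT_comp (f := expR)); first exact: meas_exp.
    apply: measurable_funM => //.
    exact: levy_exp_re_scale_meas.
  move=> u; rewrite ger0_norm ?expR_ge0// -[leRHS]expR0 ler_expR.
  by rewrite mulr_ge0_le0// levy_exp_re_le0.
move=> u _; apply: ler_wpM2l; first exact: expdens_ge0.
set v := u * N.
have [c1 c2] := levy_charf hX v s0.
have -> : \int[Pr]_w cos (u * (N * (X s w - a))) =
   cos (v * a) * \int[Pr]_w cos (v * X s w) + sin (v * a) * \int[Pr]_w sin (v * X s w).
  rewrite -!RintegralZl//; [|exact: (Rint_levy hX s0 (bm_sin v))|exact: (Rint_levy hX s0 (bm_cos v))].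
  rewrite -RintegralD//; last 2 first.
  - by apply: RintZ; exact: (Rint_levy hX s0 (bm_cos v)).
  - by apply: RintZ; exact: (Rint_levy hX s0 (bm_sin v)).
  apply: eq_Rintegral => w _; rewrite mulrA -/v mulrBr cosB; ring.
rewrite c1 c2.
have := cosB (v * a) (s * levy_exp_im gamma nu v).
have := cos_le1 (v * a - s * levy_exp_im gamma nu v).
have := expR_ge0 (s * re v).
move: (expR _) (cos (v * a)) (sin (v * a)) (cos (s * _)) (sin (s * _)) (cos (v * a - _)) => e ca sa cb sb cab e0 c1' E.
rewrite (_ : _ + _ = e * cab); last by rewrite E; ring.
by rewrite ler_piMr.
Qed.

Let annulus (e : R) : set R := [set y | e < `|y|].

Lemma annulus_meas e : measurable (annulus e).
Proof.
have mn : measurable_fun setT (fun x : R => `|x|) by exact: measurableT_comp.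
rewrite -[X in measurable X]setTI (_ : annulus e = (fun x : R => `|x|) @^-1` `]e, +oo[).
  exact: mn.
by apply/seteqP; split => x /=; rewrite in_itv/= andbT.
Qed.

Lemma annulus_Rint e : 0 < e -> nu.-Rint (\1_(annulus e) : R -> R).
Proof.
move=> e0; have wp : 0 < wc e by rewrite /wc divr_gt0 ?wc_den// exprn_gt0.
apply: (@le_Rint _ _ _ nu _ (fun y => (wc e)^-1 * wc y)).
- by apply: measurable_indic; exact: annulus_meas.
- by apply: RintZ; exact: levy_wc_Rint.
- move=> y; rewrite indicE; case: (boolP (y \in _)) => /= [|_]; last first.
    by rewrite normr0 mulr_ge0 ?wc_ge0// invr_ge0 ltW.
  rewrite inE /annulus/= normr1 => ey.
  rewrite mulrC ler_pdivlMr// mul1r /wc ler_pdivrMr ?wc_den// mulrAC ler_pdivlMr ?wc_den//.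
  have : e ^+ 2 <= y ^+ 2.
    by rewrite -(real_normK (num_real y)) lerXn2r ?nnegrE ?(ltW e0)// ltW.
  lra.
Qed.

Let mass e := \int[nu]_y (\1_(annulus e) y : R).

(** Otherwise Fatou would bound the mass of the complement of 0, while 0 itself is null. *)
Lemma annulus_mass_unbounded (C : R) : nu setT = +oo%E -> exists2 e, 0 < e & C <= mass e.
Proof.
move=> nuT; apply: contrapT => H.
have e0 n : 0 < n.+1%:R^-1 :> R by [].
have H2 n : mass n.+1%:R^-1 <= C.
  by rewrite leNgt; apply/negP => /ltW h; apply: H; exists n.+1%:R^-1.
pose f n (y : R) : R := \1_(annulus n.+1%:R^-1) y.
have [] := @Rfatou _ _ _ nu f (fun y => \1_(~` [set 0]) y) C.
- by move=> n y; rewrite /f indicE.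
- by move=> n; exact: annulus_Rint.
- move=> y; have [->|y0] := eqVneq y 0.
    rewrite indicE memNset/=; last by apply.
    apply: cvg_near_cst; near=> n; rewrite /f indicE memNset// /annulus /= normr0.
    by apply/negP; rewrite -leNgt.
  rewrite indicE mem_set/=; last exact/eqP.
  apply: cvg_near_cst; near=> n; rewrite /f indicE mem_set// /annulus /=.
  have yp : 0 < `|y| by rewrite normr_gt0.
  rewrite invf_plt ?posrE//.
  have : `|y|^-1 <= n%:R by near: n; exact: nbhs_infty_ger.
  by move/le_lt_trans; apply; rewrite ltr_nat.
- exact: H2.
move=> /integrableP[_ +] _.
have ind0 (y : R) : 0 <= (\1_(~` [set 0]) y : R) by rewrite indicE.
under eq_integral do rewrite /= (ger0_norm (ind0 _)).
have mS : measurable (~` [set 0 : R]) by exact: measurableC.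
rewrite integral_indic// setIT.
have : nu setT = (nu [set 0%R] + nu (~` [set 0%R]))%E.
  by rewrite -measureU// ?setUv ?setICr//.
rewrite nuT (_ : nu [set 0%R] = 0%E); last exact: hnu.1.
by rewrite add0e => h1; rewrite ltey => /eqP; apply; exact: (esym h1).
Unshelve. all: end_near. Qed.

(** The Gaussian part and the jumps up to [e] contribute nonpositive terms and are dropped. *)
Lemma levy_exp_re_annulus e z : 0 < e ->
  re z <= - \int[nu]_y (\1_(annulus e) y * (1 - cos (z * y))).
Proof.
move=> e0; rewrite /levy_exp_re.
have i1 : nu.-Rint (fun y => \1_(annulus e) y * (1 - cos (z * y))).
  apply: (@le_Rint _ _ _ nu _ (fun y => 2 * \1_(annulus e) y)).
  - apply: measurable_funM; first by apply: measurable_indic; exact: annulus_meas.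
    by apply: measurable_funB => //; case: (bm_cos z).
  - by apply: RintZ; exact: annulus_Rint.
  - move=> y; rewrite ger0_norm; last by rewrite mulr_ge0 ?subr_ge0 ?cos_le1// indicE.
    rewrite mulrC ler_wpM2r// ?indicE//; have := cos_geN1 (z * y); lra.
rewrite -[leRHS]mulN1r -RintegralZl//.
apply: (@le_trans _ _ (\int[nu]_y (cos (z * y) - 1))).
  by rewrite gerDr mulr_le0_ge0 ?sqr_ge0// oppr_le0 divr_ge0.
apply: le_Rintegral => //.
- exact: levy_cos_Rint.
- exact: RintZ.
- move=> y _; rewrite indicE; have := cos_le1 (z * y).
  by case: (_ \in _) => /=; rewrite ?mul1r ?mul0r ?mulr0; lra.
Qed.

Lemma exp_re_jensen e s z : 0 < e -> 0 <= s -> 0 < mass e ->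
  expR (s * re z) <=
  (mass e)^-1 * \int[nu]_y (\1_(annulus e) y * expR (- (s * mass e * (1 - cos (z * y))))).
Proof.
move=> e0 s0 l0; set l := mass e.
have D01 y : 0 <= (\1_(annulus e) y : R) by rewrite indicE.
have mD : measurable_fun setT (\1_(annulus e) : R -> R) by apply: measurable_indic; exact: annulus_meas.
have iD := annulus_Rint e0.
have ib (g : R -> R) M : measurable_fun setT g -> (forall y, `|g y| <= M) ->
    nu.-Rint (fun y => \1_(annulus e) y * g y).
  move=> mg gM; apply: (@le_Rint _ _ _ nu _ (fun y => M * \1_(annulus e) y)).
  - exact: measurable_funM.
  - exact: RintZ.
  - by move=> y; rewrite normrM (ger0_norm (D01 y)) mulrC ler_wpM2r.
have mc : measurable_fun setT (fun y : R => 1 - cos (z * y)).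
  by apply: measurable_funB => //; case: (bm_cos z).
have c0 (y : R) : 0 <= 1 - cos (z * y) by rewrite subr_ge0 cos_le1.
have c2 (y : R) : `|1 - cos (z * y)| <= 2.
  by rewrite ger0_norm//; have := cos_geN1 (z * y); lra.
set q := \int[nu]_y (\1_(annulus e) y * (1 - cos (z * y))).
pose m := - (s * q).
apply: (@le_trans _ _ (expR m)).
  rewrite ler_expR /m -mulrN ler_wpM2l//; exact: levy_exp_re_annulus.
pose M := s * l.
have M0 : 0 <= M by rewrite mulr_ge0// ltW.
have H (y : R) : expR m * (1 - m) * \1_(annulus e) y - expR m * M * (\1_(annulus e) y * (1 - cos (z * y))) <=
   \1_(annulus e) y * expR (- (M * (1 - cos (z * y)))).
  rewrite [X in X - _]mulrC (mulrCA (expR m * M)) -mulrBr ler_wpM2l//.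
  have -> : - (M * (1 - cos (z * y))) = m + (- m - M * (1 - cos (z * y))) by ring.
  rewrite expRD; apply: le_trans (ler_wpM2l (expR_ge0 m) (expR_ge1Dx _)).
  by rewrite le_eqVlt; apply/orP; left; apply/eqP; ring.
have iR : nu.-Rint (fun y => \1_(annulus e) y * expR (- (M * (1 - cos (z * y))))).
  apply: (ib _ 1).
    by apply: (measurableT_comp (f := expR)); [exact: meas_exp|apply: measurableT_comp => //; exact: measurable_funM].
  by move=> y; rewrite ger0_norm ?expR_ge0// -[leRHS]expR0 ler_expR oppr_le0 mulr_ge0.
have iq := ib _ _ mc c2.
have : \int[nu]_y (expR m * (1 - m) * \1_(annulus e) y - expR m * M * (\1_(annulus e) y * (1 - cos (z * y)))) <=
   \int[nu]_y (\1_(annulus e) y * expR (- (M * (1 - cos (z * y))))).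
  apply: le_Rintegral => //.
  by apply: RintB; exact: RintZ.
rewrite RintegralB//; [|exact: RintZ|exact: RintZ].
rewrite !RintegralZl// -/q -/(mass e) -/l => H2.
rewrite mulrC ler_pdivlMr//; apply: le_trans H2.
rewrite le_eqVlt; apply/orP; left; apply/eqP; rewrite /m /M; ring.
Qed.

(* An atom of mass [a] of the law of [X s] forces the mean of [|E e^{izX_s}|] over large [z] to
   be at least [a], whereas by Jensen's inequality and the Fejer kernel this mean is small when
   the mass of [nu] away from 0 is large. *)
Lemma levy_no_atom_infinite s (a : R) : 0 < s -> nu setT = +oo%E ->
  Pr (X s @^-1` [set a]) = 0%E.
Proof.
move=> s0 nuT.
have fP : Pr (X s @^-1` [set a]) \is a fin_num.
  apply: fin_num_measure; rewrite -[X in measurable X]setTI.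
  exact: (levy_meas hX (ltW s0)).
rewrite -(fineK fP); congr (_%:E); apply/eqP; rewrite eq_le fine_ge0// andbT.
apply/ler_addgt0Pl => eps eps0; rewrite addr0.
(* The bound reached at the end is [2 * (1 / k + 1 / k) + 1 / k]. *)
have [k k0 hk] : exists2 k, (0 < k)%N & 5 / k%:R <= eps.
  have [k _ hk] := (@nbhs_infty_ger R (5 / eps)).
  exists k.+1 => //; rewrite ler_pdivrMr// mulrC -ler_pdivrMr//.
  by apply: (le_trans (hk k (leqnn _))); rewrite ler_nat.
have kp : 0 < k%:R :> R by rewrite ltr0n.
have [e e0 he] := annulus_mass_unbounded (8 * k%:R ^+ 3 / s) nuT.
have l0 : 0 < mass e by apply: lt_le_trans he; rewrite divr_gt0// mulr_gt0// exprn_gt0.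
have lM : 8 * k%:R ^+ 3 <= s * mass e by rewrite (mulrC s) -ler_pdivrMr.
(* With this scale [|N * y| >= k] on the annulus, so the off-diagonal part of the Fejer average is
   at most [1 / k]. *)
pose N := k%:R / e.
apply: (le_trans (levy_atom_le a N (ltW s0))); apply: le_trans hk.
pose l := mass e.
have D01 y : 0 <= (\1_(annulus e) y : R) by rewrite indicE.
have mD : measurable_fun setT (\1_(annulus e) : R -> R) by apply: measurable_indic; exact: annulus_meas.
have iD := annulus_Rint e0.
pose ker u y := l^-1 * \1_(annulus e) y * (2 * fejer k (u * N * y) + k%:R^-1).
have [mF [B hB]] := @bm_fejer R k.
have mk : measurable_fun setT (fun z : R * R => ker z.1 z.2).
  apply: measurable_funM; first apply: measurable_funM => //.
    by apply: (measurableT_comp mD); exact: measurable_snd.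
  apply: measurable_funD => //; apply: measurable_funM => //.
  apply: (measurableT_comp mF); apply: measurable_funM; last exact: measurable_snd.
  by apply: measurable_funM => //; exact: measurable_fst.
have lv : 0 <= l^-1 by rewrite invr_ge0 ltW.
have kv : 0 <= k%:R^-1 :> R by rewrite invr_ge0 ltW.
have B0 : 0 <= B by exact: le_trans (hB 0).
pose g y := (2 * B + k%:R^-1) * (l^-1 * \1_(annulus e) y).
have g0 y : 0 <= g y by rewrite mulr_ge0 ?addr_ge0 ?mulr_ge0.
have ig : nu.-Rint g by apply: RintZ; exact: RintZ.
have kg0 (u y : R) : `|ker u y| <= g y.
  rewrite /ker /g normrM ger0_norm ?mulr_ge0// mulrC ler_wpM2r ?mulr_ge0//.
  have F0 := fejer_ge0 k (u * N * y).
  have F1 := le_trans (ler_norm _) (hB (u * N * y)).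
  rewrite ger0_norm; last by rewrite addr_ge0// mulr_ge0.
  by rewrite lerD2r ler_wpM2l.
have kg (u y : R) : `|ker u y| <= (1 + u ^+ 2) * g y.
  by apply: (le_trans (kg0 u y)); rewrite ler_peMl// lerDl sqr_ge0.
have [h1 h2 h3] := @expdens_Fubini _ _ _ nu _ _ mk g0 ig kg.
have kint u : nu.-Rint (ker u).
  apply: le_Rint ig (kg0 u).
  exact: (measurableT_comp mk (pair1_measurable u)).
apply: (@le_trans _ _ (\int[leb]_u (p u * \int[nu]_y ker u y))).
  apply: le_Rintegral => //.
    apply: (@expdens_Rint_bounded _ _ 1).
      apply: (measurableT_comp (f := expR)); first exact: meas_exp.
      apply: measurable_funM => //.
      exact: levy_exp_re_scale_meas.
    move=> u; rewrite ger0_norm ?expR_ge0// -[leRHS]expR0 ler_expR.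
    by rewrite mulr_ge0_le0 ?levy_exp_re_le0// ltW.
  move=> u _; apply: ler_wpM2l; first exact: expdens_ge0.
  apply: (le_trans (exp_re_jensen (u * N) e0 (ltW s0) l0)).
  rewrite -RintegralZl//; last first.
    apply: (@le_Rint _ _ _ nu _ (\1_(annulus e))) => //.
      apply: measurable_funM => //.
      apply: (measurableT_comp (f := expR)); first exact: meas_exp.
      apply: measurableT_comp => //; apply: measurable_funM => //.
      by apply: measurable_funB => //; case: (bm_cos (u * N)).
    move=> y; rewrite ger0_norm ?mulr_ge0 ?expR_ge0// ler_piMr//.
    by rewrite -[leRHS]expR0 ler_expR oppr_le0 mulr_ge0 ?subr_ge0 ?cos_le1// mulr_ge0// ltW.
  apply: le_Rintegral => //.
    apply: RintZ.
    apply: (@le_Rint _ _ _ nu _ (\1_(annulus e))) => //.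
      apply: measurable_funM => //.
      apply: (measurableT_comp (f := expR)); first exact: meas_exp.
      apply: measurableT_comp => //; apply: measurable_funM => //.
      by apply: measurable_funB => //; case: (bm_cos (u * N)).
    move=> y; rewrite ger0_norm ?mulr_ge0 ?expR_ge0// ler_piMr//.
    by rewrite -[leRHS]expR0 ler_expR oppr_le0 mulr_ge0 ?subr_ge0 ?cos_le1// mulr_ge0// ltW.
    exact: kint.
  move=> y _; rewrite /ker mulrA; apply: ler_wpM2l; first exact: mulr_ge0.
  exact: exp_fejer.
rewrite -h3.
apply: (@le_trans _ _ (\int[nu]_y (5 / k%:R * (l^-1 * \1_(annulus e) y)))); last first.
  rewrite RintegralZl//; last exact: RintZ.
  by rewrite RintegralZl// -/(mass e) mulVf ?mulr1// gt_eqF.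
apply: le_Rintegral => //; first by apply: RintZ; exact: RintZ.
move=> y _.
have -> : \int[leb]_u (p u * ker u y) =
   l^-1 * \1_(annulus e) y * (2 * \int[leb]_u (p u * fejer k (u * (N * y))) + k%:R^-1).
  have i1 : leb.-Rint (fun u => p u * fejer k (u * (N * y))).
    apply: (@expdens_Rint_bounded _ _ B) => //.
    by apply: (measurableT_comp mF); exact: mulrr_measurable.
  have i2 : leb.-Rint p := @expdens_Rint R.
  transitivity (\int[leb]_u (l^-1 * \1_(annulus e) y * 2 * (p u * fejer k (u * (N * y))) +
     l^-1 * \1_(annulus e) y * k%:R^-1 * p u)).
    apply: eq_Rintegral => u _; rewrite /ker -(mulrA u N y).
    move: (fejer _ _) (p u) (\1_ _ _) => a1 a2 a3; ring.
  rewrite RintegralD//; [|exact: RintZ|exact: RintZ].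
  rewrite !RintegralZl// expdens1; ring.
rewrite indicE; case: (boolP (y \in _)) => /= [|_]; last by rewrite !(mulr0, mul0r).
rewrite inE /annulus /= => ey.
rewrite mulr1 [leRHS]mulrC ler_wpM2l//.
have := expdens_fejer (N * y) k0.
have : (1 + (N * y) ^+ 2)^-1 <= k%:R^-1.
  rewrite lef_pV2 ?posrE// ?ltr_pwDl ?sqr_ge0//.
  apply: (@le_trans _ _ `|N * y|); last first.
    by rewrite -(real_normK (num_real (N * y))) le_1Dsqr.
  have N0 : 0 <= k%:R / e by rewrite divr_ge0// ltW.
  rewrite normrM /N (ger0_norm N0).
  by rewrite mulrAC ler_pdivlMr// ler_wpM2l// ltW.
move: (k%:R^-1) (\int[leb]_u _) (_^-1) => a1 a2 a3; lra.
Qed.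

(** As the scale [N] grows, the Gaussian factor tends to 0 at every [u] other than 0, so the bound
    of [levy_atom_le] tends to the integral of the density over a single point. *)
Lemma levy_no_atom_gauss s (a : R) : 0 < s -> 0 < sigma2 ->
  Pr (X s @^-1` [set a]) = 0%E.
Proof.
move=> s0 sig.
have fP : Pr (X s @^-1` [set a]) \is a fin_num.
  apply: fin_num_measure; rewrite -[X in measurable X]setTI.
  exact: (levy_meas hX (ltW s0)).
rewrite -(fineK fP); congr (_%:E); apply/eqP; rewrite eq_le fine_ge0// andbT.
pose c := s * (sigma2 / 2).
have c0 : 0 < c by rewrite mulr_gt0// divr_gt0.
pose f (n : nat) (u : R) := p u * expR (- (c * (u * n%:R) ^+ 2)).
pose g (u : R) := p u * (\1_[set 0] u).
have ms0 : measurable [set (0 : R)] by exact: measurable_set1.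
have fe n (u : R) : `|expR (- (c * (u * n%:R) ^+ 2))| <= 1.
  by rewrite ger0_norm ?expR_ge0// -[leRHS]expR0 ler_expR oppr_le0 mulr_ge0 ?sqr_ge0// ltW.
have me (n : nat) : measurable_fun setT (fun u : R => expR (- (c * (u * n%:R) ^+ 2))).
  apply: (measurableT_comp (f := expR)); first exact: meas_exp.
  by apply: measurableT_comp => //; apply: measurable_funM => //; apply: measurable_funX; exact: mulrr_measurable.
have mf n : measurable_fun setT (f n) by apply: measurable_funM => //; exact: expdens_meas.
have cf u : f n u @[n --> \oo] --> g u.
  apply: cvgM; first exact: cvg_cst.
  have [->|u0] := eqVneq u 0.
    rewrite indicE mem_set//=; apply: cvg_near_cst; apply: nearW => n.
    by rewrite mul0r expr0n mulr0 oppr0 expR0.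
  rewrite indicE memNset/=; last exact/eqP.
  have up : 0 < c * u ^+ 2 by rewrite mulr_gt0// exprn_even_gt0.
  apply/cvgrPdist_le => e e0; near=> n.
  rewrite sub0r normrN ger0_norm ?expR_ge0//.
  have np : 0 < n%:R :> R by rewrite ltr0n; near: n; exists 1%N.
  have n1 : 1 <= n%:R :> R by rewrite ler1n -(ltr0n R).
  rewrite expRN invf_ple ?posrE ?expR_gt0//.
  apply: (@le_trans _ _ (1 + c * (u * n%:R) ^+ 2)); last exact: expR_ge1Dx.
  apply: (@le_trans _ _ (c * u ^+ 2 * n%:R)).
    rewrite mulrC -ler_pdivrMr//; near: n; exact: nbhs_infty_ger.
  rewrite (_ : c * (u * n%:R) ^+ 2 = c * u ^+ 2 * n%:R ^+ 2); last by ring.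
  apply: (@le_trans _ _ (c * u ^+ 2 * n%:R ^+ 2)); last by rewrite lerDr.
  by rewrite ler_wpM2l ?(ltW up)// [leRHS]expr2 ler_peMl// ltW.
have fp n u : `|f n u| <= p u.
  by rewrite normrM (ger0_norm (expdens_ge0 u)) ler_piMr ?expdens_ge0.
have [_ H] := @Rdominated _ _ _ leb f g p mf cf expdens_Rint fp.
have g00 : \int[leb]_u g u = 0.
  have -> : \int[leb]_u g u = \int[leb]_(u in [set 0]) p u.
    rewrite [RHS]/Rintegral integral_mkcond /Rintegral; congr fine.
    apply: eq_integral => u _; rewrite patchE /g indicE; case: (_ \in _).
      by rewrite mulr1.
    by rewrite mulr0.
  exact: Rintegral_set1.
rewrite g00 in H.
apply: (ler_cvg_to (cvg_cst _) H); apply: nearW => n.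
apply: (le_trans (levy_atom_le a n%:R (ltW s0))); apply: le_Rintegral => //.
- apply: (@expdens_Rint_bounded _ _ 1).
    apply: (measurableT_comp (f := expR)); first exact: meas_exp.
    apply: measurable_funM => //.
    exact: levy_exp_re_scale_meas.
  move=> u; rewrite ger0_norm ?expR_ge0// -[leRHS]expR0 ler_expR.
  by rewrite mulr_ge0_le0 ?levy_exp_re_le0// ltW.
- exact: (expdens_Rint_bounded (me n) (fe n)).
- move=> u _; apply: ler_wpM2l; first exact: expdens_ge0.
  rewrite ler_expR /c -mulrA -mulrN ler_wpM2l ?(ltW s0)//.
  rewrite /levy_exp_re mulNr gerDl -oppr_ge0 -[X in 0 <= X]mulN1r -RintegralZl//; last exact: levy_cos_Rint.
  apply: Rintegral_ge0 => x _; rewrite mulN1r oppr_ge0 subr_le0; exact: cos_le1.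
Unshelve. all: end_near. Qed.

End no_atoms.

(** * Bermudan prices *)

Section bermudan.
Context {R : realType} {d : measure_display} {Omega : measurableType d}.
Variables (Pr : probability Omega R) (X : R -> Omega -> R).
Variables (sigma2 gamma : R) (nu : {sigma_finite_measure set R -> \bar R}).
Hypotheses (s20 : 0 <= sigma2) (hnu : levy_measure nu)
  (cPr : measure_is_complete Pr)
  (hX : is_levy_process Pr X sigma2 gamma nu).
Hypothesis hexp : (\int[nu]_(y in [set y : R | (1 <= `|y|)%R]) (expR y)%:E < +oo)%E.
Hypothesis hmart : ((sigma2 / 2 + gamma)%:E
     + \int[nu]_y (expR y - 1 - y * \1_[set z : R | (`|z| <= 1)%R] y)%R%:E = 0)%E.
Variables (r delta K : R).
Hypotheses (r0 : 0 < r) (delta0 : 0 <= delta) (K0 : 0 < K).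

Local Notation S := (stock X r delta).

Lemma stock_meas x s : 0 <= s -> measurable_fun setT (S x s).
Proof.
move=> s0; apply: measurable_funM => //.
apply: (measurableT_comp (f := expR)); first exact: meas_exp.
by apply: measurable_funD => //; exact: levy_meas hX _ s0.
Qed.

Lemma stock_ge0 x s w : 0 <= x -> 0 <= S x s w.
Proof. by move=> x0; rewrite mulr_ge0// expR_ge0. Qed.

Lemma stock_Rint x s : 0 <= s ->
  Pr.-Rint (S x s) /\ \int[Pr]_w S x s w = x * expR ((r - delta) * s).
Proof.
move=> s0; have [I1 _] := exp_levy_le s20 hnu cPr hX hexp hmart s0.
have E : S x s = (fun w => x * expR ((r - delta) * s) * expR (X s w)).
  by apply/funext => w; rewrite /stock expRD mulrA.
rewrite E; split; first exact: RintZ.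
by rewrite RintegralZl// (exp_levy s20 hnu cPr hX hexp hmart s0) mulr1.
Qed.

(** The absolute value extends the payoff to the whole line as a bounded 1-Lipschitz function;
    nonnegative prices do not see it. *)
Definition pay (x : R) : R := maxr (K - `|x|) 0.

(** Class preserved by each step of dynamic programming with constants that do not depend on the
    step; it carries all the compactness used in the limits. *)
Definition put_like (g : R -> R) := (forall x, 0 <= g x <= K) /\
  (forall x y, `|g x - g y| <= `|x - y|).

Lemma put_like_ge0 g x : put_like g -> 0 <= g x.
Proof. by case=> + _ => /(_ x)/andP[]. Qed.

Lemma put_like_leK g x : put_like g -> g x <= K.
Proof. by case=> + _ => /(_ x)/andP[]. Qed.

Lemma put_like_norm g x : put_like g -> `|g x| <= K.
Proof. by move=> gg; rewrite ger0_norm ?put_like_leK// put_like_ge0. Qed.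

Lemma put_like_cont g : put_like g -> continuous g.
Proof.
move=> [_ gl] x; apply/cvgrPdist_le => e e0; exists e => //= y /ltW xy.
exact: le_trans (gl x y) xy.
Qed.

Lemma put_like_cvg g (u : nat -> R) l : put_like g -> u n @[n --> \oo] --> l ->
  g (u n) @[n --> \oo] --> g l.
Proof.
move=> [_ gl] /cvgrPdist_le ul; apply/cvgrPdist_le => e e0.
by apply: filterS (ul e e0) => n; apply: le_trans; exact: gl.
Qed.

Lemma put_like_meas g : put_like g -> measurable_fun setT g.
Proof. by move=> gg; apply: continuous_measurable_fun; exact: put_like_cont. Qed.

Lemma put_like_stock_meas g x s : put_like g -> 0 <= s -> measurable_fun setT (fun w => g (S x s w)).
Proof. by move=> gg s0; exact: (measurableT_comp (put_like_meas gg) (stock_meas x s0)). Qed.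

Lemma put_like_stock_Rint g x s : put_like g -> 0 <= s -> Pr.-Rint (fun w => g (S x s w)).
Proof.
move=> gg s0; apply: (@Rint_bounded _ _ _ Pr _ K); first exact: put_like_stock_meas.
by move=> w; exact: put_like_norm.
Qed.

Lemma maxr_lip (a b a' b' c : R) : `|a - a'| <= c -> `|b - b'| <= c ->
  `|maxr a b - maxr a' b'| <= c.
Proof.
rewrite !ler_norml => /andP[h1 h2] /andP[h3 h4].
by rewrite /maxr; case: ifP => h5; case: ifP => h6; move: h5 h6;
  rewrite ?ltNge => h5 h6; apply/andP; split; lra.
Qed.

Lemma put_like_pay : put_like pay.
Proof.
split=> [x|x y]; first by rewrite /pay le_max lexx orbT/= ge_max (ltW K0) andbT gerBl.
rewrite /pay; apply: maxr_lip; last by rewrite subrr normr0.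
rewrite (_ : K - `|x| - (K - `|y|) = `|y| - `|x|); last by ring.
by rewrite (distrC x); exact: ler_dist_dist.
Qed.

Lemma put_like_max f g : put_like f -> put_like g -> put_like (fun x => maxr (f x) (g x)).
Proof.
move=> gf gg; split=> [x|x y]; last by apply: maxr_lip; [exact: gf.2|exact: gg.2].
by rewrite le_max put_like_ge0//= ge_max !put_like_leK.
Qed.

Definition Qh (h : R) (g : R -> R) (x : R) : R :=
  expR (- (r * h)) * \int[Pr]_w g (S x h w).

Lemma discount_le1 h : 0 <= h -> expR (- (r * h)) <= 1.
Proof. by move=> h0; rewrite -[leRHS]expR0 ler_expR oppr_le0 mulr_ge0// ltW. Qed.

Lemma le_norm_Rint (f : Omega -> R) g : Pr.-Rint f -> Pr.-Rint g ->
  (forall w, `|f w| <= g w) -> `|\int[Pr]_w f w| <= \int[Pr]_w g w.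
Proof.
move=> If Ig fg; rewrite ler_norml; apply/andP; split.
  rewrite -[leLHS]mulN1r -RintegralZl//; apply: le_Rintegral => //; first exact: RintZ.
  by move=> w _; rewrite mulN1r; have := fg w; rewrite ler_norml => /andP[].
by apply: le_Rintegral => // w _; have := fg w; rewrite ler_norml => /andP[].
Qed.

(** The discounted stock has mean [expR (- (delta * h)) * x], so the Lipschitz constant does not
    grow. *)
Lemma put_like_Qh h g : 0 <= h -> put_like g -> put_like (Qh h g).
Proof.
move=> h0 gg; have e0 := expR_ge0 (- (r * h)); have e1 := discount_le1 h0.
have I x := put_like_stock_Rint x gg h0.
split=> [x|x y].
  have i0 : 0 <= \int[Pr]_w g (S x h w) by apply: Rintegral_ge0 => w _; exact: put_like_ge0.
  have iK : \int[Pr]_w g (S x h w) <= K.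
    rewrite -[leRHS](Rintegral_prob_cst Pr); apply: le_Rintegral => //.
    - exact: I.
    - exact: Rint_bounded.
    - by move=> w _; exact: put_like_leK.
  rewrite /Qh mulr_ge0//=; apply: le_trans iK; exact: ler_piMl.
rewrite /Qh -mulrBr -RintegralB//; [|exact: I|exact: I].
rewrite normrM (ger0_norm e0).
have [J1 J2] := stock_Rint `|x - y| h0.
have H : `|\int[Pr]_w (g (S x h w) - g (S y h w))| <= `|x - y| * expR ((r - delta) * h).
  rewrite -J2; apply: le_norm_Rint => //; first exact: RintB.
  move=> w; apply: (le_trans (gg.2 _ _)).
  by rewrite /stock -mulrBl normrM (ger0_norm (expR_ge0 _)).
apply: (le_trans (ler_wpM2l e0 H)).
rewrite mulrCA -expRD (_ : - (r * h) + (r - delta) * h = - (delta * h)); last by ring.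
by rewrite ler_piMr// -[leRHS]expR0 ler_expR oppr_le0 mulr_ge0.
Qed.

Lemma Qh_le h f g c x : 0 <= h -> 0 <= c -> put_like f -> put_like g ->
  (forall y, 0 <= y -> f y <= g y + c) -> 0 <= x -> Qh h f x <= Qh h g x + c.
Proof.
move=> h0 c0 gf gg fg x0.
have If := put_like_stock_Rint x gf h0; have Ig := put_like_stock_Rint x gg h0.
have Ic : Pr.-Rint (fun=> c) by exact: Rint_bounded.
apply: (@le_trans _ _ (expR (- (r * h)) * (\int[Pr]_w g (S x h w) + c))).
  rewrite /Qh ler_wpM2l ?expR_ge0// -[X in _ + X](Rintegral_prob_cst Pr) -RintegralD//.
  apply: le_Rintegral => //; first exact: RintD.
  by move=> w _; apply: fg; exact: stock_ge0.
by rewrite mulrDr lerD2l ler_piMl// discount_le1.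
Qed.

Fixpoint berm (h : R) (m : nat) : R -> R :=
  if m is m'.+1 then fun x => maxr (pay x) (Qh h (berm h m') x) else pay.

Lemma put_like_berm h m : 0 <= h -> put_like (berm h m).
Proof.
move=> h0; elim: m => [|m IH] /=; first exact: put_like_pay.
by apply: put_like_max; [exact: put_like_pay|exact: put_like_Qh].
Qed.

Lemma pay_le_berm h m x : pay x <= berm h m x.
Proof. by case: m => //= m; rewrite le_max lexx. Qed.

(** An excess over the payoff at the end is carried back to the start without amplification, since
    discounting contracts. *)
Lemma berm_shift h c k m x : 0 <= h -> 0 <= c -> 0 <= x ->
  (forall y, 0 <= y -> berm h k y <= pay y + c) -> berm h (m + k) x <= berm h m x + c.
Proof.
move=> h0 c0 x0 hk; elim: m x x0 => [|m IH] x x0; first by rewrite add0n hk.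
rewrite addSn /= ge_max; apply/andP; split.
  by rewrite -[leLHS]addr0 lerD// le_max lexx.
apply: (@le_trans _ _ (Qh h (berm h m) x + c)); last by rewrite lerD2r le_max lexx orbT.
by apply: Qh_le => //; exact: put_like_berm.
Qed.

Lemma berm_mono h m x : 0 <= h -> 0 <= x -> berm h m x <= berm h m.+1 x.
Proof.
move=> h0; elim: m x => [|m IH] x x0 /=; first by rewrite le_max lexx.
rewrite ge_max le_max lexx/= le_max; apply/orP; right.
rewrite -[leRHS]addr0; apply: Qh_le => //; [exact: put_like_berm|exact: (put_like_berm m.+1)|].
by move=> y y0; rewrite addr0; exact: IH.
Qed.

Lemma berm_le h m k x : 0 <= h -> 0 <= x -> berm h m x <= berm h (m + k) x.
Proof.
move=> h0 x0; elim: k => [|k IH]; first by rewrite addn0.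
by rewrite addnS; apply: (le_trans IH); exact: berm_mono.
Qed.

(** Bound, uniform in the stock and in the grid, for what [eta] more units of time can add to a
    Bermudan price. The truncation at 1 is there because [X eta] may fail to have a first moment. *)
Definition omega (eta : R) : R := K * \int[Pr]_w minr 1 (`|X eta w| + delta * eta).

Let call_meas (a : R) : measurable_fun setT (fun z : R => maxr (K - a * expR z) 0).
Proof.
apply: measurable_maxr => //; apply: measurable_funB => //.
by apply: measurable_funM => //; exact: meas_exp.
Qed.

Let call_bound (a z : R) : 0 <= a -> `|maxr (K - a * expR z) 0| <= K.
Proof.
move=> a0; rewrite ger0_norm; last by rewrite le_max lexx orbT.
by rewrite ge_max (ltW K0) andbT gerBl mulr_ge0// expR_ge0.
Qed.

Let bm_call a : 0 <= a -> bm (fun z : R => maxr (K - a * expR z) 0).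
Proof. by move=> a0; split; [exact: call_meas|exists K => z; exact: call_bound]. Qed.

(** European put whose strike is not discounted. It dominates every exercise strategy: dropping the
    discount on [K] raises the payoff, and what remains is a decreasing convex function of the
    discounted stock, which is a supermartingale. *)
Let cap (k : nat) (h x : R) : R :=
  \int[Pr]_w maxr (K - x * expR (- (delta * (h *+ k))) * expR (X (h *+ k) w)) 0.

Let pay_le_cap k h x : 0 <= h -> 0 <= x -> pay x <= cap k h x.
Proof.
move=> h0 x0; have k0 : 0 <= h *+ k by exact: mulrn_wge0.
pose a := x * expR (- (delta * (h *+ k))).
have a0 : 0 <= a by rewrite mulr_ge0// expR_ge0.
have ax : a <= x by rewrite ler_piMr// -[leRHS]expR0 ler_expR oppr_le0 mulr_ge0.
rewrite /pay ge_max; apply/andP; split; last first.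
  by apply: Rintegral_ge0 => w _; rewrite le_max lexx orbT.
have [I1 _] := exp_levy_le s20 hnu cPr hX hexp hmart k0.
apply: (@le_trans _ _ (\int[Pr]_w (K - a * expR (X (h *+ k) w)))).
  rewrite RintegralB//; [|exact: Rint_bounded|exact: RintZ].
  rewrite Rintegral_prob_cst RintegralZl// (exp_levy s20 hnu cPr hX hexp hmart k0) mulr1.
  by rewrite ger0_norm// lerD2l lerN2.
apply: le_Rintegral => //.
- by apply: RintB; [exact: Rint_bounded|exact: RintZ].
- exact: (Rint_levy hX k0 (bm_call a0)).
- by move=> w _; rewrite le_max lexx.
Qed.

Let berm_le_cap k h x : 0 <= h -> 0 <= x -> berm h k x <= cap k h x.
Proof.
move=> h0; elim: k x => [|k IH] x x0; first exact: pay_le_cap.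
rewrite [berm _ _]/= ge_max pay_le_cap//=.
have k0 : 0 <= h *+ k by exact: mulrn_wge0.
pose a := x * expR ((r - delta) * h) * expR (- (delta * (h *+ k))).
have a0 : 0 <= a by rewrite !mulr_ge0// expR_ge0.
pose f (z : R * R) := maxr (K - a * expR z.1 * expR z.2) 0.
have f1 z : 0 <= f z <= K.
  rewrite /f le_max lexx orbT/= ge_max (ltW K0) andbT gerBl.
  by rewrite !mulr_ge0// expR_ge0.
have mf : measurable_fun setT f.
  apply: measurable_maxr => //; apply: measurable_funB => //.
  apply: measurable_funM; first apply: measurable_funM => //.
    by apply: (measurableT_comp (f := expR)); [exact: meas_exp|exact: measurable_fst].
  by apply: (measurableT_comp (f := expR)); [exact: meas_exp|exact: measurable_snd].
have e0 := expR_ge0 (- (r * h)).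
have kE : h + h *+ k = h *+ k.+1 by rewrite mulrS.
have mk := levy_markov_bounded cPr hX h0 k0 (@history_setT _ _ _ Pr X h) mf f1.
have E1 : \int[Pr]_w (\1_setT w * f (X h w, X (h + h *+ k) w - X h w)) =
    \int[Pr]_w maxr (K - a * expR (X (h *+ k.+1) w)) 0.
  apply: eq_Rintegral => w _; rewrite indicT mul1r /f /= -mulrA -expRD kE.
  by rewrite (addrC (X h w)) subrK.
have avg : measurable_fun setT (fun w => \int[Pr]_w' f (X h w, X (h *+ k) w')).
  exact: (measurableT_comp (levy_avg_meas hX k0 mf) (levy_meas hX h0)).
have Iavg : Pr.-Rint (fun w => \int[Pr]_w' f (X h w, X (h *+ k) w')).
  apply: (@Rint_bounded _ _ _ Pr _ K) => // w.
  have I : Pr.-Rint (fun w' => f (X h w, X (h *+ k) w')).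
    apply: (@Rint_bounded _ _ _ Pr _ K).
      apply: (measurableT_comp mf); apply: measurable_fun_pair => //.
      exact: levy_meas hX _ k0.
    by move=> w'; have /andP[h1 h2] := f1 (X h w, X (h *+ k) w'); rewrite ger0_norm.
  rewrite ger0_norm; last by apply: Rintegral_ge0 => w' _; have /andP[] := f1 (X h w, X (h *+ k) w').
  rewrite -[leRHS](Rintegral_prob_cst Pr); apply: le_Rintegral => //.
    exact: Rint_bounded.
  by move=> w' _; have /andP[] := f1 (X h w, X (h *+ k) w').
apply: (@le_trans _ _ (expR (- (r * h)) * \int[Pr]_w maxr (K - a * expR (X (h *+ k.+1) w)) 0)).
  rewrite /Qh ler_wpM2l// -E1 mk; apply: le_Rintegral => //.
  - by apply: put_like_stock_Rint => //; exact: put_like_berm.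
  - by under eq_fun do rewrite indicT mul1r.
  - move=> w _; rewrite indicT mul1r; apply: (le_trans (IH _ (stock_ge0 _ _ x0))).
    rewrite le_eqVlt; apply/orP; left; apply/eqP; apply: eq_Rintegral => w' _.
    by rewrite /f /a /stock expRD /=; congr (maxr (K - _) 0); ring.
have k1 : 0 <= h *+ k.+1 by exact: mulrn_wge0.
pose b := x * expR (- (delta * (h *+ k.+1))).
have b0 : 0 <= b by rewrite mulr_ge0// expR_ge0.
rewrite /cap -RintegralZl//; last exact: (Rint_levy hX k1 (bm_call a0)).
apply: le_Rintegral => //.
- by apply: RintZ; exact: (Rint_levy hX k1 (bm_call a0)).
- exact: (Rint_levy hX k1 (bm_call b0)).
move=> w _; set z := expR (X _ w).
(* Discounting and one-step growth combine into a dividend factor, which produces the argument of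
   [cap] for [k.+1] steps. *)
have ab : expR (- (r * h)) * a = b.
  have -> : b = x * (expR (- (r * h)) * expR ((r - delta) * h) * expR (- (delta * (h *+ k)))).
    by rewrite -!expRD /b mulrS; congr (_ * expR _); ring.
  rewrite /a; ring.
have e1 := discount_le1 h0.
rewrite maxr_pMr// mulr0 ge_max !le_max lexx !orbT andbT; apply/orP; left.
rewrite mulrBr mulrA ab lerD2r ler_piMl// ltW//.
Qed.

(** The positive part of [K - x * expR y] exceeds that of [K - x] by at most [K] times the positive
    part of [1 - expR y], and [1 - expR y <= - y]. Grid and number of steps enter through [h *+ k]
    alone. *)
Lemma berm_modulus k h x : 0 <= h -> 0 <= x -> berm h k x <= pay x + omega (h *+ k).
Proof.
move=> h0 x0; apply: (le_trans (berm_le_cap k h0 x0)).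
have k0 : 0 <= h *+ k by exact: mulrn_wge0.
pose a := x * expR (- (delta * (h *+ k))).
have a0 : 0 <= a by rewrite mulr_ge0// expR_ge0.
have bo : bm (fun z : R => minr 1 (`|z| + delta * (h *+ k))).
  split.
    by apply: measurable_minr => //; apply: measurable_funD => //; exact: measurableT_comp.
  exists 1 => z; rewrite ger0_norm ?ge_min ?lexx//.
  by rewrite le_min ler01 addr_ge0// mulr_ge0.
have Io := Rint_levy hX k0 bo.
rewrite /omega -RintegralZl// -[X in X + _](Rintegral_prob_cst Pr) -RintegralD//; last 2 first.
- exact: Rint_bounded.
- exact: RintZ.
apply: le_Rintegral => //.
- exact: (Rint_levy hX k0 (bm_call a0)).
- by apply: RintD; [exact: Rint_bounded|exact: RintZ].
move=> w _; rewrite -mulrA -expRD; set y := - _ + _.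
have hy : 1 - expR y <= `|X (h *+ k) w| + delta * (h *+ k).
  have := expR_ge1Dx y; have := ler_norm (- X (h *+ k) w); rewrite normrN /y; lra.
have ey := expR_ge0 y.
have m0 : 0 <= minr 1 (`|X (h *+ k) w| + delta * (h *+ k)).
  by rewrite le_min ler01 addr_ge0// mulr_ge0.
have hm : 1 - expR y <= minr 1 (`|X (h *+ k) w| + delta * (h *+ k)).
  by rewrite le_min hy andbT gerBl.
have H := ler_wpM2l (ltW K0) hm.
have p0 := mulr_ge0 (ltW K0) m0.
move: (minr _ _) m0 hm H p0 => m m0 hm H p0.
rewrite /pay (ger0_norm x0) ge_max; apply/andP; split; last first.
  by rewrite addr_ge0// le_max lexx orbT.
have [e1|e1] := leP 1 (expR y).
  apply: (@le_trans _ _ (K - x)); last by rewrite -[leLHS]addr0 lerD// le_max lexx.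
  by rewrite lerD2l lerN2 ler_peMr.
have [xK|xK] := leP x K.
  apply: (@le_trans _ _ (K - x + K * m)); last by rewrite lerD2r le_max lexx.
  by apply: (@le_trans _ _ (K - x + K * (1 - expR y))); [nra|rewrite lerD2l].
apply: (@le_trans _ _ (0 + K * m)); last by rewrite lerD2r le_max lexx orbT.
rewrite add0r; apply: le_trans H; nra.
Qed.

Lemma berm_unif h m k x : 0 <= h -> 0 <= x -> berm h (m + k) x <= berm h m x + omega (h *+ k).
Proof.
move=> h0 x0; apply: berm_shift => //; last by move=> y y0; exact: berm_modulus.
rewrite mulr_ge0 ?(ltW K0)//; apply: Rintegral_ge0 => w _.
by rewrite le_min ler01 addr_ge0// mulr_ge0// mulrn_wge0.
Qed.

Definition gain (h : R) (m : nat) (x : R) : R := (berm h m.+1 x - Qh h (berm h m) x) / h.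

Lemma gain_ge0 h m x : 0 < h -> 0 <= gain h m x.
Proof. by move=> h0; rewrite divr_ge0 ?(ltW h0)// subr_ge0 le_max lexx orbT. Qed.

(** The Bermudan price dominates [K - S], whose discounted mean is explicit. Against [K - x] this
    leaves at most [K * (1 - expR (- (r * h)))], which is below [r * K * h]. *)
Lemma gain_le h m x : 0 < h -> 0 <= x -> gain h m x <= r * K.
Proof.
move=> h0 x0; rewrite /gain ler_pdivrMr//= lerBlDr ge_max; apply/andP; split; last first.
  by rewrite lerDr !mulr_ge0// ltW.
have hn := ltW h0.
have gQ := put_like_Qh hn (put_like_berm m hn).
have rKh : 0 <= r * K * h by rewrite !mulr_ge0// ltW.
rewrite /pay ge_max; apply/andP; split; last first.
  by rewrite addr_ge0// put_like_ge0.
have [I1 I2] := stock_Rint x hn.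
have H : expR (- (r * h)) * (K - x * expR ((r - delta) * h)) <= Qh h (berm h m) x.
  rewrite /Qh ler_wpM2l ?expR_ge0// -I2 -[X in X - _](Rintegral_prob_cst Pr) -RintegralB//; last exact: Rint_bounded.
  apply: le_Rintegral => //.
  - by apply: RintB => //; exact: Rint_bounded.
  - by apply: put_like_stock_Rint => //; exact: put_like_berm.
  - move=> w _; apply: le_trans (pay_le_berm _ _ _).
    by rewrite /pay ger0_norm ?stock_ge0// le_max lexx.
apply: (@le_trans _ _ (r * K * h + expR (- (r * h)) * (K - x * expR ((r - delta) * h)))); last by rewrite lerD2l.
rewrite mulrBr mulrCA -expRD (_ : - (r * h) + (r - delta) * h = - (delta * h)); last by ring.
have e1 := expR_ge1Dx (- (r * h)).
have e2 : expR (- (delta * h)) <= 1 by rewrite -[leRHS]expR0 ler_expR oppr_le0 mulr_ge0.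
have e3 := ler_wpM2r (ltW K0) e1.
have e4 := ler_wpM2l x0 e2.
by rewrite (ger0_norm x0); lra.
Qed.

End bermudan.

(** * Null sets of a complete probability *)

Section complete_measure.
Context {d} {T : measurableType d} {R : realType} (P : probability T R).
Hypothesis cP : measure_is_complete P.

Lemma complete_measurable (N : set T) (f g : T -> R) : measurable N -> P N = 0%E ->
  (forall x, ~ N x -> f x = g x) -> measurable_fun setT f -> measurable_fun setT g.
Proof.
move=> mN N0 fg mf; apply/measurable_EFinP.
apply: (@ae_measurable_fun _ _ _ P cP setT (fun x => (f x)%:E)); last exact/measurable_EFinP.
exists N; split => // x /= H; apply: contrapT => Nx; apply: H => _.
by rewrite fg.
Qed.

Lemma Rintegral_ae (N : set T) (f g : T -> R) : measurable N -> P N = 0%E ->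
  (forall x, ~ N x -> f x = g x) -> measurable_fun setT f ->
  \int[P]_x f x = \int[P]_x g x.
Proof.
move=> mN N0 fg mf; have mg := complete_measurable mN N0 fg mf.
rewrite /Rintegral; congr fine; apply: ae_eq_integral => //.
- exact/measurable_EFinP.
- exact/measurable_EFinP.
exists N; split => // x /= H; apply: contrapT => Nx; apply: H => _.
by rewrite fg.
Qed.

(** Path properties hold off a null set only; completeness is what makes the limit measurable. *)
Lemma Rdominated_complete (N : set T) (f_ : nat -> T -> R) (f : T -> R) (M : R) :
  measurable N -> P N = 0%E ->
  (forall n, measurable_fun setT (f_ n)) -> (forall n x, `|f_ n x| <= M) ->
  (forall x, ~ N x -> f_ n x @[n --> \oo] --> f x) ->
  measurable_fun setT f /\ (\int[P]_x f_ n x @[n --> \oo] --> \int[P]_x f x).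
Proof.
move=> mN N0 mf fM fc.
pose g_ n x := f_ n x * \1_(~` N) x.
pose g x := f x * \1_(~` N) x.
have mI : measurable_fun setT (\1_(~` N) : T -> R).
  by apply: measurable_indic; exact: measurableC.
have mg n : measurable_fun setT (g_ n) by exact: measurable_funM.
have gc x : g_ n x @[n --> \oo] --> g x.
  have [xN|xN] := pselect (N x).
    rewrite /g_ /g indicE memNset /=; last by apply.
    by rewrite mulr0; apply: cvg_near_cst; apply: nearW => n; rewrite mulr0.
  by apply: cvgM; [exact: fc|exact: cvg_cst].
have gM n x : `|g_ n x| <= M.
  apply: le_trans (fM n x); rewrite normrM ler_piMr// indicE.
  by case: (_ \in _) => /=; rewrite ?normr1 ?normr0.
have iM : P.-Rint (fun=> M) by apply: (@Rint_bounded _ _ _ P _ `|M|).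
have [ig Hg] := @Rdominated _ _ _ P g_ g (fun=> M) mg gc iM gM.
have E x : ~ N x -> \1_(~` N) x = 1 :> R by move=> xN; rewrite indicE mem_set.
have gf x : ~ N x -> g x = f x by move=> xN; rewrite /g E// mulr1.
split; first exact: (complete_measurable mN N0 gf (Rint_measurable ig)).
rewrite -(Rintegral_ae mN N0 gf (Rint_measurable ig)).
have En n : \int[P]_x f_ n x = \int[P]_x g_ n x.
  by apply: (Rintegral_ae mN N0) => // x xN; rewrite /g_ E// mulr1.
by under eq_cvg do rewrite En.
Qed.

End complete_measure.

(** * Stopping times and the American price *)

Section stopping.
Context {R : realType} {d : measure_display} {Omega : measurableType d}.
Variables (Pr : probability Omega R) (X : R -> Omega -> R).
Variables (sigma2 gamma : R) (nu : {sigma_finite_measure set R -> \bar R}).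
Hypotheses (s20 : 0 <= sigma2) (hnu : levy_measure nu)
  (cPr : measure_is_complete Pr)
  (hX : is_levy_process Pr X sigma2 gamma nu).
Hypothesis hexp : (\int[nu]_(y in [set y : R | (1 <= `|y|)%R]) (expR y)%:E < +oo)%E.
Hypothesis hmart : ((sigma2 / 2 + gamma)%:E
     + \int[nu]_y (expR y - 1 - y * \1_[set z : R | (`|z| <= 1)%R] y)%R%:E = 0)%E.
Variables (r delta K : R).
Hypotheses (r0 : 0 < r) (delta0 : 0 <= delta) (K0 : 0 < K).

Local Notation S := (stock X r delta).
Local Notation pay := (pay K).
Local Notation berm := (berm Pr X r delta K).
Local Notation Qh := (Qh Pr X r delta).
Local Notation omega := (omega Pr X delta K).

(** Right-continuity read along sequences from the right, with terms equal to [t] allowed, since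
    rounded times may hit their limit. *)
Lemma levy_path : exists N0, [/\ measurable N0, Pr N0 = 0%E & forall w, ~ N0 w ->
  X 0 w = 0 /\ forall t (s : nat -> R), 0 <= t -> (forall n, t <= s n) ->
    s n @[n --> \oo] --> t -> X (s n) w @[n --> \oo] --> X t w].
Proof.
have [_ [N0 [mN0 N00 hN0]] _ _ _] := hX; exists N0; split => // w /hN0[X0 H].
split=> // t s t0 ts st; have [+ _] := H t t0.
move=> /cvgrPdist_le rc; apply/cvgrPdist_le => e e0.
have [eta /= eta0 heta] := rc e e0.
near=> n; have [->|stn] := eqVneq (s n) t; first by rewrite subrr normr0 ltW.
apply: heta; last by rewrite lt_neqAle eq_sym stn ts.
by near: n; apply: (cvgrPdist_lt _ _).1 st _ eta0.
Unshelve. all: end_near. Qed.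

Lemma omega_cvg (eta : nat -> R) : (forall n, 0 <= eta n) -> eta n @[n --> \oo] --> 0 ->
  omega (eta n) @[n --> \oo] --> 0.
Proof.
move=> e0 ec; rewrite -(mulr0 K); apply: cvgMr.
have [N0 [mN0 N00 hN0]] := levy_path.
pose f n w := minr 1 (`|X (eta n) w| + delta * eta n).
have [|||_] := @Rdominated_complete _ _ _ Pr cPr N0 f (fun=> 0) 1 mN0 N00.
- move=> n; apply: measurable_minr => //; apply: measurable_funD => //.
  by apply: measurableT_comp => //; exact: levy_meas hX _ (e0 n).
- move=> n w; rewrite ger0_norm ?ge_min ?lexx// le_min ler01/=.
  by rewrite addr_ge0// mulr_ge0.
- move=> w /hN0[X0 rc].
  have xc : X (eta n) w @[n --> \oo] --> X 0 w by apply: rc.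
  have c1 : `|X (eta n) w| + delta * eta n @[n --> \oo] --> 0.
    have -> : 0 = `|X 0 w| + delta * 0 by rewrite X0 normr0 mulr0 addr0.
    by apply: cvgD; [exact: cvg_norm|exact: cvgMr].
  apply: (@squeeze_cvgr _ _ _ _ (fun=> 0) (fun n => `|X (eta n) w| + delta * eta n)) => //.
    apply: nearW => n; rewrite /f le_min ler01 addr_ge0 ?mulr_ge0//=.
    by rewrite ge_min lexx orbT.
  exact: cvg_cst.
by rewrite Rintegral_prob_cst.
Qed.

Section discrete.
Variables (h x : R) (m : nat) (N : Omega -> nat).
Hypotheses (h0 : 0 <= h) (x0 : 0 <= x)
  (hN : forall j, history Pr X (h *+ j) [set w | (N w <= j)%N]).

Let hj j : 0 <= h *+ j. Proof. exact: mulrn_wge0. Qed.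

Lemma history_setC s A : history Pr X s A -> history Pr X s (~` A).
Proof. exact: (@measurableC _ (g_sigma_algebraType (natural_gen X s `|` null_sets Pr))). Qed.

Let hNC j : history Pr X (h *+ j) [set w | (j < N w)%N].
Proof.
have -> : [set w | (j < N w)%N] = ~` [set w | (N w <= j)%N].
  by apply/seteqP; split => w /=; rewrite ltnNge => /negP.
exact: history_setC.
Qed.

Let minnS j n : minn n j.+1 = if (j < n)%N then j.+1 else minn n j.
Proof.
case: ltnP => h1; first exact/minn_idPr.
exact/minn_idPl/leqW.
Qed.

Let stop_split (u : nat -> Omega -> R) j w :
  u (minn (N w) j.+1) w = u (minn (N w) j) w + \1_[set w | (j < N w)%N] w * (u j.+1 w - u j w).
Proof.
rewrite minnS indicE; case: ifPn => jN; last first.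
  by rewrite memNset ?mul0r ?addr0//=; exact/negP.
by rewrite mem_set// mul1r /minn ltnNge (ltnW jN)/= addrC subrK.
Qed.

Lemma stop_meas (u : nat -> Omega -> R) j : (forall i, measurable_fun setT (u i)) ->
  measurable_fun setT (fun w => u (minn (N w) j) w).
Proof.
move=> mu; elim: j => [|j IH]; first by under eq_fun do rewrite minn0; exact: mu.
under eq_fun do rewrite stop_split.
apply: measurable_funD => //; apply: measurable_funM; last exact: measurable_funB.
by apply: measurable_indic; exact: (history_measurable cPr hX (@hNC j)).
Qed.

(** Discounted Bermudan price along the grid: a supermartingale whose stopped version starts from
    [berm h m x] and ends above the stopped payoff. *)
Let a (j : nat) (w : Omega) : R :=
  expR (- (r * (h *+ j))) * berm h (m - j) (S x (h *+ j) w).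

Let a_meas j : measurable_fun setT (a j).
Proof.
have gb := put_like_berm s20 hnu cPr hX hexp hmart r0 delta0 K0 (m - j) h0.
by apply: measurable_funM => //; exact: (put_like_stock_meas hX _ _ _ gb (hj j)).
Qed.

Let a_bound j w : 0 <= a j w <= K.
Proof.
have gb := put_like_berm s20 hnu cPr hX hexp hmart r0 delta0 K0 (m - j) h0.
rewrite mulr_ge0 ?expR_ge0 ?(put_like_ge0 _ gb)//=.
rewrite (le_trans (ler_piMl (put_like_ge0 _ gb) _)) ?(put_like_leK _ gb)//.
exact: discount_le1.
Qed.

Let A j := \int[Pr]_w a (minn (N w) j) w.

Let aI j : Pr.-Rint (fun w => a (minn (N w) j) w).
Proof.
apply: (@Rint_bounded _ _ _ Pr _ K); first exact: (@stop_meas a j a_meas).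
by move=> w; have /andP[h1 h2] := a_bound (minn (N w) j) w; rewrite ger0_norm.
Qed.

Let a_step j : (j < m)%N ->
  \int[Pr]_w (\1_[set w | (j < N w)%N] w * a j.+1 w) =
  \int[Pr]_w (\1_[set w | (j < N w)%N] w *
     (expR (- (r * (h *+ j))) * Qh h (berm h (m - j.+1)) (S x (h *+ j) w))).
Proof.
move=> jm; have gb := put_like_berm s20 hnu cPr hX hexp hmart r0 delta0 K0 (m - j.+1) h0.
pose f (z : R * R) := expR (- (r * (h *+ j.+1))) *
  berm h (m - j.+1) (x * expR ((r - delta) * (h *+ j.+1) + (z.1 + z.2))).
have f1 z : 0 <= f z <= K.
  rewrite mulr_ge0 ?expR_ge0 ?(put_like_ge0 _ gb)//=.
  rewrite (le_trans (ler_piMl (put_like_ge0 _ gb) _)) ?(put_like_leK _ gb)//.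
  exact: discount_le1.
have mf : measurable_fun setT f.
  apply: measurable_funM => //; apply: (measurableT_comp (put_like_meas gb)).
  apply: measurable_funM => //; apply: (measurableT_comp (f := expR)); first exact: meas_exp.
  by apply: measurable_funD => //; apply: measurable_funD; [exact: measurable_fst|exact: measurable_snd].
have := levy_markov_bounded cPr hX (hj j) h0 (@hNC j) mf f1.
have E1 w : f (X (h *+ j) w, X (h *+ j + h) w - X (h *+ j) w) = a j.+1 w.
  rewrite /f /a /stock /=; congr (_ * berm _ _ (_ * expR _)).
  by rewrite -mulrSr (addrC (X (h *+ j) w)) subrK.
have E2 w : \int[Pr]_w' f (X (h *+ j) w, X h w') =
    expR (- (r * (h *+ j))) * Qh h (berm h (m - j.+1)) (S x (h *+ j) w).
  rewrite /f /Qh RintegralZl//; last first.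
    have := put_like_stock_Rint hX r delta (S x (h *+ j) w) gb h0.
    apply: eq_integrable => // w' _; congr (berm _ _ _)%:E.
    by rewrite /stock /= -mulrA -expRD mulrS; congr (_ * expR _); ring.
  rewrite mulrA -expRD; congr (expR _ * _); first by rewrite mulrS; ring.
  apply: eq_Rintegral => w' _; congr (berm _ _ _).
  by rewrite /stock /= -mulrA -expRD mulrS; congr (_ * expR _); ring.
under eq_Rintegral do rewrite E1.
by under [RHS]eq_Rintegral do rewrite E2.
Qed.

Let ind_meas j : measurable_fun setT (\1_[set w | (j < N w)%N] : Omega -> R).
Proof. by apply: measurable_indic; exact: (history_measurable cPr hX (@hNC j)). Qed.

Let ind_Rint j (g : Omega -> R) : measurable_fun setT g -> (forall w, 0 <= g w <= K) ->
  Pr.-Rint (fun w => \1_[set w | (j < N w)%N] w * g w).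
Proof.
move=> mg gK; apply: (@Rint_bounded _ _ _ Pr _ K); first by apply: measurable_funM => //; exact: ind_meas.
move=> w; have /andP[h1 h2] := gK w; rewrite indicE.
by case: (_ \in _); rewrite ?mul1r ?mul0r ?normr0 ?(ltW K0)// ger0_norm.
Qed.

Let A_step j : (j < m)%N ->
  A j.+1 = A j + \int[Pr]_w (\1_[set w | (j < N w)%N] w *
     (expR (- (r * (h *+ j))) * Qh h (berm h (m - j.+1)) (S x (h *+ j) w)))
   - \int[Pr]_w (\1_[set w | (j < N w)%N] w * a j w).
Proof.
move=> jm; rewrite -a_step// /A.
have I1 i := ind_Rint j (a_meas i) (a_bound i).
rewrite -RintegralD//; [|exact: aI|exact: I1].
rewrite -RintegralB//; [|by apply: RintD; [exact: aI|exact: I1]|exact: I1].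
by apply: eq_Rintegral => w _; rewrite stop_split; ring.
Qed.

Let q_le j w : (j < m)%N -> expR (- (r * (h *+ j))) * Qh h (berm h (m - j.+1)) (S x (h *+ j) w) <= a j w.
Proof.
move=> jm; rewrite ler_wpM2l ?expR_ge0//.
by rewrite -(subnSK jm) /= le_max lexx orbT.
Qed.

Let q_bound j w : (j < m)%N ->
  0 <= expR (- (r * (h *+ j))) * Qh h (berm h (m - j.+1)) (S x (h *+ j) w) <= K.
Proof.
move=> jm; have gb := put_like_berm s20 hnu cPr hX hexp hmart r0 delta0 K0 (m - j.+1) h0.
have gq := put_like_Qh s20 hnu cPr hX hexp hmart r0 delta0 h0 gb.
rewrite mulr_ge0 ?expR_ge0 ?(put_like_ge0 _ gq)//=.
by apply: le_trans (q_le w jm) _; have /andP[] := a_bound j w.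
Qed.

Let q_meas j : measurable_fun setT (fun w => expR (- (r * (h *+ j))) * Qh h (berm h (m - j.+1)) (S x (h *+ j) w)).
Proof.
have gb := put_like_berm s20 hnu cPr hX hexp hmart r0 delta0 K0 (m - j.+1) h0.
have gq := put_like_Qh s20 hnu cPr hX hexp hmart r0 delta0 h0 gb.
by apply: measurable_funM => //; exact: (put_like_stock_meas hX _ _ _ gq (hj j)).
Qed.

Let A_le j : (j < m)%N -> A j.+1 <= A j.
Proof.
move=> jm; rewrite A_step// -addrA gerDl subr_le0; apply: le_Rintegral => //.
- by apply: ind_Rint; [exact: q_meas|move=> w; exact: (q_bound w jm)].
- by apply: ind_Rint; [exact: a_meas|exact: a_bound].
- by move=> w _; rewrite ler_wpM2l ?q_le.
Qed.

Let A0 : A 0 = berm h m x.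
Proof.
rewrite /A; under eq_Rintegral do rewrite minn0.
rewrite /a; under eq_Rintegral do rewrite mulr0n mulr0 oppr0 expR0 mul1r subn0.
have gb := put_like_berm s20 hnu cPr hX hexp hmart r0 delta0 K0 m h0.
rewrite (levy_start0 hX (f := fun z => berm h m (x * expR ((r - delta) * 0 + z)))).
  by rewrite mulr0 addr0 expR0 mulr1.
apply: (measurableT_comp (put_like_meas gb)); apply: measurable_funM => //.
apply: (measurableT_comp (f := expR)); first exact: meas_exp.
exact: measurable_funD.
Qed.

Lemma discrete_stopping_le : (forall w, N w <= m)%N ->
  Pr.-Rint (fun w => expR (- (r * (h *+ N w))) * pay (S x (h *+ N w) w)) /\
  \int[Pr]_w (expR (- (r * (h *+ N w))) * pay (S x (h *+ N w) w)) <= berm h m x.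
Proof.
move=> Nm.
have gp := put_like_pay K0.
pose u j w := expR (- (r * (h *+ j))) * pay (S x (h *+ j) w).
have mu j : measurable_fun setT (u j).
  by apply: measurable_funM => //; exact: (put_like_stock_meas hX _ _ _ gp (hj j)).
have I : Pr.-Rint (fun w => u (N w) w).
  apply: (@Rint_bounded _ _ _ Pr _ K).
    have := stop_meas m mu; congr (measurable_fun _ _).
    by apply/funext => w; rewrite (minn_idPl (Nm w)).
  move=> w; rewrite ger0_norm ?mulr_ge0 ?expR_ge0 ?(put_like_ge0 _ gp)//.
  rewrite (le_trans (ler_piMl (put_like_ge0 _ gp) _)) ?(put_like_leK _ gp)//.
  exact: discount_le1.
split=> //; rewrite -A0.
have -> : A 0 = A 0 - 0 by rewrite subr0.
have Am j : (j <= m)%N -> A j <= A 0.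
  elim: j => [|j IH] jm //; apply: le_trans (A_le jm) _; exact/IH/ltnW.
rewrite subr0; apply: le_trans (Am m (leqnn _)).
apply: le_Rintegral => //; first exact: aI.
move=> w _; rewrite (_ : minn (N w) m = N w); last by apply/minn_idPl.
by rewrite ler_wpM2l ?expR_ge0// pay_le_berm.
Qed.

(** Before the first date at which price and payoff agree, the maximum in the dynamic programming
    equation is attained by continuation, so the stopped process is a martingale. *)
Lemma discrete_stopping_eq : (forall w, N w <= m)%N ->
  (forall w, berm h (m - N w) (S x (h *+ N w) w) = pay (S x (h *+ N w) w)) ->
  (forall w j, (j < N w)%N -> berm h (m - j) (S x (h *+ j) w) <> pay (S x (h *+ j) w)) ->
  \int[Pr]_w (expR (- (r * (h *+ N w))) * pay (S x (h *+ N w) w)) = berm h m x.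
Proof.
move=> Nm Np Nq; rewrite -A0.
have Am j : (j <= m)%N -> A j = A 0.
  elim: j => [|j IH] jm; first by [].
  rewrite (A_step jm) (IH (ltnW jm)) -[RHS](addrK (\int[Pr]_w (\1_[set w | (j < N w)%N] w * a j w))).
  congr (_ + _ - _); apply: eq_Rintegral => w _; rewrite indicE.
  have [/set_mem/= jN|_] := boolP (w \in _); last by rewrite !mul0r.
  congr (_ * (_ * _)); have := Nq w j jN.
  rewrite -(subnSK jm) /= /maxr.
  by case: ifP.
rewrite -(Am m (leqnn _)); apply: eq_Rintegral => w _.
rewrite (_ : minn (N w) m = N w); last by apply/minn_idPl.
by rewrite /a Np.
Qed.

End discrete.

(** The American price by time to maturity: [amer_put] at [t] is this at [T - t], by conversion. *)
Definition amer (theta x : R) : R :=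
  fine (ereal_sup [set (\int[Pr]_w
          (expR (- (r * tau w)) * maxr (K - S x (tau w) w) 0)%:E)%E
        | tau in stopping_times_le Pr X theta]).

Section american.
Variables (x : R).
Hypothesis x0 : 0 <= x.

Let stk0 s w : 0 <= S x s w. Proof. exact: stock_ge0. Qed.

Let payE s w : maxr (K - S x s w) 0 = pay (S x s w).
Proof. by rewrite /pay ger0_norm. Qed.

Let reward tau w := expR (- (r * tau w)) * maxr (K - S x (tau w) w) 0.

Let reward_bound tau w : 0 <= tau w -> 0 <= reward tau w <= K.
Proof.
move=> t0; rewrite /reward payE; have gp := put_like_pay K0.
rewrite mulr_ge0 ?expR_ge0 ?(put_like_ge0 _ gp)//=.
rewrite (le_trans (ler_piMl (put_like_ge0 _ gp) _)) ?(put_like_leK _ gp)//.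
exact: discount_le1.
Qed.

(** Strictness undoes the right limit in [aug_filtration]: the event is a countable union of events
    [tau w <= s - n.+1%:R^-1], each of which lies in the history at [s]. *)
Lemma stopping_lt theta tau (s : R) : stopping_times_le Pr X theta tau ->
  history Pr X s [set w | tau w < s].
Proof.
move=> [t01 ht].
have -> : [set w | tau w < s] = \bigcup_n [set w | tau w <= s - n.+1%:R^-1].
  apply/seteqP; split => [w /= ts|w [n _ /=] H]; last first.
    by apply: (le_lt_trans H); rewrite ltrBlDr ltrDl invr_gt0.
  have st : 0 < s - tau w by rewrite subr_gt0.
  have [n _ hn] := @nbhs_infty_ger R (s - tau w)^-1.
  exists n => //=; rewrite lerBrDr -lerBrDl.
  rewrite -[leRHS]invrK lef_pV2 ?posrE ?invr_gt0//.
  by apply: le_trans (hn n (leqnn _)) _; rewrite ler_nat.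
apply: (@bigcup_measurable _ (g_sigma_algebraType (natural_gen X s `|` null_sets Pr))) => n _.
have [h0|h0] := leP 0 (s - n.+1%:R^-1).
  by apply: (ht _ h0); rewrite ltrBlDr ltrDl invr_gt0.
rewrite (_ : [set _ | _] = set0); first exact: (@measurable0 _ (g_sigma_algebraType (natural_gen X s `|` null_sets Pr))).
apply/seteqP; split => // w /= H; have /andP[t0 _] := t01 w.
by have := lt_le_trans h0 t0; rewrite ltNge H.
Qed.

Section approx.
Variables (theta : R) (tau : Omega -> R) (hn : nat -> R) (mn : nat -> nat).
Hypotheses (ht : stopping_times_le Pr X theta tau)
  (hn0 : forall n, 0 < hn n) (hnc : hn n @[n --> \oo] --> 0)
  (hm : forall n, theta <= hn n *+ mn n).

(** The first grid date strictly after [tau], capped at the horizon. Below the cap, strictness makes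
    [Nn n w <= j] equivalent to [tau w < hn n *+ j], an event of the history at that date. *)
Let Nn n w := minn (Num.Def.trunc (tau w / hn n)).+1 (mn n).

Let Nn_stop n j : history Pr X (hn n *+ j) [set w | (Nn n w <= j)%N].
Proof.
have [mj|mj] := leqP (mn n) j.
  rewrite (_ : [set _ | _] = setT); first exact: history_setT.
  by apply/seteqP; split => // w _ /=; rewrite /Nn geq_min mj orbT.
rewrite (_ : [set _ | _] = [set w | tau w < hn n *+ j]); first exact: stopping_lt ht.
apply/seteqP; split => w /=; rewrite /Nn geq_min [X in _ || X]leqNgt mj orbF.
all: have [t01 _] := ht; have /andP[t0 _] := t01 w.
all: rewrite truncn_lt_nat ?divr_ge0 ?(ltW (hn0 n))//.
all: by rewrite ltr_pdivrMr// mulr_natl.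
Qed.

(** The rounded times converge to [tau] from above, the side on which paths are continuous.
    Measurability of the stopped reward is itself obtained from this approximation. *)
Lemma stopping_approx :
  Pr.-Rint (reward tau) /\
  forall e, 0 < e -> \forall n \near \oo, \int[Pr]_w reward tau w <= berm (hn n) (mn n) x + e.
Proof.
have [t01 _] := ht.
have [N0 [mN0 N00 hN0]] := levy_path.
pose f n w := expR (- (r * (hn n *+ Nn n w))) * pay (S x (hn n *+ Nn n w) w).
have Nm n w : (Nn n w <= mn n)%N by rewrite /Nn geq_min leqnn orbT.
have D n := discrete_stopping_le x (ltW (hn0 n)) (@Nn_stop n) (Nm n).
have mf n : measurable_fun setT (f n) by exact: Rint_measurable (D n).1.
have gp := put_like_pay K0.
have fK n w : `|f n w| <= K.
  rewrite ger0_norm ?mulr_ge0 ?expR_ge0 ?(put_like_ge0 _ gp)//.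
  rewrite (le_trans (ler_piMl (put_like_ge0 _ gp) _)) ?(put_like_leK _ gp)//.
  by apply: discount_le1 => //; rewrite mulrn_wge0// ltW.
have tge n w : tau w <= hn n *+ Nn n w.
  have /andP[_ tt] := t01 w.
  rewrite /Nn /minn; case: ifP => _; last exact: le_trans tt (hm n).
  by rewrite -mulr_natl -ler_pdivrMr// ltW// truncnS_gt.
have tle n w : hn n *+ Nn n w <= tau w + hn n.
  have /andP[tt0 _] := t01 w.
  apply: (@le_trans _ _ (hn n *+ (Num.Def.trunc (tau w / hn n)).+1)).
    by rewrite ler_wpMn2l ?(ltW (hn0 n))// /Nn geq_min leqnn.
  rewrite mulrSr lerD2r -mulr_natl -ler_pdivlMr; last exact: hn0.
  by rewrite truncn_le divr_ge0// ltW.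
have tc w : hn n *+ Nn n w @[n --> \oo] --> tau w.
  apply: (@squeeze_cvgr _ _ _ _ (fun=> tau w) (fun n => tau w + hn n)).
  - by apply: nearW => n; rewrite tge tle.
  - exact: cvg_cst.
  - by rewrite -[X in _ --> X]addr0; apply: cvgD => //; exact: cvg_cst.
have fc w : ~ N0 w -> f n w @[n --> \oo] --> reward tau w.
  move=> /hN0[_ rc]; have /andP[tt0 _] := t01 w.
  have xc : X (hn n *+ Nn n w) w @[n --> \oo] --> X (tau w) w by apply: rc.
  rewrite /reward payE; apply: cvgM.
    apply: (continuous_cvg _ (@continuous_expR R _)).
    by apply: cvgN; apply: cvgMr.
  have sc : S x (hn n *+ Nn n w) w @[n --> \oo] --> S x (tau w) w.
    apply: cvgMr; apply: (continuous_cvg _ (@continuous_expR R _)).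
    by apply: cvgD => //; exact: cvgMr.
  exact: put_like_cvg gp sc.
have [mr ic] := Rdominated_complete cPr mN0 N00 mf fK fc.
split.
  apply: (@Rint_bounded _ _ _ Pr _ K) => // w.
  have /andP[tt0 _] := t01 w; have /andP[h1 h2] := reward_bound tt0.
  by rewrite ger0_norm.
move=> e e0; near=> n.
have H : `|\int[Pr]_w reward tau w - \int[Pr]_w f n w| <= e.
  by near: n; exact: (cvgrPdist_le _ _).1 ic _ e0.
have := (D n).2; move: H; rewrite ler_norml => /andP[_].
rewrite -/(f n) /f; move: (\int[Pr]_w _) (\int[Pr]_w _) => u1 u2; lra.
Unshelve. all: end_near. Qed.

End approx.

Lemma stopping_reward theta tau : stopping_times_le Pr X theta tau ->
  Pr.-Rint (reward tau) /\ 0 <= \int[Pr]_w reward tau w <= K.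
Proof.
move=> ht; have [t01 _] := ht.
pose hn n : R := n.+1%:R^-1.
have [I _] : Pr.-Rint (reward tau) /\ forall e, 0 < e -> \forall n \near \oo, \int[Pr]_w reward tau w <= berm (hn n) ((Num.Def.trunc (theta / hn n)).+1) x + e.
  apply: (@stopping_approx theta) => //.
  - by move=> n; rewrite /hn invr_gt0.
  - exact: cvg_harmonic.
  - move=> n; have hp : 0 < hn n by rewrite /hn invr_gt0.
    by rewrite -mulr_natl -ler_pdivrMr//; exact/ltW/truncnS_gt.
split=> //.
have B w : 0 <= reward tau w <= K by apply: reward_bound; have /andP[] := t01 w.
apply/andP; split; first by apply: Rintegral_ge0 => w _; have /andP[] := B w.
rewrite -[leRHS](Rintegral_prob_cst Pr); apply: le_Rintegral => //; first exact: Rint_bounded.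
by move=> w _; have /andP[] := B w.
Qed.

Let rewardE theta tau : stopping_times_le Pr X theta tau ->
  (\int[Pr]_w (reward tau w)%:E)%E = (\int[Pr]_w reward tau w)%:E.
Proof.
by move=> /stopping_reward[I _]; rewrite fineK//; exact: integrable_fin_num I.
Qed.

Lemma stopping_const theta s : 0 <= s <= theta -> stopping_times_le Pr X theta (fun=> s).
Proof.
move=> /andP[s0 st]; split=> [w|t t0 u tu]; first by rewrite s0 st.
have [H|H] := pselect (s <= t).
  by rewrite (_ : [set _ | _] = setT); [exact: history_setT|apply/seteqP; split].
rewrite (_ : [set _ | _] = set0); first exact: (@measurable0 _ (g_sigma_algebraType (natural_gen X u `|` null_sets Pr))).
by apply/seteqP; split.
Qed.

Lemma amer_fin theta : 0 <= theta ->
  (ereal_sup [set (\int[Pr]_w (reward tau w)%:E)%E | tau in stopping_times_le Pr X theta])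
   = (amer theta x)%:E.
Proof.
move=> th0; rewrite fineK// fin_real//; apply/andP; split.
  apply: (@lt_le_trans _ _ 0%E) => //.
  apply: (@le_trans _ _ (\int[Pr]_w (reward (fun=> 0%R) w)%:E)%E).
    apply: integral_ge0 => w _; rewrite lee_fin.
    by have /andP[] := @reward_bound (fun=> 0%R) w (lexx _).
  apply: ereal_sup_ubound; exists (fun=> 0%R) => //.
  by apply: stopping_const; rewrite lexx.
apply: (@le_lt_trans _ _ K%:E); last exact: ltry.
apply: ge_ereal_sup => _ [tau ht <-]; rewrite (rewardE ht) lee_fin.
by have [_ /andP[]] := stopping_reward ht.
Qed.

Lemma stopping_le_amer theta tau : stopping_times_le Pr X theta tau ->
  \int[Pr]_w reward tau w <= amer theta x.
Proof.
move=> ht; have [t01 _] := ht.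
have th0 : 0 <= theta by have /andP[a b] := t01 point; exact: le_trans b.
by rewrite -lee_fin -amer_fin// -(rewardE ht); apply: ereal_sup_ubound; exists tau.
Qed.

Lemma amer_le theta c : 0 <= theta -> (forall tau, stopping_times_le Pr X theta tau ->
  \int[Pr]_w reward tau w <= c) -> amer theta x <= c.
Proof.
move=> th0 H; rewrite -lee_fin -amer_fin//; apply: ge_ereal_sup => _ [tau ht <-].
by rewrite (rewardE ht) lee_fin H.
Qed.

Lemma amer_mono theta theta' : 0 <= theta <= theta' -> amer theta x <= amer theta' x.
Proof.
move=> /andP[t0 tt]; apply: amer_le => // tau [t01 ht]; apply: stopping_le_amer.
by split => // w; have /andP[-> h2] := t01 w; exact: le_trans tt.
Qed.

(** The first date at which the Bermudan price equals the payoff is an admissible stopping time, and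
    it attains the Bermudan price. *)
Lemma berm_le_amer h m theta : 0 < h -> h *+ m <= theta -> berm h m x <= amer theta x.
Proof.
move=> h0 hmt; have hn := ltW h0.
pose p w j := (j <= m)%N && (berm h (m - j) (S x (h *+ j) w) == pay (S x (h *+ j) w)).
have ex w : exists j, p w j by exists m; rewrite /p leqnn subnn /= eqxx.
pose N w := ex_minn (ex w).
have Nm w : (N w <= m)%N by rewrite /N; case: ex_minnP => j /andP[].
have hN j : history Pr X (h *+ j) [set w | (N w <= j)%N].
  have -> : [set w | (N w <= j)%N] = \bigcup_(i in [set i | (i <= j)%N]) [set w | p w i].
    apply/seteqP; split => w /=; rewrite /N; case: ex_minnP => i pi imin.
      by move=> ij; exists i.
    by move=> [k /= kj pk]; apply: leq_trans kj; exact: imin.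
  apply: (@bigcup_measurable _ (g_sigma_algebraType (natural_gen X (h *+ j) `|` null_sets Pr))) => i /= ij.
  have [im|im] := leqP i m; last first.
    rewrite (_ : [set _ | _] = set0).
      exact: (@measurable0 _ (g_sigma_algebraType (natural_gen X (h *+ j) `|` null_sets Pr))).
    by apply/seteqP; split => // w /=; rewrite /p leqNgt im.
  pose g (z : R) := berm h (m - i) (x * expR ((r - delta) * (h *+ i) + z)) -
     pay (x * expR ((r - delta) * (h *+ i) + z)).
  rewrite (_ : [set _ | _] = X (h *+ i) @^-1` (g @^-1` [set 0])); last first.
    apply/seteqP; split => w /=; rewrite /p im /= /g /stock.
      by move=> /eqP ->; rewrite subrr.
    by move=> /eqP; rewrite subr_eq0.
  apply: history_gen.
    by rewrite mulrn_wge0//= ler_wpMn2l.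
  rewrite -[X in measurable X]setTI.
  have mz : measurable_fun setT (fun z : R => x * expR ((r - delta) * (h *+ i) + z)).
    apply: measurable_funM => //; apply: (measurableT_comp (f := expR)); first exact: meas_exp.
    exact: measurable_funD.
  have mg : measurable_fun setT g.
    apply: measurable_funB.
      apply: (measurableT_comp (put_like_meas _) mz).
      exact: (put_like_berm s20 hnu cPr hX hexp hmart r0 delta0 K0 (m - i) hn).
    exact: (measurableT_comp (put_like_meas (put_like_pay K0)) mz).
  exact: mg.
have Np w : berm h (m - N w) (S x (h *+ N w) w) = pay (S x (h *+ N w) w).
  by rewrite /N; case: ex_minnP => j /andP[_ /eqP].
have Nq w j : (j < N w)%N -> berm h (m - j) (S x (h *+ j) w) <> pay (S x (h *+ j) w).
  move=> jN E; have jm : (j <= m)%N by apply: leq_trans (ltnW jN) (Nm w).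
  move: jN; rewrite /N; case: ex_minnP => i _ /(_ j); rewrite /p jm E eqxx => /(_ isT).
  by rewrite leqNgt => /negP.
have E := discrete_stopping_eq hn hN Nm Np Nq.
rewrite -E; have -> : \int[Pr]_w (expR (- (r * (h *+ N w))) * pay (S x (h *+ N w) w)) =
  \int[Pr]_w reward (fun w => h *+ N w) w.
  by apply: eq_Rintegral => w _; rewrite /reward payE.
apply: stopping_le_amer; split => [w|t t0 u tu].
  by rewrite mulrn_wge0//=; apply: le_trans hmt; rewrite ler_wpMn2l.
have -> : [set w | h *+ N w <= t] = [set w | (N w <= Num.Def.trunc (t / h))%N].
  apply/seteqP; split => w /=.
    by rewrite truncn_ge_nat ?divr_ge0// ler_pdivlMr// mulr_natl.
  by rewrite truncn_ge_nat ?divr_ge0// ler_pdivlMr// mulr_natl.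
apply: history_le (hN _); apply: le_trans (ltW tu).
by rewrite -mulr_natl -ler_pdivlMr// truncn_le divr_ge0.
Qed.

End american.

End stopping.

Lemma continuous_max0 {R : realType} (f : R -> R) : continuous f ->
  continuous (fun y => maxr 0 (f y)).
Proof.
by move=> cf y; apply: (@continuous_max _ _ (fun=> 0) f y); [exact: cvg_cst|exact: cf].
Qed.

Lemma continuous_min1 {R : realType} (f : R -> R) : continuous f ->
  continuous (fun y => minr 1 (f y)).
Proof.
by move=> cf y; apply: (@continuous_min _ _ (fun=> 1) f y); [exact: cvg_cst|exact: cf].
Qed.

(** * Convergence of Bermudan prices to the American price *)

Section american_value.
Context {R : realType} {d : measure_display} {Omega : measurableType d}.
Variables (Pr : probability Omega R) (X : R -> Omega -> R).
Variables (sigma2 gamma : R) (nu : {sigma_finite_measure set R -> \bar R}).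
Hypotheses (s20 : 0 <= sigma2) (hnu : levy_measure nu)
  (cPr : measure_is_complete Pr)
  (hX : is_levy_process Pr X sigma2 gamma nu).
Hypothesis hexp : (\int[nu]_(y in [set y : R | (1 <= `|y|)%R]) (expR y)%:E < +oo)%E.
Hypothesis hmart : ((sigma2 / 2 + gamma)%:E
     + \int[nu]_y (expR y - 1 - y * \1_[set z : R | (`|z| <= 1)%R] y)%R%:E = 0)%E.
Variables (r delta K : R).
Hypotheses (r0 : 0 < r) (delta0 : 0 <= delta) (K0 : 0 < K).

Local Notation S := (stock X r delta).
Local Notation pay := (pay K).
Local Notation berm := (berm Pr X r delta K).
Local Notation amer := (amer Pr X r delta K).
Local Notation omega := (omega Pr X delta K).

Let gb h m : 0 <= h -> put_like K (berm h m).
Proof. exact: (put_like_berm s20 hnu cPr hX hexp hmart r0 delta0 K0). Qed.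

Lemma amer_approx theta x e : 0 <= theta -> 0 <= x -> 0 < e ->
  exists2 tau, stopping_times_le Pr X theta tau &
    amer theta x - e <= \int[Pr]_w (expR (- (r * tau w)) * maxr (K - S x (tau w) w) 0).
Proof.
move=> th0 x0 e0; apply: contrapT => H.
have : amer theta x <= amer theta x - e.
  apply: (amer_le s20 hnu cPr hX hexp hmart r0 delta0 K0 x0 th0) => tau ht.
  by rewrite leNgt; apply/negP => /ltW h; apply: H; exists tau.
by rewrite lerBrDr gerDl leNgt e0.
Qed.

Section sequence.
Variables (theta : R) (hn : nat -> R) (mn : nat -> nat).
Hypotheses (th0 : 0 <= theta) (hn0 : forall n, 0 < hn n) (hnc : hn n @[n --> \oo] --> 0)
  (hm : hn n *+ mn n @[n --> \oo] --> theta).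

Let fl n := Num.Def.trunc (theta / hn n).

Let fl_le n : hn n *+ fl n <= theta.
Proof. by rewrite -mulr_natl -ler_pdivlMr ?hn0// truncn_le divr_ge0// ltW. Qed.

Let fl_gt n : theta <= hn n *+ (fl n).+1.
Proof. by rewrite -mulr_natl -ler_pdivrMr ?hn0// ltW// truncnS_gt. Qed.

Let gap_cvg (k : nat -> nat) : (forall n, hn n *+ k n <= `|hn n *+ mn n - theta| + hn n) ->
  omega (hn n *+ k n) @[n --> \oo] --> 0.
Proof.
move=> hk; have k0 n : 0 <= hn n *+ k n by rewrite mulrn_wge0// ltW.
apply: (omega_cvg cPr hX _ delta0 k0).
apply: (@squeeze_cvgr _ _ _ _ (fun=> 0) (fun n => `|hn n *+ mn n - theta| + hn n)).
- by apply: nearW => n; rewrite k0 hk.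
- exact: cvg_cst.
- rewrite -[X in _ --> X]addr0; apply: cvgD => //.
  rewrite -[X in _ --> X](@normr0 _ R) -(subrr theta); apply: cvg_norm.
  by apply: cvgB => //; exact: cvg_cst.
Qed.

(** [up] counts the steps by which the grid overshoots [theta], [dn] those it lacks to cover
    [theta]. Both amount to a vanishing time, so [omega] controls their effect on the price. *)
Let up n := (mn n - fl n)%N.
Let dn n := ((fl n).+1 - mn n)%N.

Let up_gap n : hn n *+ up n <= `|hn n *+ mn n - theta| + hn n.
Proof.
have h0 := ltW (hn0 n).
have [h|h] := leqP (mn n) (fl n).
  by rewrite /up (eqP (_ : mn n - fl n == 0)%N) ?subn_eq0// mulr0n addr_ge0.
rewrite /up mulrnBr 1?ltnW//; have := fl_gt n; rewrite mulrSr.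
have := ler_norm (hn n *+ mn n - theta).
move: (hn n *+ fl n) (hn n *+ mn n) (hn n) => a b c; lra.
Qed.

Let dn_gap n : hn n *+ dn n <= `|hn n *+ mn n - theta| + hn n.
Proof.
have h0 := ltW (hn0 n).
have [h|h] := leqP (fl n).+1 (mn n).
  by rewrite /dn (eqP (_ : (fl n).+1 - mn n == 0)%N) ?subn_eq0// mulr0n addr_ge0.
rewrite /dn mulrnBr 1?ltnW//; have := fl_le n; rewrite mulrSr.
have := ler_norm (theta - hn n *+ mn n); rewrite distrC.
move: (hn n *+ fl n) (hn n *+ mn n) (hn n) => a b c; lra.
Qed.

(** Upper bound: the grid cut at [theta] stays below the American price, and the overshoot costs
    [omega]. Lower bound: a nearly optimal stopping time is rounded up on a grid covering [theta],
    again up to [omega]. *)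
Lemma berm_cvg_fixed x : 0 <= x -> berm (hn n) (mn n) x @[n --> \oo] --> amer theta x.
Proof.
move=> x0; apply/cvgrPdist_le => e e0.
have e2 : 0 < e / 2 by rewrite divr_gt0.
have [tau ht Htau] := amer_approx th0 x0 e2.
have e4 : 0 < e / 4 by rewrite divr_gt0.
have [_ /(_ _ e4) Hst] := stopping_approx s20 hnu cPr hX hexp hmart r0 delta0 K0 x0 ht hn0 hnc fl_gt.
have U := gap_cvg up_gap; have D := gap_cvg dn_gap.
near=> n; have h0 := ltW (hn0 n).
have u1 : omega (hn n *+ up n) <= e.
  have : `|0 - omega (hn n *+ up n)| <= e by near: n; exact: (cvgrPdist_le _ _).1 U _ e0.
  by rewrite sub0r normrN; apply: le_trans; exact: ler_norm.
have d1 : omega (hn n *+ dn n) <= e / 4.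
  have : `|0 - omega (hn n *+ dn n)| <= e / 4.
    by near: n; apply: (cvgrPdist_le _ _).1 D _ _; rewrite divr_gt0.
  by rewrite sub0r normrN; apply: le_trans; exact: ler_norm.
have s1 : \int[Pr]_w (expR (- (r * tau w)) * maxr (K - S x (tau w) w) 0) <= berm (hn n) (fl n).+1 x + e / 4.
  by near: n.
have B1 : berm (hn n) (mn n) x <= amer theta x + omega (hn n *+ up n).
  have E : mn n = (minn (mn n) (fl n) + up n)%N.
    by rewrite /up minnE subnK// leq_subr.
  rewrite [X in berm _ X _]E.
  apply: (le_trans (berm_unif s20 hnu cPr hX hexp hmart r0 delta0 K0 _ _ h0 x0)).
  rewrite lerD2r; apply: (berm_le_amer s20 hnu cPr hX hexp hmart r0 delta0 K0 x0 (hn0 n)).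
  by apply: le_trans (fl_le n); rewrite ler_wpMn2l// geq_minr.
have B2 : berm (hn n) (fl n).+1 x <= berm (hn n) (mn n) x + omega (hn n *+ dn n).
  apply: le_trans (berm_unif s20 hnu cPr hX hexp hmart r0 delta0 K0 _ _ h0 x0).
  have [h|h] := leqP (fl n).+1 (mn n).
    have -> : (mn n + dn n = (fl n).+1 + (mn n - (fl n).+1))%N.
      by rewrite subnKC// /dn (eqP (_ : (fl n).+1 - mn n == 0)%N) ?subn_eq0// addn0.
    exact: (berm_le s20 hnu cPr hX hexp hmart r0 delta0 K0).
  by rewrite /dn subnKC// ltnW.
move: u1 d1 s1 B1 B2 Htau.
move: (\int[Pr]_w _) (berm _ _ _) (berm _ _ _) (omega _) (omega _) (amer _ _) => a1 a2 a3 a4 a5 a6.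
by move=> u1 d1 s1 B1 B2 Htau; rewrite ler_norml; apply/andP; split; lra.
Unshelve. all: end_near. Qed.

Lemma berm_cvg (xn : nat -> R) (x : R) : 0 <= x -> xn n @[n --> \oo] --> x ->
  berm (hn n) (mn n) (xn n) @[n --> \oo] --> amer theta x.
Proof.
move=> x0 xc; have B := berm_cvg_fixed x0.
rewrite -[X in _ --> X]addr0.
have -> : (fun n => berm (hn n) (mn n) (xn n)) =
  (fun n => berm (hn n) (mn n) x + (berm (hn n) (mn n) (xn n) - berm (hn n) (mn n) x)).
  by apply/funext => n; ring.
apply: cvgD => //.
apply/cvgrPdist_le => e e0; move/cvgrPdist_le : xc => /(_ e e0).
apply: filterS => n; rewrite sub0r normrN distrC; apply: le_trans.
by have [_] := gb (mn n) (ltW (hn0 n)); exact.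
Qed.

End sequence.

Let hseq n : R := n.+1%:R^-1.
Let hseq0 n : 0 < hseq n. Proof. by rewrite invr_gt0. Qed.
Let hseqc : hseq n @[n --> \oo] --> 0. Proof. exact: cvg_harmonic. Qed.
Let hseqm theta : 0 <= theta -> hseq n *+ Num.Def.trunc (theta / hseq n) @[n --> \oo] --> theta.
Proof.
move=> th0.
apply: (@squeeze_cvgr _ _ _ _ (fun n => theta - hseq n) (fun=> theta)); last 2 first.
- rewrite -[X in _ --> X]subr0; apply: cvgB => //; exact: cvg_cst.
- exact: cvg_cst.
apply: nearW => n; apply/andP; split.
  rewrite lerBlDr -mulrSr -mulr_natl -ler_pdivrMr ?hseq0// ltW//.
  exact: truncnS_gt.
by rewrite -mulr_natl -ler_pdivlMr ?hseq0// truncn_le divr_ge0// ltW.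
Qed.

Lemma amer_cvg theta x : 0 <= theta -> 0 <= x ->
  berm (hseq n) (Num.Def.trunc (theta / hseq n)) x @[n --> \oo] --> amer theta x.
Proof. by move=> th0 x0; apply: berm_cvg_fixed => //; exact: hseqm. Qed.

Lemma amer_lip theta x y : 0 <= theta -> 0 <= x -> 0 <= y ->
  `|amer theta x - amer theta y| <= `|x - y|.
Proof.
move=> th0 x0 y0.
have c : `|berm (hseq n) (Num.Def.trunc (theta / hseq n)) x -
    berm (hseq n) (Num.Def.trunc (theta / hseq n)) y| @[n --> \oo] -->
    `|amer theta x - amer theta y|.
  by apply: cvg_norm; apply: cvgB; exact: amer_cvg.
apply: (ler_cvg_to c (cvg_cst _)); apply: nearW => n.
by have [_] := gb (Num.Def.trunc (theta / hseq n)) (ltW (hseq0 n)); exact.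
Qed.

Lemma pay_le_amer theta x : 0 <= theta -> 0 <= x -> pay x <= amer theta x.
Proof.
move=> th0 x0; apply: (ler_cvg_to (cvg_cst _) (amer_cvg th0 x0)).
by apply: nearW => n; exact: pay_le_berm.
Qed.

Lemma amer_leK theta x : 0 <= theta -> 0 <= x -> amer theta x <= K.
Proof.
move=> th0 x0; apply: (ler_cvg_to (amer_cvg th0 x0) (cvg_cst _)).
by apply: nearW => n; apply: put_like_leK; apply: gb; exact: ltW.
Qed.

Hypothesis hdeg : sigma2 != 0 \/ (0 < nu [set y : R | (y < 0)%R])%E \/
     (\int[nu]_(y in [set y : R | (0 < y)%R]) (minr y 1)%:E = +oo)%E.

(** * Non-degeneracy: a vanishing price at the strike is contradictory *)

Section degenerate.
Variable theta : R.
Hypotheses (th0 : 0 < theta) (hP : amer theta K <= 0).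

Let rho := r - delta.
Let hn n : R := theta / n.+1%:R.
Let hn0 n : 0 < hn n. Proof. by rewrite divr_gt0. Qed.
Let hnc : hn n @[n --> \oo] --> 0.
Proof. by rewrite -(mulr0 theta); apply: cvgMr; exact: cvg_harmonic. Qed.
Let hnth n : hn n <= theta.
Proof. by rewrite ler_pdivrMr// ler_peMr ?(ltW th0)// ler1n. Qed.

Let Y n w := rho * hn n + X (hn n) w.
Let mY n : measurable_fun setT (Y n).
Proof. by apply: measurable_funD => //; exact: levy_meas hX _ (ltW (hn0 n)). Qed.

Let put n w := maxr (1 - expR (Y n w)) 0.

Let put_bound n w : 0 <= put n w <= 1.
Proof. by rewrite le_max lexx orbT/= ge_max ler01 andbT gerBl expR_ge0. Qed.

Let put_Rint n : Pr.-Rint (put n).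
Proof.
apply: (@Rint_bounded _ _ _ Pr _ 1).
  apply: measurable_maxr => //; apply: measurable_funB => //.
  by apply: (measurableT_comp (f := expR)); [exact: meas_exp|exact: mY].
by move=> w; have /andP[h1 h2] := put_bound n w; rewrite ger0_norm.
Qed.

(** The constant time [hn n] is an admissible exercise time. The put at the money being worthless,
    [Y n] is almost surely nonnegative. *)
Let put_le0 n : \int[Pr]_w put n w <= 0.
Proof.
have ht : stopping_times_le Pr X theta (fun=> hn n).
  by apply: stopping_const; rewrite (ltW (hn0 n)) hnth.
have := stopping_le_amer s20 hnu cPr hX hexp hmart r0 delta0 K0 (ltW K0) ht.
move=> /le_trans/(_ hP).
have -> : \int[Pr]_w (expR (- (r * hn n)) * maxr (K - S K (hn n) w) 0) =
   \int[Pr]_w (expR (- (r * hn n)) * K * put n w).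
  apply: eq_Rintegral => w _; rewrite -mulrA; congr (_ * _).
  rewrite /put [RHS]maxr_pMr ?(ltW K0)// mulr0; congr maxr.
  by rewrite mulrBr mulr1.
rewrite RintegralZl; [|exact: measurableT|exact: put_Rint].
by rewrite pmulr_rle0// mulr_gt0// expR_gt0.
Qed.

Let expY n : Pr.-Rint (fun w => expR (Y n w) - 1) /\
  \int[Pr]_w (expR (Y n w) - 1) = expR (rho * hn n) - 1.
Proof.
have [I E] := stock_Rint s20 hnu cPr hX hexp hmart r delta 1 (ltW (hn0 n)).
have E1 : S 1 (hn n) = (fun w => expR (Y n w)).
  by apply/funext => w; rewrite /stock mul1r.
rewrite E1 in I E.
have I1 : Pr.-Rint (fun=> 1 : R) by exact: Rint_bounded.
split; first exact: RintB.
by rewrite RintegralB// Rintegral_prob_cst E mul1r.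
Qed.

Let growth : \forall n \near \oo, expR (rho * hn n) - 1 <= expR 1 * `|rho| * hn n.
Proof.
have c : rho * hn n @[n --> \oo] --> 0 by rewrite -(mulr0 rho); exact: cvgMr.
move/cvgrPdist_le : c => /(_ _ ltr01); apply: filterS => n.
rewrite sub0r normrN => /expR1_le H.
by apply: le_trans (ler_norm _) _; rewrite -mulrA -{2}(gtr0_norm (hn0 n)) -normrM.
Qed.

Let small k : \forall n \near \oo, `|rho| * hn n <= (2 * k.+1%:R)^-1.
Proof.
have k0 : 0 < (2 * k.+1%:R)^-1 :> R by rewrite invr_gt0 mulr_gt0.
have c : `|rho| * hn n @[n --> \oo] --> 0 by rewrite -(mulr0 `|rho|); exact: cvgMr.
move/cvgrPdist_le : c => /(_ _ k0); apply: filterS => n.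
by rewrite sub0r normrN ger0_norm// mulr_ge0// ltW.
Qed.

Let rho_le n : - (`|rho| * hn n) <= rho * hn n <= `|rho| * hn n.
Proof.
by rewrite -mulNr !ler_wpM2r ?(ltW (hn0 n))// ?ler_norm// lerNl -normrN ler_norm.
Qed.

Let fneg (k : nat) (y : R) : R := minr 1 (k.+1%:R * maxr 0 (- y - k.+1%:R^-1)).

Let kv k : 0 < k.+1%:R^-1 :> R. Proof. by rewrite invr_gt0. Qed.

Let fneg_cont k : continuous (fneg k).
Proof.
have cm : continuous (fun y : R => maxr 0 (- y - k.+1%:R^-1)).
  apply: continuous_max0 => y.
  by apply: cvgB; [apply: cvgN; exact: cvg_id|exact: cvg_cst].
by apply: continuous_min1 => y; apply: cvgMr; exact: cm.
Qed.

Let fneg_bound k y : 0 <= fneg k y <= 1.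
Proof.
by rewrite le_min ler01 ge_min lexx/= andbT mulr_ge0// le_max lexx.
Qed.

Let fneg0 k (y : R) : - k.+1%:R^-1 <= y -> fneg k y = 0.
Proof.
move=> ky; rewrite /fneg max_l; last by rewrite subr_le0 lerNl.
by rewrite mulr0 min_r.
Qed.

(** A jump below [- k.+1%:R^-1] outweighs the drift over a short time and would give the put a
    value. The test functions [fneg k] vanish near 0, so the small-time limit applies, and they tend
    to the indicator of the negative half-line. *)
Let neg_null : nu [set y : R | y < 0] = 0%E.
Proof.
have fb k y : `|fneg k y| <= 1 by rewrite ger0_norm; have /andP[] := fneg_bound k y.
have fz k y : `|y| <= k.+1%:R^-1 -> fneg k y = 0.
  by rewrite ler_norml => /andP[h _]; exact: fneg0.
have I k := small_time_cvg s20 hnu hX hn0 hnc (kv k) (@fneg_cont k) (fb k) (fz k).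
have le0 k : \int[nu]_y fneg k y <= 0.
  have [_ c] := I k; apply: (ler_cvg_to c (cvg_cst 0)).
  near=> n; rewrite pmulr_lle0 ?invr_gt0//.
  have sm : `|rho| * hn n <= (2 * k.+1%:R)^-1 by near: n; exact: small.
  pose p : R := 1 - expR (- (2 * k.+1%:R)^-1).
  have p0 : 0 < p by rewrite subr_gt0 -[ltRHS]expR0 ltr_expR oppr_lt0 invr_gt0 mulr_gt0.
  apply: (@le_trans _ _ (\int[Pr]_w (p^-1 * put n w))).
    apply: le_Rintegral => //.
    - exact: (Rint_levy hX (ltW (hn0 n)) (bm_continuous_bounded (@fneg_cont k) (fb k))).
    - exact: RintZ.
    - move=> w _; have [h|h] := leP (- k.+1%:R^-1) (X (hn n) w).
        by rewrite fneg0// mulr_ge0 ?invr_ge0 ?(ltW p0)//; have /andP[] := put_bound n w.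
      apply: (@le_trans _ _ 1); first by have /andP[] := fneg_bound k (X (hn n) w).
      rewrite mulrC ler_pdivlMr// mul1r /put le_max; apply/orP; left.
      rewrite lerD2l lerN2 ler_expR /Y.
      have /andP[_ h2] := rho_le n.
      have h3 : (2 * k.+1%:R)^-1 = k.+1%:R^-1 / 2 :> R by rewrite invfM mulrC.
      move: sm h h2; rewrite h3; move: (`|rho| * hn n) (rho * hn n) (X (hn n) w) (k.+1%:R^-1) => a1 a2 a3 a4; lra.
  rewrite RintegralZl; [|exact: measurableT|exact: put_Rint].
  by rewrite pmulr_rle0 ?invr_gt0.
have f0 k y : 0 <= fneg k y by have /andP[] := fneg_bound k y.
have fc y : fneg n y @[n --> \oo] --> (\1_[set y : R | y < 0] y : R).
  have [y0|y0] := ltP y 0; last first.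
    rewrite indicE memNset/=; last by apply/negP; rewrite -leNgt.
    apply: cvg_near_cst; apply: nearW => n; apply: fneg0.
    by apply: le_trans y0; rewrite oppr_le0 ltW.
  rewrite indicE mem_set//=; apply: cvg_near_cst; near=> n.
  rewrite /fneg max_r; last first.
    rewrite subr_ge0 -[leRHS]invrK lef_pV2 ?posrE ?invr_gt0 ?oppr_gt0//.
    have : (- y)^-1 <= n%:R by near: n; exact: nbhs_infty_ger.
    by move/le_trans; apply; rewrite ler_nat.
  rewrite min_l// mulrBr divff// lerBrDr.
  have : 2 / (- y) <= n%:R by near: n; exact: nbhs_infty_ger.
  rewrite ler_pdivrMr ?oppr_gt0// => H; apply: (le_trans H).
  by rewrite ler_wpM2r ?ler_nat// oppr_ge0 ltW.
have [Ii Hi] := @Rfatou _ _ _ nu fneg _ 0 f0 (fun k => (I k).1) fc le0.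
have mS : measurable [set y : R | y < 0].
  rewrite (_ : [set y : R | y < 0] = `]-oo, 0[%classic); first exact: measurable_itv.
  by apply/seteqP; split => y /=; rewrite in_itv.
move: Hi; rewrite -lee_fin /Rintegral fineK; last exact: integrable_fin_num Ii.
rewrite integral_indic// setIT => H.
by apply/eqP; rewrite eq_le measure_ge0 andbT; exact: H.
Unshelve. all: end_near. Qed.

Let C := expR 1 * `|rho|.

Let fpos (k : nat) (y : R) : R := minr 1 (maxr 0 (y - k.+1%:R^-1)).

Let fpos_cont k : continuous (fpos k).
Proof.
apply: continuous_min1; apply: continuous_max0 => y.
by apply: cvgB; [exact: cvg_id|exact: cvg_cst].
Qed.

Let fpos_bound k y : 0 <= fpos k y <= 1.
Proof. by rewrite le_min ler01 ge_min lexx/= andbT le_max lexx. Qed.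

(** Where [Y] is nonnegative, [Y <= expR Y - 1], whose mean [expR (rho * h) - 1] is at most [C * h].
    Dividing by [h] bounds the integral of the positive jumps truncated at 1. *)
Let pos_finite : nu.-Rint (fun y => minr 1 (maxr 0 y)) /\
  \int[nu]_y minr 1 (maxr 0 y) <= C.
Proof.
have fb k y : `|fpos k y| <= 1 by rewrite ger0_norm; have /andP[] := fpos_bound k y.
have fz k y : `|y| <= k.+1%:R^-1 -> fpos k y = 0.
  by rewrite ler_norml => /andP[_ h]; rewrite /fpos max_l ?min_r ?subr_le0.
have I k := small_time_cvg s20 hnu hX hn0 hnc (kv k) (@fpos_cont k) (fb k) (fz k).
have f0 k y : 0 <= fpos k y by have /andP[] := fpos_bound k y.
have leC k : \int[nu]_y fpos k y <= C.
  have [_ c] := I k; apply: (ler_cvg_to c (cvg_cst C)).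
  near=> n; rewrite ler_pdivrMr//.
  have sm : `|rho| * hn n <= (2 * k.+1%:R)^-1 by near: n; exact: small.
  have gr : expR (rho * hn n) - 1 <= C * hn n by near: n; exact: growth.
  have [I1 E1] := expY n.
  apply: (@le_trans _ _ (\int[Pr]_w ((expR (Y n w) - 1) + put n w))).
    apply: le_Rintegral => //.
    - exact: (Rint_levy hX (ltW (hn0 n)) (bm_continuous_bounded (@fpos_cont k) (fb k))).
    - exact: RintD.
    - move=> w _; rewrite /put.
      have [Y0|Y0] := leP 0 (Y n w); last first.
        rewrite /fpos max_l; last first.
          have /andP[h2 _] := rho_le n; have k0 := kv k.
          have h3 : (2 * k.+1%:R)^-1 = k.+1%:R^-1 / 2 :> R by rewrite invfM mulrC.
          move: sm Y0 h2 k0; rewrite h3 /Y; move: (`|rho| * hn n) (rho * hn n) (X (hn n) w) (k.+1%:R^-1) => a1 a2 a3 a4; lra.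
        rewrite min_r// -[leLHS](subrr (expR (Y n w) - 1)) lerD2l opprB.
        by rewrite le_max lexx.
      apply: (@le_trans _ _ (expR (Y n w) - 1)); last by rewrite lerDl le_max lexx orbT.
      apply: (@le_trans _ _ (Y n w)); last by have := expR_ge1Dx (Y n w); lra.
      rewrite /fpos ge_min; apply/orP; right; rewrite ge_max Y0/=.
      have /andP[h2 _] := rho_le n; have k0 := kv k.
      have h3 : (2 * k.+1%:R)^-1 = k.+1%:R^-1 / 2 :> R by rewrite invfM mulrC.
      move: sm h2 k0; rewrite h3 /Y; move: (`|rho| * hn n) (rho * hn n) (X (hn n) w) (k.+1%:R^-1) => a1 a2 a3 a4; lra.
  rewrite RintegralD; [|exact: measurableT|exact: I1|exact: put_Rint].
  rewrite E1; have := put_le0 n; move: gr.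
  move: (Rintegral Pr setT (put n)) (expR (rho * hn n)) (C * hn n) => a b c1; lra.
have fc (y : R) : fpos n y @[n --> \oo] --> minr 1 (maxr 0 y).
  have H : y - n.+1%:R^-1 @[n --> \oo] --> y.
    rewrite -[X in _ --> X]subr0; apply: cvgB; first exact: cvg_cst.
    exact: cvg_harmonic.
  have ct : continuous (fun z : R => minr 1 (maxr 0 z)).
    by apply: continuous_min1; apply: continuous_max0 => z; exact: cvg_id.
  exact: (continuous_cvg _ (ct y) H).
exact: (@Rfatou _ _ _ nu fpos _ C f0 (fun k => (I k).1) fc leC).
Unshelve. all: end_near. Qed.

Let bump (k : nat) (y : R) : R := maxr 0 (1 - k.+1%:R * `|y|).

Let bump_cont k : continuous (bump k).
Proof.
apply: continuous_max0 => y; by apply: cvgB; [exact: cvg_cst|apply: cvgMr; exact: norm_continuous].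
Qed.

Let bump_bound k y : 0 <= bump k y <= 1.
Proof. by rewrite le_max lexx/= ge_max ler01/= gerBl mulr_ge0. Qed.

Let bump_wc k y : wc y * bump k y <= k.+1%:R^-1 * minr 1 `|y|.
Proof.
have k1 : k.+1%:R^-1 <= 1 :> R by rewrite invf_le1 ?ler1n.
have [h|h] := leP k.+1%:R^-1 `|y|.
  rewrite /bump max_l; last by rewrite subr_le0 -ler_pdivrMl// mulr1.
  by rewrite mulr0 mulr_ge0 ?invr_ge0// le_min ler01 normr_ge0.
rewrite min_r; last by apply: ltW; exact: lt_le_trans k1.
have /andP[b0 b1] := bump_bound k y.
apply: (@le_trans _ _ (wc y)); first by rewrite ler_piMr ?wc_ge0.
apply: (@le_trans _ _ (y ^+ 2)).
  by rewrite /wc ler_pdivrMr ?wc_den// ler_peMr ?sqr_ge0// lerDl sqr_ge0.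
rewrite -(real_normK (num_real y)) expr2; apply: ler_wpM2r => //; exact: ltW.
Qed.

(** A process bounded below up to drift has truncated first absolute moment of order [h]. Tested on
    a bump supported in [|y| <= k.+1%:R^-1], this yields a factor [k.+1%:R^-1], whereas a Gaussian
    part contributes [sigma2] for every [k]. *)
Let gauss_zero : sigma2 = 0.
Proof.
pose D := C + `|rho|.
have H k : sigma2 <= k.+1%:R^-1 * D.
  have bb y : `|bump k y| <= 1 by rewrite ger0_norm; have /andP[] := bump_bound k y.
  have c := wmean_cvg s20 hnu hX hn0 hnc (@bump_cont k) bb.
  have J0 : sigma2 <= wmean_lim sigma2 nu (bump k).
    rewrite /wmean_lim {1}/bump normr0 mulr0 subr0 max_r// mulr1 lerDl.
    by apply: Rintegral_ge0 => y _; rewrite mulr_ge0 ?wc_ge0//; have /andP[] := bump_bound k y.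
  apply: (le_trans J0); apply: (ler_cvg_to c (cvg_cst _)).
  near=> n; have h0 := ltW (hn0 n).
  have gr : expR (rho * hn n) - 1 <= C * hn n by near: n; exact: growth.
  have [I1 E1] := expY n.
  have bbm := bm_continuous_bounded (@bump_cont k) bb.
  (* One copy of [put] compensates [expR Y - 1] when [Y < 0]; the other two give [2 * (1 - expR Y)],
     which is at least the minimum of 1 and [- Y]. *)
  have I2 : Pr.-Rint (fun w => 3 * put n w) by exact: RintZ.
  have I3 : Pr.-Rint (fun=> `|rho| * hn n) by exact: (@Rint_bounded _ _ _ Pr _ `| `|rho| * hn n|).
  have I4 : Pr.-Rint (fun w => expR (Y n w) - 1 + 3 * put n w) by exact: RintD.
  have I5 : Pr.-Rint (fun w => `|rho| * hn n + (expR (Y n w) - 1 + 3 * put n w)) by exact: RintD.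
  apply: (@le_trans _ _ (\int[Pr]_w (k.+1%:R^-1 / hn n * (`|rho| * hn n + (expR (Y n w) - 1 + 3 * put n w))))).
    apply: le_Rintegral => //.
    - have := RintZ (hn n)^-1 (Rint_levy hX h0 (bmM (@bm_wc R) bbm)).
      by apply: eq_integrable => // w _; congr (_%:E); ring.
    - exact: RintZ.
    - move=> w _.
      rewrite mulrAC [leRHS]mulrAC ler_wpM2r ?invr_ge0//.
      apply: (le_trans (bump_wc _ _)); apply: ler_wpM2l; first by rewrite invr_ge0.
      have /andP[q1 q2] := rho_le n.
      have [p0 p1] := andP (put_bound n w).
      have XY : `|X (hn n) w| <= `|rho| * hn n + `|Y n w|.
        rewrite (_ : X (hn n) w = Y n w - rho * hn n); last by rewrite /Y; ring.
        apply: (le_trans (ler_normB _ _)); rewrite addrC lerD2r normrM (ger0_norm h0)//.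
      have [Y0|Y0] := leP 0 (Y n w).
        rewrite ge_min; apply/orP; right; apply: (le_trans XY).
        rewrite lerD2l (ger0_norm Y0).
        have := expR_ge1Dx (Y n w); lra.
      have e0 := expR_gt0 (Y n w).
      have pE : 1 - expR (Y n w) <= put n w by rewrite /put le_max lexx.
      have ea := expR_ge1Dx (- Y n w); rewrite expRN in ea.
      have rh : 0 <= `|rho| * hn n by rewrite mulr_ge0.
      move: (`|rho| * hn n) rh XY => rh rh0 XY.
      rewrite (ltr0_norm Y0) in XY.
      have ey : expR (Y n w) * (1 - Y n w) <= 1.
        by rewrite -ler_pdivlMl// mulr1.
      move: (put n w) (expR (Y n w)) (Y n w) Y0 e0 pE ey XY => p e y Y0 e0 pE ey XY.
      have [h|h] := leP (- 1) y.
        rewrite ge_min; apply/orP; right; apply: (le_trans XY); nra.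
      rewrite ge_min; apply/orP; left; nra.
  rewrite RintegralZl// RintegralD// Rintegral_prob_cst RintegralD// E1 RintegralZl; [|exact: measurableT|exact: put_Rint].
  rewrite -mulrA ler_wpM2l ?invr_ge0// mulrC ler_pdivrMr//.
  have := put_le0 n; move: gr.
  rewrite (_ : D * hn n = C * hn n + `|rho| * hn n); last by rewrite /D mulrDl.
  move: (Rintegral Pr setT (put n)) (expR (rho * hn n)) (`|rho| * hn n) (C * hn n) => a b c1 c2; lra.
apply/eqP; rewrite eq_le s20 andbT.
have c : n.+1%:R^-1 * D @[n --> \oo] --> 0.
  by rewrite -(mul0r D); apply: cvgMl; exact: cvg_harmonic.
by apply: (ler_cvg_to (cvg_cst _) c); apply: nearW.
Unshelve. all: end_near. Qed.

Lemma nondegenerate_contra : False.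
Proof.
case: hdeg => [|[]].
- by rewrite gauss_zero eqxx.
- by rewrite neg_null ltxx.
- have [/integrableP[_ +] _] := pos_finite.
  move=> lt E; suff : (\int[nu]_(y in [set y : R | (0 < y)%R]) (minr y 1)%:E < +oo)%E by rewrite E ltxx.
  apply: le_lt_trans lt.
  have mS : measurable [set y : R | 0 < y].
    rewrite (_ : [set y : R | 0 < y] = `]0, +oo[%classic); first exact: measurable_itv.
    by apply/seteqP; split => y /=; rewrite in_itv/= andbT.
  have mm : measurable_fun setT (fun y : R => (minr y 1)%:E).
    by apply/measurable_EFinP; exact: measurable_minr.
  rewrite [X in (X <= _)%E]integral_mkcond.
  have mp : measurable_fun setT (fun y : R => minr 1 (maxr 0 y)).
    by apply: measurable_minr => //; exact: measurable_maxr.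
  apply: ge0_le_integral => //.
  + by move=> y _; rewrite patchE; case: ifPn => // /set_mem/= y0; rewrite lee_fin le_min (ltW y0) ler01.
  + apply/(measurable_restrictT _ mS); exact: (measurable_funS measurableT (@subsetT _ _) mm).
  + by apply: measurableT_comp => //; exact/measurable_EFinP.
  + move=> y _; rewrite patchE; case: ifPn => [/set_mem/= y0|_].
      by rewrite lee_fin max_r ?(ltW y0)// minC ler_norm.
    by rewrite lee_fin.
Qed.

End degenerate.

Lemma amer_pos theta : 0 < theta -> 0 < amer theta K.
Proof.
by move=> th0; rewrite ltNge; apply/negP => h; exact: (nondegenerate_contra th0 h).
Qed.

End american_value.

(** * The critical price and the limit of the gain *)

(** Finitely many points of spacing [e / 3] suffice, the common Lipschitz constant covering the
    gaps. *)
Lemma equi_lipschitz_unif {R : realType} (f_ : nat -> R -> R) (f : R -> R) (B e : R) :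
  (forall n x y, 0 <= x -> 0 <= y -> `|f_ n x - f_ n y| <= `|x - y|) ->
  (forall x y, 0 <= x -> 0 <= y -> `|f x - f y| <= `|x - y|) ->
  (forall x, 0 <= x -> f_ n x @[n --> \oo] --> f x) -> 0 < e ->
  \forall n \near \oo, forall x, 0 <= x <= B -> `|f_ n x - f x| <= e.
Proof.
move=> fnl fl fc e0.
have e3 : 0 < e / 3 by rewrite divr_gt0.
have grid N : \forall n \near \oo, forall i, (i <= N)%N ->
    `|f_ n (i%:R * (e / 3)) - f (i%:R * (e / 3))| <= e / 3.
  have step i : \forall n \near \oo, `|f_ n (i%:R * (e / 3)) - f (i%:R * (e / 3))| <= e / 3.
    have i0 : 0 <= i%:R * (e / 3) by rewrite mulr_ge0// ltW.
    move: (fc _ i0) => /cvgrPdist_le/(_ _ e3); apply: filterS => n.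
    by rewrite distrC.
  elim: N => [|N IH].
    by apply: filterS (step 0%N) => n h i; rewrite leqn0 => /eqP ->.
  near=> n; move=> i; rewrite leq_eqVlt => /orP[/eqP ->|].
    by near: n; exact: step.
  rewrite ltnS; move: i; near: n; exact: IH.
have := grid (Num.Def.trunc (B / (e / 3))); apply: filterS => n H x /andP[x0 xB].
pose i := Num.Def.trunc (x / (e / 3)).
have /andP[i1 i2] : i%:R <= x / (e / 3) < i.+1%:R by apply: truncn_itv; rewrite divr_ge0// ltW.
have iN : (i <= Num.Def.trunc (B / (e / 3)))%N.
  by apply: le_truncn; rewrite ler_pM2r// invr_gt0.
have y0 : 0 <= i%:R * (e / 3) by rewrite mulr_ge0// ltW.
have xy : `|x - i%:R * (e / 3)| <= e / 3.
  rewrite ger0_norm ?subr_ge0 -?ler_pdivlMr//.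
  by rewrite lerBlDl -[X in _ + X]mul1r -mulrDl natr1 -ler_pdivrMr// ltW.
have := H i iN; have := fnl n x _ x0 y0; have := fl x _ x0 y0.
set y := i%:R * (e / 3) in y0 xy *.
move=> h1 h2 h3.
rewrite (_ : f_ n x - f x = (f_ n x - f_ n y) + (f_ n y - f y) - (f x - f y)); last by ring.
apply: (le_trans (ler_normB _ _)); have := ler_normD (f_ n x - f_ n y) (f_ n y - f y).
move: xy h1 h2 h3; move: (`|x - y|) (`|f_ n x - f_ n y + _|) (`|f_ n x - f_ n y|) (`|f_ n y - f y|) (`|f x - f y|).
move=> a1 a2 a3 a4 a5; lra.
Unshelve. all: end_near. Qed.

Lemma discount_rate {R : realType} (hn : nat -> R) (c : R) :
  (forall n, 0 < hn n) -> hn n @[n --> \oo] --> 0 ->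
  (1 - expR (- (c * hn n))) / hn n @[n --> \oo] --> c.
Proof.
move=> h0 hc.
have c0 : c * hn n @[n --> \oo] --> 0 by rewrite -(mulr0 c); exact: cvgMr.
have s0 : expR 1 * c ^+ 2 * hn n @[n --> \oo] --> 0.
  by rewrite -(mulr0 (expR 1 * c ^+ 2)); exact: cvgMr.
apply/cvgrPdist_le => e e0; near=> n.
have h1 : `|c * hn n| <= 1.
  have : `|0 - c * hn n| <= 1 by near: n; exact: (cvgrPdist_le _ _).1 c0 _ ltr01.
  by rewrite sub0r normrN.
have h2 : expR 1 * c ^+ 2 * hn n <= e.
  have : `|0 - expR 1 * c ^+ 2 * hn n| <= e by near: n; exact: (cvgrPdist_le _ _).1 s0 _ e0.
  by rewrite sub0r normrN; apply: le_trans; exact: ler_norm.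
have n1 : `|- (c * hn n)| <= 1 by rewrite normrN.
have := expR2_le n1; rewrite real_normK ?num_real// sqrrN => H.
have hp := h0 n.
rewrite (_ : c - _ = (expR (- (c * hn n)) - 1 - (- (c * hn n))) / hn n); last first.
  by move: (expR _) => E; field; rewrite gt_eqF.
rewrite normrM normfV (gtr0_norm hp) ler_pdivrMr//; apply: (le_trans H).
rewrite (_ : _ * _ = expR 1 * c ^+ 2 * hn n * hn n); last by rewrite exprMn; ring.
by rewrite ler_wpM2r// ltW.
Unshelve. all: end_near. Qed.

Lemma cvgn_lt {R : realType} (u : nat -> R) (l a : R) :
  u n @[n --> \oo] --> l -> l < a -> \forall n \near \oo, u n < a.
Proof.
move=> /cvgrPdist_lt h la; have e0 : 0 < a - l by rewrite subr_gt0.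
by apply: filterS (h _ e0) => n; rewrite ltr_norml => /andP[+ _]; lra.
Qed.

Lemma cvgn_gt {R : realType} (u : nat -> R) (l a : R) :
  u n @[n --> \oo] --> l -> a < l -> \forall n \near \oo, a < u n.
Proof.
move=> /cvgrPdist_lt h la; have e0 : 0 < l - a by rewrite subr_gt0.
by apply: filterS (h _ e0) => n; rewrite ltr_norml => /andP[_]; lra.
Qed.

(** Error bookkeeping of [jump_cvg], kept apart as inequalities between reals: [j1] and [j2] are the
    bounded and large jump parts at step [n], [i6] and [i7] those of the limit, and [j3], [j4], [j5]
    the intermediate means. *)
Lemma jump_estimate {R : realType} (q a b y M t j1 j2 j3 j4 j5 i6 i7 : R) :
  0 < y -> 0 <= a -> 0 <= b -> a * (M + 1) = q -> b * (y + 1) = q -> t <= b ->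
  `|j1 - j3| <= a * j4 -> 0 <= j2 <= (y + 1) * j5 -> 0 <= i7 -> i7 <= y * t ->
  `|i6 - j3| <= q -> `|M - j4| <= 1 -> `|t - j5| <= b ->
  `|i6 + i7 - (j1 + j2)| <= 10 * q.
Proof.
move=> y0 a0 b0 Ea Eb tb h1 /andP[h2 h3] h4 h5 h6.
rewrite ler_norml => /andP[h7 _]; rewrite ler_norml => /andP[h8 _].
have k1 : a * j4 <= q by rewrite -Ea ler_wpM2l//; lra.
have k2 : (y + 1) * j5 <= 2 * q.
  rewrite -Eb (_ : 2 * _ = (y + 1) * (2 * b)); last by ring.
  by rewrite ler_wpM2l; lra.
have k3 : y * t <= q by rewrite -Eb; nra.
move: h1 h6; rewrite !ler_norml => /andP[p1 p2] /andP[p3 p4].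
by apply/andP; split; lra.
Qed.

Section gain_limit.
Context {R : realType} {d : measure_display} {Omega : measurableType d}.
Variables (Pr : probability Omega R) (X : R -> Omega -> R).
Variables (sigma2 gamma : R) (nu : {sigma_finite_measure set R -> \bar R}).
Hypotheses (s20 : 0 <= sigma2) (hnu : levy_measure nu)
  (cPr : measure_is_complete Pr)
  (hX : is_levy_process Pr X sigma2 gamma nu).
Hypothesis hexp : (\int[nu]_(y in [set y : R | (1 <= `|y|)%R]) (expR y)%:E < +oo)%E.
Hypothesis hmart : ((sigma2 / 2 + gamma)%:E
     + \int[nu]_y (expR y - 1 - y * \1_[set z : R | (`|z| <= 1)%R] y)%R%:E = 0)%E.
Variables (r delta K : R).
Hypotheses (r0 : 0 < r) (delta0 : 0 <= delta) (K0 : 0 < K).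
Hypothesis hdeg : sigma2 != 0 \/ (0 < nu [set y : R | (y < 0)%R])%E \/
     (\int[nu]_(y in [set y : R | (0 < y)%R]) (minr y 1)%:E = +oo)%E.

Local Notation S := (stock X r delta).
Local Notation pay := (pay K).
Local Notation berm := (berm Pr X r delta K).
Local Notation gain := (gain Pr X r delta K).
Local Notation Qh := (Qh Pr X r delta).
Local Notation amer := (amer Pr X r delta K).

Let gb h m : 0 <= h -> put_like K (berm h m).
Proof. exact: (put_like_berm s20 hnu cPr hX hexp hmart r0 delta0 K0). Qed.

(** Despite its name this is the continuation region, where the price exceeds the payoff; exercise
    is optimal below its infimum. *)
Definition exercise_region (theta : R) : set R :=
  [set x | 0 <= x /\ maxr (K - x) 0 < amer theta x].

Definition crit (theta : R) : R := inf (exercise_region theta).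

Definition rate (theta x : R) : R :=
  (r * K - delta * x
   - Rintegral nu `]0%R, +oo[ (fun y => amer theta (x * expR y) - (K - x * expR y)))
  * \1_[set x' | x' < crit theta] x.

Lemma exercise_region_K theta : 0 < theta -> exercise_region theta K.
Proof.
move=> th0; split; first exact: ltW.
rewrite subrr max_l//; exact: (amer_pos s20 hnu cPr hX hexp hmart r0 delta0 K0 hdeg).
Qed.

Let region_lb theta : lbound (exercise_region theta) 0.
Proof. by move=> x []. Qed.

Lemma crit_ge0 theta : 0 < theta -> 0 <= crit theta.
Proof.
move=> th0; apply: lb_le_inf; last exact: region_lb.
by exists K; exact: exercise_region_K.
Qed.

Lemma crit_leK theta : 0 < theta -> crit theta <= K.
Proof.
by move=> th0; apply: ge_inf; [exists 0; exact: region_lb|exact: exercise_region_K].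
Qed.

(** A longer horizon enlarges the set whose infimum is taken. Measurability of the critical price in
    time will come from this. *)
Lemma crit_mono theta theta' : 0 < theta -> theta <= theta' -> crit theta' <= crit theta.
Proof.
move=> th0 tt; apply: lb_le_inf; first by exists K; exact: exercise_region_K.
move=> x [x0 xr]; apply: ge_inf; first by exists 0; exact: region_lb.
split => //; apply: (lt_le_trans xr).
by apply: (amer_mono s20 hnu cPr hX hexp hmart r0 delta0 K0 x0); rewrite (ltW th0).
Qed.

Lemma amer_below theta x : 0 < theta -> 0 <= x -> x < crit theta -> amer theta x = K - x.
Proof.
move=> th0 x0 xb.
have xK : x < K by exact: lt_le_trans (crit_leK th0).
have mE : maxr (K - x) 0 = K - x by rewrite max_l// subr_ge0 ltW.
apply/eqP; rewrite eq_le; apply/andP; split.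
  rewrite -mE leNgt; apply/negP => H.
  by move: xb; rewrite ltNge => /negP; apply; apply: ge_inf; [exists 0; exact: region_lb|split].
apply: le_trans (pay_le_amer s20 hnu cPr hX hexp hmart r0 delta0 K0 (ltW th0) x0).
by rewrite /pay ger0_norm// le_max lexx.
Qed.

(** Some [y < x] lies in the region. Up to the strike the payoff falls with slope -1 and the price
    is 1-Lipschitz, so the strict inequality at [y] persists at [x]. Past the strike the other
    alternative is recorded. *)
Lemma amer_above theta x : 0 < theta -> crit theta < x -> pay x < amer theta x \/ K < x.
Proof.
move=> th0 bx; have [xK|xK] := leP x K; last by right.
left; have b0 := crit_ge0 th0; have x0 : 0 <= x by exact: le_trans (ltW bx).
have [|y [y0 yr] yx] := @inf_lt _ (exercise_region theta) x _ bx.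
  by exists K; exact: exercise_region_K.
have : K - y < amer theta y by apply: le_lt_trans yr; rewrite le_max lexx.
have := amer_lip s20 hnu cPr hX hexp hmart r0 delta0 K0 (ltW th0) x0 y0.
have xy0 : 0 < x - y by rewrite subr_gt0.
rewrite (gtr0_norm xy0) ler_norml => /andP[+ _].
rewrite /pay (ger0_norm x0) max_l; last by rewrite subr_ge0.
move: (amer theta x) (amer theta y) => a b; lra.
Qed.

Section sequence.
(** Step, number of dates and stock all move with [n]. Keeping [(mn n).+1] steps within [theta]
    ensures that the Bermudan prices involved stay below the American price at [theta]. *)
Variables (theta : R) (hn : nat -> R) (mn : nat -> nat) (yn : nat -> R) (y : R).
Hypotheses (th0 : 0 < theta) (hn0 : forall n, 0 < hn n) (hnc : hn n @[n --> \oo] --> 0)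
  (hm : hn n *+ mn n @[n --> \oo] --> theta)
  (hmS : \forall n \near \oo, hn n *+ (mn n).+1 <= theta)
  (y0 : 0 < y) (yn0 : forall n, 0 < yn n) (ync : yn n @[n --> \oo] --> y).

Let hmS_cvg : hn n *+ (mn n).+1 @[n --> \oo] --> theta.
Proof.
have -> : (fun n => hn n *+ (mn n).+1) = (fun n => hn n + hn n *+ mn n).
  by apply/funext => n; rewrite mulrS.
by rewrite -[X in _ --> X]add0r; apply: cvgD.
Qed.

Let gain0 n : pay (yn n) <= Qh (hn n) (berm (hn n) (mn n)) (yn n) ->
  gain (hn n) (mn n) (yn n) = 0.
Proof. by move=> h; rewrite /gain /= max_r// subrr mul0r. Qed.

(** A strict inequality between price and payoff passes to nearby Bermudan prices, so continuation
    eventually attains the maximum. Past the strike the payoff is 0 and continuation attains it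
    trivially. *)
Let gain_above : crit theta < y -> gain (hn n) (mn n) (yn n) @[n --> \oo] --> rate theta y.
Proof.
move=> by_.
rewrite /rate indicE memNset ?mulr0/=; last by apply/negP; rewrite -leNgt ltW.
apply: cvg_near_cst.
have [H|Ky] := amer_above th0 by_.
  have c1 := berm_cvg s20 hnu cPr hX hexp hmart r0 delta0 K0 (ltW th0) hn0 hnc hmS_cvg (ltW y0) ync.
  have c2 : pay (yn n) @[n --> \oo] --> pay y by apply: (put_like_cvg (put_like_pay K0)).
  have e0 : 0 < (amer theta y - pay y) / 3 by rewrite divr_gt0// subr_gt0.
  near=> n; apply: gain0.
  have h1 : `|amer theta y - berm (hn n) (mn n).+1 (yn n)| <= (amer theta y - pay y) / 3.
    by near: n; exact: (cvgrPdist_le _ _).1 c1 _ e0.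
  have h2 : `|pay y - pay (yn n)| <= (amer theta y - pay y) / 3.
    by near: n; exact: (cvgrPdist_le _ _).1 c2 _ e0.
  have h3 : pay (yn n) < berm (hn n) (mn n).+1 (yn n).
    move: h1 h2 H; rewrite !ler_norml => /andP[_ +] /andP[+ _].
    move: (amer _ _) (pay y) (pay (yn n)) (berm _ _ _) => a1 a2 a3 a4; lra.
  by move: h3; rewrite /= lt_max ltxx/= => /ltW.
near=> n; apply: gain0.
have h1 : K < yn n.
  by near: n; exact: (cvgn_gt ync Ky).
rewrite (_ : pay _ = 0); last by rewrite /pay gtr0_norm// max_r// subr_le0 ltW.
have gQ := put_like_Qh s20 hnu cPr hX hexp hmart r0 delta0 (ltW (hn0 n)) (gb (mn n) (ltW (hn0 n))).
exact: put_like_ge0 gQ.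
Unshelve. all: end_near. Qed.

Section below.
Hypothesis yb : y < crit theta.

(** Half the logarithmic distance to the critical price: a jump of size at most [c] leaves the stock
    below it, even from starting points close to [y]. *)
Let c := ln (crit theta / y) / 2.
Let b0 : 0 < crit theta. Proof. exact: lt_trans yb. Qed.
Let c0 : 0 < c.
Proof. by rewrite divr_gt0// ln_gt0// ltr_pdivlMr// mul1r. Qed.
Let yc : y * expR c < crit theta.
Proof.
have E : y * expR (c + c) = crit theta.
  rewrite (_ : c + c = ln (crit theta / y)); last by rewrite /c; field.
  by rewrite lnK ?posrE ?divr_gt0// mulrC divfK// gt_eqF.
by rewrite -E ltr_pM2l// ltr_expR ltrDl.
Qed.

Let an n := yn n * expR ((r - delta) * hn n).
Let an0 n : 0 < an n. Proof. by rewrite mulr_gt0// expR_gt0. Qed.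
Let anc : an n @[n --> \oo] --> y.
Proof.
rewrite -[X in _ --> X]mulr1; apply: cvgM => //.
rewrite -[X in _ --> X](@expR0 R) -(mulr0 (r - delta)).
by apply: (continuous_cvg _ (@continuous_expR R _)); exact: cvgMr.
Qed.

(** Price minus the affine function [K - S]. The affine part has an explicit mean by the martingale
    property; the remainder eventually vanishes for [z <= c], which brings it within reach of the
    small-time limits. *)
Let un n z := berm (hn n) (mn n) (an n * expR z) - (K - an n * expR z).
Let u z := amer theta (y * expR z) - (K - y * expR z).

Let un_ge0 n z : 0 <= un n z.
Proof.
rewrite subr_ge0; apply: le_trans (pay_le_berm _ _ _ _ _ _ _ _).
by rewrite /pay gtr0_norm ?le_max ?lexx// mulr_gt0// expR_gt0.
Qed.

Let un_le n z : un n z <= an n * expR z.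
Proof.
rewrite /un opprB addrCA gerDl subr_le0; exact: put_like_leK (gb _ (ltW (hn0 n))).
Qed.

Let un_zero : \forall n \near \oo, forall z, z <= c -> un n z = 0.
Proof.
have ac : an n * expR c @[n --> \oo] --> y * expR c by exact: cvgMl.
near=> n; move=> z zc.
have hnn : hn n *+ (mn n).+1 <= theta by near: n.
have an_c : an n * expR c < crit theta by near: n; exact: (cvgn_lt ac yc).
have z0 : 0 <= an n * expR z by rewrite mulr_ge0 ?expR_ge0// ltW.
have zb : an n * expR z < crit theta.
  by apply: le_lt_trans an_c; rewrite ler_pM2l// ler_expR.
apply/eqP; rewrite eq_le un_ge0 andbT /un subr_le0 -(amer_below th0 z0 zb).
apply: (berm_le_amer s20 hnu cPr hX hexp hmart r0 delta0 K0 z0 (hn0 n)).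
by apply: le_trans hnn; rewrite ler_wpMn2l// ltW.
Unshelve. all: end_near. Qed.

Let yez z : 0 <= y * expR z. Proof. by rewrite mulr_ge0 ?expR_ge0// ltW. Qed.

Let u_ge0 z : 0 <= u z.
Proof.
rewrite subr_ge0; apply: le_trans (pay_le_amer s20 hnu cPr hX hexp hmart r0 delta0 K0 (ltW th0) (yez z)).
by rewrite /pay ger0_norm ?le_max ?lexx.
Qed.

Let u_le z : u z <= y * expR z.
Proof.
rewrite /u opprB addrCA gerDl subr_le0.
exact: (amer_leK s20 hnu cPr hX hexp hmart r0 delta0 K0 (ltW th0)).
Qed.

Let u_zero z : z <= c -> u z = 0.
Proof.
move=> zc; rewrite /u (amer_below th0)// ?subrr//.
by apply: le_lt_trans yc; rewrite ler_pM2l// ler_expR.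
Qed.

Let u_cont : continuous u.
Proof.
move=> z; have ce : (fun z : R => y * expR z) z' @[z' --> z] --> y * expR z.
  by apply: cvgMr; exact: continuous_expR.
rewrite /u; apply: cvgB; last by apply: cvgB => //; exact: cvg_cst.
move/cvgrPdist_le : ce => ce; apply/cvgrPdist_le => e e0.
apply: filterS (ce e e0) => z'; apply: le_trans.
exact: (amer_lip s20 hnu cPr hX hexp hmart r0 delta0 K0 (ltW th0)).
Qed.

(** Equi-Lipschitz prices converge uniformly on the bounded range [y * expR z], [z <= A]; moving the
    base point from [y] to [an n] costs the other half of [e]. *)
Let un_unif (A e : R) : 0 < e -> \forall n \near \oo, forall z, z <= A -> `|un n z - u z| <= e.
Proof.
move=> e0; have e2 : 0 < e / 2 by rewrite divr_gt0.
have e4 : 0 < e / 2 / (2 * expR A) by rewrite divr_gt0// mulr_gt0// expR_gt0.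
have lipn n x x' : 0 <= x -> 0 <= x' -> `|berm (hn n) (mn n) x - berm (hn n) (mn n) x'| <= `|x - x'|.
  by move=> _ _; have [_] := gb (mn n) (ltW (hn0 n)); exact.
have lip x x' := @amer_lip _ _ _ Pr X _ _ nu s20 hnu cPr hX hexp hmart r delta K r0 delta0 K0 theta x x' (ltW th0).
have cv x : 0 <= x -> berm (hn n) (mn n) x @[n --> \oo] --> amer theta x.
  exact: (berm_cvg_fixed s20 hnu cPr hX hexp hmart r0 delta0 K0 (ltW th0) hn0 hnc hm).
have U := equi_lipschitz_unif (y * expR A) lipn lip cv e2.
near=> n; move=> z zA.
have h1 : forall x, 0 <= x <= y * expR A -> `|berm (hn n) (mn n) x - amer theta x| <= e / 2 by near: n.
have h2 : `|y - an n| <= e / 2 / (2 * expR A) by near: n; exact: (cvgrPdist_le _ _).1 anc _ e4.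
have eA : expR z <= expR A by rewrite ler_expR.
have ez := expR_ge0 z.
have h3 : `|an n * expR z - y * expR z| <= e / 2 / 2.
  rewrite -mulrBl normrM (ger0_norm ez) distrC.
  apply: (@le_trans _ _ (e / 2 / (2 * expR A) * expR A)); first exact: ler_pM.
  by rewrite invfM mulrA divfK// gt_eqF// expR_gt0.
have h4 := h1 (y * expR z); rewrite yez/= ler_pM2l// in h4; have {}h4 := h4 eA.
have [_ /(_ (an n * expR z) (y * expR z)) h5] := gb (mn n) (ltW (hn0 n)).
rewrite /un /u (_ : _ - _ - _ = (berm (hn n) (mn n) (an n * expR z) - berm (hn n) (mn n) (y * expR z)) +
   (berm (hn n) (mn n) (y * expR z) - amer theta (y * expR z)) + (an n * expR z - y * expR z)); last by ring.
apply: (le_trans (ler_normD _ _)).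
have := ler_normD (berm (hn n) (mn n) (an n * expR z) - berm (hn n) (mn n) (y * expR z))
  (berm (hn n) (mn n) (y * expR z) - amer theta (y * expR z)).
move: h3 h4 h5.
move: (`|an n * expR z - _|) (`|_ - amer _ _|) (`|berm _ _ _ - berm _ _ _|) (`|_ + _|) => a1 a2 a3 a4; lra.
Unshelve. all: end_near. Qed.

(** Complement of [exp_cut_cvg], the full exponential having mean exactly 1. *)
Let exp_tail_small_time (A : R) : 1 <= A ->
  \int[Pr]_w (expR (X (hn n) w) * (1 - cutoff A (X (hn n) w))) / hn n @[n --> \oo] --> exp_tail nu A.
Proof.
move=> A1.
have H : - (\int[Pr]_w (expR (X (hn n) w) * cutoff A (X (hn n) w) - 1) / hn n) @[n --> \oo] --> - - exp_tail nu A.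
  by apply: cvgN; exact: (exp_cut_cvg s20 hnu hX hexp hmart hn0 hnc A1).
rewrite opprK in H; apply: cvg_trans H; apply: near_eq_cvg; apply: nearW => n /=.
have h0 := ltW (hn0 n).
have [I1 _] := exp_levy_le s20 hnu cPr hX hexp hmart h0.
have E1 := exp_levy s20 hnu cPr hX hexp hmart h0.
have I2 : Pr.-Rint (fun w => expR (X (hn n) w) * cutoff A (X (hn n) w)).
  apply: le_Rint I1 _.
    apply: (measurableT_comp (f := fun z => expR z * cutoff A z)); last exact: levy_meas hX _ h0.
    by apply: measurable_funM; [exact: meas_exp|case: (bm_cutoff A)].
  by move=> w; rewrite ger0_norm ?mulr_ge0 ?expR_ge0 ?cutoff_ge0// ler_piMr ?expR_ge0 ?cutoff_le1.
have I3 : Pr.-Rint (fun=> 1 : R) by exact: Rint_bounded.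
rewrite -mulNr; congr (_ / _); rewrite RintegralB// Rintegral_prob_cst opprB -[X in X - _ = _]E1 -RintegralB//.
by apply: eq_Rintegral => w _; rewrite mulrBr mulr1.
Qed.

(** Equal to 0 up to [c / 2] and to 1 from [c] on: its mean divided by the step bounds the rate of
    jumps larger than [c] and converges. *)
Let cut0 (z : R) : R := minr 1 (maxr 0 (2 / c * `|z| - 1)).

Let cut0_cont : continuous cut0.
Proof.
apply: continuous_min1; apply: continuous_max0 => z.
by apply: cvgB; [apply: cvgMr; exact: norm_continuous|exact: cvg_cst].
Qed.

Let cut0_bound z : 0 <= cut0 z <= 1.
Proof. by rewrite le_min ler01 ge_min lexx/= andbT le_max lexx. Qed.

Let cut0_zero z : `|z| <= c / 2 -> cut0 z = 0.
Proof.
move=> h; rewrite /cut0 max_l ?min_r// subr_le0 mulrAC ler_pdivrMr// mul1r.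
by rewrite mulrC -ler_pdivlMr.
Qed.

Let cut0_one z : c <= `|z| -> cut0 z = 1.
Proof.
move=> h; rewrite /cut0 min_l// le_max; apply/orP; right.
rewrite lerBrDr mulrAC ler_pdivlMr// -mulr2n -[leLHS]/((1 *+ 2) * c) ler_pM2l//.
Qed.

Let u_cut_meas A z : `|u z * cutoff A z| <= y * expR (A + 1).
Proof.
rewrite ger0_norm ?mulr_ge0 ?cutoff_ge0//.
have [zA|zA] := leP `|z| (A + 1); last by rewrite cutoff0// mulr0 mulr_ge0 ?expR_ge0// ltW.
apply: (@le_trans _ _ (u z)); first by rewrite ler_piMr// cutoff_le1.
by apply: (le_trans (u_le z)); rewrite ler_pM2l// ler_expR (le_trans (ler_norm z)).
Qed.

Let u_tail A : 1 <= A -> nu.-Rint (fun z => u z * (1 - cutoff A z)) /\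
  \int[nu]_z (u z * (1 - cutoff A z)) <= y * exp_tail nu A.
Proof.
move=> A1; have It := exp_tail_Rint hexp A1.
have t0 (z : R) : 0 <= 1 - cutoff A z by rewrite subr_ge0 cutoff_le1.
have I : nu.-Rint (fun z => u z * (1 - cutoff A z)).
  apply: (@le_Rint _ _ _ nu _ (fun z => y * (expR z * (1 - cutoff A z)))).
  - apply: measurable_funM; first exact: continuous_measurable_fun.
    by apply: measurable_funB => //; case: (bm_cutoff A).
  - exact: RintZ.
  - by move=> z; rewrite ger0_norm ?mulr_ge0// mulrA ler_wpM2r.
split=> //; rewrite /exp_tail -RintegralZl//.
apply: le_Rintegral => //; first exact: RintZ.
by move=> z _; rewrite mulrA ler_wpM2r.
Qed.

Let u_cut A : 0 <= A -> nu.-Rint (fun z => u z * cutoff A z) /\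
  (\int[Pr]_w (u (X (hn n) w) * cutoff A (X (hn n) w)) / hn n @[n --> \oo] --> \int[nu]_z (u z * cutoff A z)).
Proof.
move=> A0.
apply: (small_time_cvg s20 hnu hX hn0 hnc (f := fun z => u z * cutoff A z) c0 _ (@u_cut_meas A)).
  by move=> z; apply: cvgM; [exact: u_cont|exact: cutoff_cont].
by move=> z; rewrite ler_norml => /andP[_ h]; rewrite u_zero// mul0r.
Qed.

Let meas_un n : measurable_fun setT (un n).
Proof.
have me : measurable_fun setT (fun z : R => an n * expR z).
  by apply: measurable_funM => //; exact: meas_exp.
apply: measurable_funB; last exact: measurable_funB.
exact: (measurableT_comp (put_like_meas (gb (mn n) (ltW (hn0 n)))) me).
Qed.

Let un_Rint n : Pr.-Rint (fun w => un n (X (hn n) w)).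
Proof.
have h0 := ltW (hn0 n).
have [I1 _] := exp_levy_le s20 hnu cPr hX hexp hmart h0.
apply: (@le_Rint _ _ _ Pr _ (fun w => an n * expR (X (hn n) w))).
- exact: (measurableT_comp (meas_un n) (levy_meas hX h0)).
- exact: RintZ.
- by move=> w; rewrite ger0_norm ?un_ge0// un_le.
Qed.

(** Three errors: replacing [un n] by [u] on bounded jumps, uniformly small and paid only at the
    rate of jumps beyond [c]; the small-time limit for [u] times the cutoff; and large jumps, where
    [un n] and [u] are both below a multiple of the exponential. *)
Let jump_cvg : \int[Pr]_w un n (X (hn n) w) / hn n @[n --> \oo] --> \int[nu]_z u z.
Proof.
apply/cvgrPdist_le => e e0.
have fb z : `|cut0 z| <= 1 by rewrite ger0_norm; have /andP[] := cut0_bound z.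
have c20 : 0 < c / 2 by rewrite divr_gt0.
have [_ Hcut] := small_time_cvg s20 hnu hX hn0 hnc c20 cut0_cont fb cut0_zero.
pose M := \int[nu]_z cut0 z.
have M0 : 0 <= M by apply: Rintegral_ge0 => z _; have /andP[] := cut0_bound z.
have ey : 0 < e / (10 * (y + 1)) by rewrite divr_gt0// mulr_gt0// ltr_wpDl// ltW.
have [N _ hN] := (cvgrPdist_le _ _).1 (exp_tail_cvg hexp) _ ey.
pose A : R := N.+1%:R.
have tA : exp_tail nu A <= e / (10 * (y + 1)).
  by have := hN N (leqnn N); rewrite sub0r normrN; apply: le_trans; exact: ler_norm.
have A1 : 1 <= A by rewrite ler1n.
have tA0 := exp_tail_ge0 nu A.
have ct := exp_tail_small_time A1.
have [Iu1 cu] := u_cut (le_trans ler01 A1).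
have [Iu2 bu] := u_tail A1.
have eM : 0 < e / (10 * (M + 1)) by rewrite divr_gt0// mulr_gt0// ltr_wpDl.
have U := un_unif (A + 1) eM.
have e10 : 0 < e / 10 by rewrite divr_gt0.
near=> n; have hp := hn0 n; have h0 := ltW hp.
have hz : forall z, z <= c -> un n z = 0 by near: n; exact: un_zero.
have hU : forall z, z <= A + 1 -> `|un n z - u z| <= e / (10 * (M + 1)) by near: n.
have hct : `|exp_tail nu A - \int[Pr]_w (expR (X (hn n) w) * (1 - cutoff A (X (hn n) w))) / hn n| <= e / (10 * (y + 1)).
  by near: n; exact: (cvgrPdist_le _ _).1 ct _ ey.
have hcu : `|\int[nu]_z (u z * cutoff A z) - \int[Pr]_w (u (X (hn n) w) * cutoff A (X (hn n) w)) / hn n| <= e / 10.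
  by near: n; exact: (cvgrPdist_le _ _).1 cu _ e10.
have hM : `|M - \int[Pr]_w cut0 (X (hn n) w) / hn n| <= 1.
  by near: n; exact: (cvgrPdist_le _ _).1 Hcut _ ltr01.
have hy : `|y - an n| <= 1 by near: n; exact: (cvgrPdist_le _ _).1 anc _ ltr01.
have bcut : bm cut0 by exact: bm_continuous_bounded cut0_cont fb.
have bu' : bm (fun z => u z * cutoff A z).
  apply: bm_continuous_bounded (@u_cut_meas A).
  by move=> z; apply: cvgM; [exact: u_cont|exact: cutoff_cont].
have t0 (z : R) : 0 <= 1 - cutoff A z by rewrite subr_ge0 cutoff_le1.
have [Ie _] := exp_levy_le s20 hnu cPr hX hexp hmart h0.
have mX := levy_meas hX h0.
have mc : measurable_fun setT (cutoff A) by case: (bm_cutoff A).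
have IT : Pr.-Rint (fun w => expR (X (hn n) w) * (1 - cutoff A (X (hn n) w))).
  apply: le_Rint Ie _.
    apply: (measurableT_comp (f := fun z => expR z * (1 - cutoff A z)) _ mX).
    by apply: measurable_funM; [exact: meas_exp|exact: measurable_funB].
  by move=> w; rewrite ger0_norm ?mulr_ge0 ?expR_ge0// ler_piMr ?expR_ge0// gerBl cutoff_ge0.
have J1 : Pr.-Rint (fun w => un n (X (hn n) w) * cutoff A (X (hn n) w)).
  apply: le_Rint (un_Rint n) _.
    exact: (measurableT_comp (measurable_funM (meas_un n) mc) mX).
  by move=> w; rewrite ger0_norm ?mulr_ge0 ?un_ge0 ?cutoff_ge0// ler_piMr ?un_ge0 ?cutoff_le1.
have J2 : Pr.-Rint (fun w => un n (X (hn n) w) * (1 - cutoff A (X (hn n) w))).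
  have := RintB (un_Rint n) J1; apply: eq_integrable => // w _; congr (_%:E); ring.
have J3 := Rint_levy hX h0 bu'.
have J4 := Rint_levy hX h0 bcut.
have E1 : \int[Pr]_w un n (X (hn n) w) = \int[Pr]_w (un n (X (hn n) w) * cutoff A (X (hn n) w)) +
   \int[Pr]_w (un n (X (hn n) w) * (1 - cutoff A (X (hn n) w))).
  by rewrite -RintegralD//; apply: eq_Rintegral => w _; ring.
have E2 : \int[nu]_z u z = \int[nu]_z (u z * cutoff A z) + \int[nu]_z (u z * (1 - cutoff A z)).
  by rewrite -RintegralD//; apply: eq_Rintegral => z _; ring.
have T3 : 0 <= \int[Pr]_w (un n (X (hn n) w) * (1 - cutoff A (X (hn n) w))) <=
   (y + 1) * \int[Pr]_w (expR (X (hn n) w) * (1 - cutoff A (X (hn n) w))).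
  apply/andP; split; first by apply: Rintegral_ge0 => w _; rewrite mulr_ge0.
  rewrite -RintegralZl//; apply: le_Rintegral => //; first exact: RintZ.
  move=> w _; rewrite mulrA ler_wpM2r//; apply: (le_trans (un_le _ _)).
  apply: ler_wpM2r; first exact: expR_ge0.
  move: hy; rewrite ler_norml => /andP[+ _]; lra.
have T4 : 0 <= \int[nu]_z (u z * (1 - cutoff A z)) by apply: Rintegral_ge0 => z _; rewrite mulr_ge0.
have T1 : `|\int[Pr]_w (un n (X (hn n) w) * cutoff A (X (hn n) w)) - \int[Pr]_w (u (X (hn n) w) * cutoff A (X (hn n) w))|
   <= e / (10 * (M + 1)) * \int[Pr]_w cut0 (X (hn n) w).
  rewrite -RintegralB// -RintegralZl//; apply: le_norm_Rint; [exact: RintB|exact: RintZ|].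
  move=> w; set z := X (hn n) w; have /andP[k0 k1] := cut0_bound z.
  rewrite -mulrBl.
  have [zc|zc] := leP z c.
    by rewrite hz// u_zero// subrr mul0r normr0 mulr_ge0// ltW.
  have [zA|zA] := leP `|z| (A + 1); last by rewrite cutoff0// mulr0 normr0 mulr_ge0// ltW.
  rewrite cut0_one; last by rewrite (le_trans (ltW zc))// ler_norm.
  rewrite mulr1 normrM (ger0_norm (cutoff_ge0 _ _)).
  apply: le_trans (hU z (le_trans (ler_norm z) zA)).
  by rewrite ler_piMr// cutoff_le1.
have yp1 : 0 < y + 1 by rewrite ltr_wpDl// ltW.
have Mp1 : 0 < M + 1 by rewrite ltr_wpDl.
have hv : 0 <= (hn n)^-1 by rewrite invr_ge0.
rewrite E1 E2 mulrDl (_ : e = 10 * (e / 10)); last by rewrite mulrC divfK.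
apply: (@jump_estimate R (e / 10) (e / (10 * (M + 1))) (e / (10 * (y + 1))) y M (exp_tail nu A) _ _
  (\int[Pr]_w (u (X (hn n) w) * cutoff A (X (hn n) w)) / hn n)
  (\int[Pr]_w cut0 (X (hn n) w) / hn n)
  (\int[Pr]_w (expR (X (hn n) w) * (1 - cutoff A (X (hn n) w))) / hn n)).
- exact: y0.
- exact: ltW.
- exact: ltW.
- by rewrite invfM mulrA divfK// gt_eqF.
- by rewrite invfM mulrA divfK// gt_eqF.
- exact: tA.
- by rewrite -mulrBl normrM (ger0_norm hv) mulrA ler_wpM2r.
- move: T3 => /andP[T31 T32]; rewrite mulr_ge0//= mulrA; exact: ler_wpM2r.
- exact: T4.
- exact: bu.
- exact: hcu.
- exact: hM.
- exact: hct.
Unshelve. all: end_near. Qed.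

Let rate_below : rate theta y = r * K - delta * y - \int[nu]_z u z.
Proof.
rewrite /rate indicE mem_set//= mulr1; congr (_ - _).
rewrite /Rintegral [in LHS]integral_mkcond; congr fine; apply: eq_integral => z _.
rewrite patchE; case: ifPn => // zn; rewrite -/(u z) u_zero//.
move: zn; rewrite notin_setE/= in_itv/= andbT => /negP; rewrite -leNgt => z0.
exact: le_trans (ltW c0).
Qed.

(** Below the critical price the Bermudan price is exactly [K - yn n], so the gain is an algebraic
    combination of the two discount rates and of the mean of [un n] divided by the step. *)
Lemma gain_below : gain (hn n) (mn n) (yn n) @[n --> \oo] --> rate theta y.
Proof.
rewrite rate_below.
have d1 := @discount_rate R hn r hn0 hnc; have d2 := @discount_rate R hn delta hn0 hnc.
have er : expR (- (r * hn n)) @[n --> \oo] --> (1 : R).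
  rewrite -(@expR0 R) -oppr0 -[X in - X](mulr0 r).
  by apply: (continuous_cvg _ (@continuous_expR R _)); apply: cvgN; exact: cvgMr.
have L : (1 - expR (- (r * hn n))) / hn n * K - yn n * ((1 - expR (- (delta * hn n))) / hn n)
   - expR (- (r * hn n)) * (\int[Pr]_w un n (X (hn n) w) / hn n) @[n --> \oo] -->
   r * K - delta * y - \int[nu]_z u z.
  rewrite -[X in _ - X]mul1r (mulrC delta).
  apply: cvgB; last exact: cvgM jump_cvg.
  by apply: cvgB; [exact: cvgMl|exact: cvgM].
apply: cvg_trans L; apply: near_eq_cvg; near=> n.
have hp := hn0 n; have h0 := ltW hp.
have hnn : hn n *+ (mn n).+1 <= theta by near: n.
have ynb : yn n < crit theta by near: n; exact: (cvgn_lt ync yb).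
have yn0' := ltW (yn0 n).
have payE : pay (yn n) = K - yn n.
  rewrite /pay ger0_norm// max_l// subr_ge0 ltW//; exact: lt_le_trans (crit_leK th0).
have VE : berm (hn n) (mn n).+1 (yn n) = K - yn n.
  apply/eqP; rewrite eq_le; apply/andP; split; last by rewrite -payE pay_le_berm.
  rewrite -(amer_below th0 yn0' ynb).
  exact: (berm_le_amer s20 hnu cPr hX hexp hmart r0 delta0 K0).
rewrite /gain VE /Qh.
have SE w : S (yn n) (hn n) w = an n * expR (X (hn n) w).
  by rewrite /stock expRD mulrA.
have [I1 _] := exp_levy_le s20 hnu cPr hX hexp hmart h0.
have E1 := exp_levy s20 hnu cPr hX hexp hmart h0.
have IK : Pr.-Rint (fun=> K) by exact: (@Rint_bounded _ _ _ Pr _ `|K|).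
have Ia : Pr.-Rint (fun w => an n * expR (X (hn n) w)) by exact: RintZ.
have -> : \int[Pr]_w berm (hn n) (mn n) (S (yn n) (hn n) w) =
   K - an n + \int[Pr]_w un n (X (hn n) w).
  transitivity (\int[Pr]_w ((K - an n * expR (X (hn n) w)) + un n (X (hn n) w))).
    by apply: eq_Rintegral => w _; rewrite /un SE; ring.
  rewrite RintegralD//; [|exact: RintB|exact: un_Rint].
  by rewrite RintegralB// Rintegral_prob_cst RintegralZl// E1 mulr1.
have Ed : expR (- (delta * hn n)) = expR (- (r * hn n)) * expR ((r - delta) * hn n).
  by rewrite -expRD; congr expR; ring.
rewrite Ed /an.
move: (expR (- (r * _))) (expR (_ * _)) (\int[Pr]_w _) => a1 a2 a3.
by field; rewrite gt_eqF.
Unshelve. all: end_near. Qed.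

End below.

Lemma gain_cvg : y <> crit theta -> gain (hn n) (mn n) (yn n) @[n --> \oo] --> rate theta y.
Proof.
by move=> /eqP; rewrite neq_lt => /orP[h|h]; [exact: gain_below|exact: gain_above].
Qed.

End sequence.

End gain_limit.

(** * The early exercise premium *)

Lemma meas_indic_fst {d1 d2} {T1 : measurableType d1} {T2 : measurableType d2} {R : realType}
  (A : set T1) : measurable A -> measurable_fun setT (fun z : T1 * T2 => \1_A z.1 : R).
Proof.
move=> mA; have mi : measurable_fun setT (\1_A : T1 -> R) by exact: measurable_indic.
exact: (measurableT_comp mi measurable_fst).
Qed.

Lemma meas_indic_snd {d1 d2} {T1 : measurableType d1} {T2 : measurableType d2} {R : realType}
  (A : set T2) : measurable A -> measurable_fun setT (fun z : T1 * T2 => \1_A z.2 : R).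
Proof.
move=> mA; have mi : measurable_fun setT (\1_A : T2 -> R) by exact: measurable_indic.
exact: (measurableT_comp mi measurable_snd).
Qed.

(** * Step functions in time *)

Section step_functions.
Context {R : realType}.
Local Notation leb := (@lebesgue_measure R).

Definition step (h : R) (p : nat) (f : nat -> R) (s : R) : R :=
  if 0 <= s < h *+ p then f (Num.Def.trunc (s / h)) else 0.

Let cell (h : R) (j : nat) : set R := `[h *+ j, h *+ j.+1[%classic.

(** The truncated quotient selects one cell; as a finite sum, the step function has an immediate
    integral and is jointly measurable when its values are random. *)
Lemma step_sum h p f s : 0 < h ->
  step h p f s = \sum_(0 <= j < p) f j * \1_(cell h j) s.
Proof.
move=> h0; have hv : 0 < h^-1 by rewrite invr_gt0.
have cellE j : (s \in cell h j) = (h *+ j <= s < h *+ j.+1).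
  by rewrite /cell; apply/idP/idP => [/set_mem/=|H]; [rewrite in_itv|apply/mem_set; rewrite /= in_itv].
rewrite /step; case: ifPn => [/andP[s0 sp]|H]; last first.
  rewrite big_seq big1// => j; rewrite mem_index_iota => /andP[_ jp].
  rewrite indicE cellE; case: (boolP (_ && _)) => /= [/andP[h1 h2]|_]; last by rewrite mulr0.
  move: H; rewrite negb_and -ltNge -leNgt => /orP[h3|h3].
    by move: h1; rewrite leNgt (lt_le_trans h3)// mulrn_wge0// ltW.
  by move: h2; rewrite ltNge (le_trans _ h3)// ler_wpMn2l// ltW.
set j0 := Num.Def.trunc (s / h).
have sh0 : 0 <= s / h by rewrite divr_ge0// ltW.
have /andP[j1 j2] : j0%:R <= s / h < j0.+1%:R by exact: truncn_itv.
have j0p : (j0 < p)%N by rewrite truncn_lt_nat// ltr_pdivrMr// mulr_natl.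
have ce j : \1_(cell h j) s = (j0 == j)%:R :> R.
  by rewrite indicE cellE -!(mulr_natl h) -ler_pdivlMr// -ltr_pdivrMr// -truncn_eq.
rewrite (eq_bigr (fun j => f j * (j0 == j)%:R)); last by move=> j _; rewrite ce.
rewrite (bigD1_seq j0) /=; [|by rewrite mem_index_iota|exact: iota_uniq].
rewrite eqxx mulr1 big1 ?addr0// => j; rewrite eq_sym => /negPf ->.
by rewrite mulr0.
Qed.

Lemma cell_Rint h j : 0 < h -> leb.-Rint (\1_(cell h j) : R -> R) /\
  \int[leb]_s (\1_(cell h j) s : R) = h.
Proof.
move=> h0; have mc : measurable (cell h j) by exact: measurable_itv.
have hh : h *+ j < h *+ j.+1 by rewrite mulrS ltrDr.
have E : (\int[leb]_s (\1_(cell h j) s)%:E = h%:E)%E.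
  have E0 : lebesgue_measure (cell h j) = h%:E.
    by rewrite /cell lebesgue_measure_itv/= lte_fin hh -EFinB mulrS addrK.
  by rewrite integral_indic// setIT; exact: E0.
split; last by rewrite /Rintegral E.
apply/integrableP; split; first by apply/measurable_EFinP; exact: measurable_indic.
under eq_integral do rewrite /= ger0_norm ?indicE//.
by rewrite (_ : (\int[leb]_x _)%E = h%:E) ?ltry// -E; apply: eq_integral => s _; rewrite indicE.
Qed.

Lemma step_Rint h p f : 0 < h -> leb.-Rint (step h p f) /\
  \int[leb]_s step h p f s = \sum_(0 <= j < p) f j * h.
Proof.
move=> h0; have -> : step h p f = (fun s => \sum_(0 <= j < p) f j * \1_(cell h j) s).
  by apply/funext => s; rewrite step_sum.
have I j : leb.-Rint (fun s => f j * \1_(cell h j) s).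
  by apply: RintZ; exact: (cell_Rint j h0).1.
have [J1 J2] := Rint_sum (index_iota 0 p) I; split => //.
rewrite J2; apply: eq_bigr => j _; rewrite RintegralZl//; last exact: (cell_Rint j h0).1.
by rewrite (cell_Rint j h0).2.
Qed.

Lemma step_meas {d} {T : measurableType d} h p (f : nat -> T -> R) : 0 < h ->
  (forall j, measurable_fun setT (f j)) ->
  measurable_fun setT (fun z : R * T => step h p (fun j => f j z.2) z.1).
Proof.
move=> h0 mf; under eq_fun do rewrite step_sum//.
apply: measurable_sum => j; apply: measurable_funM.
  by apply: (measurableT_comp (mf j)); exact: measurable_snd.
by apply: meas_indic_fst; exact: measurable_itv.
Qed.

Lemma grid_time (h s : R) : 0 < h -> 0 <= s ->
  s <= h *+ (Num.Def.trunc (s / h)).+1 <= s + h.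
Proof.
move=> h0 s0; have sh0 : 0 <= s / h by rewrite divr_ge0// ltW.
apply/andP; split; first by rewrite -mulr_natl -ler_pdivrMr// ltW// truncnS_gt.
by rewrite mulrSr lerD2r -mulr_natl -ler_pdivlMr// truncn_le.
Qed.

Lemma point_Rint (a c : R) : leb.-Rint (fun s => c * \1_[set a] s) /\
  \int[leb]_s (c * \1_[set a] s) = 0.
Proof.
have ms : measurable [set a] by exact: measurable_set1.
have I : leb.-Rint (\1_[set a] : R -> R).
  apply/integrableP; split; first by apply/measurable_EFinP; exact: measurable_indic.
  rewrite (_ : (\int[leb]_x _)%E = (\int[leb]_x (\1_[set a] x)%:E)%E); last first.
    by apply: eq_integral => s _; rewrite /= ger0_norm// indicE.
  have E0 : (\int[leb]_x (\1_[set a] x)%:E = 0)%E.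
    by rewrite integral_indic// setIT; exact: lebesgue_measure_set1.
  by rewrite E0.
split; first exact: RintZ.
have E0 : (\int[leb]_x (\1_[set a] x)%:E = 0)%E.
  by rewrite integral_indic// setIT; exact: lebesgue_measure_set1.
by rewrite RintegralZl// /Rintegral E0 mulr0.
Qed.

Lemma itv_Rint (a b : R) : leb.-Rint (\1_(`[a, b]%classic) : R -> R).
Proof.
have ms : measurable (`[a, b]%classic : set R) by exact: measurable_itv.
apply/integrableP; split; first by apply/measurable_EFinP; exact: measurable_indic.
rewrite (_ : (\int[leb]_x _)%E = (\int[leb]_x (\1_(`[a, b]%classic) x)%:E)%E); last first.
  by apply: eq_integral => s _; rewrite /= ger0_norm// indicE.
have E0 : (lebesgue_measure (`[a, b]%classic : set R) < +oo)%E.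
  by rewrite lebesgue_measure_itv; case: ifP => _; rewrite ?ltry// -EFinB ltry.
by rewrite integral_indic// setIT; exact: E0.
Qed.

Lemma discount_integral (r b : R) : 0 < r -> 0 < b ->
  leb.-Rint (fun s => expR (- (r * s)) * \1_(`[0, b]%classic) s) /\
  \int[leb]_s (r * (expR (- (r * s)) * \1_(`[0, b]%classic) s)) = 1 - expR (- (r * b)).
Proof.
move=> r0 b0.
have mi : measurable (`[0, b]%classic : set R) by exact: measurable_itv.
have me : measurable_fun setT (fun s : R => expR (- (r * s))).
  apply: (measurableT_comp (f := expR)); first exact: meas_exp.
  by apply: measurableT_comp => //; exact: measurable_funM.
have I : leb.-Rint (fun s => expR (- (r * s)) * \1_(`[0, b]%classic) s).
  refine (@le_Rint _ _ _ leb _ (\1_(`[0, b]%classic)) _ (itv_Rint 0 b) _).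
    by apply: measurable_funM => //; exact: measurable_indic.
  move=> s; rewrite indicE; case: (boolP (s \in _)) => /= [/set_mem/=|_]; last by rewrite mulr0 normr0.
  rewrite in_itv/= => /andP[s0 _]; rewrite mulr1 ger0_norm ?expR_ge0//.
  by rewrite -[leRHS]expR0 ler_expR oppr_le0 mulr_ge0// ltW.
split => //.
have ce : continuous (fun s : R => r * expR (- (r * s))).
  move=> s; apply: cvgMr; apply: continuous_comp; last exact: continuous_expR.
  by apply: cvgN; apply: cvgMr; exact: cvg_id.
have dF (s : R) : is_derive s 1 (fun s => - expR (- (r * s))) (r * expR (- (r * s))).
  by apply: is_derive_eq; rewrite /GRing.scale /=; ring.
have cF : continuous (fun s : R => - expR (- (r * s))).
  move=> s; apply: cvgN; apply: continuous_comp; last exact: continuous_expR.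
  by apply: cvgN; apply: cvgMr; exact: cvg_id.
have := @continuous_FTC2 R (fun s => r * expR (- (r * s))) (fun s => - expR (- (r * s))) 0 b b0.
have -> : 1 - expR (- (r * b)) = - expR (- (r * b)) - (- expR (- (r * 0))).
  by rewrite mulr0 oppr0 expR0; ring.
move=> H; have {}H : (\int[leb]_(x in `[0%R, b]) (r * expR (- (r * x)))%:E)%E =
    ((- expR (- (r * b)))%:E - (- expR (- (r * 0)))%:E)%E.
  apply: H.
  - by apply: continuous_subspaceT.
  - split; first by move=> s _; have [] := dF s.
    + by apply: cvg_at_right_filter; exact: cF.
    + by apply: cvg_at_left_filter; exact: cF.
  - by move=> s _; rewrite derive1E; have [_ ->] := dF s.
rewrite /Rintegral; transitivity (fine (\int[leb]_(x in `[0%R, b]) (r * expR (- (r * x)))%:E)%E).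
  rewrite [in RHS]integral_mkcond; congr fine; apply: eq_integral => s _.
  by rewrite patchE indicE; case: (s \in _); rewrite ?mulr1 ?mulr0.
by rewrite H -EFinB.
Qed.

End step_functions.

Lemma Rint_bounded_ae {d} {T : measurableType d} {R : realType} (P : probability T R)
  (N : set T) (f : T -> R) (M : R) :
  measurable N -> P N = 0%E -> measurable_fun setT f -> (forall x, ~ N x -> `|f x| <= M) ->
  P.-Rint f.
Proof.
move=> mN N0 mf fM; pose g x := f x * \1_(~` N) x.
have mg : measurable_fun setT g.
  by apply: measurable_funM => //; apply: measurable_indic; exact: measurableC.
have Ig : P.-Rint g.
  apply: (@Rint_bounded _ _ _ P _ `|M|) => // x; rewrite /g.
  have [xN|xN] := pselect (N x).
    by rewrite indicE memNset ?mulr0 ?normr0//=; apply.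
  by rewrite indicE mem_set// mulr1; exact: le_trans (fM _ xN) (ler_norm _).
have [_ fin] := integrableP _ _ _ Ig.
apply/integrableP; split; first exact/measurable_EFinP.
rewrite (_ : (\int[P]_x `|(f x)%:E| = \int[P]_x `|(g x)%:E|)%E)//.
apply: ae_eq_integral => //.
- by apply: measurableT_comp => //; exact/measurable_EFinP.
- by apply: measurableT_comp => //; exact/measurable_EFinP.
exists N; split => // x /= H; apply: contrapT => Nx; apply: H => _.
by rewrite /g indicE mem_set// mulr1.
Qed.

(** * Passage to the limit for positive starting points *)

Section representation.
Context {R : realType} {d : measure_display} {Omega : measurableType d}.
Variables (Pr : probability Omega R) (X : R -> Omega -> R).
Variables (sigma2 gamma : R) (nu : {sigma_finite_measure set R -> \bar R}).
Hypotheses (s20 : 0 <= sigma2) (hnu : levy_measure nu)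
  (cPr : measure_is_complete Pr)
  (hX : is_levy_process Pr X sigma2 gamma nu).
Hypothesis hexp : (\int[nu]_(y in [set y : R | (1 <= `|y|)%R]) (expR y)%:E < +oo)%E.
Hypothesis hmart : ((sigma2 / 2 + gamma)%:E
     + \int[nu]_y (expR y - 1 - y * \1_[set z : R | (`|z| <= 1)%R] y)%R%:E = 0)%E.
Variables (r delta K : R).
Hypotheses (r0 : 0 < r) (delta0 : 0 <= delta) (K0 : 0 < K).
Hypothesis hdeg : sigma2 != 0 \/ (0 < nu [set y : R | (y < 0)%R])%E \/
     (\int[nu]_(y in [set y : R | (0 < y)%R]) (minr y 1)%:E = +oo)%E.
Hypothesis hatom : forall s a, 0 < s -> Pr (X s @^-1` [set a]) = 0%E.

Local Notation leb := (@lebesgue_measure R).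
Local Notation S := (stock X r delta).
Local Notation pay := (pay K).
Local Notation berm := (berm Pr X r delta K).
Local Notation gain := (gain Pr X r delta K).
Local Notation Qh := (Qh Pr X r delta).
Local Notation amer := (amer Pr X r delta K).
Local Notation crit := (crit Pr X r delta K).
Local Notation rate := (rate Pr X nu r delta K).

Let gb h m : 0 <= h -> put_like K (berm h m).
Proof. exact: (put_like_berm s20 hnu cPr hX hexp hmart r0 delta0 K0). Qed.

Lemma stock_markov (g : R -> R) x s h : put_like K g -> 0 <= s -> 0 <= h ->
  expR (- (r * h)) * \int[Pr]_w g (S x (s + h) w) = \int[Pr]_w Qh h g (S x s w).
Proof.
move=> gg s0' h0.
pose f (z : R * R) := g (x * expR ((r - delta) * (s + h) + (z.1 + z.2))).
have f1 z : 0 <= f z <= K by rewrite /f (put_like_ge0 _ gg) (put_like_leK _ gg).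
have mf : measurable_fun setT f.
  apply: (measurableT_comp (put_like_meas gg)).
  apply: measurable_funM => //; apply: (measurableT_comp (f := expR)); first exact: meas_exp.
  by apply: measurable_funD => //; apply: measurable_funD; [exact: measurable_fst|exact: measurable_snd].
have mk := levy_markov_bounded cPr hX s0' h0 (@history_setT _ _ _ Pr X s) mf f1.
have gQ := put_like_Qh s20 hnu cPr hX hexp hmart r0 delta0 h0 gg.
have E1 : \int[Pr]_w (\1_setT w * f (X s w, X (s + h) w - X s w)) = \int[Pr]_w g (S x (s + h) w).
  apply: eq_Rintegral => w _; rewrite indicT mul1r /f /stock /=; congr (g (_ * expR _)).
  by rewrite (addrC (X s w)) subrK.
have sE w w' : x * expR ((r - delta) * (s + h) + (X s w + X h w')) = S (S x s w) h w'.
  by rewrite /stock -mulrA -expRD; congr (_ * expR _); ring.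
have E2 w : \int[Pr]_w' f (X s w, X h w') = \int[Pr]_w' g (S (S x s w) h w').
  by apply: eq_Rintegral => w' _; rewrite /f /= sE.
rewrite -E1 mk; under eq_Rintegral do rewrite indicT mul1r E2.
rewrite -RintegralZl; [|exact: measurableT|].
  by apply: eq_Rintegral => w _; rewrite /Qh.
have avg : measurable_fun setT (fun w => \int[Pr]_w' f (X s w, X h w')).
  exact: (measurableT_comp (levy_avg_meas hX h0 mf) (levy_meas hX s0')).
apply: (@Rint_bounded _ _ _ Pr _ K).
  by under eq_fun do rewrite -E2.
move=> w; have I := put_like_stock_Rint hX r delta (S x s w) gg h0.
rewrite ger0_norm; last by apply: Rintegral_ge0 => w' _; exact: put_like_ge0 gg.
rewrite -[leRHS](Rintegral_prob_cst Pr); apply: le_Rintegral => //.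
  exact: Rint_bounded.
by move=> w' _; exact: put_like_leK gg.
Qed.

Section horizon.
Variables (theta0 x : R).
Hypotheses (th0 : 0 < theta0) (x0 : 0 < x).

Let stk0 s w : 0 < S x s w. Proof. by rewrite mulr_gt0// expR_gt0. Qed.

Let h (n : nat) : R := theta0 / n.+1%:R.
Let h0 n : 0 < h n. Proof. by rewrite divr_gt0. Qed.
Let hc : h n @[n --> \oo] --> 0.
Proof. by rewrite -(mulr0 theta0); apply: cvgMr; exact: cvg_harmonic. Qed.
Let hp n : h n *+ n.+1 = theta0. Proof. by rewrite -mulr_natr divfK. Qed.

(** At date [i] there remain [n.+1 - i] steps, written [(n - i).+1] as [gain] expects; this is right
    for [i <= n] only, hence the extension by 0 in [F]. *)
Let G n i w := expR (- (r * (h n *+ i))) * gain (h n) (n - i)%N (S x (h n *+ i) w).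
Let F n i w := if (i < n.+1)%N then G n i w else 0.

Let hi0 n i : 0 <= h n *+ i. Proof. by rewrite mulrn_wge0// ltW. Qed.

Let gain_meas n m : measurable_fun setT (gain (h n) m).
Proof.
apply: measurable_funM => //; apply: measurable_funB.
  exact: (put_like_meas (gb m.+1 (ltW (h0 n)))).
exact: (put_like_meas (put_like_Qh s20 hnu cPr hX hexp hmart r0 delta0 (ltW (h0 n)) (gb m (ltW (h0 n))))).
Qed.

Let G_meas n i : measurable_fun setT (G n i).
Proof.
apply: measurable_funM => //.
exact: (measurableT_comp (gain_meas n (n - i)) (stock_meas hX r delta x (hi0 n i))).
Qed.

Let G_bound n i w : 0 <= G n i w <= r * K.
Proof.
have g0 := @gain_ge0 _ _ _ Pr X r delta K (h n) (n - i)%N (S x (h n *+ i) w) (h0 n).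
have g1 := gain_le s20 hnu cPr hX hexp hmart r0 delta0 K0 (n - i) (h0 n) (ltW (stk0 (h n *+ i) w)).
rewrite mulr_ge0 ?expR_ge0//=; apply: le_trans g1; rewrite ler_piMl//.
exact: discount_le1.
Qed.

Let F_meas n i : measurable_fun setT (F n i).
Proof. by rewrite /F; case: (i < n.+1)%N => //; exact: G_meas. Qed.

Let rK0 : 0 <= r * K. Proof. by rewrite mulr_ge0// ltW. Qed.

Let F_bound n i w : 0 <= F n i w <= r * K.
Proof. by rewrite /F; case: ifP => _; [exact: G_bound|rewrite lexx rK0]. Qed.

Let G_Rint n i : Pr.-Rint (G n i).
Proof.
by apply: (@Rint_bounded _ _ _ Pr _ (r * K)) => // w; have /andP[a b] := G_bound n i w; rewrite ger0_norm.
Qed.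

Let F_Rint n i : Pr.-Rint (F n i).
Proof.
apply: (@Rint_bounded _ _ _ Pr _ (r * K)); first exact: F_meas.
by move=> w; have /andP[a b] := F_bound n i w; rewrite ger0_norm.
Qed.

(** Mean discounted Bermudan price along the stock: it runs from the Bermudan price to the European
    one, and its decrements are the mean gains. *)
Let a n j := expR (- (r * (h n *+ j))) * \int[Pr]_w berm (h n) (n.+1 - j)%N (S x (h n *+ j) w).

Let a_step n j : (j < n.+1)%N -> a n j - a n j.+1 = h n * \int[Pr]_w G n j w.
Proof.
move=> jn; have hn := ltW (h0 n).
have gm := gb (n - j)%N hn.
have E : a n j.+1 = expR (- (r * (h n *+ j))) * \int[Pr]_w Qh (h n) (berm (h n) (n - j)%N) (S x (h n *+ j) w).
  rewrite -stock_markov// mulrA -expRD /a subSS mulrSr; congr (expR _ * _); ring.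
rewrite E /a subSn// -mulrBr.
have gS := gb (n - j).+1 hn.
have gQ := put_like_Qh s20 hnu cPr hX hexp hmart r0 delta0 hn gm.
rewrite -RintegralB; [|exact: measurableT|exact: (put_like_stock_Rint hX _ _ _ gS)|exact: (put_like_stock_Rint hX _ _ _ gQ)].
rewrite -[RHS]RintegralZl; [|exact: measurableT|exact: G_Rint].
rewrite -RintegralZl; [|exact: measurableT|]; last first.
  by apply: RintB; [exact: (put_like_stock_Rint hX _ _ _ gS)|exact: (put_like_stock_Rint hX _ _ _ gQ)].
apply: eq_Rintegral => w _; rewrite /G /gain [RHS]mulrCA.
by congr (_ * _); rewrite mulrC divfK// gt_eqF.
Qed.

Let euro := expR (- (r * theta0)) * \int[Pr]_w pay (S x theta0 w).

(** On the cell of index [j] the gain of date [j.+1] is used, so that the sampled time lies to the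
    right of [s] and right-continuity applies. *)
Let Phi n (s : R) (w : Omega) := step (h n) n.+1 (fun j => F n j.+1 w) s.

Let Phi_bound n s w : 0 <= Phi n s w <= r * K * \1_(`[0, theta0]%classic) s.
Proof.
rewrite /Phi /step hp; case: ifPn => [/andP[s0' s1]|_].
  by rewrite indicE mem_set ?mulr1 ?F_bound//= in_itv/= s0' ltW.
by rewrite lexx mulr_ge0// indicE.
Qed.

Let Y n w := \int[leb]_s Phi n s w.

Let Y_sum n w : Y n w = \sum_(0 <= j < n.+1) F n j.+1 w * h n.
Proof. by rewrite /Y /Phi (step_Rint _ _ (h0 n)).2. Qed.

(** Using right end points splits off the gain of date 0, which carries a factor [h n] and
    disappears in the limit; the term of date [n.+1] is 0 by the convention in [F]. *)
Let berm_decomp n : berm (h n) n.+1 x = euro + h n * \int[Pr]_w G n 0%N w + \int[Pr]_w Y n w.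
Proof.
have -> : \int[Pr]_w Y n w = \sum_(0 <= j < n.+1) h n * \int[Pr]_w F n j.+1 w.
  transitivity (\int[Pr]_w \sum_(0 <= j < n.+1) F n j.+1 w * h n).
    by apply: eq_Rintegral => w _; exact: Y_sum.
  have I j : Pr.-Rint (fun w => F n j.+1 w * h n).
    by under eq_fun do rewrite mulrC; apply: RintZ; exact: F_Rint.
  have [_ ->] := Rint_sum (index_iota 0 n.+1) I.
  apply: eq_bigr => j _; rewrite -RintegralZl; [|exact: measurableT|exact: F_Rint].
  by apply: eq_Rintegral => w _; rewrite mulrC.
have a0 : a n 0%N = berm (h n) n.+1 x.
  rewrite /a mulr0n mulr0 oppr0 expR0 mul1r subn0.
  rewrite (levy_start0 hX (f := fun z => berm (h n) n.+1 (x * expR ((r - delta) * 0 + z)))).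
    by rewrite mulr0 addr0 expR0 mulr1.
  apply: (measurableT_comp (put_like_meas (gb n.+1 (ltW (h0 n))))); apply: measurable_funM => //.
  apply: (measurableT_comp (f := expR)); first exact: meas_exp.
  exact: measurable_funD.
have aN : a n n.+1 = euro by rewrite /a subnn hp.
have T : a n 0%N - a n n.+1 = \sum_(0 <= j < n.+1) h n * \int[Pr]_w G n j w.
  rewrite -opprB -(telescope_sumr (a n))// -sumrN; apply: eq_big_nat => j /andP[_ jn].
  by rewrite opprB a_step.
have -> : \sum_(0 <= j < n.+1) h n * \int[Pr]_w F n j.+1 w =
    \sum_(0 <= j < n) h n * \int[Pr]_w G n j.+1 w.
  have F0 : \int[Pr]_w F n n.+1 w = 0.
    by rewrite -[RHS](Rintegral_prob_cst Pr); apply: eq_Rintegral => w _; rewrite /F ltnn.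
  have F0h : h n * \int[Pr]_w F n n.+1 w = 0 by rewrite F0 mulr0.
  apply: (etrans (big_nat_recr n 0 (fun j => h n * \int[Pr]_w F n j.+1 w) (leq0n n))).
  apply: (etrans (congr1 (fun z => _ + z) F0h)); apply: (etrans (addr0 _)).
  apply: eq_big_nat => j /andP[_ jn]; congr (_ * _); apply: eq_Rintegral => w _.
  by rewrite /F ltnS jn.
have TT : \sum_(0 <= j < n.+1) h n * \int[Pr]_w G n j w =
    h n * \int[Pr]_w G n 0%N w + \sum_(0 <= j < n) h n * \int[Pr]_w G n j.+1 w.
  exact: (big_nat_recl n 0 (fun j => h n * \int[Pr]_w G n j w) (leq0n n)).
by rewrite -addrA -TT -T a0 aN addrC subrK.
Qed.

Let Y_limit : \int[Pr]_w Y n w @[n --> \oo] --> amer theta0 x - euro.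
Proof.
have c1 : berm (h n) n.+1 x @[n --> \oo] --> amer theta0 x.
  apply: (berm_cvg_fixed s20 hnu cPr hX hexp hmart r0 delta0 K0 (ltW th0) h0 hc _ (ltW x0)).
  by under eq_cvg do rewrite hp; exact: cvg_cst.
have c2 : h n * \int[Pr]_w G n 0%N w @[n --> \oo] --> 0.
  apply: (@squeeze_cvgr _ _ _ _ (fun=> 0) (fun n => h n * (r * K))).
  - apply: nearW => n; have hn := ltW (h0 n).
    have g0 : 0 <= \int[Pr]_w G n 0%N w by apply: Rintegral_ge0 => w _; have /andP[] := G_bound n 0 w.
    rewrite mulr_ge0//=; apply: ler_wpM2l => //.
    rewrite -[leRHS](Rintegral_prob_cst Pr); apply: le_Rintegral => //.
    + exact: G_Rint.
    + exact: (@Rint_bounded _ _ _ Pr _ `|r * K|).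
    + by move=> w _; have /andP[] := G_bound n 0 w.
  - exact: cvg_cst.
  - by rewrite -(mul0r (r * K)); apply: cvgMl.
have E n : \int[Pr]_w Y n w = berm (h n) n.+1 x - euro - h n * \int[Pr]_w G n 0%N w.
  by rewrite berm_decomp; ring.
under eq_cvg do rewrite E.
rewrite -(subr0 (amer theta0 x - euro)); apply: cvgB => //; apply: cvgB => //; exact: cvg_cst.
Qed.

Let N0 := projT1 (cid (levy_path hX)).
Let mN0 : measurable N0.
Proof. by rewrite /N0; case: (cid _) => N [] /=. Qed.
Let N00 : Pr N0 = 0%E.
Proof. by rewrite /N0; case: (cid _) => N [] /=. Qed.
Let hN0 w : ~ N0 w -> X 0 w = 0 /\ forall t (s : nat -> R), 0 <= t -> (forall n, t <= s n) ->
    s n @[n --> \oo] --> t -> X (s n) w @[n --> \oo] --> X t w.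
Proof. by rewrite /N0; case: (cid _) => N [] /= _ _; apply. Qed.

Let tn (s : R) n := h n *+ (Num.Def.trunc (s / h n)).+1.
Let tn_ge s n : 0 <= s -> s <= tn s n.
Proof. by move=> s0'; have /andP[] := grid_time (h0 n) s0'. Qed.
Let tn_cvg s : 0 <= s -> tn s n @[n --> \oo] --> s.
Proof.
move=> s0'; apply: (@squeeze_cvgr _ _ _ _ (fun=> s) (fun n => s + h n)).
- by apply: nearW => n; exact: grid_time.
- exact: cvg_cst.
- by rewrite -[X in _ --> X]addr0; apply: cvgD => //; exact: cvg_cst.
Qed.

Let stock_cvg s w : 0 <= s -> ~ N0 w -> S x (tn s n) w @[n --> \oo] --> S x s w.
Proof.
move=> s0' /hN0[_ rc]; apply: cvgMr; apply: (continuous_cvg _ (@continuous_expR R _)).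
apply: cvgD; first by apply: cvgMr; exact: tn_cvg.
by apply: rc => //; [move=> n; exact: tn_ge|exact: tn_cvg].
Qed.

(** A version of the stock jointly measurable in time and scenario, as a limit of step functions off
    the null set of irregular paths. *)
Let Zt (s : R) w := \1_(~` N0) w * (\1_(`[0, theta0[%classic) s * S x s w).

Let Zt_meas : measurable_fun setT (fun z : R * Omega => Zt z.1 z.2).
Proof.
pose Zn n (z : R * Omega) := \1_(~` N0) z.2 * step (h n) n.+1 (fun j => S x (h n *+ j.+1) z.2) z.1.
have mZ n : measurable_fun setT (Zn n).
  apply: measurable_funM.
    by apply: meas_indic_snd; exact: measurableC.
  apply: (step_meas n.+1 (f := fun j => S x (h n *+ j.+1)) (h0 n)) => j.
  exact: stock_meas hX _ _ _ _ (hi0 n j.+1).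
apply: (measurable_fun_cvg mZ) => -[s w] _ /=; rewrite /Zn /Zt /=.
have [wN|wN] := pselect (N0 w).
  rewrite indicE memNset/=; last by apply.
  by rewrite mul0r; apply: cvg_near_cst; apply: nearW => n; rewrite mul0r.
apply: cvgMr; rewrite /step.
have [/andP[s0' s1]|H] := boolP (0 <= s < theta0).
  rewrite indicE mem_set/= ?in_itv/= ?s0'// mul1r.
  have := stock_cvg s0' wN; apply: cvg_trans; apply: near_eq_cvg; apply: nearW => n.
  by rewrite hp s1.
rewrite indicE memNset/=; last by rewrite in_itv/=; exact/negP.
by rewrite mul0r; apply: cvg_near_cst; apply: nearW => n; rewrite hp (negPf H).
Qed.

(** Continued past maturity by the upper bound [K], so that it stays nondecreasing on the whole
    line, hence measurable. *)
Let mcrit (s : R) := if s < theta0 then crit (theta0 - s) else K.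

Let mcrit_meas : measurable_fun setT mcrit.
Proof.
apply: nondecreasing_measurable => // s s' ss; rewrite /mcrit.
case: ifPn => h1; case: ifPn => h2.
- apply: (crit_mono s20 hnu cPr hX hexp hmart r0 delta0 K0 hdeg); first by rewrite subr_gt0.
  by rewrite lerD2l lerN2.
- by apply: (crit_leK s20 hnu cPr hX hexp hmart r0 delta0 K0 hdeg); rewrite subr_gt0.
- by move: h1; rewrite (le_lt_trans ss h2).
- by [].
Qed.

Let hit (s : R) w := \1_(`]0, theta0[%classic) s * (\1_(~` N0) w * (\1_[set (0 : R)] (Zt s w - mcrit s) : R)).

Let hit_meas : measurable_fun setT (fun z : R * Omega => hit z.1 z.2).
Proof.
apply: measurable_funM.
  by apply: meas_indic_fst; exact: measurable_itv.
apply: measurable_funM.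
  by apply: meas_indic_snd; exact: measurableC.
have m1 : measurable_fun setT (\1_[set (0 : R)] : R -> R).
  by apply: measurable_indic; exact: measurable_set1.
apply: (measurableT_comp m1).
apply: measurable_funB; first exact: Zt_meas.
by apply: (measurableT_comp mcrit_meas); exact: measurable_fst.
Qed.

Let ind01 (T : Type) (A : set T) (t : T) : 0 <= (\1_A t : R) <= 1.
Proof. by rewrite indicE; case: (_ \in _); rewrite ?lexx ?ler01. Qed.

Let hit_bound s w : 0 <= hit s w <= 1.
Proof.
have /andP[a1 a2] := @ind01 _ (`]0, theta0[%classic) s.
have /andP[b1 b2] := @ind01 _ (~` N0) w.
have /andP[c1 c2] := @ind01 _ [set (0 : R)] (Zt s w - mcrit s).
by rewrite /hit !mulr_ge0//= mulr_ile1 ?mulr_ge0// mulr_ile1.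
Qed.

(** At a fixed positive time, being at the critical price prescribes the value [c] of [X s], an
    event of probability 0. *)
Let hit_null s : \int[Pr]_w hit s w = 0.
Proof.
have [/andP[s0' s1]|H] := boolP (0 < s < theta0); last first.
  rewrite -[RHS](Rintegral_prob_cst Pr); apply: eq_Rintegral => w _.
  rewrite /hit indicE memNset ?mul0r//= in_itv/=; exact/negP.
have sge := ltW s0'.
pose c := ln (mcrit s / x) - (r - delta) * s.
have mA : measurable (X s @^-1` [set c]) by rewrite -[X in measurable X]setTI; exact: (levy_meas hX sge).
have ms : measurable_fun setT (hit s).
  exact: (measurableT_comp hit_meas (pair1_measurable s)).
apply/eqP; rewrite eq_le; apply/andP; split; last first.
  by apply: Rintegral_ge0 => w _; have /andP[] := hit_bound s w.
have <- : \int[Pr]_w (\1_(X s @^-1` [set c]) w : R) = 0.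
  rewrite /Rintegral integral_indic// setIT.
  by transitivity (fine (0%E : \bar R)) => //; congr fine; exact: hatom.
apply: le_Rintegral => //.
- apply: (@Rint_bounded _ _ _ Pr _ 1) => // w.
  by have /andP[u1 u2] := hit_bound s w; rewrite ger0_norm.
- apply: (@Rint_bounded _ _ _ Pr _ 1); first exact: measurable_indic.
  by move=> w; have /andP[u1 u2] := @ind01 _ (X s @^-1` [set c]) w; rewrite ger0_norm.
move=> w _; rewrite /hit.
have [wN|wN] := pselect (N0 w).
  rewrite [X in _ * (X * _)]indicE memNset/=; last by apply.
  by rewrite mul0r mulr0 indicE.
have [E|E] := eqVneq (Zt s w - mcrit s) 0; last first.
  by rewrite [X in _ * (_ * X)]indicE memNset/= ?mulr0 ?indicE//; exact/eqP.
suff -> : \1_(X s @^-1` [set c]) w = 1 :> R.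
  by have := hit_bound s w; rewrite /hit => /andP[].
rewrite indicE mem_set//= /c.
move/eqP : E; rewrite subr_eq0 => /eqP <-.
rewrite /Zt indicE mem_set//= mul1r indicE mem_set/= ?in_itv/= ?sge// mul1r.
rewrite /stock mulrAC divff ?gt_eqF// mul1r expRK.
by rewrite addrAC subrr add0r.
Qed.

(** Time 0 is added by hand: the absence of atoms is known for positive times, and the gains are
    followed on the open interval only. *)
Let bad (s : R) w := hit s w + \1_[set (0 : R)] s.

Let dom (s : R) : R := 2 * \1_(`[0, theta0]%classic) s.

Let bad_bound s w : `|bad s w| <= dom s.
Proof.
have /andP[u1 u2] := hit_bound s w.
have /andP[v1 v2] := @ind01 _ [set (0 : R)] s.
rewrite ger0_norm ?addr_ge0// /dom.
have [si|si] := boolP (s \in (`[0, theta0]%classic : set R)).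
  by rewrite [leRHS]mulr_natl indicE si mulr2n lerD.
have sn : ~ (0 <= s <= theta0).
  by move=> H; move/negP : si; apply; rewrite mem_set//= in_itv.
rewrite /bad /hit [X in X * _]indicE memNset/=; last first.
  by rewrite in_itv/= => /andP[p1 p2]; apply: sn; rewrite !ltW.
rewrite mul0r add0r [leLHS]indicE memNset/= ?mulr_ge0 ?indicE// => s0'.
by apply: sn; rewrite s0' lexx ltW.
Qed.

Let dom_Rint : leb.-Rint dom.
Proof. by apply: RintZ; exact: itv_Rint. Qed.

Let bad_mean : \int[Pr]_w \int[leb]_s bad s w = 0 /\
  Pr.-Rint (fun w => \int[leb]_s bad s w).
Proof.
have g10 s : 0 <= dom s by rewrite mulr_ge0// indicE.
have ig2 : Pr.-Rint (fun=> 1 : R) by exact: (@Rint_bounded _ _ _ Pr _ `|1|).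
have mb : measurable_fun setT (fun z : R * Omega => bad z.1 z.2).
  apply: measurable_funD; first exact: hit_meas.
  by apply: meas_indic_fst; exact: measurable_set1.
have bb s w : `|bad s w| <= dom s * 1 by rewrite mulr1.
have [H1 H2 H3] := @RFubini _ _ _ _ _ leb Pr bad dom (fun=> 1) mb g10 (fun=> ler01) dom_Rint ig2 bb.
split => //; rewrite -H3.
have -> : \int[leb]_s \int[Pr]_w bad s w = \int[leb]_s (1 * \1_[set (0 : R)] s).
  apply: eq_Rintegral => s _; rewrite /bad mul1r RintegralD//.
  - by rewrite hit_null add0r Rintegral_prob_cst.
  - apply: (@Rint_bounded _ _ _ Pr _ 1).
      exact: (measurableT_comp hit_meas (pair1_measurable s)).
    by move=> w; have /andP[u1 u2] := hit_bound s w; rewrite ger0_norm.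
  - by apply: (@Rint_bounded _ _ _ Pr _ 1) => // w; have /andP[u1 u2] := @ind01 _ [set (0 : R)] s; rewrite ger0_norm.
by have [_ ->] := point_Rint (0 : R) 1.
Qed.

Let clean (s : R) w := \1_(`]0, theta0[%classic) s * (1 - hit s w).

Let clean_meas : measurable_fun setT (fun z : R * Omega => clean z.1 z.2).
Proof.
apply: measurable_funM.
  by apply: meas_indic_fst; exact: measurable_itv.
by apply: measurable_funB => //; exact: hit_meas.
Qed.

Let clean_bound s w : 0 <= clean s w <= 1.
Proof.
have /andP[a1 a2] := @ind01 _ (`]0, theta0[%classic) s.
have /andP[u1 u2] := hit_bound s w.
have v1 : 0 <= 1 - hit s w by rewrite subr_ge0.
have v2 : 1 - hit s w <= 1 by rewrite gerBl.
by rewrite mulr_ge0//= mulr_ile1.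
Qed.

Let Phi_meas n : measurable_fun setT (fun z : R * Omega => Phi n z.1 z.2).
Proof. by apply: (step_meas n.+1 (f := fun j => F n j.+1) (h0 n)) => j; exact: F_meas. Qed.

Let density (s : R) w := \1_(`]0, theta0[%classic) s * (rate (theta0 - s) (S x s w) * expR (- (r * s))).

(** At the critical price [clean] is 0 on one side and the strict indicator in [rate] is 0 on the
    other. Elsewhere in the open interval [gain_cvg] applies with time to maturity [theta0 - s] and
    the stock sampled at grid times. *)
Let Phi_clean_cvg s w : ~ N0 w -> Phi n s w * clean s w @[n --> \oo] --> density s w.
Proof.
move=> wN; rewrite /clean /density.
have [/andP[s0' s1]|H] := boolP (0 < s < theta0); last first.
  rewrite indicE memNset/=; last by rewrite in_itv/=; exact/negP.
  by rewrite mul0r; apply: cvg_near_cst; apply: nearW => n; rewrite mul0r mulr0.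
have sge := ltW s0'.
have in1 : \1_(`]0, theta0[%classic) s = 1 :> R.
  by rewrite indicE mem_set//= in_itv/= s0' s1.
rewrite in1 !mul1r.
have ZE : Zt s w = S x s w.
  by rewrite /Zt !indicE !mem_set//= ?in_itv/= ?sge// !mul1r.
have mE : mcrit s = crit (theta0 - s) by rewrite /mcrit s1.
have [E|E] := eqVneq (S x s w) (crit (theta0 - s)).
  have -> : hit s w = 1.
    by rewrite /hit in1 ZE mE E subrr !indicE !mem_set//= !mul1r.
  rewrite subrr /rate [X in _ * X * _]indicE memNset/=; last by rewrite E ltxx.
  by rewrite mulr0 mul0r; apply: cvg_near_cst; apply: nearW => n; rewrite mulr0.
have -> : hit s w = 0.
  rewrite /hit ZE mE [X in _ * (_ * X)]indicE memNset/= ?mulr0//.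
  by apply/eqP; rewrite subr_eq0.
rewrite subr0; under eq_cvg do rewrite mulr1.
pose jn n := (Num.Def.trunc (s / h n)).+1.
have tc := tn_cvg sge.
have th_s : 0 < theta0 - s by rewrite subr_gt0.
have jlt : \forall n \near \oo, (jn n < n.+1)%N.
  apply: filterS (cvgn_lt tc s1) => n; rewrite /tn -(hp n) => H.
  by rewrite ltnNge; apply/negP => H2; move: H; rewrite ltNge ler_wpMn2l// ltW.
have gc : gain (h n) (n - jn n)%N (S x (tn s n) w) @[n --> \oo] --> rate (theta0 - s) (S x s w).
  apply: (gain_cvg s20 hnu cPr hX hexp hmart r0 delta0 K0 hdeg th_s h0 hc) => //.
  (* One step is missing from [theta0 - tn s n] because [gain] with index [m] concerns [m.+1]
     remaining steps; the condition on [(mn n).+1] then reads [s <= tn s n]. *)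
  - have L : theta0 - h n - tn s n @[n --> \oo] --> theta0 - s.
      rewrite -[X in _ --> X - _]subr0; apply: cvgB => //; apply: cvgB => //; exact: cvg_cst.
    apply: cvg_trans L; apply: near_eq_cvg; apply: filterS jlt => n; rewrite ltnS => jn_le.
    by rewrite mulrnBr// -[X in X - _ - _](hp n) mulrSr addrK.
  - apply: filterS jlt => n; rewrite ltnS => jn_le.
    rewrite -subSn// mulrnBr ?(leq_trans jn_le)// hp lerD2l lerN2.
    exact: tn_ge.
  - exact: stock_cvg.
  - exact/eqP.
have L : gain (h n) (n - jn n)%N (S x (tn s n) w) * expR (- (r * tn s n)) @[n --> \oo] -->
    rate (theta0 - s) (S x s w) * expR (- (r * s)).
  apply: cvgM => //; apply: (continuous_cvg _ (@continuous_expR R _)).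
  by apply: cvgN; apply: cvgMr.
apply: cvg_trans L; apply: near_eq_cvg; apply: filterS jlt => n jn_lt.
by rewrite /Phi /step hp sge s1/= /F -/(jn n) jn_lt /G mulrC.
Qed.

Let PC_bound n s w : `|Phi n s w * clean s w| <= r * K * \1_(`[0, theta0]%classic) s.
Proof.
have /andP[a1 a2] := Phi_bound n s w; have /andP[b1 b2] := clean_bound s w.
have p1 : Phi n s w * clean s w <= Phi n s w by rewrite ler_piMr.
rewrite ger0_norm; [exact: (le_trans p1 a2)|exact: mulr_ge0].
Qed.

Let itvI : leb.-Rint (fun s => r * K * \1_(`[0, theta0]%classic) s).
Proof. by apply: RintZ; exact: itv_Rint. Qed.

Let A n w := \int[leb]_s (Phi n s w * clean s w).

Let PC_meas n : measurable_fun setT (fun z : R * Omega => Phi n z.1 z.2 * clean z.1 z.2).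
Proof. by apply: measurable_funM; [exact: Phi_meas|exact: clean_meas]. Qed.

Let A_Rint n : Pr.-Rint (A n).
Proof.
have ig2 : Pr.-Rint (fun=> 1 : R) by exact: (@Rint_bounded _ _ _ Pr _ `|1|).
have g10 s : 0 <= r * K * \1_(`[0, theta0]%classic) s by rewrite mulr_ge0// indicE.
have bb s w : `|Phi n s w * clean s w| <= r * K * \1_(`[0, theta0]%classic) s * 1.
  by rewrite mulr1; exact: PC_bound.
by have [] := @RFubini _ _ _ _ _ leb Pr (fun s w => Phi n s w * clean s w) _ (fun=> 1) (PC_meas n) g10 (fun=> ler01) itvI ig2 bb.
Qed.

Let PC_Rint n w : leb.-Rint (fun s => Phi n s w * clean s w).
Proof.
refine (@le_Rint _ _ _ leb _ (fun s => r * K * \1_(`[0, theta0]%classic) s) _ itvI (fun s => PC_bound n s w)).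
exact: (measurableT_comp (PC_meas n) (pair2_measurable w)).
Qed.

Let Y_Rint n : Pr.-Rint (Y n).
Proof.
have -> : Y n = (fun w => \sum_(0 <= j < n.+1) h n * F n j.+1 w).
  by apply/funext => w; rewrite Y_sum; apply: eq_bigr => j _; rewrite mulrC.
have I j : Pr.-Rint (fun w => h n * F n j.+1 w) by apply: RintZ; exact: F_Rint.
by have [] := Rint_sum (index_iota 0 n.+1) I.
Qed.

(** By Fubini, the expected time spent at the critical price is an integral over [s] of null
    probabilities, so the factor [clean] does not change the expectation. *)
Let Y_A n : \int[Pr]_w Y n w = \int[Pr]_w A n w.
Proof.
have [B0 IB] := bad_mean.
have IPhi w : leb.-Rint (fun s => Phi n s w) by have [] := step_Rint n.+1 (fun j => F n j.+1 w) (h0 n).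
have YA w : 0 <= Y n w - A n w <= r * K * \int[leb]_s bad s w.
  rewrite /Y /A -RintegralB; [|exact: measurableT|exact: IPhi|exact: PC_Rint].
  have D s : 0 <= Phi n s w - Phi n s w * clean s w <= r * K * bad s w.
    have /andP[p1 p2] := Phi_bound n s w; have /andP[c1 c2] := clean_bound s w.
    have /andP[u1 u2] := hit_bound s w; have /andP[v1 v2] := @ind01 _ [set (0 : R)] s.
    have b0 : 0 <= bad s w by rewrite addr_ge0.
    rewrite -{1 3}[Phi n s w]mulr1 -mulrBr mulr_ge0 ?subr_ge0//=.
    have [si|si] := boolP (s \in (`[0, theta0[%classic : set R)); last first.
      rewrite /Phi /step hp ifF; first by rewrite mul0r; apply: mulr_ge0.
      by apply/negP => H; move/negP : si; apply; rewrite mem_set//= in_itv.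
    have p3 : Phi n s w <= r * K.
      by apply: (le_trans p2); rewrite ler_piMr//; have /andP[] := @ind01 _ (`[0, theta0]%classic) s.
    apply: ler_pM => //; first by rewrite subr_ge0.
    move: si => /set_mem/=; rewrite in_itv/= => /andP[s0' s1].
    rewrite /bad /clean; move: s0'; rewrite le_eqVlt => /orP[/eqP <-|s0'].
      have -> : \1_[set (0 : R)] (0 : R) = 1 :> R by rewrite indicE mem_set.
      rewrite lerBlDr -addrA; apply: (@le_trans _ _ (1 + 0)); first by rewrite addr0.
      have /andP[k1 _] := clean_bound 0 w; have /andP[k2 _] := hit_bound 0 w.
      by rewrite addr0 addrCA lerDl addr_ge0.
    rewrite [X in 1 - X * _]indicE mem_set/= ?in_itv/= ?s0'// mul1r.
    by rewrite opprB addrCA subrr addr0 lerDl.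
  have mB : measurable_fun setT (fun s => bad s w).
    apply: measurable_funD; first exact: (measurableT_comp hit_meas (pair2_measurable w)).
    by apply: measurable_indic; exact: measurable_set1.
  have IBs : leb.-Rint (fun s => bad s w).
    exact: (@le_Rint _ _ _ leb _ dom mB dom_Rint (fun s => bad_bound s w)).
  apply/andP; split; first by apply: Rintegral_ge0 => s _; have /andP[] := D s.
  rewrite -RintegralZl//; apply: le_Rintegral => //.
  - by apply: RintB.
  - exact: RintZ.
  - by move=> s _; have /andP[] := D s.
apply/eqP; rewrite -subr_eq0 -RintegralB; [|exact: measurableT|exact: Y_Rint|exact: A_Rint].
rewrite eq_le; apply/andP; split; last by apply: Rintegral_ge0 => w _; have /andP[] := YA w.
apply: (@le_trans _ _ (\int[Pr]_w (r * K * \int[leb]_s bad s w))).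
  apply: le_Rintegral => //.
  - by apply: RintB; [exact: Y_Rint|exact: A_Rint].
  - exact: RintZ.
  - by move=> w _; have /andP[] := YA w.
by rewrite RintegralZl// B0 mulr0.
Qed.

Let density_bound s w : ~ N0 w -> 0 <= density s w <= r * K * \1_(`[0, theta0]%classic) s.
Proof.
move=> wN; have c := @Phi_clean_cvg s w wN; have n0 n : 0 <= Phi n s w * clean s w.
  by have /andP[a1 _] := Phi_bound n s w; have /andP[b1 _] := clean_bound s w; exact: mulr_ge0.
apply/andP; split.
  by apply: (ler_cvg_to (cvg_cst _) c); apply: nearW.
apply: (ler_cvg_to c (cvg_cst _)); apply: nearW => n.
exact: le_trans (ler_norm _) (PC_bound n s w).
Qed.

Let density_Rint w : ~ N0 w -> leb.-Rint (fun s => density s w).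
Proof.
move=> wN.
have m n : measurable_fun setT (fun s : R => Phi n s w * clean s w).
  exact: (measurableT_comp (PC_meas n) (pair2_measurable w)).
by have [] := @Rdominated _ _ _ leb _ (fun s => density s w) _ m (fun s => @Phi_clean_cvg s w wN) itvI (fun n s => PC_bound n s w).
Qed.

(** The exceptional set is part of the conclusion because the limit in time is taken path by path,
    and integrability in time is known only for regular paths. *)
Lemma amer_representation : exists N, [/\ measurable N, Pr N = 0%E,
  (forall w, ~ N w -> leb.-Rint (fun s => \1_(`]0, theta0[%classic) s *
     (rate (theta0 - s) (S x s w) * expR (- (r * s))))),
  Pr.-Rint (fun w => \int[leb]_s (\1_(`]0, theta0[%classic) s *
     (rate (theta0 - s) (S x s w) * expR (- (r * s))))) &
  amer theta0 x = expR (- (r * theta0)) * \int[Pr]_w pay (S x theta0 w) +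
    \int[Pr]_w \int[leb]_s (\1_(`]0, theta0[%classic) s *
     (rate (theta0 - s) (S x s w) * expR (- (r * s))))].
Proof.
exists N0.
have Ac w : ~ N0 w -> A n w @[n --> \oo] --> \int[leb]_s density s w.
  move=> wN.
  have m n : measurable_fun setT (fun s : R => Phi n s w * clean s w).
    exact: (measurableT_comp (PC_meas n) (pair2_measurable w)).
  by have [] := @Rdominated _ _ _ leb _ (fun s => density s w) _ m (fun s => @Phi_clean_cvg s w wN) itvI (fun n s => PC_bound n s w).
have AB n w : `|A n w| <= \int[leb]_s (r * K * \1_(`[0, theta0]%classic) s).
  apply: (le_trans (@le_normr_Rintegral _ _ _ leb _ _ measurableT (PC_Rint n w))).
  apply: le_Rintegral => //; exact: (integrable_norm (PC_Rint n w)).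
have [mD cD] := Rdominated_complete cPr mN0 N00 (fun n => Rint_measurable (A_Rint n)) AB Ac.
split => //.
  apply: (@Rint_bounded_ae _ _ _ Pr N0 _ (\int[leb]_s (r * K * \1_(`[0, theta0]%classic) s)) mN0 N00 mD) => w wN.
  apply: (le_trans (@le_normr_Rintegral _ _ _ leb _ _ measurableT (density_Rint wN))).
  apply: le_Rintegral => //; first exact: (integrable_norm (density_Rint wN)).
  by move=> s _; have /andP[a1 a2] := @density_bound s w wN; rewrite ger0_norm.
have L := Y_limit.
have E : (fun n => \int[Pr]_w Y n w) = (fun n => \int[Pr]_w A n w) by apply/funext => n; exact: Y_A.
rewrite E in L; have U := @cvg_unique _ (@Rhausdorff R) _ _ _ _ L cD.
by rewrite -/euro -[LHS](subrK euro) addrC U.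
Qed.

End horizon.

End representation.

(** * Starting point 0 and the formula with extended-real integrals *)

Section final.
Context {R : realType} {d : measure_display} {Omega : measurableType d}.
Variables (Pr : probability Omega R) (X : R -> Omega -> R).
Variables (sigma2 gamma : R) (nu : {sigma_finite_measure set R -> \bar R}).
Hypotheses (s20 : 0 <= sigma2) (hnu : levy_measure nu)
  (cPr : measure_is_complete Pr)
  (hX : is_levy_process Pr X sigma2 gamma nu).
Hypothesis hexp : (\int[nu]_(y in [set y : R | (1 <= `|y|)%R]) (expR y)%:E < +oo)%E.
Hypothesis hmart : ((sigma2 / 2 + gamma)%:E
     + \int[nu]_y (expR y - 1 - y * \1_[set z : R | (`|z| <= 1)%R] y)%R%:E = 0)%E.
Variables (r delta K : R).
Hypotheses (r0 : 0 < r) (delta0 : 0 <= delta) (K0 : 0 < K).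
Hypothesis hdeg : sigma2 != 0 \/ (0 < nu [set y : R | (y < 0)%R])%E \/
     (\int[nu]_(y in [set y : R | (0 < y)%R]) (minr y 1)%:E = +oo)%E.
Hypothesis hatom : forall s a, 0 < s -> Pr (X s @^-1` [set a]) = 0%E.

Local Notation leb := (@lebesgue_measure R).
Local Notation S := (stock X r delta).
Local Notation pay := (pay K).
Local Notation amer := (amer Pr X r delta K).
Local Notation crit := (crit Pr X r delta K).
Local Notation rate := (rate Pr X nu r delta K).

Lemma rate_le theta y : 0 <= theta -> 0 <= y -> rate theta y <= r * K.
Proof.
move=> th0 y0; rewrite /rate indicE.
have I0 : 0 <= Rintegral nu `]0%R, +oo[ (fun z => amer theta (y * expR z) - (K - y * expR z)).
  apply: Rintegral_ge0 => z _; rewrite subr_ge0.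
  have yz : 0 <= y * expR z by rewrite mulr_ge0 ?expR_ge0.
  apply: (le_trans _ (pay_le_amer s20 hnu cPr hX hexp hmart r0 delta0 K0 th0 yz)).
  by rewrite /pay ger0_norm// le_max lexx.
have dy : 0 <= delta * y by exact: mulr_ge0.
have rK : 0 <= r * K by rewrite mulr_ge0// ltW.
case: (_ \in _); last by rewrite mulr0.
by rewrite mulr1 -addrA gerDl -opprD oppr_le0 addr_ge0.
Qed.

(** If the critical price vanished at [theta], it would vanish for all longer horizons. With horizon
    [theta + 1] no premium would then accrue before time 1, and the price would be at most
    [K * expR (- r)], which is less than the payoff at small stocks. *)
Lemma crit_gt0 theta : 0 < theta -> 0 < crit theta.
Proof.
move=> th0; rewrite ltNge; apply/negP => c0.
have th1 : 0 < theta + 1 by rewrite addr_gt0.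
have e1 : expR (- (r * 1)) < 1 by rewrite -[ltRHS]expR0 ltr_expR oppr_lt0 mulr1.
(* Half of the gap between [K] and [K * expR (- r)], so that [K - x] still exceeds the latter. *)
pose x := K * (1 - expR (- (r * 1))) / 2.
have x0 : 0 < x by rewrite !mulr_gt0// subr_gt0.
have [N [mN N0 dI JI E]] :=
  amer_representation s20 hnu cPr hX hexp hmart r0 delta0 K0 hdeg hatom th1 x0.
have [I1 V1] := @discount_integral R r (theta + 1) r0 th1.
have [I2 V2] := @discount_integral R r 1 r0 ltr01.
have B w : ~ N w -> \int[leb]_s (\1_(`]0, theta + 1[%classic) s *
     (rate (theta + 1 - s) (S x s w) * expR (- (r * s)))) <=
     K * (expR (- (r * 1)) - expR (- (r * (theta + 1)))).
  move=> wN.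
  have -> : K * (expR (- (r * 1)) - expR (- (r * (theta + 1)))) =
    \int[leb]_s (K * (r * (expR (- (r * s)) * \1_(`[0, theta + 1]%classic) s)
      - r * (expR (- (r * s)) * \1_(`[0, 1]%classic) s))).
    rewrite RintegralZl; [|exact: measurableT|].
      rewrite RintegralB; [|exact: measurableT|exact: RintZ|exact: RintZ].
      by rewrite V1 V2; congr (_ * _); lra.
    by apply: RintB; exact: RintZ.
  apply: le_Rintegral => //.
  - exact: dI.
  - by apply: RintZ; apply: RintB; exact: RintZ.
  move=> s _.
  have es := expR_ge0 (- (r * s)).
  have Sp : 0 < S x s w by rewrite mulr_gt0// expR_gt0.
  have [|sn] := boolP (0 < s < theta + 1); last first.
    rewrite [X in X * _ <= _]indicE memNset/=; last by rewrite in_itv/=; exact/negP.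
    rewrite mul0r mulr_ge0 ?(ltW K0)// subr_ge0; apply: ler_wpM2l; first exact: ltW.
    apply: ler_wpM2l => //; rewrite !indicE.
    have [|_] := boolP (s \in (`[0, 1]%classic : set R)); last by case: (_ \in _).
    move/set_mem; rewrite /= in_itv/= => /andP[u1 u2].
    by rewrite mem_set//= in_itv/= u1 (le_trans u2)// lerDr ltW.
  move=> /andP[sp s1].
  rewrite [X in X * _ <= _]indicE mem_set/= ?in_itv/= ?sp// mul1r.
  rewrite [X in _ * (_ * (_ * X) - _)]indicE mem_set/= ?in_itv/= ?(ltW sp) ?(ltW s1)// mulr1.
  have [ss|ss] := leP s 1.
    rewrite [X in _ * (_ - _ * (_ * X))]indicE mem_set/= ?in_itv/= ?(ltW sp) ?ss// mulr1 subrr mulr0.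
    rewrite /rate indicE memNset ?mulr0 ?mul0r//= => H.
    have := le_trans (crit_mono s20 hnu cPr hX hexp hmart r0 delta0 K0 hdeg th0 (theta' := theta + 1 - s) _) c0.
    move=> /(_ _)/(lt_le_trans H) H2.
    have : S x s w < 0 by apply: H2; rewrite -addrA lerDl subr_ge0.
    by rewrite ltNge (ltW Sp).
  rewrite [X in _ * (_ - _ * (_ * X))]indicE memNset/= ?mulr0 ?subr0; last first.
    by rewrite in_itv/= => /andP[_]; rewrite leNgt ss.
  rewrite mulrA (mulrC K r); apply: ler_wpM2r => //.
  by apply: rate_le; [rewrite subr_ge0 ltW|exact: ltW].
have J : \int[Pr]_w \int[leb]_s (\1_(`]0, theta + 1[%classic) s *
     (rate (theta + 1 - s) (S x s w) * expR (- (r * s)))) <=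
     K * (expR (- (r * 1)) - expR (- (r * (theta + 1)))).
  set c := (X in _ <= X); set J := (fun w : Omega => \int[leb]_s _) in JI B *.
  have mJ := Rint_measurable JI.
  (* The bound [B] is known off [N] only; taking the minimum with the constant makes it hold
     everywhere and changes the integrand on a null set. *)
  have NE w : ~ N w -> J w = minr (J w) c by move=> /B H; rewrite min_l.
  have mM := complete_measurable cPr mN N0 NE mJ.
  rewrite (Rintegral_ae cPr mN N0 NE mJ) -[leRHS](Rintegral_prob_cst Pr).
  apply: le_Rintegral => //.
  - have Ic : Pr.-Rint (fun=> `|c|) by apply: (@Rint_bounded _ _ _ Pr _ `|c|) => // w; rewrite normr_id.
    apply: (le_Rint mM (RintD (integrable_norm JI) Ic)) => w /=.
    by case: (leP (J w) c) => _; rewrite (lerDl, lerDr).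
  - exact: (@Rint_bounded _ _ _ Pr _ `|c|).
  - by move=> w _; rewrite ge_min lexx orbT.
have P1 : \int[Pr]_w pay (S x (theta + 1) w) <= K.
  rewrite -[leRHS](Rintegral_prob_cst Pr); apply: le_Rintegral => //.
  - exact: (put_like_stock_Rint hX r delta x (put_like_pay K0) (ltW th1)).
  - exact: (@Rint_bounded _ _ _ Pr _ `|K|).
  - by move=> w _; exact: (put_like_leK _ (put_like_pay K0)).
have L := pay_le_amer s20 hnu cPr hX hexp hmart r0 delta0 K0 (ltW th1) (ltW x0).
have xp : K - x <= pay x by rewrite /pay ger0_norm ?(ltW x0)// le_max lexx.
have := le_trans xp L; rewrite E leNgt => /negP; apply.
apply: (@le_lt_trans _ _ (expR (- (r * (theta + 1))) * K + K * (expR (- (r * 1)) - expR (- (r * (theta + 1)))))).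
  by apply: lerD => //; apply: ler_wpM2l => //; exact: expR_ge0.
rewrite /x; move: e1 K0; move: (expR (- (r * 1))) (expR (- (r * (theta + 1)))) => a b a1 k0.
by nra.
Qed.

(** The open time interval becomes closed, its end points being Lebesgue null, and the real iterated
    integral becomes an extended-real one off the exceptional set. *)
Lemma premium_pos theta0 x : 0 < theta0 -> 0 < x ->
  ((amer theta0 x)%:E = (expR (- (r * theta0)) * \int[Pr]_w pay (S x theta0 w))%R%:E +
    \int[Pr]_w \int[leb]_(s in `[0%R, theta0]) (rate (theta0 - s) (S x s w) * expR (- (r * s)))%R%:E)%E.
Proof.
move=> th0 x0.
have [N [mN N0 dI JI E]] :=
  amer_representation s20 hnu cPr hX hexp hmart r0 delta0 K0 hdeg hatom th0 x0.
rewrite {}E EFinD; congr (_ + _)%E.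
have inner w : ~ N w -> (\int[leb]_(s in `[0%R, theta0]) (rate (theta0 - s) (S x s w) * expR (- (r * s)))%R%:E =
    (\int[leb]_s (\1_(`]0, theta0[%classic) s *
     (rate (theta0 - s) (S x s w) * expR (- (r * s)))))%:E)%E.
  move=> /dI dw.
  have mf : measurable_fun `]0%R, theta0[ (fun s => (rate (theta0 - s) (S x s w) * expR (- (r * s)))%:E).
    apply: (@eq_measurable_fun _ _ _ _ _ (fun s => (\1_(`]0, theta0[%classic) s *
      (rate (theta0 - s) (S x s w) * expR (- (r * s))))%:E)).
      by move=> s /= si; rewrite indicE si mul1r.
    exact: (measurable_funS measurableT (@subsetT _ _) (measurable_int _ dw)).
  rewrite (integral_itv_bndoo _ _ mf) integral_mkcond/= /Rintegral fineK; last exact: integrable_fin_num.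
  apply: eq_integral => s _; rewrite patchE indicE; case: (_ \in _); first by rewrite mul1r.
  by rewrite mul0r.
rewrite /Rintegral fineK; last exact: integrable_fin_num.
have ae : ae_eq Pr setT (fun w => (\int[leb]_s (\1_(`]0, theta0[%classic) s *
     (rate (theta0 - s) (S x s w) * expR (- (r * s)))))%:E)
   (fun w => \int[leb]_(s in `[0%R, theta0]) (rate (theta0 - s) (S x s w) * expR (- (r * s)))%R%:E)%E.
  by exists N; split => // w /= H; apply: contrapT => Nw; apply: H => _; rewrite inner.
apply: ae_eq_integral => //; first exact: measurable_int JI.
by apply: (ae_measurable_fun cPr ae); exact: measurable_int JI.
Qed.

Lemma amer0 theta : 0 <= theta -> amer theta 0 = K.
Proof.
move=> th0; apply/eqP; rewrite eq_le (amer_leK s20 hnu cPr hX hexp hmart r0 delta0 K0)//=.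
apply: le_trans (pay_le_amer s20 hnu cPr hX hexp hmart r0 delta0 K0 th0 (lexx 0)).
by rewrite /pay normr0 subr0 le_max lexx.
Qed.

Lemma rate0 theta : 0 < theta -> rate theta 0 = r * K.
Proof.
move=> th0; rewrite /rate indicE mem_set/= ?crit_gt0// mulr1 mulr0 subr0.
rewrite (_ : Rintegral _ _ _ = 0) ?subr0//.
rewrite /Rintegral integral0_eq// => z _.
by rewrite mul0r amer0 ?ltW// subr0 subrr.
Qed.

(** The stock stays at 0, where the price is [K] and, the critical price being positive, the rate is
    [r * K]; its discounted integral makes up for the discount in the European price. *)
Lemma premium0 theta0 : 0 < theta0 ->
  ((amer theta0 0)%:E = (expR (- (r * theta0)) * \int[Pr]_w pay (S 0 theta0 w))%R%:E +
    \int[Pr]_w \int[leb]_(s in `[0%R, theta0]) (rate (theta0 - s) (S 0 s w) * expR (- (r * s)))%R%:E)%E.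
Proof.
move=> th0.
have S0 s w : S 0 s w = 0 by rewrite /stock mul0r.
have [I1 V1] := @discount_integral R r theta0 r0 th0.
have inner w : (\int[leb]_(s in `[0%R, theta0]) (rate (theta0 - s) (S 0 s w) * expR (- (r * s)))%R%:E =
    (K * (1 - expR (- (r * theta0))))%:E)%E.
  have me : measurable_fun setT (fun s : R => (r * K * expR (- (r * s)))%:E).
    apply/measurable_EFinP; apply: measurable_funM => //; apply: (measurableT_comp (f := expR)); first exact: meas_exp.
    by apply: measurableT_comp => //; exact: measurable_funM.
  have fE : {in (`]0, theta0[%classic : set R), (fun s : R => (r * K * expR (- (r * s)))%:E)
      =1 (fun s => (rate (theta0 - s) (S 0 s w) * expR (- (r * s)))%:E)}.
    move=> s /set_mem; rewrite /= in_itv/= => /andP[_ s1].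
    by rewrite S0 rate0// subr_gt0.
  have mr : measurable_fun `]0%R, theta0[ (fun s : R => (r * K * expR (- (r * s)))%:E).
    exact: (measurable_funS measurableT (@subsetT _ _) me).
  have mR := eq_measurable_fun _ fE mr; rewrite (integral_itv_bndoo _ _ mR).
  transitivity (\int[leb]_(s in `]0%R, theta0[) (r * K * expR (- (r * s)))%:E)%E.
    by apply: eq_integral => s si; rewrite fE.
  rewrite -(@integral_itv_bndoo _ _ _ _ true false)//.
  rewrite -V1 -RintegralZl; [|exact: measurableT|exact: RintZ].
  rewrite integral_mkcond/= /Rintegral fineK; last first.
    by apply: integrable_fin_num => //; apply: RintZ; exact: RintZ.
  apply: eq_integral => s _; rewrite patchE indicE; case: (_ \in _); last by rewrite !mulr0.
  by rewrite mulr1 mulrCA mulrA.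
rewrite amer0 ?ltW//.
under eq_integral do rewrite inner.
have cst_mean c : (\int[Pr]_w c%:E = c%:E)%E.
  by rewrite integral_cst//= (@probability_setT _ _ _ Pr) mule1.
rewrite cst_mean -EFinD; congr (_%:E).
under eq_Rintegral do rewrite S0 /pay normr0 subr0 (max_l (ltW K0)).
rewrite Rintegral_prob_cst; ring.
Qed.

Lemma premium theta0 x : 0 < theta0 -> 0 <= x ->
  ((amer theta0 x)%:E = (expR (- (r * theta0)) * \int[Pr]_w pay (S x theta0 w))%R%:E +
    \int[Pr]_w \int[leb]_(s in `[0%R, theta0]) (rate (theta0 - s) (S x s w) * expR (- (r * s)))%R%:E)%E.
Proof.
by move=> th0; rewrite le_eqVlt => /predU1P[<-|]; [exact: premium0|exact: premium_pos].
Qed.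

End final.

(** A synonym of the measure whose type mentions the proof of sigma-finiteness, so that the
    corresponding structure can be attached to it. *)
Definition sigma_finite_copy {d} {T : measurableType d} {R : realType}
  (nu : {measure set T -> \bar R}) (h : sigma_finite setT nu) : set T -> \bar R := nu.

Section sigma_finite_copy.
Context {d} {T : measurableType d} {R : realType} (nu : {measure set T -> \bar R}).
Hypothesis h : sigma_finite setT nu.
HB.instance Definition _ := Measure.copy (sigma_finite_copy h) nu.
HB.instance Definition _ := @Measure_isSigmaFinite.Build _ _ _ (sigma_finite_copy h) h.

Lemma sigma_finite_measure_exists :
  exists nu' : {sigma_finite_measure set T -> \bar R}, nu = nu'.
Proof. by exists (sigma_finite_copy h); exact: eq_measure. Qed.

End sigma_finite_copy.

(** A finite measure integrates [|y|] over the unit ball to at most its total mass. *)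
Lemma small_jumps_infinite {R : realType} (nu : {measure set R -> \bar R}) :
  (\int[nu]_(y in [set y : R | (`|y| <= 1)%R]) (`|y|)%R%:E = +oo)%E -> nu setT = +oo%E.
Proof.
move=> h; apply: contrapT => nuT.
have nf : (nu setT < +oo)%E by rewrite ltey; exact/eqP.
have mD : measurable [set y : R | `|y| <= 1].
  rewrite (_ : [set y | _] = `[-1, 1]%classic); first exact: measurable_itv.
  by apply/seteqP; split => y /=; rewrite in_itv/= ler_norml.
have : (\int[nu]_(y in [set y : R | (`|y| <= 1)%R]) (`|y|)%R%:E <=
    \int[nu]_(y in [set y : R | (`|y| <= 1)%R]) (cst 1%E) y)%E.
  apply: ge0_le_integral => //.
  by apply/measurable_EFinP; exact: (measurable_funS measurableT (@subsetT _ _) (@normr_measurable _ setT)).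
rewrite integral_cst// mul1e h leye_eq => /eqP H.
have := le_lt_trans (le_measure nu (mem_set mD) (mem_set measurableT) (@subsetT _ _)) nf.
by rewrite [X in (X < _)%E]H ltxx.
Qed.

Theorem theorem3p1 (R : realType) (d : measure_display) (Omega : measurableType d)
    (Pr : probability Omega R) (X : R -> Omega -> R)
    (sigma2 gamma : R) (nu : {measure set R -> \bar R}) (T K r delta : R) :
  0 < T -> 0 < K -> 0 < r -> 0 <= delta -> 0 <= sigma2 ->
  measure_is_complete Pr ->
  levy_measure nu ->
  is_levy_process Pr X sigma2 gamma nu ->
  (* martingale conditions *)
  (\int[nu]_(y in [set y : R | (1 <= `|y|)%R]) (expR y)%:E < +oo)%E ->
  ((sigma2 / 2 + gamma)%:E
     + \int[nu]_y (expR y - 1 - y * \1_[set z : R | (`|z| <= 1)%R] y)%R%:E = 0)%E ->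
  (* non-degeneracy *)
  (sigma2 != 0 \/ (0 < nu [set y : R | (y < 0)%R])%E \/
     (\int[nu]_(y in [set y : R | (0 < y)%R]) (minr y 1)%:E = +oo)%E) ->
  (* X is of type B or C *)
  ((sigma2 = 0 /\ nu setT = +oo%E /\
      (\int[nu]_(y in [set y : R | (`|y| <= 1)%R]) (`|y|)%R%:E < +oo)%E) \/
   (0 < sigma2 \/ (\int[nu]_(y in [set y : R | (`|y| <= 1)%R]) (`|y|)%R%:E = +oo)%E)) ->
  forall t x, 0 <= t < T -> 0 <= x ->
    (amer_put Pr X r delta K T t x)%:E =
      ((euro_put Pr X r delta K T t x)%:E
       + \int[Pr]_w (\int[lebesgue_measure]_(s in [set s : R | (0 <= s <= T - t)%R])
            (kfun Pr X r delta K T nu (t + s) (stock X r delta x s w)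
               * expR (- (r * s)))%:E))%E.
Proof.
move=> T0 K0 r0 delta0 s20 cPr hnu hX hexp hmart hdeg htype t x /andP[t0 tT] x0.
have [nuS nuE] := sigma_finite_measure_exists (levy_measure_sigma_finite hnu).
rewrite nuE in hnu hX hexp hmart hdeg htype *.
have hatom s a : 0 < s -> Pr (X s @^-1` [set a]) = 0%E.
  move=> s0.
  (* Type B and the infinite-variation case of type C both make [nu] infinite; the remaining case
     has a Gaussian part. *)
  have [sg|nuT] : 0 < sigma2 \/ nuS setT = +oo%E.
    case: htype => [[_ [nuT _]]|[sg|h]]; [by right|by left|].
    by right; exact: small_jumps_infinite.
  - exact: (@levy_no_atom_gauss _ _ _ Pr X sigma2 gamma nuS s20 hnu hX).
  - exact: (@levy_no_atom_infinite _ _ _ Pr X sigma2 gamma nuS s20 hnu hX).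
have th0 : 0 < T - t by rewrite subr_gt0.
have := @premium _ _ _ Pr X sigma2 gamma nuS s20 hnu cPr hX hexp hmart r delta K r0 delta0 K0 hdeg hatom _ _ th0 x0.
have -> : [set s : R | 0 <= s <= T - t] = `[0, T - t]%classic.
  by apply/seteqP; split => s /=; rewrite in_itv.
have -> : euro_put Pr X r delta K T t x =
    expR (- (r * (T - t))) * \int[Pr]_w pay K (stock X r delta x (T - t) w).
  have E w : pay K (stock X r delta x (T - t) w) = maxr (K - stock X r delta x (T - t) w) 0.
    by rewrite /pay ger0_norm// mulr_ge0// expR_ge0.
  rewrite -RintegralZl; [|exact: measurableT|exact: (put_like_stock_Rint hX r delta x (put_like_pay K0) (ltW th0))].
  by rewrite /euro_put /Rintegral; congr fine; apply: eq_integral => w _; rewrite E.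
have -> : amer_put Pr X r delta K T t x = amer Pr X r delta K (T - t) x by [].
have kE s w : rate Pr X nuS r delta K (T - t - s) (stock X r delta x s w) =
    kfun Pr X r delta K T nuS (t + s) (stock X r delta x s w).
  by have -> : T - t - s = T - (t + s) by rewrite opprD addrA.
move=> ->; apply: (congr1 (fun z => _ + z)%E).
by apply: eq_integral => w _; apply: eq_integral => s _; rewrite kE.
Qed.
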